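(* Assume that there exist $v\in H^k_{\rm per}(0,T)$ and $z\in H^k(\mathbb R)$ ($\mathbb F^m$-valued) such that $v$ and $z+v$ are solutions of $Au+\mathcal N(u,\cdot)=0$ and $z+v$ is nondegenerate. Let $u_n$ ($n$ sufficiently large) be the associated $nT$-periodic pulse solutions described in the context. Suppose that $z+v$ is strongly spectrally stable. Let $\mathcal L_n$ denote either the operator $\mathcal L(u_n)$ (for all $n$) or the operator $\mathcal L_{\rm per}(u_n)$ (for all $n$), and assume that there exist a compact set $\mathcal K\subset\mathbb C$ and $N\in\mathbb N$ such that $$\sigma(\mathcal L_n)\cap\{z\in\mathbb C:\operatorname{Re}(z)\ge0\}\subset\mathcal K\qquad\text{for all }n\ge N.$$ Then there exists $N_1\in\mathbb N$ with $N_1\ge N$ such that for all $n\ge N_1$ the spectrum of $\mathcal L_n$ is confined to the open left-half plane.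
   Context: Let $k,m\in\mathbb N$, $T>0$, $\mathbb F\in\{\mathbb R,\mathbb C\}$. Let $\alpha_1,\dots,\alpha_k\in C(\mathbb R,\mathbb F^{m\times m})$ be $T$-periodic with $\alpha_k(x)$ invertible for every $x$, and put $Au=\alpha_k\partial_x^ku+\dots+\alpha_1\partial_xu$. Let $\mathcal N:\mathbb F^m\times\mathbb R\to\mathbb F^m$ be continuous, twice continuously differentiable in its first argument (with $\partial_u\mathcal N,\partial_u^2\mathcal N$ continuous on $\mathbb F^m\times\mathbb R$) and $T$-periodic in its second argument. $H^k_{\rm per}(0,L)$: $L$-periodic, locally $H^k$ functions, with the $H^k(0,L)$-norm. For $\underline u\in L^\infty(\mathbb R,\mathbb F^m)$, $\mathcal L(\underline u)$ is the operator on (complex-valued) $L^2(\mathbb R)$ with domain $H^k(\mathbb R)$, $\mathcal L(\underline u)\varphi=A\varphi+\partial_u\mathcal N(\underline u,\cdot)\varphi$; for $nT$-periodic continuous $\underline u$, $\mathcal L_{\rm per}(\underline u)$ is the operator on $L^2_{\rm per}(0,nT)$ with domain $H^k_{\rm per}(0,nT)$ given by the same expression. $\underline u$ is nondegenerate if $\mathcal L(\underline u)$ is invertible, and strongly spectrally stable if there is $\varrho>0$ with $\sigma(\mathcal L(\underline u))\subset\{\operatorname{Re}\lambda\le-\varrho\}$. For each (sufficiently large) $n$, $\chi_n:\mathbb R\to[0,1]$ is a smooth $nT$-periodic cut-off with $\|\chi_n\|_{W^{k,\infty}}\le1$ (maximum of sup norms of derivatives of order $\le k$), $\chi_n=1$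 on $[-\frac n6T,\frac n6T]$, $\chi_n=0$ on $[-\frac n2T,-\frac n3T]\cup[\frac n3T,\frac n2T]$. Periodic pulse solutions: under the assumptions on $v,z$ there exist $C>0$ and $N_0\in\mathbb N$ such that for each $n\ge N_0$ there is $a_n\in H^k_{\rm per}(0,nT)$ with $\|a_n\|_{H^k_{\rm per}(0,nT)}\le C\|z\|_{H^k(\mathbb R\setminus(-\frac n6T,\frac n6T))}$ such that the $nT$-periodic function $u_n$ with $u_n=\chi_nz+v+a_n$ on $[-\frac n2T,\frac n2T)$ lies in $H^k_{\rm per}(0,nT)$ and solves $Au+\mathcal N(u,\cdot)=0$. The $u_n$ of the claim are these solutions ($N\ge N_0$). *)

(* Defs.v *)
From HB Require Import structures.
From mathcomp Require Import all_boot all_order all_algebra.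
From mathcomp Require Import complex.
From mathcomp Require Import all_classical all_reals all_analysis.
Set Implicit Arguments.
Unset Strict Implicit.
Unset Printing Implicit Defensive.
Import Order.TTheory GRing.Theory Num.Theory.
Import numFieldNormedType.Exports.
Local Open Scope classical_set_scope.
Local Open Scope complex_scope.
Local Open Scope ring_scope.

Inductive field_kind := RealField | ComplexField.

Definition scal (R : realType) (F : field_kind) : numFieldType :=
  match F with
  | RealField => R
  | ComplexField => R[i]
  end.

Definition re (R : realType) (F : field_kind) : scal R F -> R :=
  match F with
  | RealField => fun a => a
  | ComplexField => fun a => complex.Re a
  end.

Definition im (R : realType) (F : field_kind) : scal R F -> R :=
  match F with
  | RealField => fun=> 0
  | ComplexField => fun a => complex.Im a
  end.

Definition of_real (R : realType) (F : field_kind) : R -> scal R F :=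
  match F with
  | RealField => fun a => a
  | ComplexField => fun a => a%:C
  end.

Definition to_complex (R : realType) (F : field_kind) (a : scal R F)
  : scal R ComplexField := re a +i* im a.

Section function_spaces.
Context {R : realType} {F : field_kind} {m : nat}.
Local Notation mu := (@lebesgue_measure R).
Local Notation vfun := (R -> 'cV[scal R F]_m).
Implicit Types (u w : vfun) (D : set R) (L : R) (j k : nat).

Definition smooth (f : R -> R) := forall j x, derivable (derive1n j f) x 1.

Definition test_function (psi : R -> R) :=
  smooth psi /\ exists M : R, forall x, M < `|x| -> psi x = 0.

Definition sqnorm (a : 'cV[scal R F]_m) : R :=
  \sum_(i < m) (re (a i 0) ^+ 2 + im (a i 0) ^+ 2).

Definition L2norm D u : \bar R := sqrte (\int[mu]_(x in D) (sqnorm (u x))%:E)%E.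

Definition vmeasurable u := forall i,
  measurable_fun setT (fun x => re (u x i 0)) /\
  measurable_fun setT (fun x => im (u x i 0)).

(* Functions are everywhere defined and Borel; elements of the spaces below are
   meant up to equality almost everywhere. *)
Definition L2 u := vmeasurable u /\ (L2norm setT u < +oo)%E.

Definition L2loc u :=
  vmeasurable u /\ forall a b : R, (L2norm `[a, b] u < +oo)%E.

Definition L2per L u := periodic u L /\ L2loc u.

Definition vlocally_integrable u := forall i,
  locally_integrable setT (fun x => re (u x i 0)) /\
  locally_integrable setT (fun x => im (u x i 0)).

Definition is_wder j u w :=
  [/\ vlocally_integrable u, vlocally_integrable w &
    forall psi, test_function psi -> forall i,
      \int[mu]_x (derive1n j psi x * re (u x i 0)) =
        (-1) ^+ j * \int[mu]_x (psi x * re (w x i 0)) /\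
      \int[mu]_x (derive1n j psi x * im (u x i 0)) =
        (-1) ^+ j * \int[mu]_x (psi x * im (w x i 0))].

(* A representative of the j-th weak derivative; junk value 0 if none exists. *)
Definition wder j u : vfun := xget (cst 0) [set w | is_wder j u w].

Definition Hk k u :=
  forall j, (j <= k)%N -> is_wder j u (wder j u) /\ L2 (wder j u).

Definition Hkloc k u :=
  forall j, (j <= k)%N -> is_wder j u (wder j u) /\ L2loc (wder j u).

Definition Hkper k L u := periodic u L /\ Hkloc k u.

Definition Hknorm k D u : \bar R :=
  sqrte (\sum_(j < k.+1) L2norm D (wder j u) ^+ 2)%E.

End function_spaces.

Section equation.
Context {R : realType} {F : field_kind} {m : nat}.
Local Notation mu := (@lebesgue_measure R).
Local Notation K := (scal R F).

Definition Aop (k : nat) (alpha : nat -> R -> 'M[K]_m) (u : R -> 'cV[K]_m)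
    (x : R) : 'cV[K]_m :=
  \sum_(1 <= j < k.+1) alpha j x *m wder j u x.

Definition solution k alpha (N : 'cV[K]_m -> R -> 'cV[K]_m) (u : R -> 'cV[K]_m) :=
  {ae mu, forall x, Aop k alpha u x + N (u x) x = 0}.

(* Jacobian matrix of N(., x) at a; differentiation is over the field K, hence
   holomorphic when K is the field of complex numbers. *)
Definition dN (N : 'cV[K]_m -> R -> 'cV[K]_m) (a : 'cV[K]_m) (x : R) : 'M[K]_m :=
  \matrix_(i, j) ('d (N^~ x) a (delta_mx j 0 : 'cV[K]_m) : 'cV[K]_m) i 0.

Definition coefficients_ok k (T : R) (alpha : nat -> R -> 'M[K]_m) :=
  (forall j, (1 <= j <= k)%N -> continuous (alpha j) /\ periodic (alpha j) T) /\
  (forall x, alpha k x \in unitmx).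

Definition nonlinearity_ok (T : R) (N : 'cV[K]_m -> R -> 'cV[K]_m) :=
  [/\ continuous (fun p : 'cV[K]_m * R => N p.1 p.2),
      forall a x, differentiable (N^~ x) a,
      continuous (fun p : 'cV[K]_m * R => dN N p.1 p.2),
      forall a x, differentiable ((dN N)^~ x) a &
      forall h : 'cV[K]_m, continuous
        (fun p : 'cV[K]_m * R => 'd ((dN N)^~ (p.2)) (p.1) h : 'M[K]_m)] /\
  (forall a, periodic (N a) T).

End equation.

Section operators.
Context {R : realType} {m : nat}.
Local Notation mu := (@lebesgue_measure R).
Local Notation cfun := (R -> 'cV[scal R ComplexField]_m).

Definition ae_same (f g : cfun) := {ae mu, forall x, f x = g x}.

(* Unbounded operator op_app : op_dom -> op_space on a space of functions taken
   up to equality almost everywhere; op_app is irrelevant outside op_dom. *)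
Record unbounded_operator := UnboundedOperator {
  op_space : set cfun ;
  op_norm : cfun -> \bar R ;
  op_dom : set cfun ;
  op_app : cfun -> cfun
}.

Definition op_shift (T : unbounded_operator) (l : R[i]) (phi : cfun) : cfun :=
  fun x => op_app T phi x - (l : scal R ComplexField) *: phi x.

(* l is in the resolvent set when T - l is injective, surjective and has a
   bounded inverse on op_space. *)
Definition resolvent_set (T : unbounded_operator) : set R[i] :=
  [set l | [/\
    forall phi psi, op_dom T phi -> op_dom T psi ->
      ae_same (op_shift T l phi) (op_shift T l psi) -> ae_same phi psi,
    forall f, op_space T f ->
      exists2 phi, op_dom T phi & ae_same (op_shift T l phi) f &
    exists M : R, forall phi, op_dom T phi ->
      (op_norm T phi <= M%:E * op_norm T (op_shift T l phi))%E]].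

Definition spectrum (T : unbounded_operator) : set R[i] := ~` resolvent_set T.

Definition invertible (T : unbounded_operator) := resolvent_set T 0.

Section linearization.
Context {F : field_kind}.
Variables (k : nat) (alpha : nat -> R -> 'M[scal R F]_m)
  (N : 'cV[scal R F]_m -> R -> 'cV[scal R F]_m).

Definition Lapp (u : R -> 'cV[scal R F]_m) (phi : cfun) : cfun := fun x =>
  Aop k (fun j y => map_mx (@to_complex R F) (alpha j y)) phi x +
  map_mx (@to_complex R F) (dN N (u x) x) *m phi x.

Definition Lop u := UnboundedOperator L2 (L2norm setT) (Hk k) (Lapp u).

Definition Lper (L : R) u :=
  UnboundedOperator (L2per L) (L2norm `]0, L[) (Hkper k L) (Lapp u).

Definition nondegenerate_state u := invertible (Lop u).

Definition strongly_spectrally_stable u :=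
  exists2 rho : R, 0 < rho &
    forall l, spectrum (Lop u) l -> complex.Re l <= - rho.

End linearization.
End operators.

Section pulses.
Context {R : realType} {F : field_kind} {m : nat}.
Local Notation mu := (@lebesgue_measure R).
Local Notation K := (scal R F).

Definition cutoff (k : nat) (T : R) (n : nat) (chi : R -> R) :=
  [/\ smooth chi, periodic chi (n%:R * T), forall x, 0 <= chi x <= 1,
      forall j x, (j <= k)%N -> `|derive1n j chi x| <= 1 &
      (forall x, `|x| <= n%:R / 6 * T -> chi x = 1) /\
      (forall x, n%:R / 3 * T <= `|x| <= n%:R / 2 * T -> chi x = 0)].

Definition pulse_solution k (T : R) alpha (N : 'cV[K]_m -> R -> 'cV[K]_m)
    (v z : R -> 'cV[K]_m) (C : R) (n : nat) (chi : R -> R)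
    (an un : R -> 'cV[K]_m) :=
  [/\ Hkper k (n%:R * T) an,
      (Hknorm k `]0%R, (n%:R * T)%R[ an <=
        C%:E * Hknorm k (~` `](- (n%:R / 6 * T))%R, (n%:R / 6 * T)%R[) z)%E,
      {ae mu, forall x, - (n%:R / 2 * T) <= x < n%:R / 2 * T ->
        un x = of_real F (chi x) *: z x + v x + an x},
      Hkper k (n%:R * T) un &
      solution k alpha N un].

End pulses.

(* Main.v *)
Require Import Defs.
From HB Require Import structures.
From mathcomp Require Import all_boot all_order all_algebra.
From mathcomp Require Import complex.
From mathcomp Require Import all_classical all_reals all_analysis.
From mathcomp Require Import measurable_realfun.
From mathcomp Require Import ring lra zify.
Set Implicit Arguments.
Unset Strict Implicit.
Unset Printing Implicit Defensive.
Import Order.TTheory GRing.Theory Num.Theory.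
Import numFieldNormedType.Exports.
Local Open Scope classical_set_scope.
Local Open Scope complex_scope.
Local Open Scope ring_scope.

(** In real coordinates, [(L_n - l) phi = f] is a first-order linear system with [n T]-periodic
    coefficients.  By Floquet theory, [l] lies in the resolvent set of both [L(u_n)] and
    [L_per(u_n)] as soon as the homogeneous equation has no nontrivial Bloch solution
    [phi(x + n T) = gamma phi(x)], [|gamma| = 1].

    Let [phi] be such a Bloch solution, with [l] in [K] and [Re l >= 0].  By the Sobolev
    embedding, [u_n] is uniformly close to [z + v] on [-5nT/6, 5nT/6].  Multiplying [phi] by a
    plateau function that is [1] on a full period, vanishes outside that interval and has
    slope [O(1/n)] gives [psi] in [H^k(R)] with
    [|(L(z + v) - l) psi| <= eps_n |phi|_{H^(k-1)}], the norm of [phi] being taken over a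
    period.  No boundary terms appear when a Bloch function is integrated by parts over a
    period, so interpolation and the equation bound this norm by the [L^2] norm of [phi].
    Stability of [z + v] gives [|psi| <= M |(L(z + v) - l) psi|] with [M] uniform over the
    compact set [K].  Hence [|phi| <= C eps_n |phi|], and [phi = 0] for [n] large. *)

(** The data are known only up to null sets and through weak derivatives, so every function is
    replaced by absolutely continuous representatives, and solutions are taken in a mild sense that
    needs only a primitive of the right-hand side. Values in either field are split into real and
    imaginary parts; a Bloch solution becomes a pair of real solutions which a period rotates. The
    interval [[-5nT/6, 5nT/6]] is forced from two sides. The plateau has to be 1 on [[-nT/2, nT/2]]
    and needs a margin proportional to [n] to descend slowly. On that margin [u_n] is the periodic
    continuation of the pulse, which stays close to [z + v] as long as both [x] and its translate by
    [nT] towards 0 keep distance [nT/6] from 0, where [z] is small. This is exactly [|x| <= 5nT/6].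
    For [L_per(u_n)] the multiplier criterion is used at [gamma = 1]. For [L(u_n)] it makes the
    monodromy matrix hyperbolic, and an inhomogeneous recurrence over the periods is solved in
    [l^2]. Uniformity over [K] rests on a perturbation argument: the bound for one [l] holds near
    [l] with constant multiplied by 4. *)

(** * Integrals over compact intervals and primitives of locally integrable functions *)

Section interval_integral.
Context {R : realType}.
Local Notation mu := (@lebesgue_measure R).
Implicit Types (f g w : R -> R) (a b c : R).

(** Integrability is tested on intervals, the domains of [iint]; this agrees with the test on all
    compact sets because a compact set of reals lies in an interval. *)
Definition locint w :=
  measurable_fun setT w /\ forall a b, mu.-integrable `[a, b] (EFin \o w).

Definition iint w a b := \int[mu]_(t in `[a, b]) w t.

Lemma locintP w : locint w <-> locally_integrable setT w.
Proof.
split=> [[mw iw]|[mw _ iw]].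
  split => //; first exact: openT.
  move=> K _ cK.
  have [M [_ KM]] := compact_bounded cK.
  have /integrableP[_] := iw (- (M + 1)) (M + 1).
  apply: le_lt_trans; apply: ge0_subset_integral => //=.
  - exact: compact_measurable.
  - by apply/measurable_EFinP; apply: measurableT_comp => //; exact: measurable_funTS.
  - move=> x Kx /=; rewrite in_itv/= -ler_norml.
    by apply: (KM (M + 1)) => //; rewrite ltrDl.
split=> // a b; apply/integrableP; split.
  by apply/measurable_EFinP; exact: measurable_funTS.
by apply: iw => //; exact: segment_compact.
Qed.

Lemma locint_int w a b : locint w -> mu.-integrable `[a, b] (EFin \o w).
Proof. by case. Qed.

Lemma locint_continuous f : continuous f -> locint f.
Proof.
move=> cf; split; first exact: continuous_measurable_fun.
move=> a b; apply: continuous_compact_integrable; first exact: segment_compact.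
exact: continuous_subspaceT.
Qed.

Lemma locintD f g : locint f -> locint g -> locint (fun x => f x + g x).
Proof.
move=> [mf f1] [mg g1]; split; first exact: measurable_funD.
by move=> a b; have := integrableD _ (f1 a b) (g1 a b); apply.
Qed.

Lemma locintZ (k : R) f : locint f -> locint (fun x => k * f x).
Proof.
move=> [mf f1]; split; first exact: measurable_funM.
by move=> a b; have := integrableZl _ k (f1 a b); apply.
Qed.

Lemma locintN f : locint f -> locint (fun x => - f x).
Proof.
move=> /(locintZ (-1)); congr locint; apply/funext => x; exact: mulN1r.
Qed.

Lemma locintB f g : locint f -> locint g -> locint (fun x => f x - g x).
Proof. by move=> fi gi; apply: locintD => //; exact: locintN. Qed.

Lemma locint0 : locint (fun=> 0).
Proof. by apply: locint_continuous => x; exact: cvg_cst. Qed.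

Lemma locint_sum (I : Type) (r : seq I) (P : pred I) (F : I -> R -> R) :
  (forall i, P i -> locint (F i)) -> locint (fun x => \sum_(i <- r | P i) F i x).
Proof.
move=> H; elim: r => [|i r IH].
  by under eq_fun do rewrite big_nil; exact: locint0.
under eq_fun do rewrite big_cons.
move: (H i); case: (P i) => [/(_ isT) Hi|_]; last exact: IH.
exact: locintD.
Qed.

Lemma locint_norm f : locint f -> locint (fun x => `|f x|).
Proof.
move=> [mf f1]; split; first exact: measurableT_comp.
move=> a b; exact: (integrable_norm (f1 a b)).
Qed.

Lemma continuous_bounded_itv f a b : continuous f ->
  exists2 M, 0 < M & forall x, a <= x <= b -> `|f x| <= M.
Proof.
move=> cf.
have cK : compact (f @` `[a, b]).
  by apply: continuous_compact; [exact: continuous_subspaceT|exact: segment_compact].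
have [M [_ KM]] := compact_bounded cK.
exists (`|M| + 1); first by rewrite ltr_wpDl.
move=> x xab; apply: (KM (`|M| + 1)).
  by rewrite (le_lt_trans (ler_norm M))// ltrDl.
by exists x => //=; rewrite in_itv.
Qed.

Lemma locintM f w : continuous f -> locint w -> locint (fun x => f x * w x).
Proof.
move=> cf [mw iw]; have mf := continuous_measurable_fun cf.
split; first exact: measurable_funM.
move=> a b; apply: (integrableMr _ _ _ (iw a b)) => //.
  exact: measurable_funTS.
have [M M0 fM] := continuous_bounded_itv a b cf.
exists M; split; first by rewrite num_real.
move=> y My x /=; rewrite in_itv/= => /fM /le_trans; apply; exact: ltW.
Qed.

Lemma integrable_sq_le f g a b : measurable_fun setT f ->
  (forall x, `|f x| <= g x) -> mu.-integrable `[a, b] (EFin \o g) ->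
  mu.-integrable `[a, b] (EFin \o f).
Proof.
move=> mf fg; apply: le_integrable => //.
  by apply/measurable_EFinP; exact: measurable_funTS.
move=> x _ /=; rewrite lee_fin; apply: (le_trans (fg x)); exact: ler_norm.
Qed.

Lemma locint_le f g : measurable_fun setT f ->
  (forall x, `|f x| <= g x) -> locint g -> locint f.
Proof. by move=> mf fg [_ gi]; split=> // a b; exact: integrable_sq_le (gi a b). Qed.

Lemma locint_sq w : measurable_fun setT w -> locint (fun x => w x ^+ 2) -> locint w.
Proof.
move=> mw w2; apply: (@locint_le _ (fun x => 1 + w x ^+ 2)) => //.
  move=> x; rewrite -real_normK ?num_real//.
  have := normr_ge0 (w x); nra.
apply: locintD => //; apply: locint_continuous => x; exact: cvg_cst.
Qed.

Lemma locint_mul f g : measurable_fun setT f -> measurable_fun setT g ->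
  locint (fun x => f x ^+ 2) -> locint (fun x => g x ^+ 2) ->
  locint (fun x => f x * g x).
Proof.
move=> mf mg f2 g2; apply: (@locint_le _ (fun x => f x ^+ 2 + g x ^+ 2)).
- exact: measurable_funM.
- move=> x; rewrite normrM -(real_normK (num_real (f x))) -(real_normK (num_real (g x))).
  have := normr_ge0 (f x); have := normr_ge0 (g x); nra.
- exact: locintD.
Qed.

Lemma locint_sqD f g : measurable_fun setT f -> measurable_fun setT g ->
  locint (fun x => f x ^+ 2) -> locint (fun x => g x ^+ 2) ->
  locint (fun x => (f x + g x) ^+ 2).
Proof.
move=> mf mg f2 g2; under eq_fun do rewrite sqrrD.
apply: locintD => //; apply: locintD => //.
have := locintZ 2 (locint_mul mf mg f2 g2).
by congr locint; apply/funext => x; rewrite mulr_natl.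
Qed.

Lemma iintD f g a b : locint f -> locint g ->
  iint (fun x => f x + g x) a b = iint f a b + iint g a b.
Proof. by move=> [_ fi] [_ gi]; rewrite /iint RintegralD. Qed.

Lemma iintZ (k : R) f a b : locint f ->
  iint (fun x => k * f x) a b = k * iint f a b.
Proof. by move=> [_ fi]; rewrite /iint RintegralZl. Qed.

Lemma iintN f a b : locint f -> iint (fun x => - f x) a b = - iint f a b.
Proof.
move=> fi; rewrite -mulN1r -iintZ//; congr iint; apply/funext => x.
by rewrite mulN1r.
Qed.

Lemma iintB f g a b : locint f -> locint g ->
  iint (fun x => f x - g x) a b = iint f a b - iint g a b.
Proof. by move=> fi gi; rewrite iintD ?iintN//; exact: locintN. Qed.

Lemma iint_sum (I : Type) (r : seq I) (P : pred I) (F : I -> R -> R) a b :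
  (forall i, P i -> locint (F i)) ->
  iint (fun x => \sum_(i <- r | P i) F i x) a b = \sum_(i <- r | P i) iint (F i) a b.
Proof.
move=> H; elim: r => [|i r IH].
  under eq_fun do rewrite big_nil.
  by rewrite big_nil /iint Rintegral_cst// mul0r.
under eq_fun do rewrite big_cons.
rewrite big_cons; case: ifP => // Pi; rewrite iintD ?IH//; first exact: H.
exact: locint_sum.
Qed.

Lemma iint_cst (k : R) a b : a <= b -> iint (fun=> k) a b = k * (b - a).
Proof.
move=> ab; rewrite /iint Rintegral_cst//=; congr (_ * _).
rewrite lebesgue_measure_itv/= lte_fin.
by move: ab; rewrite le_eqVlt => /orP[/eqP->|->//]; rewrite ltxx subrr.
Qed.

Lemma iintxx f a : iint f a a = 0.
Proof. by rewrite /iint set_itv1 Rintegral_set1. Qed.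

Lemma iint_cat f a b c : locint f -> a <= b -> b <= c ->
  iint f a c = iint f a b + iint f b c.
Proof.
move=> [mf fi] ab bc; apply/eqP; rewrite addrC -subr_eq /iint; apply/eqP.
rewrite (Rintegral_itvB (fi a c)) ?bnd_simp//.
rewrite (@Rintegral_itv_obnd_cbnd R b (BRight c))//.
by apply: integrableS (fi b c) => //; exact: subset_itv_oc_cc.
Qed.

Lemma iint_ge0 f a b : (forall x, a <= x <= b -> 0 <= f x) -> 0 <= iint f a b.
Proof. by move=> f0; apply: Rintegral_ge0 => x /=; rewrite in_itv; exact: f0. Qed.

Lemma iint_le f g a b : locint f -> locint g ->
  (forall x, a <= x <= b -> f x <= g x) -> iint f a b <= iint g a b.
Proof.
move=> [_ fi] [_ gi] fg; by apply: le_Rintegral.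
Qed.

Lemma iint_abs f a b : locint f -> `|iint f a b| <= iint (fun x => `|f x|) a b.
Proof. by move=> [_ fi]; exact: le_normr_Rintegral. Qed.

Lemma iint_subset f a b c d : locint f -> (forall x, 0 <= f x) ->
  a <= b -> b <= c -> c <= d -> iint f b c <= iint f a d.
Proof.
move=> fi f0 ab bc cd.
rewrite (iint_cat fi ab (le_trans bc cd)) (iint_cat fi bc cd).
have := @iint_ge0 f a b (fun x _ => f0 x).
have := @iint_ge0 f c d (fun x _ => f0 x); lra.
Qed.

Lemma eq_iint f g a b : (forall x, a <= x <= b -> f x = g x) -> iint f a b = iint g a b.
Proof.
by move=> fg; apply: eq_Rintegral => x; rewrite inE/= in_itv; exact: fg.
Qed.

(** Cauchy-Schwarz against the constant 1. With [v] the mean of [|w|], the integral of [(|w| - v)^2]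
    is nonnegative, and expanding it gives the claim. *)
Lemma iint_CS w a b : a <= b -> measurable_fun setT w -> locint (fun x => w x ^+ 2) ->
  iint (fun x => `|w x|) a b ^+ 2 <= (b - a) * iint (fun x => w x ^+ 2) a b.
Proof.
rewrite le_eqVlt => /orP[/eqP<-|ab] mw w2; first by rewrite !iintxx subrr mul0r expr0n.
have wi := locint_norm (locint_sq mw w2).
set m := iint (fun x => `|w x|) a b; pose v := m / (b - a).
have : 0 <= iint (fun x => w x ^+ 2 + (- (2 * v) * `|w x| + v ^+ 2)) a b.
  apply: iint_ge0 => x _; rewrite -(real_normK (num_real (w x))).
  have := sqr_ge0 (`|w x| - v); nra.
have ci : locint (fun=> v ^+ 2) by apply: locint_continuous => x; exact: cvg_cst.
rewrite iintD//; last by apply: locintD => //; exact: locintZ.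
rewrite iintD//; last exact: locintZ.
rewrite iintZ// iint_cst ?(ltW ab)// -/m => H.
have e : v * (b - a) = m by rewrite /v divfK// gt_eqF// subr_gt0.
have d0 : 0 < b - a by rewrite subr_gt0.
move: H; rewrite -subr_ge0 -e -(pmulr_rge0 _ d0); congr (0 <= _); ring.
Qed.

(** The integrated form of [Y' = w], which describes absolutely continuous functions without
    differentiation almost everywhere. *)
Definition prim w Y := forall a b, a <= b -> Y b - Y a = iint w a b.

Definition J w x := if 0 <= x then iint w 0 x else - iint w x 0.

Lemma prim_J w : locint w -> prim w (J w).
Proof.
move=> wi a b ab; rewrite /J; case: (leP 0 a) => a0; case: (leP 0 b) => b0.
- by rewrite (iint_cat wi a0 ab) addrC addKr.
- by have := le_lt_trans (le_trans a0 ab) b0; rewrite ltxx.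
- by rewrite (iint_cat wi (ltW a0) b0) opprK addrC.
- by rewrite (iint_cat wi ab (ltW b0)) opprK addrC addrK.
Qed.

Lemma J0 w : J w 0 = 0. Proof. by rewrite /J lexx iintxx. Qed.

Lemma prim_eqJ w Y x : locint w -> prim w Y -> Y x = Y 0 + J w x.
Proof.
move=> wi pY; rewrite /J; case: leP => x0.
  by rewrite -(pY 0 x x0) addrC subrK.
by rewrite -(pY x 0 (ltW x0)) opprB addrC subrK.
Qed.

Lemma prim_translate w Y k : prim w Y -> prim w (fun x => Y x + k).
Proof. by move=> pY a b ab; rewrite -(pY a b ab); lra. Qed.

Lemma prim_continuous w Y : locint w -> prim w Y -> continuous Y.
Proof.
move=> wi pY x.
have wc : {within `[x - 1, x + 1],
    continuous (fun y => parameterized_integral mu (x - 1) y w)}.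
  apply: parameterized_integral_continuous; first by lra.
  exact: (locint_int _ _ wi).
have /continuous_within_itvP[|+ _ _] := wc; first by lra.
move=> /(_ x); rewrite in_itv/= => /(_ ltac:(lra)) cx.
have E y : x - 1 <= y -> Y y = Y (x - 1) + parameterized_integral mu (x - 1) y w.
  by move=> xy; have := pY _ _ xy; rewrite /iint /parameterized_integral; lra.
rewrite /continuous_at E; last by lra.
have H : (fun y => Y (x - 1) + parameterized_integral mu (x - 1) y w) y @[y --> x]
    --> Y (x - 1) + parameterized_integral mu (x - 1) x w.
  by apply: cvgD; [exact: cvg_cst|exact: cx].
apply: cvg_trans H; apply: near_eq_cvg.
near=> y; rewrite (E y)//; near: y.
by exists 1 => //= y; rewrite /ball_/= ltr_distlC => /andP[/ltW h _].
Unshelve. all: by end_near. Qed.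

Lemma prim_derive w (Y : R -> R) (x : R) : locint w -> prim w Y -> {for x, continuous w} ->
  is_derive x 1 Y (w x).
Proof.
move=> wi pY cw.
pose F y := iint w (x - 1) y.
have [d1 d2] : derivable F x 1 /\ derive1 F x = w x.
  by apply: (@continuous_FTC1_closed R w (x - 1) x (x + 1)) => //; [lra|exact: locint_int|lra].
have e : {near x, Y =1 F \+ cst (Y (x - 1))}.
  exists 1 => //= y /=; rewrite ltr_distl => xy.
  have : x - 1 <= y by lra.
  by move=> /pY; rewrite /F /= => <-; rewrite subrK.
apply: (@near_eq_is_derive _ _ _ (F \+ cst (Y (x - 1)))).
  by near=> y; rewrite (near e y).
rewrite -[w x]addr0.
have dF : is_derive x (1 : R) F (w x) by apply: (DeriveDef d1); rewrite -d2 derive1E.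
exact: is_deriveD.
Unshelve. all: by end_near. Qed.

Lemma derive_prim f (Y : R -> R) :
  continuous f -> (forall x : R, is_derive x 1 Y (f x)) -> prim f Y.
Proof.
move=> cf dY a b; rewrite le_eqVlt => /orP[/eqP->|ab]; first by rewrite subrr iintxx.
have dd x : derivable Y x 1 by apply: ex_derive; exact: dY.
have cY : continuous Y by move=> x; apply/differentiable_continuous/derivable1_diffP.
have := @continuous_FTC2 R f Y a b ab.
rewrite /iint /Rintegral => ->//.
- exact: continuous_subspaceT.
- split => //; [exact/cvg_at_right_filter/cY|exact/cvg_at_left_filter/cY].
- by move=> x _; rewrite derive1E; apply: derive_val.
Qed.

End interval_integral.

(** * Translation invariance and identities that hold almost everywhere *)

Section translation.
Context {R : realType}.
Local Notation mu := (@lebesgue_measure R).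
Implicit Types (f g w : R -> R) (a b c s : R).

Lemma measurable_shift s :
  @measurable_fun _ _ (measurableTypeR R) (measurableTypeR R) setT (fun x : R => x + s).
Proof. exact: measurable_funD. Qed.

Definition shift_measure s : {measure set (measurableTypeR R) -> \bar R} :=
  measure_function_pushforward__canonical__measure_function_Measure
    mu (measurable_shift s).

(** The translated measure gives half-open intervals their length, and this determines Lebesgue
    measure. *)
Lemma lebesgue_measure_shift s (A : set R) : measurable A ->
  mu ((fun x => x + s) @^-1` A) = mu A.
Proof.
move=> mA; rewrite -[LHS]/(shift_measure s A); apply/esym.
apply: lebesgue_measure_unique => // X [[a b] _ <-].
rewrite /= /pushforward.
have -> : (fun x : R => x + s) @^-1` `]a, b] = `](a - s), (b - s)]%classic.
  by apply/seteqP; split => x /=; rewrite !in_itv/=; lra.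
rewrite !lebesgue_measure_itv/= !lte_fin ltrD2r; case: ifP => // _.
by rewrite -!EFinB; congr EFin; lra.
Qed.

Lemma ae_imp (P Q : R -> Prop) : (forall x, P x -> Q x) ->
  {ae mu, forall x, P x} -> {ae mu, forall x, Q x}.
Proof. by move=> PQ; exact: (@filterS _ (almost_everywhere mu) (ae_filter_ringOfSetsType mu)). Qed.

Lemma ae_imp2 (P Q S : R -> Prop) : (forall x, P x -> Q x -> S x) ->
  {ae mu, forall x, P x} -> {ae mu, forall x, Q x} -> {ae mu, forall x, S x}.
Proof. by move=> PQ; exact: (@filterS2 _ (almost_everywhere mu) (ae_filter_ringOfSetsType mu)). Qed.

Lemma ae_all (P : R -> Prop) : (forall x, P x) -> {ae mu, forall x, P x}.
Proof.
exact: (@filterE _ (almost_everywhere mu) (ae_filter_ringOfSetsType mu)).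
Qed.

Lemma ae_forall_fin (I : finType) (P : I -> R -> Prop) :
  (forall i, {ae mu, forall x, P i x}) -> {ae mu, forall x, forall i, P i x}.
Proof.
move=> H; suff : {ae mu, forall x, forall i, i \in enum I -> P i x}.
  by apply: ae_imp => x h i; apply: h; rewrite mem_enum.
elim: (enum I) => [|i s IH]; first exact: ae_all.
apply: (ae_imp2 _ (H i) IH) => x Pi Ps j; rewrite in_cons => /orP[/eqP->//|].
exact: Ps.
Qed.

Lemma ge0_integral_shift s (f : R -> \bar R) (D : set R) : measurable D ->
  measurable_fun D f -> (forall x, D x -> (0 <= f x)%E) ->
  (\int[mu]_(x in (fun x => x + s)%R @^-1` D) f (x + s)%R = \int[mu]_(x in D) f x)%E.
Proof.
move=> mD mf f0.
have -> : integral mu D f = integral (shift_measure s) D f.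
  apply/esym; apply: (@eq_measure_integral _ (measurableTypeR R) R D mu (shift_measure s) f).
  by move=> A mA _; exact: lebesgue_measure_shift.
apply/esym; apply: (@ge0_integral_pushforward _ _ (measurableTypeR R)
  (measurableTypeR R) R (fun x => x + s)%R (measurable_shift s) mu D f mD mf).
by move=> x; rewrite inE; exact: f0.
Qed.

(** The change of variables is available for nonnegative integrands, so it is applied to the
    positive and the negative part separately. *)
Lemma iint_shift w s a b : locint w ->
  iint (fun x => w (x + s)) a b = iint w (a + s) (b + s).
Proof.
move=> [mw wi].
have e : `[a, b]%classic = (fun x : R => x + s) @^-1` `[a + s, b + s].
  by apply/seteqP; split => x /=; rewrite !in_itv/=; lra.
have mws : measurable_fun setT (fun x : R => w (x + s)).
  by apply: (measurableT_comp mw); exact: measurable_shift.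
rewrite /iint /Rintegral; congr fine.
rewrite [LHS]integralE [RHS]integralE; congr (_ - _)%E.
  rewrite -(@ge0_integral_shift s _ `[a + s, b + s])// -?e.
    by apply: eq_integral => x _; rewrite !funeposE.
  by apply: measurable_funepos; apply/measurable_EFinP; exact: measurable_funTS.
rewrite -(@ge0_integral_shift s _ `[a + s, b + s])// -?e.
  by apply: eq_integral => x _; rewrite !funenegE.
by apply: measurable_funeneg; apply/measurable_EFinP; exact: measurable_funTS.
Qed.

Lemma ae_shift s (P : R -> Prop) :
  {ae mu, forall x, P x} -> {ae mu, forall x, P (x + s)}.
Proof.
move=> [A [mA A0 PA]]; exists ((fun x => x + s) @^-1` A); split.
- by rewrite -[X in measurable X]setTI; exact: measurable_shift.
- by rewrite lebesgue_measure_shift.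
- by move=> x /= H; apply: PA.
Qed.

Lemma ae_iint f g a b : measurable_fun setT f -> measurable_fun setT g ->
  {ae mu, forall x, f x = g x} -> iint f a b = iint g a b.
Proof.
move=> mf mg fg; rewrite /iint /Rintegral; congr fine.
apply: ae_eq_integral => //; [by apply/measurable_EFinP; exact: measurable_funTS..|].
by apply: ae_imp fg => x /= -> _.
Qed.

Lemma ae_locint f g : measurable_fun setT g -> locint f ->
  {ae mu, forall x, f x = g x} -> locint g.
Proof.
move=> mg [mf fi] fg; split=> // a b.
have /integrableP[_ fo] := fi a b; apply/integrableP; split.
  by apply/measurable_EFinP; exact: measurable_funTS.
rewrite (_ : integral _ _ _ = (\int[mu]_(x in `[a, b]) `|(EFin \o f) x|)%E)//.
apply: ae_eq_integral => //.
- by apply: measurableT_comp => //; apply/measurable_EFinP; exact: measurable_funTS.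
- by apply: measurableT_comp => //; apply/measurable_EFinP; exact: measurable_funTS.
- by apply: ae_imp fg => x /= -> _.
Qed.

(** A positive value would persist on an interval around the point; an interval has positive measure
    and cannot lie in a null set. *)
Lemma ae_le0_continuous (h : R -> R) a b : continuous h ->
  {ae mu, forall x, a < x < b -> h x <= 0} -> forall x, a < x < b -> h x <= 0.
Proof.
move=> ch [A [mA A0 PA]] x xab; rewrite leNgt; apply/negP => hx.
have [e e0 eh] : exists2 e : R, 0 < e & forall y, `|y - x| < e -> 0 < h y.
  have [e /= e0 eh] := cvgr_gt _ (ch x) _ hx.
  by exists e => // y yx; apply: eh; rewrite /ball_/= distrC.
(* This half-width keeps the interval where [h] is positive and inside []a, b[]. *)
pose d := Num.min e (Num.min (x - a) (b - x)).
have d0 : 0 < d by rewrite !lt_min e0 !subr_gt0.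
have : (mu `](x - d)%R, (x + d)%R[ <= mu A)%E.
  apply: le_measure; rewrite ?inE//.
  move=> y /=; rewrite in_itv/= => yx.
  have yd : `|y - x| < d by rewrite ltr_norml; lra.
  move: (yd); rewrite !lt_min => /andP[y1 /andP[y2 y3]].
  apply: PA => /= H; have := H; have := eh _ y1; move: y2 y3.
  rewrite !ltr_norml => /andP[? ?] /andP[? ?] h0 /(_ ltac:(lra)); lra.
rewrite A0 lebesgue_measure_itv/= lte_fin ifT; last by lra.
by rewrite -EFinB lee_fin; lra.
Qed.

Lemma ae_eq_continuous f g a b : continuous f -> continuous g ->
  {ae mu, forall x, a < x < b -> f x = g x} -> forall x, a < x < b -> f x = g x.
Proof.
move=> cf cg fg x xab.
have c1 : continuous (fun x => f x - g x) by move=> y; apply: cvgB; [exact: cf|exact: cg].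
have c2 : continuous (fun x => g x - f x) by move=> y; apply: cvgB; [exact: cg|exact: cf].
have h1 := ae_le0_continuous c1 (b := b) (a := a).
have h2 := ae_le0_continuous c2 (b := b) (a := a).
apply/eqP; rewrite eq_le -subr_le0 -[X in _ && X]subr_le0.
apply/andP; split; [apply: h1 => // | apply: h2 => //].
  by apply: ae_imp fg => y h yab; rewrite (h yab) subrr.
by apply: ae_imp fg => y h yab; rewrite (h yab) subrr.
Qed.

Lemma ae_eq_continuousT f g : continuous f -> continuous g ->
  {ae mu, forall x, f x = g x} -> f = g.
Proof.
move=> cf cg fg; apply/funext => x.
apply: (ae_eq_continuous (a := x - 1) (b := x + 1) cf cg); last by lra.
by apply: ae_imp fg => y ->.
Qed.

End translation.

(** * A product rule for absolutely continuous functions *)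

Section derivatives.
Context {R : realType}.
Local Notation mu := (@lebesgue_measure R).
Implicit Types (f g w : R -> R) (a b c s x : R).

Lemma derive_continuous_at f x df : is_derive x (1 : R) f df -> {for x, continuous f}.
Proof.
move=> H; apply: differentiable_continuous; apply/derivable1_diffP.
exact: ex_derive.
Qed.

Lemma derive_le (f df : R -> R) a b :
  (forall x, a <= x <= b -> is_derive x (1 : R) f (df x)) ->
  (forall x, a <= x <= b -> 0 <= df x) -> a <= b -> f a <= f b.
Proof.
move=> fd df0 ab; rewrite -subr_ge0.
have [||c cab ->] := @MVT_segment R f df a b ab.
- by move=> x; rewrite in_itv/= => /andP[? ?]; apply: fd; rewrite !ltW.
- apply: derivable_within_continuous => x; rewrite in_itv/= => xab.
  by apply: ex_derive; exact: fd.
by rewrite mulr_ge0 ?subr_ge0//; apply: df0; move: cab; rewrite in_itv.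
Qed.

Lemma derive0_cst f a b : (forall x, is_derive x (1 : R) f 0) -> f a = f b.
Proof.
move=> fd; wlog ab : a b / a <= b.
  by move=> H; case: (leP a b) => [/H//|/ltW/H].
apply/eqP; rewrite eq_le (@derive_le f (cst 0))//= -[f b <= _]lerN2.
apply: (@derive_le (fun x => - f x) (cst 0)) => //= x _.
by rewrite -oppr0; apply: is_deriveN.
Qed.

(** The difference quotient is at most [C |v y - v x|], which tends to 0 by continuity of [v]. *)
Lemma is_derive0_dominated (f v : R -> R) (x : R) : {for x, continuous v} ->
  (exists2 C, 0 <= C & \forall y \near (x : R), `|f y - f x| <= C * `|y - x| * `|v y - v x|) ->
  is_derive x (1 : R) f 0.
Proof.
move=> cv [C C0 H].
suff L : h^-1 *: ((f \o shift x) (h *: (1 : R)) - f x) @[h --> (0 : R)^'] --> (0 : R).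
  apply: DeriveDef; first by apply/cvg_ex; exists 0.
  by apply/cvg_lim => //; exact: Rhausdorff.
apply/cvgr0Pnorm_lt => e e0.
have C1 : 0 < C + 1 by lra.
have d0 : 0 < e / (C + 1) by rewrite divr_gt0.
have := cv; rewrite /continuous_at => /cvgrPdist_lt/(_ _ d0) cv'.
have [r /= r0 Hr] := filterI H cv'.
exists r => //= h; rewrite /ball_/= sub0r normrN => hr h0.
have hA : h *: (1 : R) = h := mulr1 h.
have h1 : 0 < `|h| by rewrite normr_gt0.
have [] := Hr (h + x); first by rewrite /ball_/= opprD addrCA subrr addr0 normrN.
rewrite addrK => H1 H2.
rewrite hA normrM normfV mulrC ltr_pdivrMr//; apply: le_lt_trans H1 _.
rewrite (mulrC C) -mulrA (mulrC e) ltr_pM2l//.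
apply: (@le_lt_trans _ _ (C * (e / (C + 1)))).
  by rewrite ler_wpM2l// distrC ltW.
by rewrite mulrA ltr_pdivrMr//; nra.
Qed.

(** The difference [F] between [f * Y] and the claimed primitive turns out to have derivative 0 at
    every point, although [Y] may be differentiable only almost everywhere. Its increments are
    products of two quantities that both vanish with the length of the interval. *)
Lemma prim_mul (f df w Y : R -> R) : (forall x, is_derive x (1 : R) f (df x)) ->
  continuous df -> locint w -> prim w Y ->
  prim (fun x => df x * Y x + f x * w x) (fun x => f x * Y x).
Proof.
move=> fd cdf wi pY.
have cf : continuous f by move=> x; exact: derive_continuous_at (fd x).
have cY := prim_continuous wi pY.
have i1 : locint (fun x => df x * Y x).
  by apply: locintM => //; exact: locint_continuous.
have i2 : locint (fun x => f x * w x) by exact: locintM.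
have i12 := locintD i1 i2.
have aw := locint_norm wi.
set q := fun x => _; set F0 := fun x => _.
pose F x := F0 x - J q x; pose v := J (fun x => `|w x|).
have pv : prim (fun x => `|w x|) v by exact: prim_J.
have pq : prim q (J q) by exact: prim_J.
have pf := derive_prim cdf fd.
(* [F b - F a] is the integral of [(f b - f t) * w t] plus that of [df t * (Y a - Y t)]. In each,
   one factor is bounded by means of [M (b - a)] and the other by the increment of [v], the
   primitive of [|w|]. *)
have est M a b : a <= b -> (forall t, a <= t <= b -> `|df t| <= M) ->
    `|F b - F a| <= 2 * M * (b - a) * (v b - v a).
  move=> ab dM.
  have M0 : 0 <= M by apply: le_trans (dM a _); rewrite ?lexx.
  have wv c d : a <= c -> c <= d -> d <= b -> `|Y d - Y c| <= v b - v a.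
    move=> ac cd db; rewrite pY// (le_trans (iint_abs _ _ wi))// pv//.
    by apply: iint_subset.
  have -> : F b - F a = iint (fun t => (f b - f t) * w t) a b
       + iint (fun t => df t * (Y a - Y t)) a b.
    have e1 : locint (fun t => (f b - f t) * w t).
      by apply: locintM => // t; apply: cvgB; [exact: cvg_cst|exact: cf].
    have e2 : locint (fun t => df t * (Y a - Y t)).
      by apply: locintM => //; apply: locint_continuous => t;
        apply: cvgB; [exact: cvg_cst|exact: cY].
    have e3 : iint (fun t => f b * w t) a b = f b * (Y b - Y a).
      by rewrite iintZ// pY.
    have e4 : iint (fun t => Y a * df t) a b = Y a * (f b - f a).
      by rewrite iintZ ?pf//; exact: locint_continuous.
    have e5 : iint (fun t => f b * w t) a b + iint (fun t => Y a * df t) a b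
       = iint (fun t => (f b - f t) * w t) a b
       + iint (fun t => df t * (Y a - Y t)) a b + iint q a b.
      rewrite -!iintD//; last 3 first.
      - exact: locintD.
      - exact: locintZ.
      - by apply: locintZ; exact: locint_continuous.
      by apply: eq_iint => t _; rewrite /q; ring.
    by rewrite /F /F0; have := pq a b ab; move: e5; rewrite e3 e4; lra.
  have B1 : `|iint (fun t => (f b - f t) * w t) a b| <= M * (b - a) * (v b - v a).
    rewrite pv// -iintZ//.
    have e1 : locint (fun t => (f b - f t) * w t).
      by apply: locintM => // t; apply: cvgB; [exact: cvg_cst|exact: cf].
    apply: (le_trans (iint_abs _ _ e1)); apply: iint_le.
    - exact: locint_norm.
    - exact: locintZ.
    - move=> t /andP[at_ tb]; rewrite normrM ler_wpM2r//.
      rewrite pf//; have li := locint_continuous cdf.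
      apply: (le_trans (iint_abs _ _ li)).
      apply: (@le_trans _ _ (iint (cst M) t b)).
        apply: iint_le; [exact: locint_norm|by apply: locint_continuous => y; exact: cvg_cst|].
        by move=> y /andP[ty yb]; apply: dM; rewrite yb (le_trans at_ ty).
      by rewrite iint_cst// ler_wpM2l//; lra.
  have B2 : `|iint (fun t => df t * (Y a - Y t)) a b| <= M * (b - a) * (v b - v a).
    have e2 : locint (fun t => df t * (Y a - Y t)).
      by apply: locintM => //; apply: locint_continuous => t;
        apply: cvgB; [exact: cvg_cst|exact: cY].
    apply: (le_trans (iint_abs _ _ e2)).
    apply: (@le_trans _ _ (iint (cst (M * (v b - v a))) a b)).
      apply: iint_le; [exact: locint_norm|by apply: locint_continuous => y; exact: cvg_cst|].
      move=> t /andP[at_ tb]; rewrite normrM ler_pM//; first by apply: dM; rewrite at_.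
      by rewrite distrC; apply: wv.
    by rewrite iint_cst//; nra.
  apply: (le_trans (ler_normD _ _)); nra.
have cv : continuous v := prim_continuous aw pv.
have dF x : is_derive x (1 : R) F 0.
  have [M M0 dM] := continuous_bounded_itv (x - 1) (x + 1) cdf.
  apply: (is_derive0_dominated (v := v)); first exact: cv.
  exists (2 * M); first by rewrite mulr_ge0 // ltW.
  exists 1 => //= y; rewrite /ball_/= ltr_distlC => /andP[y1 y2].
  case: (leP x y) => xy.
    rewrite (ger0_norm (x := y - x)) ?subr_ge0//.
    apply: (le_trans (est M x y xy _)); last by rewrite ler_wpM2l ?ler_norm// mulr_ge0 ?subr_ge0// mulr_ge0// ltW.
    by move=> t ?; apply: dM; lra.
  rewrite distrC (distrC y) (distrC (v y)) (ger0_norm (x := x - y)) ?subr_ge0; last exact: ltW.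
  apply: (le_trans (est M y x (ltW xy) _)); last by rewrite ler_wpM2l ?ler_norm// mulr_ge0 ?subr_ge0 ?(ltW xy)// mulr_ge0// ltW.
  by move=> t ?; apply: dM; lra.
by move=> a b ab; rewrite -pq//; have := derive0_cst a b dF; rewrite /F; lra.
Qed.

End derivatives.

(** * Smooth cut-offs and weak derivatives *)

Section smooth_functions.
Context {R : realType}.
Implicit Types (f g : R -> R) (x : R) (j : nat).

Lemma is_derive_smooth f j x : smooth f ->
  is_derive x (1 : R) (derive1n j f) (derive1n j.+1 f x).
Proof. by move=> sf; rewrite derive1nS derive1E; apply: DeriveDef => //; exact: sf. Qed.

Lemma smooth_continuous f j : smooth f -> continuous (derive1n j f).
Proof. by move=> sf x; exact: derive_continuous_at (is_derive_smooth j x sf). Qed.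

Lemma smooth_continuous0 f : smooth f -> continuous f.
Proof. exact: (@smooth_continuous f 0%N). Qed.

Lemma smooth_derive1 f : smooth f -> smooth (derive1 f).
Proof. by move=> sf j x; rewrite -derive1Sn; exact: sf. Qed.

Lemma derive1_eq f (df : R -> R) :
  (forall x, is_derive x (1 : R) f (df x)) -> derive1 f = df.
Proof. by move=> fd; apply/funext => x; rewrite derive1E; exact: derive_val. Qed.

(** Exhibiting all candidate derivatives at once identifies the iterated derivatives by a one-line
    induction; explicit smooth functions below are treated this way. *)
Lemma smooth_ladder (F : nat -> R -> R) :
  (forall j x, is_derive x (1 : R) (F j) (F j.+1 x)) ->
  forall j, derive1n j (F 0%N) = F j.
Proof.
by move=> FD; elim=> [//|j IH]; rewrite derive1nS IH; exact: derive1_eq.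
Qed.

Lemma smooth_of_ladder (F : nat -> R -> R) :
  (forall j x, is_derive x (1 : R) (F j) (F j.+1 x)) -> smooth (F 0%N).
Proof.
by move=> FD j x; rewrite (smooth_ladder FD); apply: ex_derive; exact: FD.
Qed.

Lemma is_derive_affine (s t x : R) : is_derive x (1 : R) (fun x => s * x + t) s.
Proof. by apply: is_derive_eq; rewrite addr0 /GRing.scale/= mulr1. Qed.

Lemma is_derive_comp_affine f (s t x df : R) : is_derive (s * x + t) (1 : R) f df ->
  is_derive x (1 : R) (fun x => f (s * x + t)) (s * df).
Proof.
move=> fd; rewrite mulrC.
exact: (@is_derive1_comp R f (fun x => s * x + t) x _ _ fd (is_derive_affine s t x)).
Qed.

Lemma derive1n_affine f (s t : R) : smooth f ->
  forall j, derive1n j (fun x => f (s * x + t)) =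
            fun x => s ^+ j * derive1n j f (s * x + t).
Proof.
move=> sf j.
have FD i x : is_derive x (1 : R) (fun x => s ^+ i * derive1n i f (s * x + t))
    (s ^+ i.+1 * derive1n i.+1 f (s * x + t)).
  rewrite exprSr -mulrA; apply: (@is_deriveZ _ _ _ (fun x => derive1n i f (s * x + t))).
  exact: is_derive_comp_affine (is_derive_smooth i _ sf).
rewrite -(smooth_ladder FD j); congr derive1n; apply/funext => x.
by rewrite expr0 mul1r.
Qed.

Lemma smooth_affine f (s t : R) : smooth f -> smooth (fun x => f (s * x + t)).
Proof.
move=> sf j x; rewrite derive1n_affine//.
apply: (@derivableZ _ _ _ (fun x => derive1n j f (s * x + t))).
by apply: ex_derive; exact: is_derive_comp_affine (is_derive_smooth j _ sf).
Qed.

Lemma smoothB f g : smooth f -> smooth g -> smooth (fun x => f x - g x).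
Proof.
move=> sf sg; apply: (@smooth_of_ladder (fun j x => derive1n j f x - derive1n j g x)).
by move=> i x; apply: is_deriveB; exact: is_derive_smooth.
Qed.

Lemma smoothZ (k : R) f : smooth f -> smooth (fun x => k * f x).
Proof.
move=> sf; apply: (@smooth_of_ladder (fun j x => k * derive1n j f x)).
by move=> i x; apply: (@is_deriveZ _ _ _ (derive1n i f)); exact: is_derive_smooth.
Qed.

Lemma smooth_prim f g : smooth g -> (forall x, is_derive x (1 : R) f (g x)) -> smooth f.
Proof.
move=> sg fd; apply: (@smooth_of_ladder (fun j => if j is i.+1 then derive1n i g else f)).
by case=> [//|i] x; exact: is_derive_smooth.
Qed.

(** Derivatives depend only on germs. This allows a function to be glued from smooth pieces that
    agree on overlapping open sets. *)
Lemma derive1n_locality f g (U : set R) : open U -> smooth f ->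
  (forall x, U x -> f x = g x) ->
  forall j x, U x -> derive1n j f x = derive1n j g x /\ derivable (derive1n j g) x 1.
Proof.
move=> oU sf fg.
have H j : (forall x, U x -> derive1n j f x = derive1n j g x) ->
    forall x, U x -> is_derive x (1 : R) (derive1n j g) (derive1n j.+1 f x).
  move=> e x Ux; apply: near_eq_is_derive (is_derive_smooth j x sf).
  by have /= := open_nbhs_nbhs (conj oU Ux); apply: filterS => y; exact: e.
have E j : forall x, U x -> derive1n j f x = derive1n j g x.
  elim: j => [//|j IH] x Ux.
  have h := H j IH x Ux.
  by rewrite (derive1nS g j) derive1E; apply/esym; exact: derive_val.
by move=> j x Ux; split; [exact: E|apply: ex_derive; exact: H (E j) _ Ux].
Qed.

Lemma open_norm_lt (c : R) : open [set x : R | `|x| < c].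
Proof.
apply: (@open_comp _ _ (fun x : R => `|x|) [set y | y < c]); last exact: open_lt.
by move=> y _; exact: norm_continuous.
Qed.

Lemma open_norm_gt (c : R) : open [set x : R | c < `|x|].
Proof.
apply: (@open_comp _ _ (fun x : R => `|x|) [set y | c < y]); last exact: open_gt.
by move=> y _; exact: norm_continuous.
Qed.

Lemma derive1n_cst0 j : derive1n j (fun=> 0 : R) = (fun=> 0).
Proof.
apply: (@smooth_ladder (fun _ _ => 0)) => i x; exact: is_derive_cst.
Qed.

Lemma smooth_cst (k : R) : smooth (fun=> k : R).
Proof.
apply: (@smooth_of_ladder (fun j => if j is 0%N then fun=> k else fun=> 0)).
by case=> [|j] x; exact: is_derive_cst.
Qed.

Definition bump f := [/\ smooth f, forall x, 0 <= f x <= 1,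
  forall x, 2 / 3 <= `|x| -> f x = 0 & forall x, `|x| <= 1 / 3 -> f x = 1].

(** The given periodic cut-off is the source of a compactly supported one: rescaled so that a period
    becomes [[-1, 1]], it is 1 up to 1/3 and 0 between 2/3 and 1, and its other copies are then
    removed. *)
Lemma cutoff_bump k (T : R) n chi : 0 < n%:R * T -> cutoff k T n chi ->
  exists rho : R -> R, bump rho.
Proof.
move=> L0 [sc pc c01 _ [c1 c0]]; set L := n%:R * T in L0.
pose F (x : R) := chi (L / 2 * x + 0).
have sF : smooth F by exact: smooth_affine.
have F0 x : 2 / 3 <= `|x| <= 1 -> F x = 0.
  move=> xb; rewrite /F addr0; apply: c0.
  rewrite normrM gtr0_norm ?divr_gt0//; move: xb; rewrite /L => xb.
  have -> : n%:R / 3 * T = L / 2 * (2 / 3) by rewrite /L; field.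
  have -> : n%:R / 2 * T = L / 2 * 1 by rewrite /L; field.
  by rewrite !ler_pM2l ?divr_gt0.
pose g x := if `|x| < 5 / 6 then F x else 0.
have g0 x : 2 / 3 <= `|x| -> 0 = g x.
  by rewrite /g; case: ifP => // xs xl; rewrite F0//; lra.
have g1 x : `|x| < 5 / 6 -> F x = g x by rewrite /g => ->.
exists g; split.
- move=> j x; case: (ltP `|x| (5 / 6)) => xs.
    have oU : open [set x : R | `|x| < 5 / 6].
      exact: open_norm_lt.
    by have [] := derive1n_locality oU sF g1 j xs.
  have oU : open [set x : R | 2 / 3 < `|x|].
    exact: open_norm_gt.
  have xl : 2 / 3 < `|x| by lra.
  by have [] := derive1n_locality oU (@smooth_cst 0) (fun y h => g0 y (ltW h)) j xl.
- by move=> x; rewrite /g; case: ifP => _; [exact: c01|rewrite lexx ler01].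
- by move=> x /g0.
- move=> x xs; rewrite -g1; last by lra.
  rewrite /F addr0; apply: c1.
  rewrite normrM gtr0_norm ?divr_gt0//.
  have -> : n%:R / 6 * T = L / 2 * (1 / 3) by rewrite /L; field.
  by rewrite ler_pM2l ?divr_gt0.
Qed.

Lemma test_function_derive1 f : test_function f -> test_function (derive1 f).
Proof.
move=> [sf [M fM]]; split; first exact: smooth_derive1.
exists M => x xM.
have oU : open [set x : R | M < `|x|].
  exact: open_norm_gt.
have [+ _] := derive1n_locality oU (@smooth_cst 0) (fun x h => esym (fM x h)) 1%N xM.
by rewrite derive1n_cst0 derive1n1.
Qed.

Lemma test_function_supp f : test_function f ->
  exists2 M, 0 < M & forall j x, M <= `|x| -> derive1n j f x = 0.
Proof.
move=> [sf [M fM]]; exists (`|M| + 1); first by rewrite ltr_wpDl.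
move=> j x xM.
have oU : open [set x : R | M < `|x|].
  exact: open_norm_gt.
have xM' : M < `|x| by have := ler_norm M; lra.
have [+ _] := derive1n_locality oU (@smooth_cst 0) (fun x h => esym (fM x h)) j xM'.
by rewrite derive1n_cst0.
Qed.

End smooth_functions.

Section weak_derivatives.
Context {R : realType}.
Local Notation mu := (@lebesgue_measure R).
Implicit Types (f g w u Y psi : R -> R) (x a b : R) (j : nat).

Lemma Rint_supp (h : R -> R) a b : (forall x, ~~ (a <= x <= b) -> h x = 0) ->
  \int[mu]_x h x = iint h a b.
Proof.
move=> h0; rewrite /iint [RHS]Rintegral_mkcond; apply: eq_Rintegral => x _.
rewrite patchE; case: ifPn => //; rewrite notin_setE/= in_itv/= => /negP; exact: h0.
Qed.

Lemma test_int psi M u : (forall x, M <= `|x| -> psi x = 0) ->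
  \int[mu]_x (psi x * u x) = iint (fun x => psi x * u x) (- M) M.
Proof.
move=> pM; apply: Rint_supp => x; rewrite -ler_norml -ltNge => /ltW/pM ->.
by rewrite mul0r.
Qed.

(** The product rule on an interval beyond which [psi] vanishes leaves no boundary terms. *)
Lemma weak_by_parts psi w Y : test_function psi -> locint w -> prim w Y ->
  \int[mu]_x (derive1 psi x * Y x) = - \int[mu]_x (psi x * w x).
Proof.
move=> tp wi pY; have [M M0 pM] := test_function_supp tp.
have sp := tp.1; have pM0 : forall x, M <= `|x| -> psi x = 0 := pM 0%N.
rewrite (@test_int (derive1 psi) M); last by move=> x /(pM 1%N); rewrite derive1n1.
rewrite (@test_int psi M); last by move=> x /(pM 0%N).
have cp : continuous (derive1 psi).
  by have := @smooth_continuous _ psi 1%N sp; rewrite derive1n1.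
have := prim_mul (f := psi) (df := derive1 psi) _ cp wi pY (a := - M) (b := M).
move=> /(_ _ ltac:(lra)) -H.
have d x : is_derive x (1 : R) psi (derive1 psi x).
  by have := is_derive_smooth 0%N x sp; rewrite derive1n1.
have := H d; rewrite (pM0 M) ?gtr0_norm// (pM0 (- M)) ?normrN ?gtr0_norm//.
rewrite !mul0r subrr iintD//; last 2 first.
- by apply: locintM => //; exact: locint_continuous (prim_continuous wi pY).
- by apply: locintM => //; exact: smooth_continuous0.
by move=> /eqP; rewrite eq_sym addr_eq0 => /eqP.
Qed.

Definition wd j u w := forall psi, test_function psi ->
  \int[mu]_x (derive1n j psi x * u x) = (-1) ^+ j * \int[mu]_x (psi x * w x).

(** The derivative of a test function is again one, so [psi'] can be inserted in the definition of
    [w]; the signs combine to a single minus. *)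
Lemma wd_succ j u w w' : wd j u w -> wd j.+1 u w' ->
  wd 1%N w w'.
Proof.
move=> d1 d2 psi tp; have := d2 psi tp; rewrite derive1Sn (d1 _ (test_function_derive1 tp)).
rewrite exprS -mulrA expr1 derive1n1 mulrCA => /(congr1 ( *%R ((-1) ^+ j))).
by rewrite !mulrA -expr2 sqrr_sign !mul1r.
Qed.

Lemma lebesgue_pt_iint u a : locint u -> lebesgue_pt u a ->
  forall d : R, 0 < d -> exists2 r : R, 0 < r &
    forall e : R, 0 < e -> e < r -> iint (fun x => `|u x - u a|) (a - e) (a + e) <= d * e.
Proof.
move=> ui /fine_cvgP[fin /cvgrPdist_lt lp] d d0.
have d2 : 0 < d / 2 by rewrite divr_gt0.
have [r /= r0 H] := filterI fin (lp _ d2).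
exists r => // e e0 er.
have [] := H e _ e0; first by rewrite /ball_/= sub0r normrN gtr0_norm.
rewrite sub0r normrN /=.
have i1 : locint (fun x => `|u x - u a|).
  by apply: locint_norm; apply: locintB => //; apply: locint_continuous => x; exact: cvg_cst.
have -> : davg u a e = (iint (fun x => `|u x - u a|) (a - e) (a + e) / (e *+ 2))%:E.
  rewrite /davg /iavg lebesgue_measure_ball ?(ltW e0)// ball_itv.
  have e2 : e *+ 2 != 0 by rewrite mulrn_eq0 /= gt_eqF.
  rewrite inver (negbTE e2) mulrC EFinM; congr (_ * _)%E.
  rewrite /iint /Rintegral fineK; last exact: integrable_fin_num (locint_int _ _ i1).
  have mm : measurable_fun `]a - e, a + e[ (EFin \o (fun x => `|u x - u a|)).
    by apply/measurable_EFinP; apply: measurable_funTS; case: i1.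
  by rewrite [RHS]integral_itv_bndoo.
have e2e : e *+ 2 = 2 * e by rewrite mulr2n; ring.
rewrite e2e.
move=> _ /=; rewrite ger0_norm; last first.
  by rewrite divr_ge0 ?iint_ge0// mulr_ge0// ltW.
rewrite ltr_pdivrMr ?mulr_gt0// => /ltW /le_trans; apply.
by rewrite mulrA divfK// .
Qed.

Variable rho : R -> R.
Hypothesis rhoP : bump rho.

Let srho : smooth rho. Proof. by case: rhoP. Qed.
Let rho01 x : 0 <= rho x <= 1. Proof. by case: rhoP. Qed.
Let rho0 x : 2 / 3 <= `|x| -> rho x = 0. Proof. by case: rhoP => _ _ + _; apply. Qed.

Definition mass := iint rho (-1) 1.

Lemma mass_gt0 : 0 < mass.
Proof.
have ri : locint rho := locint_continuous (smooth_continuous0 srho).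
have -> : mass = iint rho (-1) (-(1 / 3)) + iint rho (-(1 / 3)) (1 / 3) + iint rho (1 / 3) 1.
  by rewrite /mass -iint_cat// -?iint_cat//; lra.
have -> : iint rho (-(1 / 3)) (1 / 3) = iint (cst 1) (-(1 / 3)) (1 / 3).
  by apply: eq_iint => x xs; case: rhoP => _ _ _ ->//; rewrite ler_norml.
rewrite iint_cst; last by lra.
have := @iint_ge0 _ rho (-1) (- (1 / 3)) (fun x _ => proj1 (andP (rho01 x))).
have := @iint_ge0 _ rho (1 / 3) 1 (fun x _ => proj1 (andP (rho01 x))).
lra.
Qed.

(** The primitive of the bump that vanishes to its left: a smooth step from 0 to [mass]. *)
Definition Theta x := J rho x - J rho (-1).

Lemma Theta_derive x : is_derive x (1 : R) Theta (rho x).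
Proof.
have ri : locint rho := locint_continuous (smooth_continuous0 srho).
rewrite -[rho x]subr0; apply: is_deriveB.
apply: prim_derive => //; first exact: prim_J.
exact: smooth_continuous0.
Qed.

Lemma smooth_Theta : smooth Theta.
Proof. by apply: smooth_prim srho _; exact: Theta_derive. Qed.

Lemma iint_rho0 a b : a <= b -> (forall x, a <= x <= b -> rho x = 0) -> iint rho a b = 0.
Proof.
by move=> ab r0; rewrite (eq_iint (g := cst 0))// iint_cst// mul0r.
Qed.

Lemma Theta_left x : x <= - (2 / 3) -> Theta x = 0.
Proof.
have ri : locint rho := locint_continuous (smooth_continuous0 srho).
have pr := prim_J ri; move=> x1; rewrite /Theta.
have z y : y <= - (2 / 3) -> rho y = 0.
  by move=> h; apply: rho0; rewrite -normrN; have := ler_norm (- y); lra.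
case: (leP (-1) x) => h.
  rewrite pr//; apply: iint_rho0 => // y /andP[_ yx]; apply: z; exact: le_trans yx x1.
apply/eqP; rewrite -oppr_eq0 opprB pr ?ltW//; apply/eqP; apply: iint_rho0; first exact: ltW.
by move=> y /andP[_ yx]; apply: z; lra.
Qed.

Lemma Theta_right x : 2 / 3 <= x -> Theta x = mass.
Proof.
have ri : locint rho := locint_continuous (smooth_continuous0 srho).
have pr := prim_J ri; move=> x1; rewrite /Theta /mass -pr; last by lra.
have z y : 2 / 3 <= y -> rho y = 0.
  by move=> h; apply: rho0; have := ler_norm y; lra.
case: (leP 1 x) => h.
  suff : J rho x - J rho 1 = 0 by lra.
  by rewrite pr//; apply: iint_rho0 => // y /andP[yx _]; apply: z; lra.
suff : J rho 1 - J rho x = 0 by lra.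
rewrite pr ?ltW//; apply: iint_rho0; first exact: ltW.
by move=> y /andP[yx _]; apply: z; lra.
Qed.

(** The weight has height at most [1/e] and integral [mass], so the error is at most [1/e] times the
    integral of [|u - u a|], which is small at a Lebesgue point. *)
Lemma mollify u a : locint u -> lebesgue_pt u a ->
  forall d : R, 0 < d -> exists2 r : R, 0 < r & forall e : R, 0 < e -> e < r ->
    `|iint (fun x => e^-1 * rho (e^-1 * x + - (a / e)) * u x) (a - e) (a + e)
      - mass * u a| <= d.
Proof.
move=> ui lp d d0; have [r r0 H] := lebesgue_pt_iint ui lp d0.
exists r => // e e0 er; have {}H := H e e0 er.
have ae : a - e <= a + e by lra.
pose rr x := e^-1 * rho (e^-1 * x + - (a / e)).
have crr : continuous rr.
  have s1 : smooth rr by apply: smoothZ; exact: smooth_affine.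
  exact: smooth_continuous0 s1.
have m1 : iint rr (a - e) (a + e) = mass.
  have pT : prim rr (fun x => Theta (e^-1 * x + - (a / e))).
    apply: derive_prim => // x.
    exact: is_derive_comp_affine (Theta_derive _).
  rewrite -pT//.
  have -> : e^-1 * (a + e) + - (a / e) = 1 by field; rewrite gt_eqF.
  have -> : e^-1 * (a - e) + - (a / e) = -1 by field; rewrite gt_eqF.
  by rewrite Theta_right ?Theta_left ?subr0; lra.
have i0 : locint (fun x => u x - u a).
  by apply: locintB => //; apply: locint_continuous => x; exact: cvg_cst.
have i1 : locint (fun x => `|u x - u a|) by exact: locint_norm.
have -> : mass * u a = iint (fun x => u a * rr x) (a - e) (a + e).
  by rewrite iintZ ?m1 1?mulrC//; exact: locint_continuous.
rewrite -iintB; last 2 first.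
- exact: locintM.
- by apply: locintZ; exact: locint_continuous.
rewrite (eq_iint (g := fun x => rr x * (u x - u a))); last first.
  by move=> x _; rewrite /rr; ring.
apply: (le_trans (iint_abs _ _ _)); first exact: locintM.
apply: (@le_trans _ _ (iint (fun x => e^-1 * `|u x - u a|) (a - e) (a + e))).
  apply: iint_le; [by apply: locint_norm; exact: locintM|exact: locintZ|].
  move=> x _; rewrite normrM ler_wpM2r// /rr normrM gtr0_norm ?invr_gt0//.
  rewrite ler_piMr ?invr_ge0 ?(ltW e0)// ger0_norm; by case/andP: (rho01 (e^-1 * x + - (a / e))).
by rewrite iintZ// mulrC ler_pdivrMr.
Qed.

Lemma rho_affine_supp a e x : 0 < e -> e <= `|x - a| -> rho (e^-1 * x + - (a / e)) = 0.
Proof.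
move=> e0 xa; apply: rho0.
have -> : e^-1 * x + - (a / e) = (x - a) / e by ring.
rewrite normrM normfV (gtr0_norm e0) ler_pdivlMr//.
by apply: le_trans xa; rewrite ger_pMl//; lra.
Qed.

Lemma rho_affine_test a e : 0 < e -> test_function (fun x => e^-1 * rho (e^-1 * x + - (a / e))).
Proof.
move=> e0; split; first by apply: smoothZ; exact: smooth_affine.
exists (`|a| + e) => x xe; rewrite rho_affine_supp ?mulr0//.
have := ler_normD (x - a) a; rewrite subrK; lra.
Qed.

(** The difference integrates to 0 against every test function. Testing with bumps that shrink to a
    Lebesgue point shows that it vanishes there, and almost every point is a Lebesgue point. *)
Lemma wd_unique u w w' j : locint w -> locint w' -> wd j u w -> wd j u w' ->
  {ae mu, forall x, w x = w' x}.
Proof.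
move=> wi wi' d1 d2.
pose h x := w x - w' x.
have hi : locint h by exact: locintB.
have H psi : test_function psi -> \int[mu]_x (psi x * h x) = 0.
  move=> tp; have [M M0 pM] := test_function_supp tp.
  have cp := smooth_continuous0 tp.1.
  have pM0 x : M <= `|x| -> psi x = 0 by exact: (pM 0%N).
  rewrite (test_int _ pM0).
  rewrite (eq_iint (g := fun x => psi x * w x - psi x * w' x)); last by move=> x _; rewrite /h; ring.
  rewrite iintB; [|exact: locintM..]; rewrite -!test_int//.
  have := d1 _ tp; rewrite (d2 _ tp) => /(congr1 ( *%R ((-1) ^+ j))).
  by rewrite !mulrA -expr2 sqrr_sign !mul1r => ->; rewrite subrr.
have lh := (@lebesgue_differentiation R h).
have {}lh := lh (proj1 (locintP h) hi).
apply: ae_imp lh => a la; apply/eqP; rewrite -subr_eq0; apply/eqP.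
have m0 := mass_gt0.
suff : `|mass * h a| <= 0.
  by rewrite normr_le0 mulf_eq0 gt_eqF//= => /eqP.
apply/ler_addgt0Pl => d d0; rewrite addr0.
have [r r0 Hm] := mollify hi la d0.
have e0 : 0 < r / 2 by rewrite divr_gt0.
have := Hm (r / 2) e0; rewrite -(Rint_supp (h := fun x => (r / 2)^-1 * rho ((r / 2)^-1 * x + - (a / (r / 2))) * h x)); last first.
  move=> x; rewrite -ler_distl -ltNge => xa.
  by rewrite rho_affine_supp ?mulr0 ?mul0r// ltW.
rewrite H; last exact: rho_affine_test.
by rewrite sub0r normrN; apply; rewrite ltr_pdivrMr//; lra.
Qed.

(** After subtraction of a primitive of [w], the rest [h] has weak derivative 0. The difference of
    two mollifiers, centred at Lebesgue points [a0] and [b], is the derivative of a test function,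
    so both see the same mean of [h] and [h a0 = h b]. *)
Lemma wd1_prim u w : locint u -> locint w -> wd 1%N u w ->
  exists Y, prim w Y /\ {ae mu, forall x, u x = Y x}.
Proof.
move=> ui wi d1.
have pW := prim_J wi; set W := J w in pW.
have cW : continuous W := prim_continuous wi pW.
pose h x := u x - W x.
have hi : locint h by apply: locintB => //; exact: locint_continuous.
have H psi : test_function psi -> \int[mu]_x (derive1 psi x * h x) = 0.
  move=> tp; have [M M0 pM] := test_function_supp (test_function_derive1 tp).
  have cp := smooth_continuous0 (test_function_derive1 tp).1.
  have pM0 x : M <= `|x| -> derive1 psi x = 0 by exact: (pM 0%N).
  rewrite (test_int _ pM0).
  rewrite (eq_iint (g := fun x => derive1 psi x * u x - derive1 psi x * W x)); last by move=> x _; rewrite /h; ring.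
  rewrite iintB; [|apply: locintM => //; exact: locint_continuous..].
  rewrite -!test_int// (weak_by_parts tp wi pW).
  by have := d1 _ tp; rewrite derive1n1 expr1 mulN1r => ->; rewrite opprK addNr.
have lh := (@lebesgue_differentiation R h) (proj1 (locintP h) hi).
(* If no Lebesgue point existed, a false statement would hold almost everywhere, and the constant 1
   would be at most 0 on []0, 1[]. *)
have [a0 la0] : exists a0, lebesgue_pt h a0.
  apply: contrapT => no.
  have cc : continuous (cst (1 : R) : R -> R) by move=> x; exact: cvg_cst.
  have := @ae_le0_continuous R (cst 1) 0 1 cc.
  have aeF : {ae mu, forall x : R, 0 < x < 1 -> cst 1 x <= (0 : R)}.
    by apply: ae_imp lh => x lx; exfalso; apply: no; exists x.
  by move=> /(_ aeF (1 / 2) ltac:(lra)) /=; lra.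
have m0 := mass_gt0.
have hc : {ae mu, forall b, h b = h a0}.
  apply: ae_imp lh => b lb; apply/eqP; rewrite -subr_eq0 -normr_le0.
  rewrite -(pmulr_rle0 _ m0); apply/ler_addgt0Pl => d d0; rewrite addr0.
  have d2 : 0 < d / 2 by rewrite divr_gt0.
  have [r1 r10 H1] := mollify hi la0 d2.
  have [r2 r20 H2] := mollify hi lb d2.
  pose e := Num.min r1 r2 / 2.
  have e0 : 0 < e by rewrite divr_gt0// lt_min r10.
  have er : e < Num.min r1 r2 by rewrite ltr_pdivrMr// ltr_pMr ?lt_min ?r10//; lra.
  move: (er); rewrite lt_min => /andP[er1 er2]; clearbody e.
  have {}H1 := H1 e e0 er1; have {}H2 := H2 e e0 er2.
  pose rr c (x : R) := e^-1 * rho (e^-1 * x + - (c / e)).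
  have supp c : \int[mu]_x (rr c x * h x) = iint (fun x => rr c x * h x) (c - e) (c + e).
    apply: Rint_supp => x; rewrite -ler_distl -ltNge => xa.
    by rewrite /rr rho_affine_supp ?mulr0 ?mul0r// ltW.
  pose A := \int[mu]_x (rr a0 x * h x); pose B := \int[mu]_x (rr b x * h x).
  have {}H1 : `|A - mass * h a0| <= d / 2 by rewrite /A supp; exact: H1.
  have {}H2 : `|B - mass * h b| <= d / 2 by rewrite /B supp; exact: H2.
  pose th c (x : R) := Theta (e^-1 * x + - (c / e)).
  have dth c x : is_derive x (1 : R) (th c) (rr c x).
    exact: is_derive_comp_affine (Theta_derive _).
  have sth (c : R) : smooth (th c).
    by apply: (@smooth_affine R Theta (e^-1) (- (c / e))); exact: smooth_Theta.
  (* Both steps rise from 0 to the same height [mass], so their difference has compact support. *)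
  have tp : test_function (fun x => th a0 x - th b x).
    split; first exact: (smoothB (sth a0) (sth b)).
    exists (`|a0| + `|b| + e) => x.
    have ee c : e^-1 * x + - (c / e) = (x - c) / e by ring.
    have ba := ler_norm a0; have ba' := ler_norm (- a0); rewrite normrN in ba'.
    have bb := ler_norm b; have bb' := ler_norm (- b); rewrite normrN in bb'.
    have na := normr_ge0 a0; have nb := normr_ge0 b.
    have t3 : 2 / 3 * e <= e by rewrite ger_pMl//; lra.
    rewrite /th !ee; case: (lerP 0 x) => x0 xl.
      rewrite (ger0_norm x0) in xl.
      by rewrite !Theta_right ?subrr// ler_pdivlMr//; lra.
    rewrite (ltr0_norm x0) in xl.
    by rewrite !Theta_left ?subrr// ler_pdivrMr// mulNr; lra.
  have := H _ tp.
  have -> : derive1 (fun x => th a0 x - th b x) = fun x => rr a0 x - rr b x.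
    by apply: derive1_eq => x; apply: is_deriveB.
  have crr c : continuous (rr c).
    exact: smooth_continuous0 (rho_affine_test c e0).1.
  pose M := `|a0| + `|b| + e.
  have ba := ler_norm a0; have ba' := ler_norm (- a0); rewrite normrN in ba'.
  have bb := ler_norm b; have bb' := ler_norm (- b); rewrite normrN in bb'.
  have supp' c : \int[mu]_x (rr c x * h x) = iint (fun x => rr c x * h x) (c - M) (c + M).
    apply: Rint_supp => x; rewrite -ler_distl -ltNge => xa.
    rewrite /rr rho_affine_supp ?mulr0 ?mul0r//.
    by have := normr_ge0 a0; have := normr_ge0 b; rewrite /M in xa; lra.
  have suppM c : `|c| + e <= M -> \int[mu]_x (rr c x * h x) = iint (fun x => rr c x * h x) (- M) M.
    move=> cM; apply: Rint_supp => x; rewrite -ler_norml -ltNge => xa.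
    rewrite /rr rho_affine_supp ?mulr0 ?mul0r//.
    by have := ler_normD (x - c) c; rewrite subrK; lra.
  rewrite (Rint_supp (a := - M) (b := M)); last first.
    move=> x; rewrite -ler_norml -ltNge => xa; rewrite /rr.
    have n1 := ler_normD (x - a0) a0; have n2 := ler_normD (x - b) b.
    have := normr_ge0 a0; have := normr_ge0 b; rewrite !subrK /M in n1 n2 xa * => ? ?.
    by rewrite !rho_affine_supp ?mulr0 ?subrr ?mul0r//; lra.
  rewrite (eq_iint (g := fun x => rr a0 x * h x - rr b x * h x)); last by move=> x _; ring.
  rewrite iintB; [|exact: locintM..].
  rewrite -!suppM /M; [|by have := normr_ge0 a0; lra|by have := normr_ge0 b; lra].
  rewrite -/A -/B => AB.
  rewrite -[X in X * _](gtr0_norm m0) -normrM.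
  have -> : mass * (h b - h a0) = (A - mass * h a0) - (B - mass * h b).
    by rewrite -[A](subrK B) AB; ring.
  by apply: (le_trans (ler_normB _ _)); lra.
exists (fun x => W x + h a0); split; first exact: prim_translate.
by apply: ae_imp hc => b hb; rewrite -hb /h; lra.
Qed.

(* Absolutely continuous representatives of a function and its weak derivatives. *)
Definition ladder k (y : nat -> R -> R) :=
  [/\ forall j, (j < k)%N -> prim (y j.+1) (y j),
      forall j, (j < k)%N -> continuous (y j) & locint (y k)].

Lemma ladder_locint k y j : ladder k y -> (j <= k)%N -> locint (y j).
Proof.
move=> [_ cy yk]; rewrite leq_eqVlt => /orP[/eqP->//|jk].
by apply: locint_continuous; exact: cy.
Qed.

Lemma ladder_derive k y j x : ladder k y -> (j.+1 < k)%N ->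
  is_derive x (1 : R) (y j) (y j.+1 x).
Proof.
move=> ly jk; have [py cy yk] := ly; apply: prim_derive.
- exact: ladder_locint ly (ltnW jk).
- by apply: py; exact: ltnW.
- exact: cy.
Qed.

(** The levels below [k] are replaced by primitives of the level above, while the top level keeps
    the given representative, which has no better one. *)
Lemma wd_ladder k u (w : nat -> R -> R) : locint u ->
  (forall j, (j <= k)%N -> locint (w j)) -> (forall j, (j <= k)%N -> wd j u (w j)) ->
  exists2 y, ladder k y & forall j, (j <= k)%N -> {ae mu, forall x, w j x = y j x}.
Proof.
move=> ui wi du.
have ex j : exists Y, (j < k)%N -> prim (w j.+1) Y /\ {ae mu, forall x, w j x = Y x}.
  case: (ltnP j k) => jk; last by exists (w j).
  have [|Y HY] := @wd1_prim (w j) (w j.+1) (wi _ (ltnW jk)) (wi _ jk); last by exists Y.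
  exact: wd_succ (du _ (ltnW jk)) (du _ jk).
have [Y HY] := choice ex.
pose y j := if (j < k)%N then Y j else w j.
have ae j : (j <= k)%N -> {ae mu, forall x, w j x = y j x}.
  rewrite /y; case: ifPn => [jk _|_ _]; [by case: (HY j jk)|exact: ae_all].
have cy j : (j < k)%N -> continuous (y j).
  by move=> jk; rewrite /y jk; have [p _] := HY j jk; exact: prim_continuous (wi _ jk) p.
exists y => //; split=> //; last first.
  by rewrite /y ltnn; exact: wi.
move=> j jk a b ab.
have my : measurable_fun setT (y j.+1).
  case: (ltnP j.+1 k) => jk2; first by apply: continuous_measurable_fun; exact: cy.
  by rewrite /y ltnNge jk2 /=; case: (wi _ jk).
have [p _] := HY j jk; rewrite {1 2}/y jk p//.
by apply: ae_iint => //; [case: (wi _ jk)|exact: ae].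
Qed.

Lemma ladder_wd k y j : ladder k y -> (j <= k)%N -> wd j (y 0%N) (y j).
Proof.
move=> ly; have [py cy yk] := ly.
elim: j => [_ psi tp|j IH jk psi tp]; first by rewrite derive1n0 expr0 mul1r.
rewrite derive1Sn (IH (ltnW jk) _ (test_function_derive1 tp)).
rewrite (weak_by_parts tp (ladder_locint ly jk) (py _ jk)) exprS; ring.
Qed.

End weak_derivatives.

(** * Linear systems of differential equations *)

Section derivative_rules.
Context {R : realType}.
Implicit Types (f h : R -> R) (x : R).

Lemma derD f h x df dh : is_derive x (1 : R) f df -> is_derive x (1 : R) h dh ->
  is_derive x (1 : R) (fun y => f y + h y) (df + dh).
Proof. by move=> ? ?; exact: is_deriveD. Qed.

Lemma derZ (k : R) f x df : is_derive x (1 : R) f df ->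
  is_derive x (1 : R) (fun y => k * f y) (k * df).
Proof. by move=> ?; exact: (@is_deriveZ _ _ _ f). Qed.

Lemma derM f h x df dh : is_derive x (1 : R) f df -> is_derive x (1 : R) h dh ->
  is_derive x (1 : R) (fun y => f y * h y) (df * h x + f x * dh).
Proof.
move=> d1 d2; rewrite addrC [df * _]mulrC; exact: (is_deriveM d1 d2).
Qed.

Lemma der_sum (I : finType) (F : I -> R -> R) (dF : I -> R) x :
  (forall i, is_derive x (1 : R) (F i) (dF i)) ->
  is_derive x (1 : R) (fun y => \sum_i F i y) (\sum_i dF i).
Proof.
move=> FD; elim: (index_enum I) => [|i r IH].
  rewrite big_nil; under eq_fun do rewrite big_nil; exact: is_derive_cst.
rewrite big_cons; under eq_fun do rewrite big_cons; exact: derD.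
Qed.

End derivative_rules.

Section linear_systems.
Context {R : realType} {I : finType}.
Implicit Types (B : I -> I -> R -> R) (g V : I -> R -> R) (x s t : R) (a b : I).

Definition lin_sol B g V := forall a x,
  is_derive x (1 : R) (V a) (\sum_b B a b x * V b x + g a x).

Lemma continuous_sum (P : pred I) (F : I -> R -> R) :
  (forall i, continuous (F i)) -> continuous (fun x => \sum_(i | P i) F i x).
Proof. by move=> cF x; apply: cvg_big => [|i _]; [exact: add_continuous|exact: cF]. Qed.

Lemma continuousMf (f h : R -> R) : continuous f -> continuous h ->
  continuous (fun x => f x * h x).
Proof. by move=> cf ch x; apply: cvgM; [exact: cf|exact: ch]. Qed.

Lemma continuousDf (f h : R -> R) : continuous f -> continuous h ->
  continuous (fun x => f x + h x).
Proof. by move=> cf ch x; apply: cvgD; [exact: cf|exact: ch]. Qed.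

Lemma is_derive_sqr_sum V dV x : (forall a, is_derive x (1 : R) (V a) (dV a)) ->
  is_derive x (1 : R) (fun y => \sum_a V a y ^+ 2) (\sum_a 2 * V a x * dV a).
Proof.
move=> VD.
apply: der_sum => a; have -> : (fun y => V a y ^+ 2) = (fun y => V a y * V a y).
  by apply/funext => y; rewrite expr2.
by rewrite (_ : 2 * _ * _ = dV a * V a x + V a x * dV a); [exact: derM|ring].
Qed.

Lemma is_derive_expR_affine (k s x : R) :
  is_derive x (1 : R) (fun y => expR (k * (y - s))) (k * expR (k * (x - s))).
Proof.
have := is_derive_comp_affine (s := k) (t := - (k * s)) (x := x) (is_derive_expR _).
rewrite (_ : (fun y => expR (k * y - k * s)) = (fun y => expR (k * (y - s)))).
  by rewrite -mulrBr.
by apply/funext => y; rewrite mulrBr.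
Qed.

Lemma sum_mul_le (B : I -> I -> R) (K : R) (v : I -> R) : (forall a b, `|B a b| <= K) ->
  \sum_a 2 * v a * (\sum_b B a b * v b) <= 2 * K * #|I|%:R * \sum_a v a ^+ 2.
Proof.
move=> BK.
have H a b : 2 * v a * (B a b * v b) <= K * (v a ^+ 2 + v b ^+ 2).
  have := BK a b; rewrite ler_norml => /andP[B1 B2].
  have := sqr_ge0 (v a - v b); have := sqr_ge0 (v a + v b); nra.
apply: (@le_trans _ _ (\sum_a \sum_b K * (v a ^+ 2 + v b ^+ 2))).
  by apply: ler_sum => a _; rewrite mulr_sumr; apply: ler_sum => b _; exact: H.
under eq_bigr do rewrite -mulr_sumr big_split/= sumr_const.
rewrite -mulr_sumr big_split/= sumr_const -sumrMnl.
set S := \sum_(i in I) v i ^+ 2.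
rewrite (_ : \sum_(i in I) v i ^+ 2 *+ #|I| = S *+ #|I|); last by rewrite sumrMnl.
by rewrite -(mulr_natr S) le_eqVlt; apply/orP; left; apply/eqP; ring.
Qed.

(** Gronwall's inequality for the sum of squares: [exp(-k (y - s)) E(y) - beta (y - s)] decreases.
    The extra 1 in the rate [k] absorbs the mixed term [2 V g <= V^2 + g^2]. *)
Lemma lin_growth B g V (K beta s t : R) : lin_sol B g V ->
  (forall a b x, `|B a b x| <= K) -> s <= t ->
  (forall x, s <= x <= t -> \sum_a g a x ^+ 2 <= beta) ->
  \sum_a V a t ^+ 2 <= expR ((2 * K * #|I|%:R + 1) * (t - s)) *
    (\sum_a V a s ^+ 2 + beta * (t - s)).
Proof.
move=> VS BK st gb; set k := _ + 1.
pose E y := \sum_a V a y ^+ 2.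
pose F y := expR (- k * (y - s)) * E y - beta * (y - s).
pose dE y := \sum_a 2 * V a y * (\sum_b B a b y * V b y + g a y).
have dF x : is_derive x (1 : R) F
    (expR (- k * (x - s)) * dE x + - k * expR (- k * (x - s)) * E x - beta).
  apply: is_deriveB.
    have d1 := is_derive_expR_affine (- k) s x.
    have d2 : is_derive x (1 : R) E (dE x).
      by apply: is_derive_sqr_sum => a; exact: VS.
    by rewrite addrC; exact: derM.
  have := is_derive_affine beta (- (beta * s)) x.
  by congr is_derive; apply/funext => y; ring.
have b0 : 0 <= beta.
  apply: le_trans (gb s _); last by rewrite lexx.
  by apply: sumr_ge0 => a _; exact: sqr_ge0.
have E0 y : 0 <= E y by apply: sumr_ge0 => a _; exact: sqr_ge0.
have dEle x : s <= x <= t -> dE x <= k * E x + beta.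
  move=> xst; rewrite /dE.
  apply: (@le_trans _ _ (\sum_a (2 * V a x * (\sum_b B a b x * V b x) + (V a x ^+ 2 + g a x ^+ 2)))).
    apply: ler_sum => a _; have := sqr_ge0 (V a x - g a x); lra.
  rewrite big_split/= big_split/= /k mulrDl mul1r -addrA.
  apply: lerD; first exact: sum_mul_le.
  by rewrite lerD2l; exact: gb.
have FF : F t <= F s.
  rewrite -[F t <= _]lerN2.
  apply: (@derive_le _ (fun y => - F y) (fun x =>
    - (expR (- k * (x - s)) * dE x + - k * expR (- k * (x - s)) * E x - beta))) => //.
  move=> x xst.
  have := dEle x xst; set e := expR _ => h.
  have e0 : 0 < e by exact: expR_gt0.
  have e1 : e <= 1.
    rewrite -expR0 ler_expR mulNr oppr_le0 mulr_ge0//; last by rewrite subr_ge0; case/andP: xst.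
    (* With at least one index the bound on [B] forces [K] to be nonnegative; with none the rate is
       1. *)
    have K0 : `|K| = K \/ #|I| = 0%N.
      case: (posnP #|I|) => [->|/card_gt0P[i _]]; first by right.
      by left; rewrite ger0_norm// (le_trans _ (BK i i 0)).
    rewrite addr_ge0//; case: K0 => [<-|->]; last by rewrite mulr0.
    by rewrite mulr_ge0// mulr_ge0.
  nra.
move: FF; rewrite {2}/F subrr !mulr0 expR0 mul1r subr0 /F -lerBrDr opprK mulNr expRN.
rewrite mulrC ler_pdivrMr ?expR_gt0// mulrC; exact.
Qed.

Lemma lin_sol_reflect B g V : lin_sol B g V ->
  lin_sol (fun a b x => - B a b (- x)) (fun a x => - g a (- x)) (fun a x => V a (- x)).
Proof.
move=> VS a x; have := VS a (-1 * x + 0).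
move=> /is_derive_comp_affine; rewrite addr0 !mulN1r.
rewrite (_ : - (_ + _) = \sum_b - B a b (- x) * V b (- x) - g a (- x)).
  by congr is_derive; apply/funext => y; rewrite addr0 mulN1r.
by rewrite opprD -sumrN; congr (_ - _); apply: eq_bigr => b _; rewrite mulNr.
Qed.

Lemma lin_sol_eq0 B V (K : R) : lin_sol B (fun _ _ => 0) V ->
  (forall a b x, `|B a b x| <= K) -> (forall a, V a 0 = 0) -> forall a x, V a x = 0.
Proof.
move=> VS BK V0.
have fwd B' V' : lin_sol B' (fun _ _ => 0) V' -> (forall a b x, `|B' a b x| <= K) ->
    (forall a, V' a 0 = 0) -> forall a x, 0 <= x -> V' a x = 0.
  move=> VS' BK' V0' a x x0.
  have g0 y : 0 <= y <= x -> \sum_(a : I) (0 : R) ^+ 2 <= 0.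
    by rewrite big1// => *; rewrite expr0n.
  have := lin_growth VS' BK' x0 g0.
  move=> H.
  have : \sum_a V' a x ^+ 2 <= 0.
    by move: H; rewrite [X in _ * (X + _)]big1 ?mul0r ?addr0 ?mulr0// => i _; rewrite V0' expr0n.
  rewrite le_eqVlt ltNge sumr_ge0 ?orbF//= => [/eqP|i _]; last exact: sqr_ge0.
  move=> /psumr_eq0P => /(_ (fun i _ => sqr_ge0 _) a isT) /eqP.
  by rewrite sqrf_eq0 => /eqP.
move=> a x; case: (leP 0 x) => x0; first exact: fwd.
have := lin_sol_reflect VS => VR.
rewrite -[x]opprK; apply: (fwd (fun a b x => - B a b (- x)) (fun a x => V a (- x))).
- by move=> b y; have := VR b y; rewrite oppr0.
- by move=> ? ? ?; rewrite normrN.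
- by move=> b; rewrite oppr0.
- by rewrite oppr_ge0 ltW.
Qed.

Lemma JD (f h : R -> R) x : locint f -> locint h ->
  J (fun t => f t + h t) x = J f x + J h x.
Proof. by move=> fi hi; rewrite /J; case: ifP => _; rewrite iintD// opprD. Qed.

Lemma J_derive (f : R -> R) x : continuous f -> is_derive x (1 : R) (J f) (f x).
Proof.
move=> cf; have fi := locint_continuous cf.
by apply: prim_derive; [|exact: prim_J|exact: cf].
Qed.

Lemma J_continuous (f : R -> R) : continuous f -> continuous (J f).
Proof. by move=> cf x; exact: derive_continuous_at (J_derive x cf). Qed.

(** Integration against the weight [exp(l |t|)] gains a factor [1/l]. This turns Picard iteration
    into a contraction on all of the line at once, whatever the size of the coefficients. *)
Lemma J_exp_bound (f : R -> R) (M l X : R) : continuous f -> 0 < l -> 0 <= M ->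
  (forall t, `|t| <= X -> `|f t| <= M * expR (l * `|t|)) ->
  forall x, `|x| <= X -> `|J f x| <= M / l * expR (l * `|x|).
Proof.
move=> cf l0 M0 fM.
have key (h : R -> R) : continuous h ->
    (forall t, 0 <= t <= X -> `|h t| <= M * expR (l * t)) ->
    forall x, 0 <= x <= X -> J h x <= M / l * expR (l * x).
  move=> ch hM x /andP[x0 xX].
  have dd y : is_derive y (1 : R) (fun y => M / l * expR (l * (y - 0)) - J h y)
      (M * expR (l * y) - h y).
    apply: is_deriveB; last exact: J_derive.
    have -> : M * expR (l * y) = M / l *: (l * expR (l * (y - 0))).
      by rewrite /GRing.scale/= subr0 mulrA divfK// gt_eqF.
    apply: (@is_deriveZ _ _ _ (fun y => expR (l * (y - 0)))).
    exact: is_derive_expR_affine.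
  have := derive_le (fun y _ => dd y) _ x0.
  have H y : 0 <= y <= x -> 0 <= M * expR (l * y) - h y.
    move=> /andP[y0 yx]; rewrite subr_ge0.
    apply: le_trans (ler_norm _) _; apply: hM; rewrite y0/=; exact: le_trans yx xX.
  move=> /(_ H); rewrite !subr0 mulr0 expR0 mulr1 J0 subr0 => h1.
  rewrite -subr_ge0; apply: le_trans h1; by rewrite divr_ge0// ltW.
have Jr (h : R -> R) x : continuous h -> J h (- x) = - J (fun t => h (- t)) x.
  move=> ch; have chr : continuous (fun t => h (- t)).
    by move=> t; apply: continuous_comp; [exact: opp_continuous|exact: ch].
  suff : J h (- x) + J (fun t => h (- t)) x = J h (- 0) + J (fun t => h (- t)) 0.
    by rewrite oppr0 !J0 addr0 => /eqP; rewrite addr_eq0 => /eqP.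
  apply: (derive0_cst (f := fun x => J h (- x) + J (fun t => h (- t)) x)) => y.
  rewrite -(addNr (h (- y))); apply: is_deriveD; last exact: J_derive.
  have := is_derive_comp_affine (J_derive (-1 * y + 0) ch).
  rewrite addr0 !mulN1r; congr is_derive; apply/funext => z.
  by rewrite addr0 mulN1r.
have JN (h : R -> R) x : continuous h -> J (fun t => - h t) x = - J h x.
  by move=> ch; have hi := locint_continuous ch; rewrite /J; case: ifP => _; rewrite iintN.
have keyN (h : R -> R) : continuous h ->
    (forall t, 0 <= t <= X -> `|h t| <= M * expR (l * t)) ->
    forall x, 0 <= x <= X -> `|J h x| <= M / l * expR (l * x).
  move=> ch hM x xX; rewrite ler_norml key// andbT lerNl -JN//; apply: key => //.
    by move=> t; apply: cvgN; exact: ch.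
  by move=> t /hM; rewrite normrN.
move=> x xX; case: (leP 0 x) => x0.
  rewrite (ger0_norm x0); apply: keyN => //; last by rewrite x0 -(ger0_norm x0).
  move=> t /andP[t0 tX]; have := fM t; rewrite (ger0_norm t0); exact.
rewrite (ltr0_norm x0) -{1}[x]opprK Jr// normrN; apply: keyN.
- by move=> t; apply: continuous_comp; [exact: opp_continuous|exact: cf].
- move=> t /andP[t0 tX]; have := fM (- t); rewrite normrN (ger0_norm t0); exact.
- by rewrite oppr_ge0 (ltW x0)/= -(ltr0_norm x0).
Qed.

Lemma uniform_continuous_at (f : R -> R) x (d : R) : 0 < d ->
  (forall e, 0 < e -> exists2 q : R -> R, continuous q &
     forall y, `|y - x| < d -> `|f y - q y| <= e) -> {for x, continuous f}.
Proof.
move=> d0 H; apply/cvgrPdist_le => e e0.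
have e3 : 0 < e / 3 by rewrite divr_gt0.
have [q cq fq] := H _ e3.
have := cq x; rewrite /continuous_at => /cvgrPdist_le/(_ _ e3) [r /= r0 Hr].
exists (Num.min r d); first by rewrite /= lt_min r0.
move=> y; rewrite /ball_/= lt_min => /andP[yr yd].
have h1 := Hr y yr; have h2 := fq y; rewrite distrC in h2; have {}h2 := h2 yd.
have := fq x; rewrite subrr normr0 => /(_ d0) h3.
have -> : f x - f y = (f x - q x) + (q x - q y) - (f y - q y) by ring.
apply: (le_trans (ler_normB _ _)); apply: (le_trans (lerD (ler_normD _ _) (lexx _))).
move: h1 h2 h3 => /=; lra.
Qed.

(** Picard iteration written as a series with terms [W n]. The rate [l] exceeds twice the norm of
    the coefficient matrix, so each term is half the previous one in the weighted sup norm. *)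
Lemma lin_sol_exists B g (K : R) (v : I -> R) :
  (forall a b, continuous (B a b)) -> (forall a b x, `|B a b x| <= K) ->
  (forall a, continuous (g a)) ->
  exists V, lin_sol B g V /\ forall a, V a 0 = v a.
Proof.
move=> cB BK cg.
pose l := 2 * `|K| * #|I|%:R + 1.
have l0 : 0 < l by rewrite ltr_wpDl// mulr_ge0// mulr_ge0.
pose W := fix W n a x := if n is n'.+1 then J (fun t => \sum_b B a b t * W n' b t) x
                         else v a + J (g a) x.
have cW n : forall a, continuous (W n a).
  elim: n => [|n IH] a.
    by apply: continuousDf; [move=> x; exact: cvg_cst|exact: J_continuous].
  by apply: J_continuous; apply: continuous_sum => b; apply: continuousMf; [exact: cB|exact: IH].
have bW X : exists2 C, 0 <= C & forall n a x, `|x| <= X ->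
    `|W n a x| <= C * 2^-1 ^+ n * expR (l * `|x|).
  have ex a : exists M, forall x, - X <= x <= X -> `|W 0%N a x| <= M.
    by have [M _ HM] := continuous_bounded_itv (- X) X (cW 0%N a); exists M.
  have [Ca HCa] := choice ex.
  exists (\sum_a `|Ca a|); first by apply: sumr_ge0.
  elim=> [|n IH] a x xX.
    rewrite expr0 mulr1.
    apply: (@le_trans _ _ (Ca a)); first by apply: HCa; rewrite -ler_norml.
    apply: (@le_trans _ _ (\sum_a `|Ca a|)).
      rewrite (bigD1 a)//= ler_wpDr//; first by apply: sumr_ge0.
      exact: ler_norm.
    rewrite ler_peMr ?sumr_ge0// -expR0 ler_expR mulr_ge0//; exact: ltW.
  have cS : continuous (fun t => \sum_b B a b t * W n b t).
    by apply: continuous_sum => b; apply: continuousMf; [exact: cB|exact: cW].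
  set C := \sum_a `|Ca a| in IH *.
  have C0 : 0 <= C by apply: sumr_ge0.
  pose M := `|K| * #|I|%:R * (C * 2^-1 ^+ n).
  have M0 : 0 <= M by rewrite !mulr_ge0// exprn_ge0.
  apply: (le_trans (J_exp_bound cS l0 M0 (X := X) _ xX)).
    move=> t tX; apply: (le_trans (ler_norm_sum _ _ _)).
    apply: (@le_trans _ _ (\sum_(b : I) `|K| * (C * 2^-1 ^+ n * expR (l * `|t|)))).
      apply: ler_sum => b _; rewrite normrM ler_pM//; last exact: IH.
      by apply: le_trans (BK a b t) _; exact: ler_norm.
    by rewrite sumr_const -[_ *+ _]mulr_natr /M le_eqVlt; apply/orP; left; apply/eqP; ring.
  rewrite ler_wpM2r ?expR_ge0// ler_pdivrMr// /M exprS /l.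
  have D0 : 0 <= C * 2^-1 ^+ n by rewrite mulr_ge0// exprn_ge0.
  rewrite (_ : C * (2^-1 * 2^-1 ^+ n) = (C * 2^-1 ^+ n) / 2); last by ring.
  set D := C * _ in D0 *; set Q := `|K| * _.
  by rewrite -mulrA -/Q; lra.
pose S n a x := \sum_(0 <= i < n) W i a x.
have SnS n a x : S n.+1 a x = S n a x + W n a x by rewrite /S big_nat_recr.
have cS n a : continuous (S n a).
  elim: n => [|n IH].
    by rewrite /S; under eq_fun do rewrite big_nil; move=> x; exact: cvg_cst.
  have -> : S n.+1 a = fun x => S n a x + W n a x by apply/funext => x.
  exact: continuousDf.
have cBS n a : continuous (fun t => \sum_b B a b t * S n b t).
  by apply: continuous_sum => b; apply: continuousMf.
have cBW n a : continuous (fun t => \sum_b B a b t * W n b t).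
  by apply: continuous_sum => b; apply: continuousMf.
have SS n a x : S n.+1 a x = W 0%N a x + J (fun t => \sum_b B a b t * S n b t) x.
  elim: n => [|n IH].
    rewrite SnS /S big_nil add0r [X in _ + X](_ : _ = 0) ?addr0//.
    rewrite (_ : (fun t => _) = fun=> 0).
      by rewrite /J; case: leP => x0; rewrite iint_cst ?mul0r ?oppr0// ltW.
    by apply/funext => t; apply: big1 => b _; rewrite big_nil mulr0.
  rewrite SnS IH -addrA -JD; [|exact: locint_continuous..].
  congr (_ + J _ _); apply/funext => t; rewrite -big_split/=; apply: eq_bigr => b _.
  by rewrite SnS mulrDr.
pose V a x := limn (fun n => S n a x).
(* Geometric tails give convergence that is uniform on bounded intervals, hence a continuous
   limit. *)
have tail X : exists2 C, 0 <= C & forall n a x, `|x| <= X ->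
    `|V a x - S n a x| <= C * 2^-1 ^+ n.
  have [C C0 HC] := bW X.
  pose D := C * expR (l * `|X|).
  have D0 : 0 <= D by rewrite mulr_ge0// expR_ge0.
  have WD n a x : `|x| <= X -> `|W n a x| <= D * 2^-1 ^+ n.
    move=> xX; apply: (le_trans (HC n a x xX)); rewrite /D mulrAC.
    apply: ler_wpM2r; first by rewrite exprn_ge0.
    apply: ler_wpM2l => //; rewrite ler_expR; apply: ler_wpM2l; first exact: ltW.
    exact: le_trans xX (ler_norm _).
  have SD n d a x : `|x| <= X -> `|S (n + d)%N a x - S n a x| <= 2 * D * 2^-1 ^+ n * (1 - 2^-1 ^+ d).
    move=> xX; elim: d => [|d IH]; first by rewrite addn0 !subrr normr0 mulr0.
    rewrite addnS SnS addrAC; apply: (le_trans (ler_normD _ _)).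
    have := WD (n + d)%N a x xX; rewrite exprD exprS.
    move: IH; set p := 2^-1 ^+ n; set q := 2^-1 ^+ d; lra.
  exists (2 * D) => [|n a x xX]; first by rewrite mulr_ge0.
  have cv : cvgn (fun n => S n a x).
    have -> : (fun n => S n a x) = series (fun n => W n a x).
      by apply/funext => i; rewrite /S /series/=.
    apply: normed_cvg.
    apply: (@series_le_cvg _ (fun n => `|W n a x|) (geometric D 2^-1)) => //.
    - by move=> i /=; rewrite mulr_ge0// exprn_ge0.
    - by move=> i; rewrite /geometric/=; exact: WD.
    - by apply: is_cvg_geometric_series; rewrite ger0_norm// invf_lt1// ltr1n.
  apply/ler_addgt0Pl => e e0.
  have := cv; rewrite -/(V a x) => /cvgrPdist_le/(_ _ e0) [N _ HN].
  have := HN (n + N)%N (leq_addl _ _); rewrite -/(V a x) /= => h1.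
  have h2 := SD n N a x xX.
  have p0 : 0 <= 2 * D * 2^-1 ^+ n by rewrite !mulr_ge0// exprn_ge0.
  have q0 : 0 <= (2^-1 : R) ^+ N by rewrite exprn_ge0.
  rewrite -(subrK (S (n + N)%N a x) (V a x)) -addrA.
  apply: (le_trans (ler_normD _ _)); apply: lerD => //; nra.
have small (C e : R) : 0 < e -> exists n, C * 2^-1 ^+ n <= e.
  move=> e0; pose n := (Num.truncn (`|C| / e)).+1; exists n.
  have h : `|C| / e <= 2 ^+ n.
    apply: (@le_trans _ _ n%:R); first exact/ltW/truncnS_gt.
    by rewrite -natrX ler_nat ltnW// ltn_expl.
  rewrite exprVn ler_pdivrMr ?exprn_gt0//.
  by move: h; rewrite ler_pdivrMr// mulrC => /(le_trans (ler_norm C)).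
have cV a : continuous (V a).
  move=> x; apply: (@uniform_continuous_at _ _ 1) => // e e0.
  have [C C0 HC] := tail (`|x| + 1); have [n Hn] := small C _ e0.
  exists (S n a) => // y yx; apply: (le_trans (HC n a y _)) => //.
  by have := ler_normD (y - x) x; rewrite subrK; lra.
have cBV a : continuous (fun t => \sum_b B a b t * V b t).
  by apply: continuous_sum => b; apply: continuousMf.
(* The limit satisfies the integral equation because the partial sums satisfy it with one index
   shift and both error terms are geometric. *)
have VE a x : V a x = W 0%N a x + J (fun t => \sum_b B a b t * V b t) x.
  have [C C0 HC] := tail `|x|.
  apply/eqP; rewrite -subr_eq0 -normr_le0; apply/ler_addgt0Pl => e e0; rewrite addr0.
  pose Q := `|K| * #|I|%:R.
  have Q0 : 0 <= Q by rewrite mulr_ge0.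
  have [n Hn] := small (C + Q * C * expR (1 * `|x|)) _ e0.
  rewrite (_ : V a x - _ = (V a x - S n.+1 a x) -
     J (fun t => \sum_b B a b t * (V b t - S n b t)) x); last first.
    have h : J (fun t => \sum_b B a b t * V b t) x =
        J (fun t => \sum_b B a b t * S n b t) x +
        J (fun t => \sum_b B a b t * (V b t - S n b t)) x.
      rewrite -JD; last 2 first.
      - exact: locint_continuous.
      - apply: locint_continuous; apply: continuous_sum => b; apply: continuousMf => //.
        by move=> t; apply: cvgB; [exact: cV|exact: cS].
      congr J; apply/funext => t; rewrite -big_split/=; apply: eq_bigr => b _; ring.
    by rewrite h SS; ring.
  apply: (le_trans (ler_normB _ _)); apply: le_trans Hn; rewrite mulrDl; apply: lerD.
    apply: (le_trans (HC n.+1 a x (lexx _))); rewrite ler_wpM2l// exprS.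
    have : 0 <= (2^-1 : R) ^+ n by rewrite exprn_ge0.
    lra.
  have p0 : 0 <= C * 2^-1 ^+ n by rewrite mulr_ge0// exprn_ge0.
  have := @J_exp_bound (fun t => \sum_b B a b t * (V b t - S n b t)) (Q * (C * 2^-1 ^+ n)) 1 `|x|.
  rewrite divr1 => H; apply: (le_trans (H _ _ _ _ x (lexx _))) => //.
  - apply: continuous_sum => b; apply: continuousMf => //.
    by move=> t; apply: cvgB; [exact: cV|exact: cS].
  - by rewrite mulr_ge0.
  - move=> t tx; apply: (le_trans (ler_norm_sum _ _ _)).
    apply: (@le_trans _ _ (\sum_(b : I) `|K| * (C * 2^-1 ^+ n))).
      apply: ler_sum => b _; rewrite normrM ler_pM//; last exact: HC.
      by apply: le_trans (BK a b t) _; exact: ler_norm.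
    rewrite sumr_const -[_ *+ _]mulr_natr.
    rewrite (_ : _ * #|I|%:R = Q * (C * 2^-1 ^+ n)); last by rewrite /Q; ring.
    apply: ler_peMr; first by rewrite mulr_ge0.
    by rewrite -[leLHS]expR0 ler_expR mul1r.
  - by rewrite le_eqVlt; apply/orP; left; apply/eqP; ring.
exists V; split.
  move=> a x; have -> : V a = fun x => W 0%N a x + J (fun t => \sum_b B a b t * V b t) x.
    by apply/funext => y; exact: VE.
  rewrite addrC; apply: derD; last exact: J_derive.
  have := @derD _ (cst (v a)) _ x 0 _ (is_derive_cst _ _ _) (J_derive x (cg a)).
  by rewrite add0r.
by move=> a; rewrite VE /= !J0 !addr0.
Qed.

End linear_systems.

(** * Hyperbolic recurrences on square-summable sequences *)

Section l2_sequences.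
Context {R : realType}.
Local Notation C := (R[i]).

Definition csq (z : C) : R := complex.Re z ^+ 2 + complex.Im z ^+ 2.

Lemma csq_ge0 z : 0 <= csq z.
Proof. by rewrite addr_ge0// sqr_ge0. Qed.

Lemma csqM z w : csq (z * w) = csq z * csq w.
Proof. by case: z => a b; case: w => c d; rewrite /csq/=; ring. Qed.

Lemma csqN z : csq (- z) = csq z.
Proof. by case: z => a b; rewrite /csq/=; ring. Qed.

Lemma csqD z w (d : R) : 0 < d -> csq (z + w) <= (1 + d) * csq z + (1 + d^-1) * csq w.
Proof.
move=> d0; case: z => a b; case: w => a' b'; rewrite /csq/=.
have H (x y : R) : (x + y) ^+ 2 <= (1 + d) * x ^+ 2 + (1 + d^-1) * y ^+ 2.
  rewrite -subr_ge0 (_ : _ - _ = d^-1 * (d * x - y) ^+ 2).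
    by rewrite mulr_ge0 ?sqr_ge0// invr_ge0 ltW.
  by field; rewrite gt_eqF.
have := H a a'; have := H b b'; lra.
Qed.

Definition vsq n (v : 'rV[C]_n) : R := \sum_i csq (v 0 i).

Lemma vsqZ n (l : C) (v : 'rV[C]_n) : vsq (l *: v) = csq l * vsq v.
Proof. by rewrite /vsq mulr_sumr; apply: eq_bigr => i _; rewrite mxE csqM. Qed.

Lemma vsqD n (v w : 'rV[C]_n) (d : R) : 0 < d ->
  vsq (v + w) <= (1 + d) * vsq v + (1 + d^-1) * vsq w.
Proof.
move=> d0; rewrite /vsq !mulr_sumr -big_split; apply: ler_sum => i _ /=.
by rewrite mxE; exact: csqD.
Qed.

Lemma sum_sqr_le (I : finType) (f : I -> R) :
  (\sum_i f i) ^+ 2 <= #|I|%:R * \sum_i f i ^+ 2.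
Proof.
have : 0 <= \sum_i \sum_j (f i - f j) ^+ 2.
  by apply: sumr_ge0 => i _; apply: sumr_ge0 => j _; exact: sqr_ge0.
have -> : \sum_i \sum_j (f i - f j) ^+ 2 =
    2 * (#|I|%:R * \sum_i f i ^+ 2) - 2 * (\sum_i f i) ^+ 2.
  transitivity (\sum_i (f i ^+ 2 * #|I|%:R + \sum_j f j ^+ 2 - 2 * f i * \sum_j f j)).
    apply: eq_bigr => i _; rewrite mulr_natr -sumr_const mulr_sumr -!big_split -sumrN -big_split/=.
    by apply: eq_bigr => j _; ring.
  rewrite sumrB big_split/= -mulr_suml sumr_const -mulr_suml -mulr_sumr.
  rewrite (_ : (\sum_(i in I) f i ^+ 2) *+ #|I| = #|I|%:R * \sum_(i in I) f i ^+ 2); last by rewrite mulr_natl.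
  ring.
lra.
Qed.

Lemma csq_sum (I : finType) (F : I -> C) : csq (\sum_i F i) <= #|I|%:R * \sum_i csq (F i).
Proof.
have -> : csq (\sum_i F i) = (\sum_i complex.Re (F i)) ^+ 2 + (\sum_i complex.Im (F i)) ^+ 2.
  by rewrite /csq; congr (_ ^+ 2 + _ ^+ 2); elim/big_rec2: _ => // i x [a b] _ <-; case: (F i).
rewrite /csq big_split/= mulrDr; apply: lerD; exact: sum_sqr_le.
Qed.

Lemma vsq_mulmx n (Q : 'M[C]_n) : exists2 K : R, 0 <= K &
  forall v : 'rV[C]_n, vsq (v *m Q) <= K * vsq v.
Proof.
pose K := n%:R * \sum_i \sum_j csq (Q j i).
exists K; first by rewrite mulr_ge0// sumr_ge0// => i _; apply: sumr_ge0 => j _; exact: csq_ge0.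
move=> v; rewrite /K mulrAC mulr_sumr; apply: ler_sum => i _; rewrite mxE.
apply: (le_trans (csq_sum _)); rewrite card_ord -mulrA ler_wpM2l// mulr_sumr.
apply: ler_sum => j _; rewrite csqM ler_wpM2r ?csq_ge0//.
by rewrite /vsq (bigD1 j)//= lerDl sumr_ge0// => k _; exact: csq_ge0.
Qed.

Section vectors.
Context {n : nat}.
Implicit Types (x y h : int -> 'rV[C]_n) (M H : R).

(** [M] bounds the squared [l^2] norm over all integers, expressed by finite windows so that no
    infinite sum has to converge. *)
Definition l2 x M := forall (a : int) (k : nat), \sum_(i < k) vsq (x (a + i%:Z)) <= M.

Lemma l2_ge0 x M : l2 x M -> 0 <= M.
Proof. by move=> /(_ 0 0%N); rewrite big_ord0. Qed.

Lemma l2_le x M M' : M <= M' -> l2 x M -> l2 x M'.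
Proof. by move=> MM xM a k; exact: le_trans (xM a k) MM. Qed.

Lemma l2_ext x y M : (forall j, x j = y j) -> l2 x M -> l2 y M.
Proof. by move=> xy xM a k; under eq_bigr do rewrite -xy; exact: xM. Qed.

Lemma l2_shift x M (s : int) : l2 x M -> l2 (fun j => x (j + s)) M.
Proof.
move=> xM a k; rewrite (eq_bigr (fun i : 'I_k => vsq (x ((a + s) + i%:Z)))); first exact: xM.
by move=> i _; rewrite addrAC.
Qed.

Lemma l2_reflect x M : l2 x M -> l2 (fun j => x (- j)) M.
Proof.
move=> xM a k; case: k => [|k]; first by rewrite big_ord0; exact: l2_ge0 xM.
have := xM (- (a + k%:Z)) k.+1; rewrite (reindex_inj rev_ord_inj)/=.
congr (_ <= _); apply: eq_bigr => i _; congr (vsq (x _)).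
have ik : (i <= k)%N by rewrite -ltnS.
by rewrite subSS; lia.
Qed.

Lemma l2_point x M j : l2 x M -> vsq (x j) <= M.
Proof. by move=> /(_ j 1%N); rewrite big_ord1 addr0. Qed.

Lemma l2_comb x y M H (al be : R) : 0 <= al -> 0 <= be -> l2 x M -> l2 y H ->
  forall z : int -> 'rV[C]_n, (forall j, vsq (z j) <= al * vsq (x j) + be * vsq (y j)) ->
  l2 z (al * M + be * H).
Proof.
move=> al0 be0 xM yH z zxy a k.
apply: (@le_trans _ _ (\sum_(i < k) (al * vsq (x (a + i%:Z)) + be * vsq (y (a + i%:Z))))).
  by apply: ler_sum.
rewrite big_split/= -!mulr_sumr.
by apply: lerD; apply: ler_wpM2l => //; [exact: xM|exact: yH].
Qed.

Lemma l2D x y M H : l2 x M -> l2 y H -> l2 (fun j => x j + y j) (2 * M + 2 * H).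
Proof.
move=> xM yH; apply: (l2_comb _ _ xM yH) => // j.
by have := vsqD (x j) (y j) ltr01; rewrite invr1.
Qed.

Lemma l2_mulmx (Q : 'M[C]_n) : exists2 K : R, 0 <= K &
  forall x M, l2 x M -> l2 (fun j => x j *m Q) (K * M).
Proof.
have [K K0 QK] := vsq_mulmx Q; exists K => // x M xM a k.
apply: (@le_trans _ _ (\sum_(i < k) K * vsq (x (a + i%:Z)))); first by apply: ler_sum.
by rewrite -mulr_sumr; apply: ler_wpM2l => //; exact: xM.
Qed.

Lemma l2Z (l : C) x M : l2 x M -> l2 (fun j => l *: x j) (csq l * M).
Proof.
move=> xM a k; under eq_bigr do rewrite vsqZ.
by rewrite -mulr_sumr; apply: ler_wpM2l; [exact: csq_ge0|exact: xM].
Qed.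

(** Let [S] be the supremum of the window sums, finite by [M]. Moving windows by one index gives
    [S <= r S + be H], and the final bound no longer involves [M]. *)
Lemma l2_contraction (r : R) x h M H (be : R) : 0 <= r -> r < 1 -> 0 <= be ->
  l2 x M -> l2 h H ->
  (forall j, vsq (x (j + 1)) <= r * vsq (x j) + be * vsq (h j)) ->
  l2 x (be * H / (1 - r)).
Proof.
move=> r0 r1 be0 xM hH xr.
pose A := [set s | exists a k, s = \sum_(i < k) vsq (x (a + i%:Z))].
have Aub : has_ubound A by exists M => s [a [k ->]]; exact: xM.
have A0 : A !=set0 by exists 0, 0, 0%N; rewrite big_ord0.
have xS : l2 x (sup A) by move=> a k; apply: ub_le_sup => //; exists a, k.
have : sup A <= r * sup A + be * H.
  apply: ge_sup => // s [a [k ->]].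
  rewrite (eq_bigr (fun i : 'I_k => vsq (x ((a - 1 + i%:Z) + 1)))); last first.
    by move=> i _; congr (vsq (x _)); ring.
  exact: (l2_comb r0 be0 xS hH (z := fun j => x (j + 1))).
move=> SS; apply: l2_le xS; rewrite ler_pdivlMr ?subr_gt0//; lra.
Qed.

Lemma contraction_rate (l : C) : csq l < 1 -> exists r be : R,
  [/\ 0 <= r, r < 1, 0 <= be & forall v w : 'rV[C]_n, vsq (l *: v + w) <= r * vsq v + be * vsq w].
Proof.
have l0 := csq_ge0 l; set p := csq l in l0 * => p1.
pose d := (1 - p) / 2; have d0 : 0 < d by rewrite divr_gt0// subr_gt0.
exists ((1 + d) * p), (1 + d^-1); split.
- by rewrite mulr_ge0// addr_ge0// ltW.
- by rewrite /d; nra.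
- by rewrite addr_ge0// invr_ge0 ltW.
- by move=> v w; rewrite -mulrA -vsqZ; exact: vsqD.
Qed.

Lemma shift_bound_lt1 (l : C) : csq l < 1 -> exists2 K : R, 0 <= K &
  forall x h M H, l2 x M -> l2 h H -> (forall j, x (j + 1) = l *: x j + h j) -> l2 x (K * H).
Proof.
move=> /contraction_rate[r [be [r0 r1 be0 H0]]].
exists (be / (1 - r)); first by rewrite divr_ge0// subr_ge0 ltW.
move=> x h M H xM hH xr; rewrite mulrAC.
by apply: (l2_contraction r0 r1 be0 xM hH) => j; rewrite xr.
Qed.

Lemma geometric_cvg (u : nat -> R) (r M : R) : 0 <= r -> r < 1 -> 0 <= M ->
  (forall k, (u k.+1 - u k) ^+ 2 <= M * r ^+ k) -> cvgn u.
Proof.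
move=> r0 r1 M0 uM.
pose s := Num.sqrt r.
have s0 : 0 <= s by exact: sqrtr_ge0.
have s1 : s < 1 by rewrite -sqrtr1 ltr_sqrt.
have ub k : `|u k.+1 - u k| <= Num.sqrt M * s ^+ k.
  rewrite -sqrtr_sqr; apply: (le_trans (ler_wsqrtr (uM k))).
  rewrite sqrtrM// ler_wpM2l ?sqrtr_ge0// /s.
  by elim: k => [|k IH]; rewrite ?expr0 ?sqrtr1// !exprS sqrtrM// ler_wpM2l.
have -> : u = fun k => u 0%N + series (fun k => u k.+1 - u k) k.
  by apply/funext => k; rewrite /series/= telescope_sumr// addrC subrK.
apply: is_cvgD; first exact: is_cvg_cst.
apply: normed_cvg; apply: (series_le_cvg _ _ ub) => //.
- by move=> k /=; rewrite mulr_ge0 ?sqrtr_ge0// exprn_ge0.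
- by apply: is_cvg_geometric_series; rewrite ger0_norm.
Qed.

(** The sequences [y N] are partial sums of the Neumann series in the past values of [h]. They
    converge geometrically at each index and keep a common [l^2] bound, which passes to the
    limit. *)
Lemma shift_solve_lt1 (l : C) : csq l < 1 -> exists2 K : R, 0 <= K &
  forall h H, l2 h H -> exists2 x, l2 x (K * H) & forall j, x (j + 1) = l *: x j + h j.
Proof.
move=> l1; have [r [be [r0 r1 be0 HR]]] := contraction_rate l1.
have r1' : 0 < 1 - r by rewrite subr_gt0.
exists (be / (1 - r)); first by rewrite divr_ge0// ltW.
move=> h H hH; set K := _ / _.
have H0 := l2_ge0 hH.
have KH0 : 0 <= K * H by rewrite mulr_ge0// divr_ge0// ltW.
pose y := fix y N (j : int) : 'rV[C]_n := if N is N'.+1 then l *: y N' (j - 1) + h (j - 1) else 0.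
have yK N : l2 (y N) (K * H).
  elim: N => [|N IH].
    move=> a k; rewrite big1// => i _.
    by rewrite /vsq big1// => j _; rewrite /csq mxE /= expr0n addr0.
  (* [K * H] is the fixed point of [t -> r t + be H], so the bound is reproduced by each
     iteration. *)
  have e : r * (K * H) + be * H = K * H by rewrite /K; field; rewrite gt_eqF.
  rewrite -e; apply: (l2_comb r0 be0 (l2_shift (-1) IH) (l2_shift (-1) hH)) => j /=.
  exact: HR.
have dy N j : vsq (y N.+1 j - y N j) <= H * csq l ^+ N.
  elim: N j => [|N IH] j.
    rewrite expr0 mulr1 /= subr0 scaler0 add0r; exact: l2_point hH.
  have -> : y N.+2 j - y N.+1 j = l *: (y N.+1 (j - 1) - y N (j - 1)).
    by rewrite [y N.+2 j]/= [y N.+1 j in LHS]/= opprD addrACA subrr addr0 scalerBr.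
  by rewrite vsqZ exprS mulrCA ler_wpM2l ?csq_ge0.
have cy (f : C -> R) : (forall z w, f (z - w) = f z - f w) -> (forall z, f z ^+ 2 <= csq z) ->
    forall j i, cvgn (fun N => f (y N j 0 i)).
  move=> fB fq j i; apply: (@geometric_cvg _ (csq l) H) => //; first exact: csq_ge0.
  move=> N; rewrite -fB; apply: (le_trans (fq _)); apply: le_trans (dy N j).
  rewrite /vsq (bigD1 i)//= !mxE lerDl; apply: sumr_ge0 => k _; exact: csq_ge0.
have ReB (z w : C) : complex.Re (z - w) = complex.Re z - complex.Re w by case: z w => [? ?] [? ?].
have ImB (z w : C) : complex.Im (z - w) = complex.Im z - complex.Im w by case: z w => [? ?] [? ?].
have Req (z : C) : complex.Re z ^+ 2 <= csq z by rewrite /csq lerDl sqr_ge0.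
have Imq (z : C) : complex.Im z ^+ 2 <= csq z by rewrite /csq lerDr sqr_ge0.
have cRe := cy _ ReB Req; have cIm := cy _ ImB Imq.
pose x j : 'rV[C]_n := \row_i (limn (fun N => complex.Re (y N j 0 i)) +i*
                               limn (fun N => complex.Im (y N j 0 i)))%C.
exists x.
  move=> a k.
  have cs : (fun N => \sum_(i < k) vsq (y N (a + i%:Z))) @ \oo -->
      \sum_(i < k) vsq (x (a + i%:Z)).
    apply: cvg_big => [|i _]; first exact: add_continuous.
    apply: cvg_big => [|q _]; first exact: add_continuous.
    rewrite /x mxE /csq/=; apply: cvgD.
      by under eq_fun do rewrite expr2; rewrite expr2; apply: cvgM; exact: cRe.
    by under eq_fun do rewrite expr2; rewrite expr2; apply: cvgM; exact: cIm.
  apply: (cvgr_to_le cs); by near=> N; exact: yK.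
move=> j; apply/rowP => i; rewrite !mxE.
set p := limn _; set q := limn _; set p' := limn _; set q' := limn _.
have yS N : y N.+1 (j + 1) 0 i = l * y N j 0 i + h j 0 i.
  by rewrite /= addrK !mxE.
have cS (f : C -> R) : cvgn (fun N => f (y N (j + 1) 0 i)) ->
    limn (fun N => f (y N (j + 1) 0 i)) = limn (fun N => f (l * y N j 0 i + h j 0 i)).
  move=> /cvg_ex[/= L fL].
  have -> : (fun N => f (l * y N j 0 i + h j 0 i)) = (fun N => f (y N.+1 (j + 1) 0 i)).
    by apply/funext => N; rewrite yS.
  rewrite (cvg_lim (@Rhausdorff R) fL); apply/esym/cvg_lim; first exact: Rhausdorff.
  by rewrite (cvg_shiftS (fun N => f (y N (j + 1) 0 i))).
have ReE (a b c : C) : complex.Re (a * b + c) =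
    complex.Re a * complex.Re b - complex.Im a * complex.Im b + complex.Re c.
  by case: a b c => [? ?] [? ?] [? ?].
have ImE (a b c : C) : complex.Im (a * b + c) =
    complex.Re a * complex.Im b + complex.Im a * complex.Re b + complex.Im c.
  by case: a b c => [? ?] [? ?] [? ?].
have pE : p = complex.Re (l * (p' +i* q')%C + h j 0 i).
  rewrite /p (cS (fun z => complex.Re z) (cRe _ _)) ReE; under eq_fun do rewrite ReE.
  apply/cvg_lim; first exact: Rhausdorff.
  apply: cvgD; last exact: cvg_cst.
  apply: cvgB; apply: cvgMl_tmp; [exact: cRe|exact: cIm].
have qE : q = complex.Im (l * (p' +i* q')%C + h j 0 i).
  rewrite /q (cS (fun z => complex.Im z) (cIm _ _)) ImE; under eq_fun do rewrite ImE.
  apply/cvg_lim; first exact: Rhausdorff.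
  apply: cvgD; last exact: cvg_cst.
  apply: cvgD; apply: cvgMl_tmp; [exact: cIm|exact: cRe].
by rewrite pE qE; case: (_ + _).
Unshelve. all: by end_near.
Qed.

(** Read backwards, the recurrence has multiplier [1/l], which reduces the case of modulus above 1
    to that below 1. *)
Lemma shift_reverse (l : C) x h : l != 0 -> (forall j, x (j + 1) = l *: x j + h j) ->
  forall j, x (- (j + 1)) = l^-1 *: x (- j) + - (l^-1 *: h (- j - 1)).
Proof.
move=> l0 xr j; have := xr (- j - 1); rewrite subrK => ->.
by rewrite opprD scalerDr scalerA mulVf// scale1r addrK.
Qed.

Lemma csq_neq1 (l : C) : csq l != 1 -> csq l < 1 \/ l != 0 /\ csq l^-1 < 1.
Proof.
case: (ltgtP (csq l) 1) => // l1 _; [by left|right].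
have l0 : l != 0.
  by apply/eqP => e; move: l1; rewrite e /csq/= expr0n addr0 ltNge ler01.
split=> //; have : csq l * csq l^-1 = 1.
  by rewrite -csqM mulfV// /csq/= expr1n expr0n addr0.
by move=> e; rewrite -(ltr_pM2l (lt_trans ltr01 l1)) e mulr1.
Qed.

Lemma shift_bound (l : C) : csq l != 1 -> exists2 K : R, 0 <= K &
  forall x h M H, l2 x M -> l2 h H -> (forall j, x (j + 1) = l *: x j + h j) -> l2 x (K * H).
Proof.
move=> /csq_neq1[/shift_bound_lt1//|[l0 /[dup] li /shift_bound_lt1[K K0 HK]]].
exists (K * csq l^-1); first by rewrite mulr_ge0// csq_ge0.
move=> x h M H xM hH xr; rewrite -mulrA.
apply: (l2_ext (x := fun j => x (- - j))) => [j|]; first by rewrite opprK.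
apply: (@l2_reflect (fun j => x (- j))).
apply: (HK _ (fun j => - (l^-1 *: h (- j - 1))) M) (shift_reverse l0 xr).
  exact: l2_reflect.
have := l2Z (- l^-1) (l2_shift 1 (l2_reflect hH)).
rewrite csqN; apply: l2_ext => j.
by rewrite scaleNr opprD.
Qed.

Lemma shift_solve (l : C) : csq l != 1 -> exists2 K : R, 0 <= K &
  forall h H, l2 h H -> exists2 x, l2 x (K * H) & forall j, x (j + 1) = l *: x j + h j.
Proof.
move=> /csq_neq1[/shift_solve_lt1//|[l0 /[dup] li /shift_solve_lt1[K K0 HK]]].
exists (K * csq l^-1); first by rewrite mulr_ge0// csq_ge0.
move=> h H hH.
have hr : l2 (fun j => - (l^-1 *: h (- j - 1))) (csq l^-1 * H).
  have := l2Z (- l^-1) (l2_shift 1 (l2_reflect hH)).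
  by rewrite csqN; apply: l2_ext => j; rewrite scaleNr opprD.
have [y yK yr] := HK _ _ hr.
exists (fun j => y (- j)); first by rewrite -mulrA; exact: l2_reflect.
move=> j; have := yr (- (j + 1)).
have -> : - (j + 1) + 1 = - j by ring.
have -> : - - (j + 1) - 1 = j by ring.
move=> /(congr1 (fun v => l *: v)); rewrite scalerDr scalerN !scalerA mulfV// !scale1r => ->.
by rewrite subrK.
Qed.

End vectors.

Section matrices.
Context {n : nat}.
Variable Q : 'M[C]_n.
Implicit Types (x y h : int -> 'rV[C]_n) (M H : R) (rs : seq C).

(** The polynomial with roots [rs], evaluated at the shift operator and applied to [x]; [mx_prod] is
    the same polynomial at [Q]. *)
Fixpoint shift_prod rs x : int -> 'rV[C]_n :=
  if rs is l :: rs' then fun j => shift_prod rs' x (j + 1) - l *: shift_prod rs' x j else x.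

Fixpoint mx_prod rs : 'M[C]_n :=
  if rs is l :: rs' then mx_prod rs' *m (Q - l%:M) else 1%:M.

Lemma shift_prod_l2 rs : exists2 K : R, 0 <= K &
  forall x M, l2 x M -> l2 (shift_prod rs x) (K * M).
Proof.
elim: rs => [|l rs [K K0 HK]]; first by exists 1 => // x M; rewrite mul1r.
exists (2 * K + 2 * csq l * K); first by rewrite addr_ge0// !mulr_ge0// csq_ge0.
move=> x M /HK xM /=.
have := l2D (l2_shift 1 xM) (l2Z (- l) xM); rewrite csqN.
rewrite (_ : _ + _ = (2 * K + 2 * csq l * K) * M); last by ring.
by apply: l2_ext => j; rewrite scaleNr.
Qed.

Lemma shift_prod_bound rs : all (fun l => csq l != 1) rs -> exists2 K : R, 0 <= K &
  forall x M H, l2 x M -> l2 (shift_prod rs x) H -> l2 x (K * H).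
Proof.
elim: rs => [_|l rs IH /= /andP[l1 /IH[K K0 HK]]].
  by exists 1 => // x M H _; rewrite mul1r.
have [K' K'0 HK'] := shift_bound (n := n) l1; have [S S0 HS] := shift_prod_l2 rs.
exists (K * K'); first exact: mulr_ge0.
move=> x M H xM xH; rewrite -mulrA; apply: (HK _ _ _ xM).
apply: (HK' _ _ _ _ (HS _ _ xM) xH) => j.
by rewrite [RHS]addrC subrK.
Qed.

Lemma shift_prod_solve rs : all (fun l => csq l != 1) rs -> exists2 K : R, 0 <= K &
  forall h H, l2 h H -> exists2 x, l2 x (K * H) & shift_prod rs x = h.
Proof.
elim: rs => [_|l rs IH /= /andP[l1 /IH[K K0 HK]]].
  by exists 1 => // h H hH; exists h; rewrite ?mul1r.
have [K' K'0 HK'] := shift_solve (n := n) l1.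
exists (K * K'); first exact: mulr_ge0.
move=> h H /HK'[z zK zr]; have [x xK xz] := HK _ _ zK.
by exists x; rewrite -?mulrA// xz; apply/funext => j; rewrite zr addrAC subrr add0r.
Qed.

(* Division of [chi(S) - chi(Q)] by [S - Q], for [S] the shift, on solutions. *)
Lemma shift_prod_of_solution rs : exists2 K : R, 0 <= K &
  forall x h H, l2 h H -> (forall j, x (j + 1) = x j *m Q + h j) ->
  exists2 q, l2 q (K * H) & forall j, shift_prod rs x j = x j *m mx_prod rs + q j.
Proof.
elim: rs => [|l rs [K K0 HK]].
  exists 0 => // x h H hH _; exists (fun=> 0) => [a k|j]; last by rewrite mulmx1 addr0.
  rewrite mul0r big1// => i _; rewrite /vsq big1// => q _.
  by rewrite mxE /csq/= expr0n addr0.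
have [S S0 HS] := l2_mulmx (mx_prod rs).
exists (2 * S + 2 * (2 * K + 2 * csq l * K)).
  by rewrite addr_ge0// ?mulr_ge0// addr_ge0// !mulr_ge0// csq_ge0.
move=> x h H hH xr; have [q qK qE] := HK _ _ _ hH xr.
have := l2D (HS _ _ hH) (l2D (l2_shift 1 qK) (l2Z (- l) qK)); rewrite csqN.
rewrite (_ : _ + _ = (2 * S + 2 * (2 * K + 2 * csq l * K)) * H); last by ring.
move=> qq; exists (fun j => h j *m mx_prod rs + (q (j + 1) + - l *: q j)) => // j /=.
have cQ : comm_mx Q (mx_prod rs).
  elim: (rs) => [|l' rs' IH] /=; first exact: comm_mx1.
  by apply: comm_mxM => //; apply: comm_mxB => //; exact: comm_mx_scalar.
rewrite !qE xr mulmxDl -mulmxA cQ mulmxBr mul_mx_scalar mulmxBr.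
rewrite -scalemxAr mulmxA scalerDr scaleNr opprD.
by rewrite -!addrA; congr (_ + _); rewrite [RHS]addrCA; congr (_ + _); rewrite [RHS]addrCA.
Qed.

(** The same polynomial division in the other direction: the quotient of [chi(S) - chi(Q)] by
    [S - Q], applied to [y], solves the recurrence with forcing [chi(S) y - chi(Q) y]. *)
Lemma solution_of_shift_prod rs : exists2 K : R, 0 <= K &
  forall y M, l2 y M -> exists2 x, l2 x (K * M) &
    forall j, x (j + 1) = x j *m Q + (shift_prod rs y j - y j *m mx_prod rs).
Proof.
elim: rs => [|l rs [K K0 HK]].
  exists 0 => // y M yM; exists (fun=> 0) => [a k|j]; last by rewrite mulmx1 subrr mul0mx addr0.
  rewrite mul0r big1// => i _; rewrite /vsq big1// => q _.
  by rewrite mxE /csq/= expr0n addr0.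
have [S S0 HS] := l2_mulmx (Q - l%:M); have [Y Y0 HY] := shift_prod_l2 rs.
exists (2 * Y + 2 * (S * K)); first by rewrite addr_ge0// !mulr_ge0.
move=> y M yM; have [x xK xr] := HK _ _ yM.
have := l2D (HY _ _ yM) (HS _ _ xK).
rewrite (_ : _ + _ = (2 * Y + 2 * (S * K)) * M); last by ring.
move=> xx; exists (fun j => shift_prod rs y j + x j *m (Q - l%:M)) => // j /=.
have key v : v *m (Q - l%:M) = v *m Q - l *: v by rewrite mulmxBr mul_mx_scalar.
rewrite mulmxA !key xr !mulmxDl ?mulNmx -?scalemxAl.
move: (x j *m Q *m Q) (x j *m Q) (shift_prod rs y j *m Q) (shift_prod rs y j)
  (shift_prod rs y (j + 1)) (y j *m mx_prod rs *m Q) (y j *m mx_prod rs) => *.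
by apply/rowP => i; rewrite !mxE; ring.
Qed.

End matrices.

Section hyperbolic.
Context {n : nat}.
Variable Q : 'M[C]_n.+1.
Hypothesis hypQ : forall l, csq l = 1 -> ~~ eigenvalue Q l.

(** Cayley-Hamilton for the split characteristic polynomial, whose roots are eigenvalues and so
    avoid the unit circle. Scalar recurrences, one for each root, then replace spectral projections
    or a Jordan form. *)
Lemma hyperbolic_annihilator : exists2 rs, all (fun l => csq l != 1) rs & mx_prod Q rs = 0.
Proof.
have [rs rsE] := closed_field_poly_normal (char_poly Q).
exists rs.
  apply/allP => l lrs; apply/eqP => /hypQ; rewrite eigenvalue_root_char rsE.
  by rewrite rootZ ?lead_coef_eq0 ?monic_neq0 ?char_poly_monic// root_prod_XsubC lrs.
have <- : horner_mx Q (\prod_(z <- rs) ('X - z%:P)) = mx_prod Q rs.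
  elim: (rs) => [|l rs' IH]; first by rewrite big_nil rmorph1.
  rewrite big_cons mulrC rmorphM/= IH; congr (_ *m _).
  by rewrite rmorphB/= horner_mx_X horner_mx_C.
have := Cayley_Hamilton Q; rewrite {1}rsE (monicP (char_poly_monic Q)) scale1r.
exact.
Qed.

(** As [chi(Q) = 0], division shows that [chi(S) x] depends on [h] alone, and each factor [S - l] of
    [chi(S)] has a bounded inverse. *)
Lemma hyperbolic_bound : exists2 K : R, 0 <= K & forall (x h : int -> 'rV[C]_n.+1) (M H : R),
  l2 x M -> l2 h H -> (forall j, x (j + 1) = x j *m Q + h j) -> l2 x (K * H).
Proof.
have [rs rs1 rs0] := hyperbolic_annihilator.
have [K K0 HK] := shift_prod_bound (n := n.+1) rs1.
have [K' K'0 HK'] := shift_prod_of_solution Q rs.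
exists (K * K'); first exact: mulr_ge0.
move=> x h M H xM hH xr; have [q qK qE] := HK' _ _ _ hH xr.
rewrite -mulrA; apply: (HK _ _ _ xM); apply: (l2_ext _ qK) => j.
by rewrite qE rs0 mulmx0 add0r.
Qed.

(** Solve [chi(S) y = h] factor by factor; the quotient applied to [y] is then a solution because
    [chi(Q) = 0]. *)
Lemma hyperbolic_solve : exists2 K : R, 0 <= K & forall (h : int -> 'rV[C]_n.+1) (H : R),
  l2 h H -> exists2 x, l2 x (K * H) & forall j, x (j + 1) = x j *m Q + h j.
Proof.
have [rs rs1 rs0] := hyperbolic_annihilator.
have [K K0 HK] := shift_prod_solve (n := n.+1) rs1.
have [K' K'0 HK'] := solution_of_shift_prod Q rs.
exists (K' * K); first exact: mulr_ge0.
move=> h H hH; have [y yK yr] := HK _ _ hH; have [x xK xr] := HK' _ _ yK.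
by exists x; [rewrite -mulrA|move=> j; rewrite xr yr rs0 mulmx0 subr0].
Qed.

End hyperbolic.

Lemma l2_dim0 (x : int -> 'rV[C]_0) (M : R) : 0 <= M -> l2 x M.
Proof. by move=> M0 a k; rewrite big1// => i _; rewrite /vsq big_ord0. Qed.

Lemma hyperbolic_boundn n (Q : 'M[C]_n) : (forall l, csq l = 1 -> ~~ eigenvalue Q l) ->
  exists2 K : R, 0 <= K & forall (x h : int -> 'rV[C]_n) (M H : R),
  l2 x M -> l2 h H -> (forall j, x (j + 1) = x j *m Q + h j) -> l2 x (K * H).
Proof.
case: n Q => [|n] Q hQ; last exact: hyperbolic_bound.
by exists 0 => // *; apply: l2_dim0; rewrite mul0r.
Qed.

Lemma hyperbolic_solven n (Q : 'M[C]_n) : (forall l, csq l = 1 -> ~~ eigenvalue Q l) ->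
  exists2 K : R, 0 <= K & forall (h : int -> 'rV[C]_n) (H : R),
  l2 h H -> exists2 x, l2 x (K * H) & forall j, x (j + 1) = x j *m Q + h j.
Proof.
case: n Q => [|n] Q hQ; last exact: hyperbolic_solve.
exists 0 => // h H _; exists (fun=> 0) => [|j]; first by apply: l2_dim0; rewrite mul0r.
by apply/rowP; case.
Qed.

End l2_sequences.

Lemma periodic_int {R : realType} {A : Type} (L : R) (f : R -> A) :
  (forall x, f (x + L) = f x) -> forall (j : int) x, f (x + j%:~R * L) = f x.
Proof.
move=> fL.
have H (n : nat) x : f (x + n%:R * L) = f x.
  elim: n x => [|n IH] x; first by rewrite mul0r addr0.
  by rewrite -natr1 mulrDl mul1r addrA fL IH.
case=> n x; first exact: H.
have := H n.+1 (x - n.+1%:R * L); rewrite subrK => ->.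
by rewrite NegzE mulrNz mulNr.
Qed.

(** * Floquet theory *)

Section floquet.
Context {R : realType} {S : finType}.
Variables (B : S -> S -> R -> R) (Kb L : R).
Hypothesis L0 : 0 < L.
Hypothesis cB : forall s t, continuous (B s t).
Hypothesis BK : forall s t x, `|B s t x| <= Kb.
Hypothesis BL : forall s t x, B s t (x + L) = B s t x.
Implicit Types (G Y V : S -> R -> R) (x : R) (s t : S) (v : S -> R).

Definition sqs v := \sum_s v s ^+ 2.

Lemma sqs_ge0 v : 0 <= sqs v.
Proof. by apply: sumr_ge0 => s _; exact: sqr_ge0. Qed.

Lemma sqsD v w : sqs (fun s => v s + w s) <= 2 * sqs v + 2 * sqs w.
Proof.
rewrite /sqs !mulr_sumr -big_split; apply: ler_sum => s _ /=.
have := sqr_ge0 (v s - w s); lra.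
Qed.

Lemma sqs_eq0 v : sqs v <= 0 -> forall s, v s = 0.
Proof.
move=> v0 s; have /eqP : sqs v = 0 by apply/eqP; rewrite eq_le v0 sqs_ge0.
rewrite /sqs => /eqP/psumr_eq0P => /(_ (fun i _ => sqr_ge0 _) s isT) /eqP.
by rewrite sqrf_eq0 => /eqP.
Qed.

Lemma sqs_apply (M : S -> S -> R) (K : R) v : (forall s t, `|M s t| <= K) ->
  sqs (fun s => \sum_t M s t * v t) <= (#|S|%:R * K) ^+ 2 * sqs v.
Proof.
move=> MK.
have H s : (\sum_t M s t * v t) ^+ 2 <= #|S|%:R * K ^+ 2 * sqs v.
  have K0 : 0 <= K by apply: le_trans (MK s s).
  apply: (le_trans (sum_sqr_le _)); rewrite -mulrA ler_wpM2l// mulr_sumr.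
  apply: ler_sum => t _; rewrite exprMn ler_wpM2r ?sqr_ge0//.
  rewrite -[M s t ^+ 2]real_normK ?num_real// lerXn2r ?nnegrE//.
apply: (@le_trans _ _ (\sum_(s : S) #|S|%:R * K ^+ 2 * sqs v)); first by apply: ler_sum.
by rewrite sumr_const -[_ *+ _]mulr_natr le_eqVlt; apply/orP; left; apply/eqP; ring.
Qed.

(* Mild solutions of [Y' = B Y + G'], where [G] need not be differentiable. *)
Definition mild G Y := forall s x,
  is_derive x (1 : R) (fun x => Y s x - G s x) (\sum_t B s t x * Y t x).

(** [Y - (G - c)] solves a classical system forced by [B (G - c)]. The free constant [c] is set to
    the value of [G] at the start of a period, so that only the oscillation of [G] counts. *)
Lemma mild_lin G Y (c : S -> R) : mild G Y ->
  lin_sol B (fun s x => \sum_t B s t x * (G t x - c t)) (fun s x => Y s x - (G s x - c s)).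
Proof.
move=> mY s x; have := derD (mY s x) (is_derive_cst (c s) x 1).
rewrite addr0.
have -> : (fun y => Y s y - G s y + cst (c s) y) = (fun y => Y s y - (G s y - c s)).
  by apply/funext => y /=; ring.
congr is_derive; rewrite -big_split/=; apply: eq_bigr => t _; ring.
Qed.

Lemma lin_mild G Y : 
  lin_sol B (fun s x => \sum_t B s t x * G t x) (fun s x => Y s x - G s x) -> mild G Y.
Proof.
move=> mY s x; have := mY s x.
congr is_derive; rewrite -big_split/=; apply: eq_bigr => t _; ring.
Qed.

Lemma hom_mild V : lin_sol B (fun _ _ => 0) V <-> mild (fun _ _ => 0) V.
Proof.
split=> VS s x; have := VS s x; rewrite ?addr0.
  by congr is_derive; apply/funext => y; rewrite subr0.
by congr is_derive; apply/funext => y; rewrite subr0.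
Qed.

Lemma mildD G G' Y Y' (k k' : R) : mild G Y -> mild G' Y' ->
  mild (fun s x => k * G s x + k' * G' s x) (fun s x => k * Y s x + k' * Y' s x).
Proof.
move=> mY mY' s x; have := derD (derZ k (mY s x)) (derZ k' (mY' s x)).
have -> : (fun y => k * (Y s y - G s y) + k' * (Y' s y - G' s y)) =
  (fun y => k * Y s y + k' * Y' s y - (k * G s y + k' * G' s y)).
  by apply/funext => y; ring.
congr is_derive; rewrite !mulr_sumr -big_split/=; apply: eq_bigr => t _; ring.
Qed.

Lemma mild_shift G Y (j : int) (c : S -> R) : mild G Y ->
  mild (fun s x => G s (x + j%:~R * L) - c s) (fun s x => Y s (x + j%:~R * L)).
Proof.
move=> mY s x; have := mY s (1 * x + j%:~R * L) => /is_derive_comp_affine.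
rewrite !mul1r => H; have := derD H (is_derive_cst (c s) x 1); rewrite addr0.
have -> : (fun y => Y s (1 * y + j%:~R * L) - G s (1 * y + j%:~R * L) + cst (c s) y) =
  (fun y => Y s (y + j%:~R * L) - (G s (y + j%:~R * L) - c s)).
  by apply/funext => y /=; rewrite mul1r; ring.
by congr is_derive; apply: eq_bigr => t _; rewrite (periodic_int (BL s t)).
Qed.

Lemma mild_exists G v : (forall s, continuous (G s)) ->
  exists Y, mild G Y /\ forall s, Y s 0 = v s + G s 0.
Proof.
move=> cG.
have [|V [VS V0]] := @lin_sol_exists R S B (fun s x => \sum_t B s t x * G t x) Kb v cB BK.
  by move=> s; apply: continuous_sum => t; exact: continuousMf.
exists (fun s x => V s x + G s x); split; last by move=> s; rewrite V0.
apply: lin_mild => s x; have := VS s x.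
have -> : (fun y => V s y + G s y - G s y) = V s by apply/funext => y; rewrite addrK.
by congr is_derive; congr (_ + _); apply: eq_bigr => b _; rewrite addrK.
Qed.

Lemma mild_eq0 Y : mild (fun _ _ => 0) Y -> (forall s, Y s 0 = 0) -> forall s x, Y s x = 0.
Proof. by move=> /hom_mild VS; exact: lin_sol_eq0 VS BK. Qed.

Lemma mild_unique G Y Y' : mild G Y -> mild G Y' -> (forall s, Y s 0 = Y' s 0) ->
  forall s x, Y s x = Y' s x.
Proof.
move=> mY mY' YY s x; have := mildD 1 (-1) mY mY' => m0.
apply/eqP; rewrite -subr_eq0; apply/eqP.
rewrite -[Y s x]mul1r -mulN1r; apply: (@mild_eq0 (fun s x => 1 * Y s x + -1 * Y' s x)).
  move=> t y; have := m0 t y; congr is_derive; apply/funext => q; ring.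
by move=> t; rewrite YY; ring.
Qed.

Let C1 := expR ((2 * Kb * #|S|%:R + 1) * L).
Let C2 := (#|S|%:R * Kb) ^+ 2.

Let C20 : 0 <= C2. Proof. exact: sqr_ge0. Qed.

Lemma growth_cell G Y (c : S -> R) (beta x : R) : mild G Y -> 0 <= x <= L ->
  (forall y, 0 <= y <= L -> sqs (fun s => G s y - c s) <= beta) ->
  sqs (fun s => Y s x - (G s x - c s)) <=
    `|C1| * (sqs (fun s => Y s 0 - (G s 0 - c s)) + C2 * beta * L) /\ 0 <= beta.
Proof.
move=> mY /andP[x0 xL] Gb.
have b0 : 0 <= beta by apply: le_trans (Gb 0 _); rewrite ?sqs_ge0// lexx ltW.
split=> //.
have H y : 0 <= y <= x ->
    sqs (fun s => \sum_t B s t y * (G t y - c t)) <= C2 * beta.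
  move=> /andP[y0 yx]; apply: (le_trans (sqs_apply _ (fun s t => BK s t y))).
  by rewrite ler_wpM2l ?sqr_ge0// Gb// y0 (le_trans yx).
have := lin_growth (mild_lin c mY) BK x0 H; rewrite subr0.
move=> /le_trans; apply; apply: ler_pM.
- exact: expR_ge0.
- by rewrite addr_ge0 ?sqs_ge0// mulr_ge0// mulr_ge0// sqr_ge0.
- rewrite ger0_norm ?expR_ge0// ler_expR; apply: ler_wpM2l => //.
  have K0 : `|Kb| = Kb \/ #|S| = 0%N.
    case: (posnP #|S|) => [->|/card_gt0P[i _]]; first by right.
    by left; rewrite ger0_norm// (le_trans _ (BK i i 0)).
  rewrite addr_ge0//; case: K0 => [<-|->]; last by rewrite mulr0.
  by rewrite mulr_ge0// mulr_ge0.
- by rewrite lerD2l ler_wpM2l// mulr_ge0// sqr_ge0.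
Qed.

Definition fund t : S -> R -> R :=
  projT1 (cid (@mild_exists (fun _ _ => 0) (fun s => (s == t)%:R)
    (fun s x => cvg_cst 0))).

Lemma fund_mild t : mild (fun _ _ => 0) (fund t).
Proof. by rewrite /fund; case: cid => Y []. Qed.

Lemma fund0 s t : fund t s 0 = (s == t)%:R.
Proof. by rewrite /fund; case: cid => Y [_ H] /=; rewrite H addr0. Qed.

Definition mono s t := fund t s L.

Lemma mild_sum v : mild (fun _ _ => 0) (fun s x => \sum_t v t * fund t s x).
Proof.
move=> s x.
have := der_sum (fun t => derZ (v t) (fund_mild t s x)).
have -> : (fun y => \sum_i v i * (fund i s y - 0)) = (fun y => \sum_t v t * fund t s y - 0).
  by apply/funext => y; rewrite subr0; apply: eq_bigr => t _; rewrite subr0.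
congr is_derive; under eq_bigr do rewrite mulr_sumr.
rewrite exchange_big; apply: eq_bigr => t _ /=; rewrite mulr_sumr.
by apply: eq_bigr => i _; ring.
Qed.

Lemma hom_mono V x : mild (fun _ _ => 0) V ->
  (forall s, V s x = \sum_t V t 0 * fund t s x).
Proof.
move=> mV s; apply: (mild_unique mV (mild_sum (fun t => V t 0))) => q.
rewrite (bigD1 q)//= fund0 eqxx mulr1 big1 ?addr0// => t tq.
by rewrite fund0 eq_sym (negbTE tq) mulr0.
Qed.

Lemma hom_monoL V s : mild (fun _ _ => 0) V -> V s L = \sum_t mono s t * V t 0.
Proof. by move=> /(hom_mono L) ->; apply: eq_bigr => t _; rewrite mulrC. Qed.

(** A solution that vanishes at [L] vanishes everywhere, in particular at 0, where its value is
    [v]. *)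
Lemma mono_inj v : (forall s, \sum_t mono s t * v t = 0) -> forall s, v s = 0.
Proof.
move=> Pv s; pose V := fun s x => \sum_t v t * fund t s x.
have mV : mild (fun _ _ => 0) V := mild_sum v.
have VL q : V q L = 0 by rewrite -(Pv q); apply: eq_bigr => t _; rewrite mulrC.
have ms : mild (fun _ _ => 0) (fun s x => V s (x + (1 : int)%:~R * L)).
  by have := mild_shift 1 (fun=> 0) mV; congr mild; apply/funext => t; apply/funext => x; rewrite subr0.
have Vz := mild_eq0 ms.
have {}Vz q x : V q (x + 1 * L) = 0 by apply: Vz => t; rewrite add0r mul1r.
have := Vz s (- L); rewrite mul1r addNr /V (bigD1 s)//= fund0 eqxx mulr1.
rewrite big1 ?addr0// => t ts.
by rewrite fund0 eq_sym (negbTE ts) mulr0.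
Qed.

(** The forcing term in the recurrence that the values of [Y] on the lattice of period points
    satisfy. *)
Definition defect Y (x : R) s := Y s (x + L) - \sum_t mono s t * Y t x.

(** Subtracting the homogeneous solution with the same initial value leaves a solution [D] that
    starts at 0, and the defect is [D] at the end of the period. *)
Lemma defect_cell G Y (beta : R) : mild G Y ->
  (forall y, 0 <= y <= L -> sqs (fun s => G s y - G s 0) <= beta) ->
  sqs (defect Y 0) <= (2 * `|C1| * C2 * L + 2) * beta.
Proof.
move=> mY Gb.
have L1 : 0 <= L <= L by rewrite lexx ltW.
pose D s x := 1 * Y s x + -1 * \sum_t Y t 0 * fund t s x.
have mD : mild G D.
  have := mildD 1 (-1) mY (mild_sum (fun t => Y t 0)).
  congr mild; apply/funext => s; apply/funext => x; ring.
have D0 s : D s 0 = 0.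
  rewrite /D (bigD1 s)//= fund0 eqxx mulr1 big1; first by ring.
  by move=> t ts; rewrite fund0 eq_sym (negbTE ts) mulr0.
have [H b0] := growth_cell (c := fun s => G s 0) mD L1 Gb.
have z0 : sqs (fun s => D s 0 - (G s 0 - G s 0)) = 0.
  by rewrite /sqs big1// => s _; rewrite D0 !subrr expr0n.
move: H; rewrite z0 add0r => H.
have -> : defect Y 0 = fun s => (D s L - (G s L - G s 0)) + (G s L - G s 0).
  apply/funext => s; rewrite subrK /defect /D add0r mul1r mulN1r; congr (_ - _).
  by apply: eq_bigr => t _; rewrite mulrC.
apply: (le_trans (sqsD _ _)).
have h := Gb L L1.
rewrite (_ : _ * beta = 2 * (`|C1| * (C2 * beta * L)) + 2 * beta); last by ring.
by apply: lerD; rewrite ler_pM2l.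
Qed.

Definition cell_bound G (beta : int -> R) := forall (j : int) y, 0 <= y <= L ->
  sqs (fun s => G s (y + j%:~R * L) - G s (j%:~R * L)) <= beta j.

Definition wsum (beta : int -> R) (H : R) := forall (a : int) (k : nat),
  \sum_(i < k) beta (a + i%:Z) <= H.

Let Cd := 2 * `|C1| * C2 * L + 2.

Let Cd0 : 0 <= Cd.
Proof.
rewrite /Cd addr_ge0//; apply: mulr_ge0; last exact: ltW.
by apply: mulr_ge0 => //; apply: mulr_ge0.
Qed.

Lemma defect_bound G Y beta (j : int) : mild G Y -> cell_bound G beta ->
  sqs (defect Y (j%:~R * L)) <= Cd * beta j.
Proof.
move=> mY Gb.
have mj := mild_shift j (fun s => G s (j%:~R * L)) mY.
have -> : defect Y (j%:~R * L) = defect (fun s x => Y s (x + j%:~R * L)) 0.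
  by apply/funext => s; rewrite /defect !add0r (addrC L).
apply: (defect_cell mj) => y /(Gb j) H; rewrite add0r.
by under [X in sqs X]funext do rewrite opprB addrA subrK.
Qed.

Let Cg := 2 * (`|C1| * (1 + C2 * L)) + 2.

Lemma growth_bound G Y beta (j : int) x : mild G Y -> cell_bound G beta -> 0 <= x <= L ->
  sqs (Y^~ (x + j%:~R * L)) <= Cg * (sqs (Y^~ (j%:~R * L)) + beta j).
Proof.
move=> mY Gb xL.
have mj := mild_shift j (fun s => G s (j%:~R * L)) mY.
have Gj y : 0 <= y <= L ->
    sqs (fun s => G s (y + j%:~R * L) - G s (j%:~R * L) - 0) <= beta j.
  by move=> /(Gb j); under [X in _ -> sqs X <= _]funext do rewrite subr0.
have [H b0] := growth_cell (c := fun=> 0) mj xL Gj.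
have e0 : sqs (fun s => Y s (0 + j%:~R * L) - (G s (0 + j%:~R * L) - G s (j%:~R * L) - 0)) =
    sqs (Y^~ (j%:~R * L)).
  by congr sqs; apply/funext => s; rewrite add0r subrr !subr0.
rewrite e0 in H; set W := (fun s => Y s (x + _) - _) in H.
have -> : Y^~ (x + j%:~R * L) = fun s => W s + (G s (x + j%:~R * L) - G s (j%:~R * L)).
  by apply/funext => s; rewrite /W subr0 subrK.
apply: (le_trans (sqsD _ _)).
have y0 := sqs_ge0 (Y^~ (j%:~R * L)).
have h := Gb j x xL.
have c1 : 0 <= `|C1| by []; have c2 : 0 <= C2 * L by rewrite mulr_ge0 ?sqr_ge0// ltW.
set A := sqs W in H *; set y := sqs (Y^~ _) in H y0 *; set b := beta j in H b0 h *.
have e : Cg * (y + b) = 2 * (`|C1| * (y + C2 * b * L)) + 2 * b +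
   (2 * (`|C1| * (b + C2 * L * y)) + 2 * y) by rewrite /Cg; ring.
have p1 : 0 <= `|C1| * (b + C2 * L * y) by rewrite mulr_ge0// addr_ge0// mulr_ge0.
rewrite e; lra.
Qed.

Definition emb v : 'rV[R[i]]_#|S| := \row_i (v (enum_val i))%:C.
Definition rpart (w : 'rV[R[i]]_#|S|) s := complex.Re (w 0 (enum_rank s)).
Definition ipart (w : 'rV[R[i]]_#|S|) s := complex.Im (w 0 (enum_rank s)).
(** Transposed, since the recurrences act on row vectors from the right. *)
Definition mono_mx : 'M[R[i]]_#|S| := \matrix_(i, j) (mono (enum_val j) (enum_val i))%:C.

Lemma vsq_parts w : vsq w = sqs (rpart w) + sqs (ipart w).
Proof.
rewrite /vsq /sqs -big_split/= (reindex (@enum_rank S)); last first.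
  by apply: onW_bij; exact: enum_rank_bij.
by apply: eq_bigr => s _.
Qed.

Lemma rpart_emb v : rpart (emb v) = v.
Proof. by apply/funext => s; rewrite /rpart mxE enum_rankK. Qed.

Lemma vsq_emb v : vsq (emb v) = sqs v.
Proof.
rewrite vsq_parts rpart_emb /sqs [X in _ + X]big1 ?addr0// => s _.
by rewrite /ipart mxE /= expr0n.
Qed.

Lemma emb_mono v : emb (fun s => \sum_t mono s t * v t) = emb v *m mono_mx.
Proof.
apply/rowP => i; rewrite !mxE rmorph_sum/= (reindex (@enum_val S predT)); last first.
  by apply: onW_bij; exact: enum_val_bij.
by apply: eq_bigr => j _; rewrite !mxE rmorphM/= mulrC.
Qed.

Lemma ReM_real (z : R[i]) (a : R) : complex.Re (z * a%:C) = complex.Re z * a.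
Proof. by case: z => x y /=; rewrite mulr0 subr0. Qed.

Lemma ImM_real (z : R[i]) (a : R) : complex.Im (z * a%:C) = complex.Im z * a.
Proof. by case: z => x y /=; rewrite mulr0 add0r. Qed.

Lemma Re_sum (I : finType) (F : I -> R[i]) :
  complex.Re (\sum_i F i) = \sum_i complex.Re (F i).
Proof. by elim/big_rec2: _ => // i x [a b] _ <-; case: (F i). Qed.

Lemma Im_sum (I : finType) (F : I -> R[i]) :
  complex.Im (\sum_i F i) = \sum_i complex.Im (F i).
Proof. by elim/big_rec2: _ => // i x [a b] _ <-; case: (F i). Qed.

Lemma rpart_mono w s : rpart (w *m mono_mx) s = \sum_t mono s t * rpart w t.
Proof.
rewrite /rpart mxE Re_sum (reindex (@enum_rank S)); last first.
  by apply: onW_bij; exact: enum_rank_bij.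
by apply: eq_bigr => t _; rewrite mxE ReM_real !enum_rankK mulrC.
Qed.

Lemma ipart_mono w s : ipart (w *m mono_mx) s = \sum_t mono s t * ipart w t.
Proof.
rewrite /ipart mxE Im_sum (reindex (@enum_rank S)); last first.
  by apply: onW_bij; exact: enum_rank_bij.
by apply: eq_bigr => t _; rewrite mxE ImM_real !enum_rankK mulrC.
Qed.

(* Real form of the absence of Floquet multipliers on the unit circle: [p + i q] would be
   a Bloch solution with multiplier [c + i d]. *)
Definition no_bloch := forall (c d : R) (p q : S -> R -> R), c ^+ 2 + d ^+ 2 = 1 ->
  mild (fun _ _ => 0) p -> mild (fun _ _ => 0) q ->
  (forall s x, p s (x + L) = c * p s x - d * q s x) ->
  (forall s x, q s (x + L) = d * p s x + c * q s x) ->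
  forall s x, p s x = 0 /\ q s x = 0.

Hypothesis NB : no_bloch.

Lemma shift_comb (c d : R) (p q r : S -> R -> R) :
  mild (fun _ _ => 0) p -> mild (fun _ _ => 0) q -> mild (fun _ _ => 0) r ->
  (forall s, \sum_t mono s t * r t 0 = c * p s 0 + d * q s 0) ->
  forall s x, r s (x + L) = c * p s x + d * q s x.
Proof.
move=> mp mq mr H s x.
have ms : mild (fun _ _ => 0) (fun s x => r s (x + (1 : int)%:~R * L)).
  by have := mild_shift 1 (fun=> 0) mr; congr mild; apply/funext => t; apply/funext => y; rewrite subr0.
have mc : mild (fun _ _ => 0) (fun s x => c * p s x + d * q s x).
  have := mildD c d mp mq; congr mild; apply/funext => t; apply/funext => y; ring.
have := mild_unique ms mc _ s x; rewrite mul1r; apply => t.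
by rewrite add0r hom_monoL.
Qed.

(** Real and imaginary part of an eigenvector are initial values of a pair of real solutions that a
    period rotates by the eigenvalue; such a pair vanishes by [NB]. *)
Lemma mono_hyperbolic (l : R[i]) : csq l = 1 -> ~~ eigenvalue mono_mx l.
Proof.
move=> l1; apply/negP => /eigenvalueP[w wl w0]; case: l l1 wl => c d; rewrite /csq/= => cd wl.
pose p := fun s x => \sum_t rpart w t * fund t s x.
pose q := fun s x => \sum_t ipart w t * fund t s x.
have init v s : \sum_t v t * fund t s 0 = v s.
  rewrite (bigD1 s)//= fund0 eqxx mulr1 big1 ?addr0// => t ts.
  by rewrite fund0 eq_sym (negbTE ts) mulr0.
have rl s : rpart ((c +i* d)%C *: w) s = c * rpart w s - d * ipart w s.
  by rewrite /rpart /ipart mxE; case: (w _ _).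
have il s : ipart ((c +i* d)%C *: w) s = c * ipart w s + d * rpart w s.
  by rewrite /rpart /ipart mxE; case: (w _ _).
have H : forall s x, p s x = 0 /\ q s x = 0.
  apply: (NB cd); [exact: mild_sum|exact: mild_sum| |] => s x.
    rewrite -mulNr; apply: (shift_comb (mild_sum _) (mild_sum _) (mild_sum _)) => t.
    by under eq_bigr do rewrite init; rewrite -rpart_mono wl rl !init mulNr.
  apply: (shift_comb (mild_sum _) (mild_sum _) (mild_sum _)) => t.
  by under eq_bigr do rewrite init; rewrite -ipart_mono wl il !init addrC.
move/eqP: w0; apply; apply/rowP => i; rewrite mxE -(enum_valK i).
have [h1 h2] := H (enum_val i) 0.
move: h1 h2; rewrite /p /q !init /rpart /ipart; case: (w _ _) => a b /= -> ->.
by [].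
Qed.

Lemma line_recursion Y (j : int) :
  emb (Y^~ ((j + 1)%:~R * L)) = emb (Y^~ (j%:~R * L)) *m mono_mx + emb (defect Y (j%:~R * L)).
Proof.
rewrite -emb_mono; apply/rowP => i; rewrite !mxE -rmorphD/=; congr (_%:C).
by rewrite /defect addrCA subrr addr0 intrD mulrDl mul1r.
Qed.

Lemma line_bound : exists2 K : R, 0 <= K & forall G Y beta H M, mild G Y ->
  cell_bound G beta -> wsum beta H ->
  wsum (fun j => sqs (Y^~ (j%:~R * L))) M -> wsum (fun j => sqs (Y^~ (j%:~R * L))) (K * H).
Proof.
have [K K0 HK] := hyperbolic_boundn mono_hyperbolic.
exists (K * Cd); first exact: mulr_ge0.
move=> G Y beta H M mY Gb bH YM a k; rewrite -mulrA.
under eq_bigr do rewrite -vsq_emb.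
apply: (HK (fun j => emb (Y^~ (j%:~R * L))) (fun j => emb (defect Y (j%:~R * L))) M (Cd * H)).
- by move=> a' k'; under eq_bigr do rewrite vsq_emb; exact: YM.
- move=> a' k'; under eq_bigr do rewrite vsq_emb.
  apply: (@le_trans _ _ (\sum_(i < k') Cd * beta (a' + i%:Z))).
    by apply: ler_sum => i _; exact: defect_bound.
  by rewrite -mulr_sumr; apply: ler_wpM2l.
- by move=> j; exact: line_recursion.
Qed.

(** The defects of an arbitrary mild solution [Y0] are bounded by the data and do not depend on its
    initial value. The square-summable solution [x] of the recurrence with these defects prescribes
    the initial value of the right solution [Y]. *)
Lemma line_solve : exists2 K : R, 0 <= K & forall G beta H, (forall s, continuous (G s)) ->
  cell_bound G beta -> wsum beta H ->
  exists2 Y, mild G Y & wsum (fun j => sqs (Y^~ (j%:~R * L))) (K * H).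
Proof.
have [K K0 HK] := hyperbolic_solven mono_hyperbolic.
exists (K * Cd); first exact: mulr_ge0.
move=> G beta H cG Gb bH.
have [Y0 [mY0 _]] := mild_exists (fun=> 0) cG.
have [|x xK xr] := HK (fun j => emb (defect Y0 (j%:~R * L))) (Cd * H).
  move=> a' k'; under eq_bigr do rewrite vsq_emb.
  apply: (@le_trans _ _ (\sum_(i < k') Cd * beta (a' + i%:Z))).
    by apply: ler_sum => i _; exact: defect_bound.
  by rewrite -mulr_sumr; apply: ler_wpM2l.
have [Y [mY YE]] := mild_exists (fun s => rpart (x 0) s - G s 0) cG.
pose D s y := 1 * Y s y + -1 * Y0 s y.
have mD : mild (fun _ _ => 0) D.
  have := mildD 1 (-1) mY mY0; congr mild; apply/funext => s; apply/funext => y; ring.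
(* The mismatch solves the homogeneous recurrence and is 0 at index 0. It stays 0 forwards by the
   recurrence and backwards by injectivity of the monodromy map. *)
pose e (j : int) s := rpart (x j) s - Y s (j%:~R * L).
have eS (j : int) s : e (j + 1) s = \sum_t mono s t * e j t.
  have DS : D s ((j + 1)%:~R * L) = \sum_t mono s t * D t (j%:~R * L).
    have mj := mild_shift j (fun=> 0) mD.
    have mj' : mild (fun _ _ => 0) (fun s x => D s (x + j%:~R * L)).
      by move: mj; congr mild; apply/funext => t; apply/funext => y; rewrite subr0.
    have := hom_monoL s mj'; rewrite intrD mulrDl mul1r addrC => ->.
    by apply: eq_bigr => t _; rewrite add0r.
  have rS : rpart (x (j + 1)) s = \sum_t mono s t * rpart (x j) t + defect Y0 (j%:~R * L) s.
    rewrite xr -rpart_mono -{2}[defect _ _]rpart_emb /rpart mxE.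
    by case: ((x j *m _) _ _) => a b; case: (emb _ _ _) => a' b'.
  have YS : Y s ((j + 1)%:~R * L) =
      \sum_t mono s t * Y t (j%:~R * L) + defect Y0 (j%:~R * L) s.
    have e1 : (j + 1)%:~R * L = j%:~R * L + L by rewrite intrD mulrDl mul1r.
    move: DS; rewrite /D /defect e1 => DS.
    have -> : \sum_t mono s t * Y t (j%:~R * L) =
        \sum_t mono s t * (1 * Y t (j%:~R * L) + -1 * Y0 t (j%:~R * L)) +
        \sum_t mono s t * Y0 t (j%:~R * L).
      by rewrite -big_split; apply: eq_bigr => t _ /=; ring.
    rewrite -DS; ring.
  rewrite /e rS YS opprD addrACA subrr addr0 -sumrB.
  by apply: eq_bigr => t _; rewrite mulrBr.
have e0 s : e 0 s = 0 by rewrite /e mul0r YE subrK subrr.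
have eP (j : nat) s : e j%:Z s = 0.
  elim: j s => [|j IH] s; first exact: e0.
  rewrite -addn1 PoszD eS big1// => t _; by rewrite IH mulr0.
have eN (j : nat) s : e (- j%:Z) s = 0.
  elim: j s => [|j IH] s; first by rewrite oppr0 e0.
  apply: mono_inj => q; rewrite -eS -(IH q); congr (e _ q).
  by rewrite -addn1 PoszD opprD addrNK.
have ez (j : int) s : e j s = 0.
  by case: j => j; [exact: eP|rewrite NegzE; exact: eN].
exists Y => // a k; rewrite -mulrA; apply: le_trans _ (xK a k).
apply: ler_sum => i _; rewrite vsq_parts.
have -> : Y^~ ((a + i%:Z)%:~R * L) = rpart (x (a + i%:Z)).
  by apply/funext => s; have /eqP := ez (a + i%:Z) s; rewrite subr_eq0 => /eqP.
by rewrite lerDl sqs_ge0.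
Qed.

(** The number 1 lies on the unit circle, so it is not a multiplier. *)
Lemma per_unit : (1%:M - mono_mx) \in unitmx.
Proof.
have : ~~ eigenvalue mono_mx 1 by apply: mono_hyperbolic; rewrite /csq/= expr1n expr0n addr0.
rewrite /eigenvalue /eigenspace negbK kermx_eq0 row_free_unit.
by rewrite -opprB -scaleN1r unitmxZ// unitrN1.
Qed.

Lemma per_bound : exists2 K : R, 0 <= K & forall G Y (beta : R), mild G Y ->
  (forall y, 0 <= y <= L -> sqs (fun s => G s y - G s 0) <= beta) ->
  (forall s, Y s L = Y s 0) -> sqs (Y^~ 0) <= K * beta.
Proof.
have [K K0 HK] := vsq_mulmx (invmx (1%:M - mono_mx)).
exists (K * Cd); first exact: mulr_ge0.
move=> G Y beta mY Gb YL.
have e : emb (Y^~ 0) *m (1%:M - mono_mx) = emb (defect Y 0).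
  rewrite mulmxBr mulmx1 -emb_mono; apply/rowP => i; rewrite !mxE -rmorphB/=.
  by rewrite /defect add0r YL.
rewrite -vsq_emb -(mulmxK per_unit (emb (Y^~ 0))) e.
apply: (le_trans (HK _)); rewrite vsq_emb -mulrA; apply: ler_wpM2l => //.
exact: defect_cell mY Gb.
Qed.

(** The primitive of a periodic forcing is periodic up to the additive constants [c], and mild
    solutions do not see such constants. A fixed point of the affine period map is then the initial
    value of a periodic solution. *)
Lemma per_solve G (c : S -> R) : (forall s, continuous (G s)) ->
  (forall s x, G s (x + L) = G s x + c s) ->
  exists2 Y, mild G Y & forall s x, Y s (x + L) = Y s x.
Proof.
move=> cG Gc; have [Y0 [mY0 _]] := mild_exists (fun=> 0) cG.
pose w := emb (defect Y0 0) *m invmx (1%:M - mono_mx).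
have wE : w = w *m mono_mx + emb (defect Y0 0).
  rewrite -[in RHS](mulmxKV per_unit (emb (defect Y0 0))) -/w mulmxBr mulmx1.
  by rewrite addrC subrK.
have vE s : rpart w s = \sum_t mono s t * rpart w t + defect Y0 0 s.
  rewrite {1}wE -rpart_mono -{2}[defect _ _]rpart_emb /rpart mxE.
  by case: ((w *m _) _ _) => a b; case: (emb _ _ _) => a' b'.
have [Y [mY YE]] := mild_exists (fun s => rpart w s - G s 0) cG.
have {}YE s : Y s 0 = rpart w s by rewrite YE subrK.
exists Y => // s x.
have ms : mild G (fun s x => Y s (x + (1 : int)%:~R * L)).
  have := mild_shift 1 c mY; congr mild; apply/funext => t; apply/funext => y.
  by rewrite mul1r Gc addrK.
have := mild_unique ms mY _ s x; rewrite mul1r; apply => t.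
pose D s y := 1 * Y s y + -1 * Y0 s y.
have mD : mild (fun _ _ => 0) D.
  have := mildD 1 (-1) mY mY0; congr mild; apply/funext => q; apply/funext => y; ring.
have DL := hom_monoL t mD.
rewrite add0r YE vE.
have -> : \sum_t0 mono t t0 * rpart w t0 = D t L + \sum_t0 mono t t0 * Y0 t0 0.
  by rewrite DL -big_split; apply: eq_bigr => q _ /=; rewrite /D -YE; ring.
by rewrite /D /defect add0r; ring.
Qed.

End floquet.

(** * One-dimensional Sobolev inequalities *)

Section sobolev.
Context {R : realType}.
Implicit Types (w Y : R -> R) (a b x : R).

Lemma prim_diff_sq w Y a b x y : measurable_fun setT w -> locint (fun x => w x ^+ 2) ->
  prim w Y -> a <= x <= b -> a <= y <= b ->
  (Y y - Y x) ^+ 2 <= (b - a) * iint (fun x => w x ^+ 2) a b.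
Proof.
move=> mw w2 pY xab yab; wlog xy : x y xab yab / x <= y.
  move=> H; case: (leP x y) => [/H->//|/ltW yx].
  by rewrite -sqrrN opprB; exact: H.
have wi := locint_sq mw w2; have [/andP[ax xb] /andP[ay yb]] := (xab, yab).
rewrite pY//; apply: (@le_trans _ _ (iint (fun x => `|w x|) x y ^+ 2)).
  rewrite -[leLHS]real_normK ?num_real// lerXn2r ?nnegrE ?iint_ge0//.
  exact: iint_abs.
apply: (le_trans (iint_CS xy mw w2)); apply: ler_pM.
- by rewrite subr_ge0.
- by apply: iint_ge0 => *; exact: sqr_ge0.
- by lra.
- by apply: iint_subset => // t; exact: sqr_ge0.
Qed.

(** Average [Y(x)^2 <= 2 Y(y)^2 + 2 (Y(y) - Y(x))^2] over [y] and bound the difference by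
    Cauchy-Schwarz. *)
Lemma prim_sup_sq w Y a b x : measurable_fun setT w -> locint (fun x => w x ^+ 2) ->
  prim w Y -> a < b -> a <= x <= b ->
  Y x ^+ 2 <= 2 / (b - a) * iint (fun x => Y x ^+ 2) a b
    + 2 * (b - a) * iint (fun x => w x ^+ 2) a b.
Proof.
move=> mw w2 pY ab xab.
have cY := prim_continuous (locint_sq mw w2) pY.
have cY2 : continuous (fun x => Y x ^+ 2).
  by under eq_fun do rewrite expr2; exact: continuousMf.
set W := iint (fun x => w x ^+ 2) a b.
have d0 : 0 < b - a by rewrite subr_gt0.
have : iint (cst (Y x ^+ 2)) a b <= iint (fun y => 2 * Y y ^+ 2 + 2 * (b - a) * W) a b.
  have cc (k : R) : locint (cst k : R -> R) by apply: locint_continuous => z; exact: cvg_cst.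
  apply: iint_le => [//||y yab].
    by apply: locintD; [apply: locintZ; exact: locint_continuous|exact: cc].
  have := prim_diff_sq mw w2 pY xab yab; rewrite -/W /=.
  have := sqr_ge0 (Y x - 2 * Y y); nra.
rewrite iint_cst ?(ltW ab)//.
rewrite (@iintD _ (fun y => 2 * Y y ^+ 2) (cst (2 * (b - a) * W))); last 2 first.
- by apply: locintZ; exact: locint_continuous.
- by apply: locint_continuous => z; exact: cvg_cst.
rewrite (@iintZ _ 2 (fun y => Y y ^+ 2)) ?(iint_cst _ (ltW ab)); last exact: locint_continuous.
rewrite -ler_pdivlMr// mulrDl mulfK ?gt_eqF// => /le_trans; apply.
by rewrite lerD2r mulrAC.
Qed.

End sobolev.

(** * Systems of higher order *)

Section order_k_system.
Context {R : realType} {I : finType} {k : nat}.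
Variables (c : nat -> I -> I -> R -> R) (L : R).
Hypothesis L0 : 0 < L.
Hypothesis cc : forall j a b, (j <= k)%N -> continuous (c j a b).
Hypothesis cL : forall j a b x, (j <= k)%N -> c j a b (x + L) = c j a b x.
Implicit Types (y : nat -> I -> R -> R) (f : I -> R -> R) (a b : I) (x : R).

Let S := ('I_k.+1 * I)%type.
Implicit Types (s t : S).

Definition vladder y := forall a, ladder k.+1 (fun j => y j a).

(** Here and below the equation has order [k.+1] and is solved for its highest derivative; [csum]
    collects the levels [0] to [k]. *)
Definition csum y a x := \sum_(i < k.+1) \sum_b c i a b x * y i b x.

(** The companion matrix of the equation. *)
Definition Bsys s t x :=
  if (s.1 < k)%N then ((t.1 == s.1.+1 :> nat) && (t.2 == s.2))%:R
  else c t.1 s.2 t.2 x.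

(** Only the last block is forced. A locally integrable [f] enters through its primitive, which
    makes the mild forcing continuous. *)
Definition Gsys f s x := if (s.1 < k)%N then 0 else J (f s.2) x.

Definition states y s x := y s.1 s.2 x.

Lemma sum_Bsys y s x : \sum_t Bsys s t x * states y t x =
  if (s.1 < k)%N then y s.1.+1 s.2 x else csum y s.2 x.
Proof.
rewrite /Bsys; case: ifPn => sk; last first.
  by rewrite /csum pair_bigA; apply: eq_bigr => -[i b] _.
have h : (s.1.+1 < k.+1)%N by [].
rewrite (bigD1 (Ordinal h, s.2))//= !eqxx mul1r big1 ?addr0// => -[i b] /= ne.
case: eqP => //= [e1|]; last by rewrite mul0r.
case: eqP => //= [e2|]; last by rewrite mul0r.
by move/eqP: ne; case; congr (_, _) => //; exact: val_inj.
Qed.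

Lemma Bsys_continuous s t : continuous (Bsys s t).
Proof.
rewrite /Bsys; case: (s.1 < k)%N; first by move=> x; exact: cvg_cst.
by apply: cc; rewrite -ltnS.
Qed.

Lemma BsysL s t x : Bsys s t (x + L) = Bsys s t x.
Proof. by rewrite /Bsys; case: ifPn => // _; apply: cL; rewrite -ltnS. Qed.

Lemma Bsys_bounded : exists K, forall s t x, `|Bsys s t x| <= K.
Proof.
have H (st : S * S) : exists M, 0 <= M /\ forall x, `|Bsys st.1 st.2 x| <= M.
  have [M M0 HM] := continuous_bounded_itv 0 L (Bsys_continuous (s := st.1) (t := st.2)).
  exists M; split=> [|x]; first exact: ltW.
  have := periodic_int (BsysL st.1 st.2) (- Num.floor (x / L)) x => <-.
  apply: HM; have /andP[h1 h2] := floor_itv (x / L).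
  move: h1 h2; rewrite ler_pdivlMr// ltr_pdivrMr// intrD mulrDl mul1r => h1 h2.
  by rewrite intrN mulNr; apply/andP; split; lra.
have [M HM] := choice H.
exists (\sum_st M st) => s t x; have [_ h] := HM (s, t).
apply: (le_trans (h x)); rewrite (bigD1 (s, t))//= lerDl.
by apply: sumr_ge0 => st _; case: (HM st).
Qed.

Lemma Gsys_continuous f s : (forall a, locint (f a)) -> continuous (Gsys f s).
Proof.
move=> fi; rewrite /Gsys; case: (s.1 < k)%N; first by move=> x; exact: cvg_cst.
exact: prim_continuous (fi _) (prim_J (fi _)).
Qed.

Lemma vladder_continuous y j a : vladder y -> (j <= k)%N -> continuous (y j a).
Proof. by move=> /(_ a)[_ + _]; apply. Qed.

Lemma csum_continuous y a : (forall j b, (j <= k)%N -> continuous (y j b)) ->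
  continuous (csum y a).
Proof.
move=> cy; apply: continuous_sum => i; apply: continuous_sum => b.
by apply: continuousMf; [apply: cc|apply: cy]; rewrite -ltnS.
Qed.

Local Notation mu := (@lebesgue_measure R).

Definition solves y f := forall a,
  {ae mu, forall x, y k.+1 a x = csum y a x + f a x}.

Lemma ladder_mild y f : vladder y -> (forall a, locint (f a)) -> solves y f ->
  mild Bsys (Gsys f) (states y).
Proof.
move=> ly fi ys s x; rewrite sum_Bsys /Gsys /states; case: ifPn => sk.
  have -> : (fun x => y s.1 s.2 x - 0) = y s.1 s.2 by apply/funext => z; rewrite subr0.
  exact: (ladder_derive x (ly s.2)).
have e : s.1 = k :> nat by apply/eqP; rewrite eqn_leq -ltnS ltn_ord leqNgt.
rewrite e; have cs := csum_continuous (y := y) (a := s.2) (fun j b => @vladder_continuous y j b ly).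
apply: (prim_derive (w := csum y s.2)); first exact: locint_continuous; last exact: cs.
have [py _ yk] := ly s.2; move=> a b ab.
have := py k (ltnSn k) a b ab; have := prim_J (fi s.2) ab.
have -> : iint (y k.+1 s.2) a b = iint (fun x => csum y s.2 x + f s.2 x) a b.
  apply: ae_iint; last exact: ys; first by case: yk.
  by apply: measurable_funD; [exact: continuous_measurable_fun|case: (fi s.2)].
rewrite iintD//; last exact: locint_continuous.
lra.
Qed.

Definition unstates (Y : S -> R -> R) f j a x :=
  if (j <= k)%N then Y (inord j, a) x
  else csum (fun i b x => Y (inord i, b) x) a x + f a x.

Lemma unstates_le Y f j a : (j <= k)%N -> unstates Y f j a = Y (inord j, a).
Proof. by rewrite /unstates => ->. Qed.

Lemma states_unstates Y f : states (unstates Y f) = Y.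
Proof.
apply/funext => -[j a]; rewrite /states /=; have jk : (j <= k)%N by rewrite -ltnS.
by rewrite unstates_le// inord_val.
Qed.

Lemma unstates_solves Y f a x :
  unstates Y f k.+1 a x = csum (unstates Y f) a x + f a x.
Proof.
rewrite {1}/unstates ltnn /csum; congr (_ + _); apply: eq_bigr => i _.
by apply: eq_bigr => b _; rewrite unstates_le// -ltnS.
Qed.

Lemma mild_continuous f Y s : (forall a, locint (f a)) -> mild Bsys (Gsys f) Y -> continuous (Y s).
Proof.
move=> fi mY x; have c1 := derive_continuous_at (mY s x).
have -> : Y s = fun x => (Y s x - Gsys f s x) + Gsys f s x by apply/funext => z; rewrite subrK.
by apply: cvgD c1 _; exact: Gsys_continuous.
Qed.

Lemma mild_ladder f Y : (forall a, locint (f a)) -> mild Bsys (Gsys f) Y ->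
  vladder (unstates Y f).
Proof.
move=> fi mY a.
have cY s : continuous (Y s) by exact: mild_continuous mY.
have cu j b : (j <= k)%N -> continuous (unstates Y f j b) by move=> /unstates_le ->.
have cs := csum_continuous (a := a) cu.
have li : locint (unstates Y f k.+1 a).
  have -> : unstates Y f k.+1 a = fun x => csum (unstates Y f) a x + f a x.
    by apply/funext => x; exact: unstates_solves.
  by apply: locintD => //; exact: locint_continuous.
split=> // [j jk|j]; last by rewrite ltnS; exact: cu.
have sB s x := sum_Bsys (unstates Y f) s x; rewrite states_unstates in sB.
move: jk; rewrite ltnS leq_eqVlt => /orP[/eqP->|jk].
  have pg : prim (csum (unstates Y f) a) (fun x => Y (inord k, a) x - J (f a) x).
    apply: derive_prim => // x; have := mY (inord k, a) x.
    rewrite sB /Gsys /= inordK// ltnn.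
    exact.
  move=> u v uv; rewrite unstates_le//.
  have := pg u v uv; have := prim_J (fi a) uv.
  have -> : iint (unstates Y f k.+1 a) u v = iint (fun x => csum (unstates Y f) a x + f a x) u v.
    by apply: eq_iint => x _; exact: unstates_solves.
  rewrite iintD//; last exact: locint_continuous.
  lra.
apply: derive_prim; first exact: cu.
move=> x; have uj : unstates Y f j a = Y (inord j, a) by rewrite unstates_le// ltnW.
rewrite uj; have := mY (inord j, a) x.
rewrite sB /Gsys /= inordK ?jk; last exact: ltnW.
by congr is_derive; apply/funext => z; rewrite subr0.
Qed.

(* Real form of a Bloch solution of the homogeneous equation, as in [no_bloch]. *)
Definition no_bloch_ladder := forall (r d : R) (p q : nat -> I -> R -> R), r ^+ 2 + d ^+ 2 = 1 ->
  (forall j a x, (j <= k)%N -> is_derive x (1 : R) (p j a) (p j.+1 a x)) ->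
  (forall j a x, (j <= k)%N -> is_derive x (1 : R) (q j a) (q j.+1 a x)) ->
  (forall a, continuous (p k.+1 a)) -> (forall a, continuous (q k.+1 a)) ->
  (forall a x, p k.+1 a x = csum p a x) -> (forall a x, q k.+1 a x = csum q a x) ->
  (forall j a x, (j <= k.+1)%N -> p j a (x + L) = r * p j a x - d * q j a x) ->
  (forall j a x, (j <= k.+1)%N -> q j a (x + L) = d * p j a x + r * q j a x) ->
  forall a x, p 0%N a x = 0 /\ q 0%N a x = 0.

Lemma mild_hom_ladder Y : mild Bsys (fun _ _ => 0) Y ->
  let p := unstates Y (fun _ _ => 0) in
  [/\ forall j a x, (j <= k)%N -> is_derive x (1 : R) (p j a) (p j.+1 a x),
      forall a, continuous (p k.+1 a) & forall a x, p k.+1 a x = csum p a x].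
Proof.
move=> mY p.
have f0 (a : I) : locint (fun=> 0 : R) by exact: locint0.
have mY' : mild Bsys (Gsys (fun _ _ => 0)) Y.
  move: mY; congr mild; apply/funext => s; apply/funext => x; rewrite /Gsys; case: ifP => // _.
  by rewrite /J; case: leP => x0; rewrite iint_cst ?mul0r ?oppr0// ltW.
have ly := mild_ladder f0 mY'.
have e a x : p k.+1 a x = csum p a x by rewrite /p unstates_solves addr0.
have cp a : continuous (p k.+1 a).
  have -> : p k.+1 a = csum p a by apply/funext.
  by apply: csum_continuous => j b; exact: vladder_continuous.
split=> // j a x; rewrite leq_eqVlt => /orP[/eqP->|jk]; last exact: (ladder_derive x (ly a)).
have [py _ yk] := ly a; apply: prim_derive => //; first exact: py.
exact: cp.
Qed.

Lemma no_bloch_of_ladder : no_bloch_ladder -> no_bloch Bsys L.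
Proof.
move=> NB r d p q rd mp mq pL qL.
have [p1 p2 p3] := mild_hom_ladder mp; have [q1 q2 q3] := mild_hom_ladder mq.
set P := unstates p _ in p1 p2 p3; set Q := unstates q _ in q1 q2 q3.
have PE j a x : (j <= k)%N -> P j a x = p (inord j, a) x by move=> jk; rewrite /P unstates_le.
have QE j a x : (j <= k)%N -> Q j a x = q (inord j, a) x by move=> jk; rewrite /Q unstates_le.
have PL j a x : (j <= k.+1)%N -> P j a (x + L) = r * P j a x - d * Q j a x.
  rewrite leq_eqVlt ltnS => /orP[/eqP->|jk]; last by rewrite !PE// QE// pL.
  rewrite !p3 q3 /csum !mulr_sumr -sumrB; apply: eq_bigr => i _.
  rewrite !mulr_sumr -sumrB; apply: eq_bigr => b _.
  have ik : (i <= k)%N by rewrite -ltnS.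
  by rewrite !PE// QE// pL cL//; ring.
have QL j a x : (j <= k.+1)%N -> Q j a (x + L) = d * P j a x + r * Q j a x.
  rewrite leq_eqVlt ltnS => /orP[/eqP->|jk]; last by rewrite PE// !QE// qL.
  rewrite !q3 p3 /csum !mulr_sumr -big_split; apply: eq_bigr => i _.
  rewrite /= !mulr_sumr -big_split; apply: eq_bigr => b _ /=.
  have ik : (i <= k)%N by rewrite -ltnS.
  by rewrite PE// !QE// qL cL//; ring.
have H := NB r d P Q rd p1 q1 p2 q2 p3 q3 PL QL.
(* The ladder form only asserts that level 0 vanishes; the higher levels are its derivatives. *)
have Z (W : nat -> I -> R -> R) : (forall j a x, (j <= k)%N -> is_derive x (1 : R) (W j a) (W j.+1 a x)) ->
    (forall a x, W 0%N a x = 0) -> forall j a x, (j <= k)%N -> W j a x = 0.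
  move=> WD W0; elim=> [//|j IH] a x jk.
  have WZ : W j a = cst 0 by apply/funext => z; rewrite IH// ltnW.
  have h := WD j a x (ltnW jk); rewrite WZ in h.
  by rewrite -(derive_val (is_derive := h)) derive_cst.
have ZP := Z P p1 (fun a x => (H a x).1); have ZQ := Z Q q1 (fun a x => (H a x).2).
move=> [j a] x; have jk : (j <= k)%N by rewrite -ltnS.
have := ZP j a x jk; have := ZQ j a x jk; rewrite PE// QE//.
by have -> : inord j = j by apply: val_inj; rewrite /= inordK.
Qed.

Definition sqI f x := \sum_a f a x ^+ 2.

Definition sq_loc f := forall a, measurable_fun setT (f a) /\ locint (fun x => f a x ^+ 2).

Lemma sq_loc_locint f a : sq_loc f -> locint (f a).
Proof. by move=> /(_ a)[mf f2]; exact: locint_sq. Qed.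

Lemma sqI_locint f : sq_loc f -> locint (sqI f).
Proof. by move=> fs; apply: locint_sum => a _; case: (fs a). Qed.

Lemma sqI_ge0 f x : 0 <= sqI f x.
Proof. by apply: sumr_ge0 => a _; exact: sqr_ge0. Qed.

(** The oscillation of a primitive over a period is bounded by Cauchy-Schwarz, which yields the
    factor [L]. *)
Lemma Gsys_cell_bound f : sq_loc f ->
  cell_bound L (Gsys f) (fun j => L * iint (sqI f) (j%:~R * L) ((j + 1)%:~R * L)).
Proof.
move=> fs j y /andP[y0 yL].
have e1 : (j + 1)%:~R * L = j%:~R * L + L by rewrite intrD mulrDl mul1r.
rewrite e1 /sqI iint_sum; last by move=> a _; case: (fs a).
have P a : (J (f a) (y + j%:~R * L) - J (f a) (j%:~R * L)) ^+ 2 <=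
    L * iint (fun x => f a x ^+ 2) (j%:~R * L) (j%:~R * L + L).
  have [mf f2] := fs a.
  have := @prim_diff_sq _ (f a) (J (f a)) (j%:~R * L) (j%:~R * L + L) (j%:~R * L) (y + j%:~R * L).
  have e2 : j%:~R * L + L - j%:~R * L = L by ring.
  by rewrite e2; apply=> //; [exact: prim_J (locint_sq mf f2)|lra|lra].
apply: (@le_trans _ _ (\sum_(s : S) if s.1 == ord_max then
    (J (f s.2) (y + j%:~R * L) - J (f s.2) (j%:~R * L)) ^+ 2 else 0)).
  apply: ler_sum => -[i a] _ /=; rewrite /Gsys /=; case: ifPn => ik.
    rewrite subrr expr0n; case: ifP => // _; exact: sqr_ge0.
  by rewrite (_ : i == ord_max)//; apply/eqP/val_inj/eqP; rewrite eqn_leq -ltnS ltn_ord leqNgt.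
rewrite -(pair_bigA _ (fun (i : 'I_k.+1) a => if i == ord_max then
    (J (f a) (y + j%:~R * L) - J (f a) (j%:~R * L)) ^+ 2 else 0))/=.
rewrite (bigD1 ord_max)//= eqxx [X in _ + X]big1 ?addr0; last first.
  by move=> i /negbTE ->; rewrite big1.
by rewrite mulr_sumr; apply: ler_sum => a _; exact: P.
Qed.

(** Windows consist of whole periods, to match the lattice sums [wsum]. *)
Definition window (q : R -> R) (H : R) := forall (j : int) (n : nat),
  iint q (j%:~R * L) ((j + n%:Z)%:~R * L) <= H.

Lemma window_sum q (j : int) (n : nat) : locint q ->
  \sum_(i < n) iint q ((j + i%:Z)%:~R * L) ((j + i%:Z + 1)%:~R * L) =
  iint q (j%:~R * L) ((j + n%:Z)%:~R * L).
Proof.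
move=> qi; elim: n => [|n IH]; first by rewrite big_ord0 addr0 iintxx.
rewrite big_ord_recr/= IH -(iint_cat qi).
- by rewrite -addrA -PoszD addn1.
- by rewrite ler_pM2r// ler_int lerDl.
- by rewrite ler_pM2r// ler_int lerDl.
Qed.

Lemma window_wsum f H : sq_loc f -> window (sqI f) H ->
  wsum (fun j => L * iint (sqI f) (j%:~R * L) ((j + 1)%:~R * L)) (L * H).
Proof.
move=> fs fH j n; rewrite -mulr_sumr ler_pM2l// window_sum//; exact: sqI_locint.
Qed.

End order_k_system.

(** * Solvability and a priori bounds for the equation of order [k.+1] *)

Section order_k_estimates.
Context {R : realType} {I : finType} {k : nat}.
Variables (c : nat -> I -> I -> R -> R) (L : R).
Hypothesis L0 : 0 < L.
Hypothesis cc : forall j a b, (j <= k)%N -> continuous (c j a b).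
Hypothesis cL : forall j a b x, (j <= k)%N -> c j a b (x + L) = c j a b x.
Implicit Types (y : nat -> I -> R -> R) (f : I -> R -> R) (a b : I) (x : R).

Local Notation S := ('I_k.+1 * I)%type.
Local Notation csum := (@csum R I k c).
Local Notation states := (@states R I k).
Local Notation vladder := (@vladder R I k).
Local Notation solves := (@solves R I k c).
Local Notation Bsys := (@Bsys R I k c).
Local Notation Gsys := (@Gsys R I k).

Definition energy (Y : S -> R -> R) x := sqs (Y^~ x).

Lemma sqs_continuous (Y : S -> R -> R) : (forall s, continuous (Y s)) -> continuous (energy Y).
Proof.
move=> cY; apply: continuous_sum => s; under eq_fun do rewrite expr2.
exact: continuousMf.
Qed.

Lemma mild_growth : exists2 C, 0 <= C & forall G Y beta j x, mild Bsys G Y ->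
  cell_bound L G beta -> 0 <= x <= L ->
  energy Y (x + j%:~R * L) <= C * (energy Y (j%:~R * L) + beta j).
Proof.
have [Kb HK] := Bsys_bounded L0 cc cL.
have := growth_bound L0 HK (BsysL cL); set C := 2 * _ + 2 => H.
exists C => [|G Y beta j x]; last exact: H.
rewrite /C addr_ge0// mulr_ge0// mulr_ge0// addr_ge0// mulr_ge0 ?sqr_ge0//.
exact: ltW.
Qed.

Lemma iint_cell_shift q (j : int) : locint q ->
  iint q (j%:~R * L) ((j + 1)%:~R * L) = iint (fun x => q (x + j%:~R * L)) 0 L.
Proof. by move=> qi; rewrite iint_shift// add0r intrD mulrDl mul1r addrC. Qed.

Lemma locint_shift q (s : R) : continuous q -> locint (fun x => q (x + s)).
Proof.
move=> cq; apply: locint_continuous => x.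
by apply: continuous_comp; [apply: cvgD; [exact: cvg_id|exact: cvg_cst]|exact: cq].
Qed.

(** Inside a period the energy is controlled by its value at the left end and by the oscillation of
    [G]. Integration costs a factor [L], and the periods are summed. *)
Lemma growth_window : exists2 C, 0 <= C & forall G Y beta H H', mild Bsys G Y ->
  (forall s, continuous (Y s)) -> cell_bound L G beta -> wsum beta H ->
  wsum (fun j => energy Y (j%:~R * L)) H' -> window L (energy Y) (C * (H' + H)).
Proof.
have [C C0 HC] := mild_growth; exists (L * C) => [|G Y beta H H' mY cY bG bH YH j n].
  by rewrite mulr_ge0// ltW.
have cE := sqs_continuous cY.
rewrite -window_sum//; last exact: locint_continuous.
apply: (@le_trans _ _ (\sum_(i < n) L * (C *
    (energy Y ((j + i%:Z)%:~R * L) + beta (j + i%:Z))))).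
  apply: ler_sum => i _; rewrite iint_cell_shift; last exact: locint_continuous.
  have := iint_cst (C * (energy Y ((j + i%:Z)%:~R * L) + beta (j + i%:Z))) (ltW L0).
  rewrite subr0 [X in _ = X -> _]mulrC => <-; apply: iint_le => [||x xL]; last exact: HC mY bG xL.
    exact: locint_shift.
  by apply: locint_continuous => z; exact: cvg_cst.
rewrite -mulr_sumr -mulrA ler_pM2l// -mulr_sumr; apply: ler_wpM2l => //.
by rewrite big_split; apply: lerD; [exact: YH|exact: bH].
Qed.

Lemma unstates_vladder f Y : (forall a, locint (f a)) -> mild Bsys (Gsys f) Y ->
  [/\ vladder (unstates c Y f), states (unstates c Y f) = Y &
    forall a x, unstates c Y f k.+1 a x = csum (unstates c Y f) a x + f a x].
Proof.
move=> fi mY; split; [exact: mild_ladder|exact: states_unstates|].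
by move=> a x; exact: unstates_solves.
Qed.

Hypothesis NB : no_bloch_ladder (k := k) c L.

(** In the constant, [K * L] accounts for the lattice values and [L] for the oscillation of the
    forcing inside the periods. *)
Lemma line_solve_ladder : exists2 C, 0 <= C & forall f H, sq_loc f -> window L (sqI f) H ->
  exists y, [/\ vladder y, forall a x, y k.+1 a x = csum y a x + f a x &
    window L (energy (states y)) (C * H)].
Proof.
have [Kb HK] := Bsys_bounded L0 cc cL.
have [K K0 HS] := line_solve L0 (Bsys_continuous cc) HK (BsysL cL) (no_bloch_of_ladder cc cL NB).
have [C C0 HC] := growth_window.
exists (C * (K * L + L)) => [|f H fs fH].
  by rewrite mulr_ge0// addr_ge0 ?mulr_ge0// ltW.
have fi a : locint (f a) by exact: sq_loc_locint.
have bw := window_wsum L0 fs fH; have cb := Gsys_cell_bound (k := k) (L := L) fs.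
have cG s : continuous (Gsys f s) by exact: Gsys_continuous.
have [Y mY YH] := HS (Gsys f) _ _ cG cb bw.
have [l1 l2 l3] := unstates_vladder fi mY.
exists (unstates c Y f); split => //; rewrite l2.
have cY s : continuous (Y s) by exact: mild_continuous mY.
have := HC _ _ _ _ _ mY cY cb bw YH.
by rewrite [X in window _ _ (C * X)](_ : _ = (K * L + L) * H) ?mulrA//; ring.
Qed.

Definition total y x := \sum_(j < k.+2) sqI (y j) x.

Lemma energyE y x : energy (states y) x = \sum_(j < k.+1) sqI (y j) x.
Proof.
rewrite /energy /sqs /states /sqI.
by rewrite (pair_bigA _ (fun (j : 'I_k.+1) a => y j a x ^+ 2)).
Qed.

Lemma vladder_sq_loc y j : vladder y -> sq_loc (y k.+1) -> (j <= k.+1)%N -> sq_loc (y j).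
Proof.
move=> ly y1; rewrite leq_eqVlt => /orP[/eqP->//|]; rewrite ltnS => jk a.
have cy := vladder_continuous (a := a) ly jk.
split; first exact: continuous_measurable_fun.
by apply: locint_continuous; under eq_fun do rewrite expr2; exact: continuousMf.
Qed.

Lemma total_locint y : vladder y -> sq_loc (y k.+1) -> locint (total y).
Proof.
move=> ly y1; apply: locint_sum => j _; apply: sqI_locint.
by apply: vladder_sq_loc => //; rewrite -ltnS.
Qed.

(** The Sobolev inequality at the left end of a period, applied to each level and its derivative. It
    makes lattice values of a Sobolev function square-summable. *)
Lemma energy_le_total y u : vladder y -> sq_loc (y k.+1) ->
  energy (states y) u <= (2 / L + 2 * L) * iint (total y) u (u + L).
Proof.
move=> ly y1.
have lt i : (i <= k.+1)%N -> locint (sqI (y i)).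
  by move=> ik; apply: sqI_locint; exact: vladder_sq_loc.
have uL : u < u + L by rewrite ltrDl.
have eL : u + L - u = L by ring.
have P (j : 'I_k.+1) a : y j a u ^+ 2 <= 2 / L * iint (fun x => y j a x ^+ 2) u (u + L) +
    2 * L * iint (fun x => y j.+1 a x ^+ 2) u (u + L).
  have [m1 s1] := vladder_sq_loc ly y1 (ltn_ord j) a.
  have [py _ _] := ly a.
  have := prim_sup_sq (x := u) m1 s1 (py j (ltn_ord j)) uL; rewrite eL; apply.
  by rewrite lexx ltW.
rewrite energyE.
apply: (@le_trans _ _ (\sum_(j < k.+1) (2 / L * iint (sqI (y j)) u (u + L) +
    2 * L * iint (sqI (y j.+1)) u (u + L)))).
  apply: ler_sum => j _; rewrite /sqI !iint_sum; last 2 first.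
  - by move=> a _; have [] := vladder_sq_loc ly y1 (ltn_ord j) a.
  - by move=> a _; have [] := vladder_sq_loc ly y1 (ltnW (ltn_ord j)) a.
  by rewrite !mulr_sumr -big_split; apply: ler_sum => a _; exact: P.
have tE : iint (total y) u (u + L) = \sum_(j < k.+2) iint (sqI (y j)) u (u + L).
  by rewrite iint_sum// => j _; apply: lt; rewrite -ltnS.
rewrite big_split/= -!mulr_sumr [leRHS]mulrDl tE.
have i0 j : 0 <= iint (sqI (y j)) u (u + L) by apply: iint_ge0 => *; exact: sqI_ge0.
apply: lerD; apply: ler_wpM2l.
- by rewrite divr_ge0// ltW.
- by rewrite [leRHS]big_ord_recr/= lerDl.
- by rewrite mulr_ge0// ltW.
- by rewrite [leRHS]big_ord_recl/= lerDr.
Qed.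

(** [M] is a qualitative bound that places the lattice values in [l^2], where the recurrence has at
    most one solution; the conclusion is independent of its size. *)
Lemma line_bound_ladder : exists2 C, 0 <= C & forall y f H M, vladder y -> sq_loc (y k.+1) ->
  sq_loc f -> solves y f -> window L (sqI f) H -> window L (total y) M ->
  window L (energy (states y)) (C * H).
Proof.
have [Kb HK] := Bsys_bounded L0 cc cL.
have [K K0 HS] := line_bound L0 (Bsys_continuous cc) HK (BsysL cL) (no_bloch_of_ladder cc cL NB).
have [C C0 HC] := growth_window.
exists (C * (K * L + L)) => [|y f H M ly y1 fs ys fH yM].
  by rewrite mulr_ge0// addr_ge0 ?mulr_ge0// ltW.
have fi a : locint (f a) by exact: sq_loc_locint.
have bw := window_wsum L0 fs fH; have cb := Gsys_cell_bound (k := k) (L := L) fs.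
have mY := ladder_mild cc ly fi ys.
have YM : wsum (fun j => sqs ((states y)^~ (j%:~R * L))) ((2 / L + 2 * L) * M).
  move=> j n; apply: (@le_trans _ _ (\sum_(i < n) (2 / L + 2 * L) *
      iint (total y) ((j + i%:Z)%:~R * L) ((j + i%:Z + 1)%:~R * L))).
    apply: ler_sum => i _; have := energy_le_total ((j + i%:Z)%:~R * L) ly y1.
    have <- : (j + i%:Z + 1)%:~R * L = (j + i%:Z)%:~R * L + L by rewrite intrD mulrDl mul1r.
    exact.
  rewrite -mulr_sumr window_sum//; last exact: total_locint.
  have L1 := ltW L0; apply: ler_wpM2l; last exact: yM.
  by rewrite addr_ge0 ?divr_ge0 ?mulr_ge0.
have YH := HS _ _ _ _ _ mY cb bw YM.
have cY s : continuous (states y s).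
  by apply: vladder_continuous ly _; rewrite -ltnS.
have := HC _ _ _ _ _ mY cY cb bw YH.
by rewrite [X in window _ _ (C * X)](_ : _ = (K * L + L) * H) ?mulrA//; ring.
Qed.

Lemma J_periodic w : locint w -> (forall x, w (x + L) = w x) ->
  forall x, J w (x + L) = J w x + J w L.
Proof.
move=> wi wL x.
have p : prim w (fun x => J w (x + L)).
  move=> a b ab; rewrite (prim_J wi) ?lerD2r// -(iint_shift L a b wi).
  by apply: eq_iint => t _; exact: wL.
by rewrite (prim_eqJ x wi p) add0r addrC.
Qed.

Lemma per_solve_ladder f : sq_loc f -> (forall a x, f a (x + L) = f a x) ->
  exists y, [/\ vladder y, forall a x, y k.+1 a x = csum y a x + f a x &
    forall j a x, (j <= k.+1)%N -> y j a (x + L) = y j a x].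
Proof.
move=> fs fL; have [Kb HK] := Bsys_bounded L0 cc cL.
have fi a : locint (f a) by exact: sq_loc_locint.
have cG s : continuous (Gsys f s) by exact: Gsys_continuous.
have [s x||Y mY YL] := per_solve (G := Gsys f) (c := fun s => Gsys f s L) (Bsys_continuous cc) HK (BsysL cL) (no_bloch_of_ladder cc cL NB).
- exact: cG.
- by move=> s x; rewrite /Gsys; case: ifP => _; [rewrite addr0|exact: J_periodic].
have [l1 l2 l3] := unstates_vladder fi mY.
have uL j a x : (j <= k)%N -> unstates c Y f j a (x + L) = unstates c Y f j a x.
  by move=> jk; rewrite unstates_le// YL.
exists (unstates c Y f); split => // j a x.
rewrite leq_eqVlt ltnS => /orP[/eqP->|]; last exact: uL.
rewrite !l3 fL; congr (_ + _); apply: eq_bigr => i _; apply: eq_bigr => b _.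
by rewrite cL ?uL// -ltnS.
Qed.

(** Invertibility of 1 minus the monodromy matrix bounds the initial value of a periodic solution,
    and growth over one period bounds the rest. *)
Lemma per_bound_ladder : exists2 C, 0 <= C & forall y f, vladder y -> sq_loc f -> solves y f ->
  (forall j a, (j <= k)%N -> y j a L = y j a 0) ->
  iint (energy (states y)) 0 L <= C * iint (sqI f) 0 L.
Proof.
have [Kb HK] := Bsys_bounded L0 cc cL.
have [K K0 HS] := per_bound L0 (Bsys_continuous cc) HK (BsysL cL) (no_bloch_of_ladder cc cL NB).
have [C C0 HC] := mild_growth.
exists (L * (C * (K * L + L))) => [|y f ly fs ys yL].
  by rewrite mulr_ge0 ?mulr_ge0 ?addr_ge0 ?mulr_ge0// ltW.
have fi a : locint (f a) by exact: sq_loc_locint.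
have cb := Gsys_cell_bound (k := k) (L := L) fs.
have mY := ladder_mild cc ly fi ys.
have cY s : continuous (states y s).
  by apply: vladder_continuous ly _; rewrite -ltnS.
have b0 : sqs (states y ^~ 0) <= K * (L * iint (sqI f) 0 L).
  apply: (HS _ _ _ mY) => [x xL|s]; last by apply: yL; rewrite -ltnS.
  by have := cb 0 x xL; rewrite !mul0r !add0r !addr0 mul1r.
have := iint_cst (C * ((K * L + L) * iint (sqI f) 0 L)) (ltW L0).
rewrite subr0 [X in _ = X -> _]mulrC !mulrA => <-; apply: iint_le.
- exact: locint_continuous (sqs_continuous cY).
- by apply: locint_continuous => z; exact: cvg_cst.
move=> x xL; have := HC _ _ _ 0 x mY cb xL; rewrite !mul0r !add0r !addr0 mul1r => /le_trans; apply.
by rewrite -!mulrA; apply: ler_wpM2l => //; rewrite mulrDl lerD2r -mulrA.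
Qed.

End order_k_estimates.

(** * Exclusion of Bloch solutions *)

Section plateau.
Context {R : realType}.
Implicit Types (x : R) (t y : nat -> R -> R).

Lemma plateau_exists (rho : R -> R) : bump rho -> exists g : R -> R,
  [/\ smooth g, forall x, `|x| <= 1 / 2 -> g x = 1 &
      forall j x, 5 / 6 <= `|x| -> derive1n j g x = 0].
Proof.
move=> br; have m0 := mass_gt0 br; have sT := smooth_Theta br.
pose h (s x : R) := (mass rho)^-1 * Theta rho (6 * x + s).
have sh s : smooth (h s) by apply: smoothZ; exact: smooth_affine.
(* The rescaled steps rise on [[-7/9, -5/9]] and on [[5/9, 7/9]], so the difference is 1 up to 1/2
   and has vanished before 5/6. *)
pose g x := h 4 x - h (- 4) x.
have sg : smooth g by exact: (smoothB (sh 4) (sh (- 4))).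
have hr s x : 2 / 3 <= 6 * x + s -> h s x = 1.
  by move=> ?; rewrite /h (Theta_right br)// mulVf// gt_eqF.
have hl s x : 6 * x + s <= - (2 / 3) -> h s x = 0.
  by move=> ?; rewrite /h (Theta_left br)// mulr0.
exists g; split=> // [x|j x x56].
  rewrite ler_norml => /andP[x1 x2].
  by rewrite /g hr ?hl ?subr0//; lra.
have g0 s : 7 / 9 < `|s| -> g s = 0.
  rewrite /g; case: (ltP s 0) => s0; [rewrite ltr0_norm//|rewrite ger0_norm//] => s1.
    by rewrite !hl ?subr0//; lra.
  by rewrite !hr ?subrr//; lra.
have x79 : 7 / 9 < `|x| by lra.
have [<- _] := derive1n_locality (f := fun=> 0) (g := g) (@open_norm_gt R (7 / 9))
  (@smooth_cst R 0) (fun s hs => esym (g0 s hs)) j x79.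
by rewrite derive1n_cst0.
Qed.

Lemma plateau_bounded (g : R -> R) K : smooth g ->
  (forall j x, 5 / 6 <= `|x| -> derive1n j g x = 0) ->
  exists2 D, 0 <= D & forall j x, (j <= K)%N -> `|derive1n j g x| <= D.
Proof.
move=> sg g0.
have H (j : nat) : exists M, 0 <= M /\ forall x, `|derive1n j g x| <= M.
  have [M M0 HM] := continuous_bounded_itv (-1) 1 (smooth_continuous (j := j) sg).
  exists M; split=> [|x]; first exact: ltW.
  case: (leP (5 / 6) `|x|) => x1; first by rewrite g0// normr0 ltW.
  by apply: HM; rewrite -ler_norml; lra.
have [M HM] := choice H.
exists (\sum_(j < K.+1) M j) => [|j x jK]; first by apply: sumr_ge0 => j _; case: (HM j).
have [_ h] := HM j; apply: (le_trans (h x)).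
rewrite (bigD1 (Ordinal (jK : (j < K.+1)%N)))//= lerDl.
by apply: sumr_ge0 => i _; case: (HM i).
Qed.

(** The Leibniz formula for the derivative of order [j] of a product, organised as a recursion in
    place of binomial coefficients. It has [2 ^ j] terms, which explains this factor in the
    bounds. *)
Fixpoint prodl t y j x := if j is i.+1 then
  prodl (fun i => t i.+1) y i x + prodl t (fun i => y i.+1) i x else t 0%N x * y 0%N x.

Lemma prodl_derive t y j x :
  (forall i, (i <= j)%N -> is_derive x (1 : R) (t i) (t i.+1 x)) ->
  (forall i, (i <= j)%N -> is_derive x (1 : R) (y i) (y i.+1 x)) ->
  is_derive x (1 : R) (prodl t y j) (prodl t y j.+1 x).
Proof.
elim: j t y => [|j IH] t y tD yD; first by apply: derM; [exact: tD|exact: yD].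
apply: derD; apply: IH => i ij.
- exact: tD.
- by apply: yD; exact: leqW.
- by apply: tD; exact: leqW.
- exact: yD.
Qed.

Lemma prodl_continuous t y j : (forall i, (i <= j)%N -> continuous (t i)) ->
  (forall i, (i <= j)%N -> continuous (y i)) -> continuous (prodl t y j).
Proof.
elim: j t y => [|j IH] t y ct cy; first by apply: continuousMf; [exact: ct|exact: cy].
apply: continuousDf; apply: IH => i ij; [exact: ct| | |exact: cy].
- by apply: cy; exact: leqW.
- by apply: ct; exact: leqW.
Qed.

Lemma prodl_eq0 t y j x : (forall i, (i <= j)%N -> t i x = 0) -> prodl t y j x = 0.
Proof.
elim: j t y => [|j IH] t y t0 /=; first by rewrite t0// mul0r.
by rewrite !IH ?addr0// => i ij; apply: t0 => //; exact: leqW.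
Qed.

Lemma prodl_bound t y j x D : 0 <= D -> (forall i, (i <= j)%N -> `|t i x| <= D) ->
  `|prodl t y j x| <= D * 2 ^+ j * \sum_(i < j.+1) `|y i x|.
Proof.
move=> D0; elim: j t y => [|j IH] t y tD.
  by rewrite big_ord1 expr0 mulr1 /= normrM ler_wpM2r// tD.
apply: (le_trans (ler_normD _ _)).
rewrite exprS mulrA [D * 2]mulrC -!mulrA mulrDl !mul1r !mulrA.
have c0 : 0 <= D * 2 ^+ j by rewrite mulr_ge0// exprn_ge0.
apply: lerD; [apply: (le_trans (IH (fun i => t i.+1) y _))|apply: (le_trans (IH t (fun i => y i.+1) _))].
- by move=> i ij; exact: tD.
- by apply: ler_wpM2l => //; rewrite [leRHS]big_ord_recr/= lerDl.
- by move=> i ij; apply: tD; exact: leqW.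
- by apply: ler_wpM2l => //; rewrite [leRHS]big_ord_recl/= lerDr.
Qed.

(** Every term other than [t 0 * y j] carries a derivative of [t] and a level of [y] below [j]. *)
Lemma prodl_remainder t y j x D : 0 <= D ->
  (forall i, (0 < i <= j)%N -> `|t i x| <= D) ->
  `|prodl t y j x - t 0%N x * y j x| <= D * 2 ^+ j * \sum_(i < j) `|y i x|.
Proof.
move=> D0; elim: j y => [|j IH] y tD; first by rewrite big_ord0 mulr0 /= subrr normr0.
rewrite /= -addrA; apply: (le_trans (ler_normD _ _)).
rewrite exprS mulrA [D * 2]mulrC -!mulrA mulrDl !mul1r !mulrA.
have c0 : 0 <= D * 2 ^+ j by rewrite mulr_ge0// exprn_ge0.
apply: lerD; first by apply: prodl_bound => // i ij; exact: tD.
apply: (le_trans (IH (fun i => y i.+1) _)).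
  by move=> i /andP[i0 ij]; apply: tD; rewrite i0 leqW.
by apply: ler_wpM2l => //; rewrite [leRHS]big_ord_recl/= lerDr.
Qed.

(* The hypothesis on [t] is the log-convexity [t_(j+1)^2 <= t_j t_(j+2)] in AM-GM form. *)
Lemma interpolation k (C1 : R) : 0 <= C1 -> exists2 Ce, 0 <= Ce & forall t : nat -> R,
  (forall j, 0 <= t j) ->
  (forall j eta, (j < k)%N -> 0 < eta -> 2 * t j.+1 <= eta * t j.+2 + eta^-1 * t j) ->
  t k.+1 <= C1 * \sum_(j < k.+1) t j -> \sum_(j < k.+1) t j <= Ce * t 0%N.
Proof.
move=> C10; pose K := k.+1%:R : R; have K0 : 0 < K by rewrite ltr0n.
(* Chosen so that [K * eta * C1 <= 1/2]: the top term is then absorbed in the sum of all levels. *)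
pose eta := (2 * K * C1 + 1)^-1; have e0' : 0 < 2 * K * C1 + 1.
  by rewrite ltr_wpDl// mulr_ge0// mulr_ge0// ltW.
have e0 : 0 < eta by rewrite invr_gt0.
have e1 : eta <= 1 by rewrite invf_le1// lerDr mulr_ge0// mulr_ge0// ltW.
pose D := eta^-1 ^+ k; have D1 : 1 <= eta^-1 by rewrite invf_ge1.
exists (2 * (K * K * D)) => [|t t0 tI tk].
  by rewrite mulr_ge0// mulr_ge0 ?exprn_ge0 ?invr_ge0 ?mulr_ge0// ltW.
have H1 j : (j <= k)%N -> t j <= eta * t j.+1 + eta^-1 ^+ j * t 0%N.
  elim: j => [_|j IH jk]; first by rewrite expr0 mul1r lerDr mulr_ge0// ltW.
  have := tI j _ jk e0; have := IH (ltnW jk).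
  have V0 : 0 < eta^-1 by rewrite invr_gt0.
  rewrite -(ler_pM2l V0) mulrDr !mulrA mulVf ?gt_eqF// mul1r -exprS.
  lra.
have H2 j : (j <= k)%N -> t j <= eta * t j.+1 + D * t 0%N.
  move=> jk; apply: (le_trans (H1 j jk)); rewrite lerD2l ler_wpM2r// /D.
  by rewrite ler_weXn2l.
have D0 : 0 <= D * t 0%N by rewrite mulr_ge0// exprn_ge0// (le_trans _ D1).
have H3 i : (i <= k)%N -> t (k - i)%N <= eta * t k.+1 + i.+1%:R * (D * t 0%N).
  elim: i => [_|i IH ik]; first by rewrite subn0 mul1r; exact: H2.
  have := H2 (k - i.+1)%N (leq_subr _ _); have := IH (ltnW ik).
  rewrite subnSK// => h1 h2; apply: (le_trans h2).
  rewrite -[i.+2%:R]natr1 mulrDl mul1r addrA lerD2r; apply: le_trans h1.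
  by rewrite ler_piMl.
have H4 j : (j <= k)%N -> t j <= eta * t k.+1 + K * (D * t 0%N).
  move=> jk; rewrite -(subKn jk); apply: (le_trans (H3 _ (leq_subr _ _))).
  by rewrite lerD2l ler_wpM2r// ler_nat ltnS leq_subr.
have : \sum_(j < k.+1) t j <= \sum_(j < k.+1) (eta * t k.+1 + K * (D * t 0%N)).
  by apply: ler_sum => j _; apply: H4; rewrite -ltnS.
rewrite sumr_const card_ord -[_ *+ _]mulr_natl -/K; set A := \sum_(j < k.+1) t j in tk *.
move=> A1; have A0 : 0 <= A by apply: sumr_ge0.
have : K * (eta * t k.+1) <= A / 2.
  apply: (@le_trans _ _ (K * (eta * (C1 * A)))).
    by rewrite ler_pM2l// ler_pM2l.
  have ek : eta * (2 * K * C1 + 1) = 1 by rewrite mulVf// gt_eqF.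
  have -> : K * (eta * (C1 * A)) = (eta * (2 * K * C1 + 1) - eta) / 2 * A by field.
  rewrite ek; have := mulr_ge0 (ltW e0) A0; lra.
rewrite mulrDr in A1; lra.
Qed.

End plateau.

(** * Pointwise bounds for cut-off solutions *)

Section bloch_pairs.
Context {R : realType} {I : finType} {k : nat}.
Implicit Types (y : nat -> I -> R -> R) (c : nat -> I -> I -> R -> R) (a b : I) (x : R).

Local Notation csum := (@csum R I k).
Local Notation nS := (#|{: 'I_k.+1 * I}|%:R : R).

Definition cabs y x := \sum_(i < k.+1) \sum_b `|y i b x|.
Definition level_sum y x := \sum_(i < k.+1) sqI (y i) x.

Lemma cabs_ge0 y x : 0 <= cabs y x.
Proof. by apply: sumr_ge0 => i _; apply: sumr_ge0. Qed.

Lemma csum_abs c y a x Cb : (forall j b, (j <= k)%N -> `|c j a b x| <= Cb) ->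
  `|csum c y a x| <= Cb * cabs y x.
Proof.
move=> cC; apply: (le_trans (ler_norm_sum _ _ _)); rewrite mulr_sumr; apply: ler_sum => i _.
apply: (le_trans (ler_norm_sum _ _ _)); rewrite mulr_sumr; apply: ler_sum => b _.
by rewrite normrM ler_wpM2r// cC// -ltnS.
Qed.

Lemma cabs_sq y x : cabs y x ^+ 2 <= nS * level_sum y x.
Proof.
rewrite /cabs (pair_bigA _ (fun (i : 'I_k.+1) b => `|y i b x|)).
apply: (le_trans (sum_sqr_le _)); rewrite ler_wpM2l//.
rewrite /level_sum /sqI (pair_bigA _ (fun (i : 'I_k.+1) b => y i b x ^+ 2)).
by apply: ler_sum => s _; rewrite real_normK// num_real.
Qed.

Lemma cabs_level y j x : (j <= k.+1)%N -> \sum_(i < j) \sum_b `|y i b x| <= cabs y x.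
Proof.
move=> jk; rewrite /cabs -(subnKC jk) big_split_ord/= lerDl.
by apply: sumr_ge0 => i _; apply: sumr_ge0.
Qed.

Lemma sqI_le_cst y (f : I -> R -> R) x kappa : 0 <= kappa ->
  (forall a, `|f a x| <= kappa * cabs y x) ->
  sqI f x <= kappa ^+ 2 * (#|I|%:R * nS) * level_sum y x.
Proof.
move=> k0 fk; apply: (@le_trans _ _ (\sum_(a : I) kappa ^+ 2 * (nS * level_sum y x))).
  apply: ler_sum => a _; rewrite -[leLHS]real_normK ?num_real//.
  apply: (@le_trans _ _ ((kappa * cabs y x) ^+ 2)).
    by rewrite lerXn2r ?nnegrE ?mulr_ge0 ?cabs_ge0.
  by rewrite exprMn ler_wpM2l ?sqr_ge0// cabs_sq.
rewrite sumr_const -[_ *+ _]mulr_natl le_eqVlt; apply/orP; left; apply/eqP; ring.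
Qed.

Definition cutl (t : nat -> R -> R) y j b := prodl t (fun i => y i b) j.

(* The residual of a cut-off solution: the terms with derivatives on the cut-off
   and the coefficient difference are both small. *)
Lemma cutoff_residual (c cw : nat -> I -> I -> R -> R) (t : nat -> R -> R) y a x Cb e d D :
  0 <= d -> 0 <= D -> 0 <= e ->
  (forall j a b, (j <= k)%N -> `|cw j a b x| <= Cb) ->
  (forall j a b, (j <= k)%N -> `|c j a b x - cw j a b x| <= e) ->
  `|t 0%N x| <= D -> (forall i, (0 < i <= k.+1)%N -> `|t i x| <= d) ->
  y k.+1 a x = csum c y a x ->
  `|cutl t y k.+1 a x - csum cw (cutl t y) a x| <=
     (D * e + (1 + Cb * nS) * (d * 2 ^+ k.+1)) * cabs y x.
Proof.
move=> d0 D0 e0 cwC ce tD td ya; set P := cutl t y.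
pose r j b := P j b x - t 0%N x * y j b x.
have Cb0 : 0 <= Cb by apply: le_trans (cwC 0%N a a (leq0n _)).
have rb j b : (j <= k.+1)%N -> `|r j b| <= d * 2 ^+ k.+1 * cabs y x.
  move=> jk; apply: (@le_trans _ _ (d * 2 ^+ j * \sum_(i < j) `|y i b x|)).
    by apply: prodl_remainder => // i /andP[i0 ij]; apply: td; rewrite i0 (leq_trans ij).
  apply: ler_pM.
  - by rewrite mulr_ge0// exprn_ge0.
  - exact: sumr_ge0.
  - by rewrite ler_wpM2l// ler_weXn2l// ler1n.
  - apply: le_trans (cabs_level y x jk); apply: ler_sum => i _.
    by rewrite (bigD1 b)//= lerDl; apply: sumr_ge0.
have -> : P k.+1 a x - csum cw P a x =
    t 0%N x * csum (fun j a b x => c j a b x - cw j a b x) y a x +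
    (r k.+1 a - csum cw (fun j b _ => r j b) a x).
  have -> : csum cw (fun j b _ => r j b) a x = csum cw P a x - t 0%N x * csum cw y a x.
    rewrite /csum mulr_sumr -sumrB; apply: eq_bigr => i _.
    by rewrite mulr_sumr -sumrB; apply: eq_bigr => b _; rewrite /r; ring.
  have -> : csum (fun j a b x => c j a b x - cw j a b x) y a x = csum c y a x - csum cw y a x.
    rewrite /csum -sumrB; apply: eq_bigr => i _.
    by rewrite -sumrB; apply: eq_bigr => b _; ring.
  by rewrite /r ya; ring.
apply: (le_trans (ler_normD _ _)); rewrite mulrDl; apply: lerD.
  rewrite normrM -mulrA; apply: ler_pM => //.
  by apply: csum_abs => j b jk; exact: ce.
apply: (le_trans (ler_normB _ _)).
rewrite -[leRHS]mulrA mulrDl mul1r; apply: lerD; first exact: rb.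
apply: (le_trans (ler_norm_sum _ _ _)).
apply: (@le_trans _ _ (\sum_(i < k.+1) \sum_(b : I) Cb * (d * 2 ^+ k.+1 * cabs y x))).
  apply: ler_sum => i _; apply: (le_trans (ler_norm_sum _ _ _)); apply: ler_sum => b _.
  have ik : (i <= k)%N by rewrite -ltnS.
  by rewrite normrM; apply: ler_pM => //; [exact: cwC|apply: rb; exact: leqW].
rewrite (pair_bigA _ (fun (i : 'I_k.+1) (b : I) => Cb * (d * 2 ^+ k.+1 * cabs y x)))/=.
by rewrite sumr_const -[_ *+ _]mulr_natl le_eqVlt; apply/orP; left; apply/eqP; ring.
Qed.

Lemma periodic_iint (L : R) f u : 0 < L -> locint f -> (forall x, f (x + L) = f x) ->
  iint f u (u + L) = iint f 0 L.
Proof.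
move=> L0 fi fL; have uL : u <= u + L by rewrite lerDl ltW.
rewrite -(prim_J fi uL) (J_periodic fi fL) addrC addKr.
by rewrite -[RHS](prim_J fi (ltW L0)) J0 subr0.
Qed.

End bloch_pairs.

(** * The energy argument over one period *)

Section bloch_exclusion.
Context {R : realType} {I : finType} {k : nat}.
Implicit Types (y : nat -> I -> R -> R) (c : nat -> I -> I -> R -> R) (a b : I) (x : R).

Local Notation csum := (@csum R I k).
Local Notation nS := (#|{: 'I_k.+1 * I}|%:R : R).
Local Notation level_sum := (@level_sum R I k).

Definition classical y := (forall j a x, (j <= k)%N -> is_derive x (1 : R) (y j a) (y j.+1 a x)) /\
  forall a, continuous (y k.+1 a).

(** The a priori bound that a resolvent estimate provides, restricted to what the cut-off argument
    produces: classical functions of compact support, with the residual divided by the leading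
    coefficient. *)
Definition coercive cw (M : R) := forall y A, classical y ->
  (forall j a x, (j <= k.+1)%N -> A <= `|x| -> y j a x = 0) ->
  iint (sqI (y 0%N)) (- A) A <=
  M * iint (sqI (fun a x => y k.+1 a x - csum cw y a x)) (- A) A.

Lemma classical_continuous y j a : classical y -> (j <= k.+1)%N -> continuous (y j a).
Proof.
move=> [yD yc]; rewrite leq_eqVlt => /orP[/eqP->//|jk] x.
exact: derive_continuous_at (yD j a x jk).
Qed.

Lemma sqI_continuous (f : I -> R -> R) : (forall a, continuous (f a)) -> continuous (sqI f).
Proof.
move=> cf; apply: continuous_sum => a; under eq_fun do rewrite expr2.
exact: continuousMf.
Qed.

Lemma level_sum_continuous y : classical y -> continuous (level_sum y).
Proof.
move=> yc; apply: continuous_sum => i; apply: sqI_continuous => a.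
by apply: classical_continuous => //; exact: ltnW.
Qed.

Lemma level_sum_ge0 y x : 0 <= level_sum y x.
Proof. by apply: sumr_ge0 => i _; exact: sqI_ge0. Qed.

Variables (g : R -> R) (D : R).
Hypothesis sg : smooth g.
Hypothesis g1 : forall x, `|x| <= 1 / 2 -> g x = 1.
Hypothesis g0 : forall j x, 5 / 6 <= `|x| -> derive1n j g x = 0.
Hypothesis D0 : 0 <= D.
Hypothesis gD : forall j x, (j <= k.+1)%N -> `|derive1n j g x| <= D.

Let th (L : R) j x := L^-1 ^+ j * derive1n j g (L^-1 * x + 0).

(** The plateau of scale [L] times [y] is admissible in [cM]. It equals [y] on [[-L/2, L/2]], and
    its residual is at most [kap] times the levels of [y]; derivatives of the plateau contribute
    [D / L], as [L >= 1]. *)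
Lemma cut_estimate c cw (Cb M e L : R) y : 1 <= L -> 0 <= e -> 0 <= M ->
  (forall j a b, (j <= k)%N -> continuous (cw j a b)) ->
  (forall j a b x, (j <= k)%N -> `|cw j a b x| <= Cb) ->
  (forall j a b x, (j <= k)%N -> `|x| <= 5 / 6 * L -> `|c j a b x - cw j a b x| <= e) ->
  coercive cw M -> classical y -> (forall a x, y k.+1 a x = csum c y a x) ->
  iint (sqI (y 0%N)) (- (L / 2)) (L / 2) <=
  M * ((D * e + (1 + Cb * nS) * (D / L * 2 ^+ k.+1)) ^+ 2 * (#|I|%:R * nS)) *
    iint (level_sum y) (- L) L.
Proof.
move=> L1 e0 M0 cwc cwC ce cM yc yE.
(* An index is needed to conclude from the coefficient bound that [Cb] is nonnegative; without
   indices all sums are empty. *)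
case: (pickP I) => [a0 _|I0]; last first.
  have z (f : I -> R -> R) x : sqI f x = 0 by rewrite /sqI big1// => a _; have := I0 a.
  rewrite (eq_iint (g := cst 0)) ?iint_cst ?mul0r.
  - apply: mulr_ge0; last by apply: iint_ge0 => x _; exact: level_sum_ge0.
    by apply: mulr_ge0 => //; apply: mulr_ge0; [exact: sqr_ge0|exact: mulr_ge0].
  - by lra.
  - by move=> x _; exact: z.
have L0 : 0 < L by apply: lt_le_trans L1.
have Cb0 : 0 <= Cb by apply: le_trans (cwC 0%N a0 a0 0 (leq0n _)).
set kap := D * e + _.
have kap0 : 0 <= kap.
  apply: addr_ge0; apply: mulr_ge0 => //; first by apply: addr_ge0 => //; exact: mulr_ge0.
  by apply: mulr_ge0; [rewrite divr_ge0// ltW|exact: exprn_ge0].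
have thD j x : is_derive x (1 : R) (th L j) (th L j.+1 x).
  rewrite /th exprSr -mulrA; apply: derZ.
  exact: is_derive_comp_affine (is_derive_smooth j _ sg).
have cth j : continuous (th L j) by move=> x; exact: derive_continuous_at (thD j x).
have xL x (s : R) : (`|L^-1 * x + 0| <= s) = (`|x| <= s * L).
  by rewrite addr0 normrM gtr0_norm ?invr_gt0// mulrC ler_pdivrMr.
have xL' x (s : R) : (s <= `|L^-1 * x + 0|) = (s * L <= `|x|).
  by rewrite addr0 normrM gtr0_norm ?invr_gt0// mulrC ler_pdivlMr.
have th0 j x : 5 / 6 * L <= `|x| -> th L j x = 0.
  by rewrite -xL' => /g0 gz; rewrite /th gz mulr0.
have thd i x : (0 < i <= k.+1)%N -> `|th L i x| <= D / L.
  case: i => [//|i] /= ik; rewrite /th normrM mulrC ler_pM// ?gD//.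
  rewrite exprS ger0_norm ?mulr_ge0 ?exprn_ge0 ?invr_ge0 ?(ltW L0)//.
  by rewrite ler_piMr ?invr_ge0 ?(ltW L0)// exprn_ile1 ?invr_ge0 ?(ltW L0)// invf_le1.
pose P := cutl (th L) y.
have Pc : classical P.
  split=> [j a x jk|a].
    exact: (@prodl_derive R (th L) (fun i => y i a) j x (fun i _ => thD i x)
      (fun i ij => yc.1 i a x (leq_trans ij jk))).
  by apply: prodl_continuous => i ik; [exact: cth|exact: classical_continuous].
have P0 j a x : (j <= k.+1)%N -> L <= `|x| -> P j a x = 0.
  move=> jk Lx; apply: prodl_eq0 => i _; apply: th0; lra.
have := cM P L Pc P0.
set Rf := fun a x => P k.+1 a x - csum cw P a x => HP.
have cP a : continuous (P 0%N a) by exact: classical_continuous.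
have cR a : continuous (Rf a).
  have cs : continuous (csum cw P a).
    apply: csum_continuous => [j a' b|j b] jk; first exact: cwc.
    by apply: classical_continuous => //; exact: leqW.
  have cPk : continuous (P k.+1 a) by exact: classical_continuous.
  by move=> x; apply: cvgB; [exact: cPk|exact: cs].
have cy a : continuous (y 0%N a) by exact: classical_continuous.
have li (f : I -> R -> R) : (forall a, continuous (f a)) -> locint (sqI f).
  by move=> cf; apply: locint_continuous; exact: sqI_continuous.
apply: (@le_trans _ _ (iint (sqI (P 0%N)) (- L) L)).
  have -> : iint (sqI (y 0%N)) (- (L / 2)) (L / 2) = iint (sqI (P 0%N)) (- (L / 2)) (L / 2).
    apply: eq_iint => x xx; apply: eq_bigr => a _.
    have t1 : th L 0%N x = 1.
      by rewrite /th expr0 mul1r; apply: g1; rewrite xL ler_norml; lra.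
    by have -> : P 0%N a x = th L 0%N x * y 0%N a x by []; rewrite t1 mul1r.
  apply: iint_subset; [exact: li|by move=> x; exact: sqI_ge0| | |]; lra.
apply: (le_trans HP); rewrite -mulrA; apply: ler_wpM2l => //.
rewrite -iintZ; last exact: locint_continuous (level_sum_continuous yc).
apply: iint_le; first exact: li.
  by apply: locintZ; exact: locint_continuous (level_sum_continuous yc).
move=> x _; apply: sqI_le_cst => // a.
(* Beyond this point the coefficients need not be close, but there the cut-off function vanishes. *)
case: (leP `|x| (5 / 6 * L)) => x56; last first.
  have Pz j b : P j b x = 0 by apply: prodl_eq0 => i _; apply: th0; exact: ltW.
  rewrite /Rf Pz /csum big1 ?subr0 ?normr0 ?mulr_ge0 ?cabs_ge0//.
  by move=> i _; apply: big1 => b _; rewrite Pz mulr0.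
apply: (cutoff_residual (c := c)) => //.
- by rewrite divr_ge0// ltW.
- by move=> j a' b jk; exact: cwC.
- by move=> j a' b jk; exact: ce.
- by rewrite /th expr0 mul1r; exact: (@gD 0%N).
- by move=> i; exact: thd.
Qed.

Section pair.
Variables (c : nat -> I -> I -> R -> R) (L r d Cb : R) (p q : nat -> I -> R -> R).
Hypothesis L0 : 0 < L.
Hypothesis cC : forall j a b x, (j <= k)%N -> `|c j a b x| <= Cb.
Hypothesis rd : r ^+ 2 + d ^+ 2 = 1.
Hypothesis pc : classical p.
Hypothesis qc : classical q.
Hypothesis pE : forall a x, p k.+1 a x = csum c p a x.
Hypothesis qE : forall a x, q k.+1 a x = csum c q a x.
Hypothesis pL : forall j a x, (j <= k.+1)%N -> p j a (x + L) = r * p j a x - d * q j a x.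
Hypothesis qL : forall j a x, (j <= k.+1)%N -> q j a (x + L) = d * p j a x + r * q j a x.

Let pe j x := sqI (p j) x + sqI (q j) x.
Let s j := iint (pe j) 0 L.

Let pe_ge0 j x : 0 <= pe j x.
Proof. by rewrite addr_ge0// sqI_ge0. Qed.

Let pe_continuous j : (j <= k.+1)%N -> continuous (pe j).
Proof.
by move=> jk; apply: continuousDf; apply: sqI_continuous => a; exact: classical_continuous.
Qed.

(** A multiplier of modulus 1 acts as a rotation of the pair and preserves inner products. Quadratic
    expressions in the pair are therefore periodic, while [p] and [q] themselves are not. *)
Let rot_dot (a1 a2 b1 b2 : R) : (r * a1 - d * b1) * (r * a2 - d * b2) +
  (d * a1 + r * b1) * (d * a2 + r * b2) = a1 * a2 + b1 * b2.
Proof.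
have -> : (r * a1 - d * b1) * (r * a2 - d * b2) + (d * a1 + r * b1) * (d * a2 + r * b2) =
  (r ^+ 2 + d ^+ 2) * (a1 * a2 + b1 * b2) by ring.
by rewrite rd mul1r.
Qed.

Let pe_periodic j x : (j <= k.+1)%N -> pe j (x + L) = pe j x.
Proof.
move=> jk; rewrite /pe /sqI -!big_split; apply: eq_bigr => a _ /=.
by rewrite pL// qL// !expr2 rot_dot.
Qed.

Let pe_shift j u : (j <= k.+1)%N -> iint (pe j) u (u + L) = s j.
Proof.
move=> jk; apply: periodic_iint => // [|x]; last exact: pe_periodic.
by apply: locint_continuous; exact: pe_continuous.
Qed.

(** The integral over a period of the derivative of the inner product of levels [j] and [j.+1] is 0.
    Twice this derivative, minus the difference of the two sides, is a sum of squares weighted by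
    [eta]. *)
Let pe_interp j eta : (j < k)%N -> 0 < eta ->
  2 * s j.+1 <= eta * s j.+2 + eta^-1 * s j.
Proof.
move=> jk e0.
have j0 : (j <= k.+1)%N by exact: ltnW (leqW jk).
have j1 : (j.+1 <= k.+1)%N by exact: leqW jk.
have j2 : (j.+2 <= k.+1)%N by [].
have Fc y i a : classical y -> (i <= k.+1)%N -> continuous (y i a) by exact: classical_continuous.
pose Phi x := \sum_a (p j a x * p j.+1 a x + q j a x * q j.+1 a x).
pose dPhi x := \sum_a ((p j.+1 a x * p j.+1 a x + p j a x * p j.+2 a x) +
  (q j.+1 a x * q j.+1 a x + q j a x * q j.+2 a x)).
have cd : continuous dPhi.
  apply: continuous_sum => a; apply: continuousDf; apply: continuousDf; apply: continuousMf;
  exact: Fc.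
have PhiD x : is_derive x (1 : R) Phi (dPhi x).
  apply: der_sum => a; apply: derD; apply: derM; solve [apply: pc.1 => //; exact: ltnW | apply: qc.1 => //; exact: ltnW].
have PhiL : Phi L = Phi 0.
  apply: eq_bigr => a _; rewrite -[L]add0r !pL// !qL//; exact: rot_dot.
have := derive_prim cd PhiD (ltW L0); rewrite PhiL subrr => d0.
have l i : (i <= k.+1)%N -> locint (pe i) by move=> ik; apply: locint_continuous; exact: pe_continuous.
have : iint (fun x => 2 * pe j.+1 x - (eta * pe j.+2 x + eta^-1 * pe j x)) 0 L <=
    iint (fun x => 2 * dPhi x) 0 L.
  apply: iint_le.
  - by apply: locintB; [|apply: locintD]; apply: locintZ; exact: l.
  - by apply: locintZ; exact: locint_continuous.
  move=> x _; rewrite -subr_ge0.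
  have -> : 2 * dPhi x - (2 * pe j.+1 x - (eta * pe j.+2 x + eta^-1 * pe j x)) =
      \sum_a (eta * (p j.+2 a x + eta^-1 * p j a x) ^+ 2 + eta * (q j.+2 a x + eta^-1 * q j a x) ^+ 2).
    rewrite /dPhi /pe /sqI !mulrDr !mulr_sumr -!big_split -!sumrB /=.
    apply: eq_bigr => a _; by field; rewrite gt_eqF.
  by apply: sumr_ge0 => a _; rewrite addr_ge0// mulr_ge0 ?sqr_ge0// ltW.
rewrite iintZ -?d0 ?mulr0; last exact: locint_continuous.
rewrite iintB; last 2 first.
- by apply: locintZ; exact: l.
- by apply: locintD; apply: locintZ; exact: l.
rewrite iintD; last 2 first.
- by apply: locintZ; exact: l.
- by apply: locintZ; exact: l.
rewrite !iintZ; try exact: l.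
by rewrite subr_le0.
Qed.

Let sum_pe : \sum_(j < k.+1) s j = iint (level_sum p) 0 L + iint (level_sum q) 0 L.
Proof.
have l j y : classical y -> (j <= k)%N -> locint (sqI (y j)).
  move=> yc jk; apply: locint_continuous; apply: sqI_continuous => a.
  by apply: classical_continuous => //; exact: leqW.
rewrite /level_sum !iint_sum; last 2 first.
- by move=> i _; apply: l => //; rewrite -ltnS.
- by move=> i _; apply: l => //; rewrite -ltnS.
rewrite -big_split; apply: eq_bigr => j _; rewrite /s /pe iintD//.
- by apply: l => //; rewrite -ltnS.
- by apply: l => //; rewrite -ltnS.
Qed.

(** The equation bounds the highest derivative by the lower levels, which closes the
    interpolation. *)
Let pe_top : 0 <= Cb -> s k.+1 <= Cb ^+ 2 * (#|I|%:R * nS) * \sum_(j < k.+1) s j.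
Proof.
move=> Cb0; have ll y : classical y -> locint (level_sum y).
  by move=> yc; apply: locint_continuous; exact: level_sum_continuous.
rewrite sum_pe -iintD; try exact: ll.
rewrite -iintZ; last by apply: locintD; exact: ll.
apply: iint_le.
- by apply: locint_continuous; exact: pe_continuous.
- by apply: locintZ; apply: locintD; exact: ll.
move=> x _; rewrite mulrDr; apply: lerD; apply: sqI_le_cst => // a.
  by rewrite pE; apply: csum_abs => j b jk; exact: cC.
by rewrite qE; apply: csum_abs => j b jk; exact: cC.
Qed.

(** The chain [s 0 <= 2 kap (sum of levels) <= 2 kap Ce (s 0) <= s 0 / 2] forces [s 0 = 0]. *)
Lemma pair_eq0 kap : 0 <= Cb -> 0 <= kap ->
  (forall Ce, (forall t : nat -> R,
  (forall j, 0 <= t j) ->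
  (forall j eta, (j < k)%N -> 0 < eta -> 2 * t j.+1 <= eta * t j.+2 + eta^-1 * t j) ->
  t k.+1 <= Cb ^+ 2 * (#|I|%:R * nS) * \sum_(j < k.+1) t j -> \sum_(j < k.+1) t j <= Ce * t 0%N) ->
  2 * kap * Ce <= 1 / 2 ->
  (forall y, classical y -> (forall a x, y k.+1 a x = csum c y a x) ->
    iint (sqI (y 0%N)) (- (L / 2)) (L / 2) <= kap * iint (level_sum y) (- L) L) ->
  forall a x, p 0%N a x = 0 /\ q 0%N a x = 0).
Proof.
move=> Cb0 kap0 Ce HCe kC est.
have s0 j : 0 <= s j by apply: iint_ge0.
have HS := HCe s s0 pe_interp (pe_top Cb0).
have lq y j : classical y -> (j <= k.+1)%N -> locint (sqI (y j)).
  move=> yc jk; apply: locint_continuous; apply: sqI_continuous => a.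
  by apply: classical_continuous.
have ll y : classical y -> locint (level_sum y).
  by move=> yc; apply: locint_continuous; exact: level_sum_continuous.
(* The factor 2 arises because the cut-off estimate integrates over [[-L, L]], which is two
   periods. *)
have h0 : s 0%N <= 2 * kap * \sum_(j < k.+1) s j.
  have <- := @pe_shift 0%N (- (L / 2)) (leq0n _).
  have -> : - (L / 2) + L = L / 2 by field.
  rewrite /pe iintD; [|exact: lq|exact: lq].
  apply: (le_trans (lerD (est p pc pE) (est q qc qE))).
  rewrite -mulrDr [2 * kap]mulrC -mulrA; apply: ler_wpM2l => //.
  rewrite -iintD; [|exact: ll|exact: ll].
  have E : (fun x => level_sum p x + level_sum q x) = fun x => \sum_(j < k.+1) pe j x.
    by apply/funext => x; rewrite -big_split.
  have lp j : (j <= k.+1)%N -> locint (pe j) by move=> jk; apply: locint_continuous; exact: pe_continuous.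
  rewrite E iint_sum; last by move=> j _; apply: lp; exact: ltnW.
  rewrite mulr_sumr; apply: ler_sum => j _.
  have jk : (j <= k.+1)%N by exact: ltnW.
  have n0 : - L <= 0 by rewrite oppr_le0 ltW.
  have -> := iint_cat (lp j jk) n0 (ltW L0).
  have := pe_shift (- L) jk; rewrite addNr => ->.
  by rewrite -/(s j); lra.
have sz : s 0%N = 0.
  apply/eqP; rewrite eq_le s0 andbT.
  have : 2 * kap * \sum_(j < k.+1) s j <= 2 * kap * (Ce * s 0%N).
    by rewrite ler_wpM2l// mulr_ge0.
  have := ler_wpM2r (s0 0%N) kC; lra.
have Sz : \sum_(j < k.+1) s j = 0.
  by apply/eqP; rewrite eq_le sumr_ge0 ?andbT//; move: HS; rewrite sz mulr0.
have s1z : s 1%N = 0.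
  (* For [k = 0] level 1 is the highest derivative and is reached through the equation, not through
     the sum. *)
  case: (posnP k) => [k0|k0].
    apply/eqP; rewrite eq_le s0 andbT; have := pe_top Cb0; rewrite Sz mulr0.
    by have -> : k.+1 = 1%N by rewrite k0.
  move/eqP: Sz; rewrite psumr_eq0// => /allP/(_ (Ordinal (k0 : (1 < k.+1)%N))).
  by rewrite mem_index_enum => /(_ isT) /eqP.
(* Levels 0 and 1 have zero integral over the period starting at [x], so the Sobolev inequality at
   that end gives pointwise vanishing. *)
have zero y a x : classical y -> (forall j x, (j <= 1)%N -> sqI (y j) x <= pe j x) -> y 0%N a x = 0.
  move=> yc yp.
  have [yD yk] := yc.
  have c0 : continuous (y 0%N a) by exact: classical_continuous.
  have c1 : continuous (y 1%N a) by exact: classical_continuous.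
  have pY : prim (y 1%N a) (y 0%N a) by apply: derive_prim => // z; exact: yD.
  have c12 : locint (fun x => y 1%N a x ^+ 2).
    by apply: locint_continuous; under eq_fun do rewrite expr2; exact: continuousMf.
  have c02 : locint (fun x => y 0%N a x ^+ 2).
    by apply: locint_continuous; under eq_fun do rewrite expr2; exact: continuousMf.
  have i0 j : (j <= 1)%N -> locint (fun x => y j a x ^+ 2) -> iint (fun x => y j a x ^+ 2) x (x + L) <= s j.
    move=> j1 lj; have jk : (j <= k.+1)%N by exact: leq_trans j1 _.
    rewrite -(pe_shift x jk); apply: iint_le => // [|z _].
      by apply: locint_continuous; exact: pe_continuous.
    by apply: le_trans (yp j z j1); rewrite /sqI (bigD1 a)//= lerDl sumr_ge0// => b _; exact: sqr_ge0.
  have xx : x <= x <= x + L by rewrite lexx lerDl ltW.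
  have xl : x < x + L by rewrite ltrDl.
  have := prim_sup_sq (continuous_measurable_fun c1) c12 pY xl xx.
  rewrite [x + L]addrC addrK => H.
  have n0 : 0 <= 2 / L by rewrite divr_ge0// ltW.
  have n1 : 0 <= 2 * L by rewrite mulr_ge0// ltW.
  have h00 := ler_wpM2l n0 (i0 0%N isT c02).
  have h11 := ler_wpM2l n1 (i0 1%N isT c12).
  rewrite addrC in H; rewrite sz mulr0 in h00; rewrite s1z mulr0 in h11.
  apply/eqP; rewrite -sqrf_eq0 eq_le sqr_ge0 andbT; lra.
move=> a x; split; apply: zero => // j z _; rewrite /pe ?lerDl ?lerDr; exact: sqI_ge0.
Qed.

End pair.
End bloch_exclusion.

Section no_bloch_small.
Context {R : realType} {I : finType} {k : nat}.

(** The thresholds [e] and [L1] depend only on [Cb], [M] and the dimensions, hence are uniform in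
    the spectral parameter and the pulse once these bounds are. *)
Lemma no_bloch_small (rho : R -> R) (Cb M : R) : bump rho -> 0 <= Cb -> 0 <= M ->
  exists e L1 : R, 0 < e /\ forall L (c cw : nat -> I -> I -> R -> R), 0 < L -> L1 <= L ->
  (forall j a b, (j <= k)%N -> continuous (cw j a b)) ->
  (forall j a b x, (j <= k)%N -> `|c j a b x| <= Cb) ->
  (forall j a b x, (j <= k)%N -> `|cw j a b x| <= Cb) ->
  (forall j a b x, (j <= k)%N -> `|x| <= 5 / 6 * L -> `|c j a b x - cw j a b x| <= e) ->
  coercive (k := k) cw M -> no_bloch_ladder (k := k) c L.
Proof.
move=> br Cb0 M0; have [g [sg g1 g0]] := plateau_exists br.
have [D D0 gD] := plateau_bounded k.+1 sg g0.
pose nS := #|{: 'I_k.+1 * I}|%:R : R.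
pose nI := #|I|%:R * nS.
have nS0 : 0 <= nS by [].
have nI0 : 0 <= nI by rewrite mulr_ge0.
have C10 : 0 <= Cb ^+ 2 * nI by rewrite mulr_ge0// sqr_ge0.
have [Ce Ce0 HCe] := interpolation k C10.
pose Q := 2 * M * nI * Ce.
have Q0 : 0 <= Q by rewrite mulr_ge0// mulr_ge0// mulr_ge0.
(* Since [k0 <= 1], the bound [kap <= k0] yields [kap ^+ 2 <= k0], and [k0 * Q <= 1/2] is the
   smallness required at the end. *)
pose k0 := (2 * Q + 1)^-1.
have k0p' : 0 < 2 * Q + 1 by lra.
have k0p : 0 < k0 by rewrite invr_gt0.
have k01 : k0 <= 1 by rewrite invf_le1//; lra.
have kQ : k0 * (2 * Q + 1) = 1 by rewrite mulVf// gt_eqF.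
have D1 : 0 < D + 1 by lra.
(* Coefficient difference and plateau slope each receive half of [k0]. *)
pose e := k0 / (2 * (D + 1)).
pose E := (1 + Cb * nS) * (D * 2 ^+ k.+1).
have E0 : 0 <= E by rewrite mulr_ge0 ?addr_ge0 ?mulr_ge0// exprn_ge0.
exists e, (2 * E / k0 + 1); split; first by rewrite divr_gt0// mulr_gt0.
move=> L c cw L0 LL cwc cC cwC ce cM r d p q rd pD qD pk qk pE qE pL qL.
have L1 : 1 <= L by apply: le_trans LL; rewrite lerDr; apply: divr_ge0; [exact: mulr_ge0|exact: ltW].
have e0 : 0 <= e by rewrite divr_ge0 ?mulr_ge0// ltW.
have est y yc yE := cut_estimate (y := y) sg g1 g0 D0 gD L1 e0 M0 cwc cwC ce cM yc yE.
set kap := D * e + _ in est.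
have kap0 : 0 <= kap.
  apply: addr_ge0; apply: mulr_ge0 => //; first by apply: addr_ge0 => //; exact: mulr_ge0.
  by apply: mulr_ge0; [rewrite divr_ge0// ltW|exact: exprn_ge0].
have kapk : kap <= k0.
  have h1 : D * e <= k0 / 2.
    have -> : D * e = D / (D + 1) * (k0 / 2) by rewrite /e; field; rewrite gt_eqF.
    by rewrite ler_piMl ?divr_ge0 ?(ltW k0p)// ler_pdivrMr// mul1r lerDl.
  have h2 : E / L <= k0 / 2.
    rewrite ler_pdivrMr//; apply: (@le_trans _ _ (k0 / 2 * (2 * E / k0 + 1))); last first.
      by rewrite ler_pM2l// divr_gt0.
    have -> : k0 / 2 * (2 * E / k0 + 1) = E + k0 / 2 by field; rewrite gt_eqF.
    by rewrite lerDl divr_ge0// ltW.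
  have -> : kap = D * e + E / L by rewrite /kap /E -/nS; ring.
  lra.
have kap2 : kap ^+ 2 <= k0.
  rewrite expr2; apply: (le_trans _ kapk); rewrite ler_piMl//; exact: le_trans kapk k01.
have kk0 : 0 <= M * (kap ^+ 2 * nI) by rewrite mulr_ge0// mulr_ge0// sqr_ge0.
have kC : 2 * (M * (kap ^+ 2 * nI)) * Ce <= 1 / 2; last first.
  exact: (pair_eq0 (c := c) L0 cC rd (conj pD pk) (conj qD qk) pE qE pL qL Cb0 kk0 HCe kC est).
have -> : 2 * (M * (kap ^+ 2 * nI)) * Ce = kap ^+ 2 * Q by rewrite /Q; ring.
have := ler_wpM2r Q0 kap2; lra.
Qed.

End no_bloch_small.

(** * Real coordinates *)

Section scalars.
Context {R : realType} {F : field_kind}.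
Implicit Types (a b : scal R F).

Lemma reD a b : re (a + b) = re a + re b.
Proof. by case: F a b => // -[x y] [x' y']. Qed.

Lemma imD a b : im (a + b) = im a + im b.
Proof. by case: F a b => [x y|[x y] [x' y']] //=; rewrite addr0. Qed.

Lemma reN a : re (- a) = - re a.
Proof. by case: F a => // -[x y]. Qed.

Lemma imN a : im (- a) = - im a.
Proof. by case: F a => [x|[x y]] //=; rewrite oppr0. Qed.

Lemma reM a b : re (a * b) = re a * re b - im a * im b.
Proof. by case: F a b => [x y|[x y] [x' y']] //=; rewrite mul0r subr0. Qed.

Lemma imM a b : im (a * b) = re a * im b + im a * re b.
Proof. by case: F a b => [x y|[x y] [x' y']] //=; rewrite mulr0 mul0r addr0. Qed.

Definition mk (x y : R) : scal R F :=
  match F return scal R F with RealField => x | ComplexField => x +i* y end.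

Lemma mk_re_im a : mk (re a) (im a) = a.
Proof. by rewrite /mk; case: F a => // -[x y]. Qed.

Lemma re_of_real (x : R) : re (of_real F x) = x.
Proof. by case: F. Qed.

Lemma im_of_real (x : R) : im (of_real F x) = 0.
Proof. by case: F. Qed.

Lemma norm_scal a : `|a| = of_real F (Num.sqrt (re a ^+ 2 + im a ^+ 2)).
Proof.
case: F a => [x|[x y]] /=; first by rewrite expr0n addr0 sqrtr_sqr.
by rewrite normc_def.
Qed.

Lemma of_real_le (x y : R) : (of_real F x <= of_real F y) = (x <= y).
Proof. by case: F => //=; rewrite lecR. Qed.

Lemma of_real_lt (x y : R) : (of_real F x < of_real F y) = (x < y).
Proof. by case: F => //=; rewrite ltcR. Qed.

Lemma of_real0 : of_real F (0 : R) = 0.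
Proof. by case: F. Qed.

Lemma gt0_of_real a : 0 < a -> exists2 x : R, 0 < x & a = of_real F x.
Proof.
move=> a0; exists (Num.sqrt (re a ^+ 2 + im a ^+ 2)); last by rewrite -norm_scal gtr0_norm.
by rewrite -of_real_lt of_real0 -norm_scal gtr0_norm.
Qed.

Lemma norm_re a (x : R) : `|a| < of_real F x -> `|re a| < x.
Proof.
rewrite norm_scal of_real_lt; apply: le_lt_trans.
by rewrite -[leLHS]sqrtr_sqr ler_wsqrtr// lerDl sqr_ge0.
Qed.

Lemma norm_im a (x : R) : `|a| < of_real F x -> `|im a| < x.
Proof.
rewrite norm_scal of_real_lt; apply: le_lt_trans.
by rewrite -[leLHS]sqrtr_sqr ler_wsqrtr// lerDr sqr_ge0.
Qed.

Lemma norm_scal_le a (x : R) : `|re a| <= x / 2 -> `|im a| <= x / 2 -> `|a| <= of_real F x.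
Proof.
move=> h1 h2; have x0 : 0 <= x / 2 by apply: le_trans h1.
have x0' : 0 <= x by lra.
rewrite norm_scal of_real_le -[leRHS](ger0_norm x0') -sqrtr_sqr ler_wsqrtr//.
rewrite -(real_normK (num_real (re a))) -(real_normK (num_real (im a))).
have := lerXn2r 2 (normr_ge0 (re a)) x0 h1; have := lerXn2r 2 (normr_ge0 (im a)) x0 h2.
have -> : x ^+ 2 = 4 * (x / 2) ^+ 2 by field.
have := sqr_ge0 (x / 2); lra.
Qed.

Lemma re_continuous : continuous (@re R F).
Proof.
move=> a; have FF : Filter (nbhs a) := nbhs_filter a; apply/cvgrPdist_lt => e e0.
have e0' : 0 < of_real F e by rewrite -of_real0 of_real_lt.
have := @cvg_id _ (nbhs a) => /cvgrPdist_lt /(_ _ e0').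
by apply: filterS => b /norm_re; rewrite reD reN.
Qed.

Lemma im_continuous : continuous (@im R F).
Proof.
move=> a; have FF : Filter (nbhs a) := nbhs_filter a; apply/cvgrPdist_lt => e e0.
have e0' : 0 < of_real F e by rewrite -of_real0 of_real_lt.
have := @cvg_id _ (nbhs a) => /cvgrPdist_lt /(_ _ e0').
by apply: filterS => b /norm_im; rewrite imD imN.
Qed.

Lemma cvg_scal (T : topologicalType) (G : set_system T) {FG : Filter G} (f : T -> scal R F) a :
  re (f x) @[x --> G] --> re a -> im (f x) @[x --> G] --> im a -> f x @[x --> G] --> a.
Proof.
move=> fr fi; apply/cvgrPdist_le => e /gt0_of_real[x x0 ->].
have x20 : 0 < x / 2 by rewrite divr_gt0.
have /cvgrPdist_le/(_ _ x20) hr := fr; have /cvgrPdist_le/(_ _ x20) hi := fi.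
near=> t; apply: norm_scal_le; rewrite ?reD ?reN ?imD ?imN; near: t; [exact: hr|exact: hi].
Unshelve. all: by end_near. Qed.

Lemma cvg_mx (T : topologicalType) (G : set_system T) {FG : Filter G} n p
  (f : T -> 'M[scal R F]_(n, p)) (A : 'M[scal R F]_(n, p)) :
  (forall i j, f x i j @[x --> G] --> A i j) -> f x @[x --> G] --> A.
Proof.
move=> H U [P PA PU]; rewrite /nbhs/=/fmap/=; apply: (@filterS _ G FG (fun x => forall i j, P i j (f x i j))).
  by move=> x Px; apply: PU.
apply: filter_forall => i; apply: filter_forall => j; exact: (H i j _ (PA i j)).
Qed.

End scalars.

Section components.
Context {R : realType} {F : field_kind} {m : nat}.
Local Notation I := ('I_m * bool)%type.
Implicit Types (v w : 'cV[scal R F]_m) (u : R -> 'cV[scal R F]_m) (s t : I) (x : R).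

(** The Boolean selects the imaginary part. Over the real field these coordinates are 0, and both
    fields share one index type. *)
Definition coor v s : R := if s.2 then im (v s.1 0) else re (v s.1 0).
Definition comp u s x := coor (u x) s.

Lemma sqnorm_comp u x : sqnorm (u x) = sqI (comp u) x.
Proof.
rewrite /sqI -(pair_bigA _ (fun i b => comp u (i, b) x ^+ 2))/=.
by apply: eq_bigr => i _; rewrite big_bool /comp /coor /= addrC.
Qed.

Lemma coorD v w s : coor (v + w) s = coor v s + coor w s.
Proof. by rewrite /coor mxE reD imD; case: s.2. Qed.

Lemma coor0 s : coor 0 s = 0.
Proof. by apply: (addrI (coor 0 s)); rewrite -coorD !addr0. Qed.

Lemma coor_sum (J : Type) (r : seq J) (P : pred J) (f : J -> 'cV[scal R F]_m) s :
  coor (\sum_(j <- r | P j) f j) s = \sum_(j <- r | P j) coor (f j) s.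
Proof.
elim: r => [|j r IH]; first by rewrite !big_nil coor0.
by rewrite !big_cons; case: ifP => _ //; rewrite coorD IH.
Qed.

Lemma coor_real (a : R) v s : coor (of_real F a *: v) s = a * coor v s.
Proof.
by rewrite /coor mxE reM imM re_of_real im_of_real !mul0r subr0 addr0; case: s.2.
Qed.

Lemma coor_inj v w : (forall s, coor v s = coor w s) -> v = w.
Proof.
move=> H; apply/colP => i; have := H (i, false); have := H (i, true); rewrite /coor /=.
by move=> h1 h2; rewrite -[v i 0]mk_re_im h1 h2 mk_re_im.
Qed.

Definition vec (c : I -> R) : 'cV[scal R F]_m := \col_i mk (c (i, false)) (c (i, true)).

Lemma vec_coor v : vec (coor v) = v.
Proof. by apply/colP => i; rewrite mxE /coor mk_re_im. Qed.

Lemma cvg_vec (T : topologicalType) (G : set_system T) {FG : Filter G} (f : T -> I -> R) c :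
  (forall s, f x s @[x --> G] --> c s) -> vec (f x) @[x --> G] --> vec c.
Proof.
move=> H; apply: cvg_mx => i j; rewrite mxE.
under eq_fun do rewrite mxE.
rewrite /mk; have H1 := H (i, false); have H2 := H (i, true).
move: f c H1 H2 {H}; case: F => f c H1 H2 //.
exact: (@cvg_scal R ComplexField).
Qed.

End components.

Arguments re : simpl never.
Arguments im : simpl never.

(** * Continuity of complex matrices and their real form *)

Section complex_matrices.
Context {R : realType}.
Local Notation C := (scal R ComplexField).
Implicit Types (f g : R -> C) (x : R).

Lemma C_eq (a b : C) : re a = re b -> im a = im b -> a = b.
Proof. by move=> h1 h2; rewrite -[a]mk_re_im h1 h2 mk_re_im. Qed.

Lemma re_inv (a : C) : re a^-1 = re a / (re a ^+ 2 + im a ^+ 2).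
Proof. by case: a => x y. Qed.

Lemma im_inv (a : C) : im a^-1 = - (im a / (re a ^+ 2 + im a ^+ 2)).
Proof. by case: a. Qed.

Definition cC f := continuous (fun x => re (f x)) /\ continuous (fun x => im (f x)).

Lemma cC_cst (a : C) : cC (fun=> a).
Proof. by split=> x; exact: cvg_cst. Qed.

Lemma cC_D f g : cC f -> cC g -> cC (fun x => f x + g x).
Proof.
move=> [rf imf] [rg img]; split.
  by under eq_fun do rewrite reD; exact: continuousDf.
by under eq_fun do rewrite imD; exact: continuousDf.
Qed.

Lemma cC_N f : cC f -> cC (fun x => - f x).
Proof.
move=> [rf imf]; split.
  by under eq_fun do rewrite reN; move=> x; apply: cvgN; exact: rf.
by under eq_fun do rewrite imN; move=> x; apply: cvgN; exact: imf.
Qed.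

Lemma cC_M f g : cC f -> cC g -> cC (fun x => f x * g x).
Proof.
move=> [rf imf] [rg img]; split.
  under eq_fun do rewrite reM.
  by move=> x; apply: cvgB; [exact: (continuousMf rf rg)|exact: (continuousMf imf img)].
by under eq_fun do rewrite imM; apply: continuousDf; exact: continuousMf.
Qed.

Lemma cC_V f : (forall x, f x != 0) -> cC f -> cC (fun x => (f x)^-1).
Proof.
move=> f0 [rf imf].
have n0 x : re (f x) ^+ 2 + im (f x) ^+ 2 != 0.
  apply: contra (f0 x); rewrite paddr_eq0 ?sqr_ge0// !sqrf_eq0 => /andP[/eqP r0 /eqP i0].
  by apply/eqP; apply: C_eq.
have cn : continuous (fun x => (re (f x) ^+ 2 + im (f x) ^+ 2)^-1).
  move=> x; apply: cvgV; first exact: n0.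
  have : continuous (fun x => re (f x) ^+ 2 + im (f x) ^+ 2); last exact.
  by under eq_fun do rewrite !expr2; apply: continuousDf; exact: continuousMf.
split.
  by under eq_fun do rewrite re_inv; exact: continuousMf.
under eq_fun do rewrite im_inv.
by move=> x; apply: cvgN; exact: (continuousMf imf cn).
Qed.

Lemma cC_sum (J : Type) (r : seq J) (P : pred J) (f : J -> R -> C) :
  (forall j, cC (f j)) -> cC (fun x => \sum_(j <- r | P j) f j x).
Proof.
move=> cf; elim: r => [|j r IH].
  by under eq_fun do rewrite big_nil; exact: cC_cst.
under eq_fun do rewrite big_cons; case: (P j) => //; exact: cC_D.
Qed.

Lemma cC_prod (J : Type) (r : seq J) (P : pred J) (f : J -> R -> C) :
  (forall j, cC (f j)) -> cC (fun x => \prod_(j <- r | P j) f j x).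
Proof.
move=> cf; elim: r => [|j r IH].
  by under eq_fun do rewrite big_nil; exact: cC_cst.
under eq_fun do rewrite big_cons; case: (P j) => //; exact: cC_M.
Qed.

Definition cCmx n p (A : R -> 'M[C]_(n, p)) := forall i j, cC (fun x => A x i j).

Lemma cC_det n (A : R -> 'M[C]_n) : cCmx A -> cC (fun x => \det (A x)).
Proof.
move=> cA; rewrite /determinant; apply: cC_sum => s.
by apply: cC_M; [exact: cC_cst|apply: cC_prod => i; exact: cA].
Qed.

Lemma cCmx_mul n p q (A : R -> 'M[C]_(n, p)) (B : R -> 'M[C]_(p, q)) :
  cCmx A -> cCmx B -> cCmx (fun x => A x *m B x).
Proof.
move=> cA cB i j; under eq_fun do rewrite mxE.
by apply: cC_sum => l; apply: cC_M; [exact: cA|exact: cB].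
Qed.

(** The entries of the inverse are cofactors divided by a determinant that never vanishes. *)
Lemma cCmx_invmx n (A : R -> 'M[C]_n) : (forall x, A x \in unitmx) -> cCmx A ->
  cCmx (fun x => invmx (A x)).
Proof.
move=> uA cA i j.
have -> : (fun x => invmx (A x) i j) = fun x => (\det (A x))^-1 * \adj (A x) i j.
  by apply/funext => x; rewrite /invmx uA mxE.
apply: cC_M; first by apply: cC_V (cC_det cA) => x; have := uA x; rewrite unitmxE unitfE.
under eq_fun do rewrite mxE /cofactor.
apply: cC_M; first exact: cC_cst.
apply: cC_det => i' j'; under eq_fun do rewrite !mxE.
exact: cA.
Qed.

Context {m : nat}.
Local Notation I := ('I_m * bool)%type.
Implicit Types (A B : 'M[C]_m) (v : 'cV[C]_m) (s t : I).

(** The real matrix of multiplication by [A] in the coordinates [coor]. *)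
Definition rmx A s t : R :=
  if s.2 == t.2 then re (A s.1 t.1) else
  if s.2 then im (A s.1 t.1) else - im (A s.1 t.1).

Lemma re_sum (J : finType) (f : J -> C) : re (\sum_j f j) = \sum_j re (f j).
Proof. by apply: (big_morph (@re R ComplexField)); [exact: reD|]. Qed.

Lemma im_sum (J : finType) (f : J -> C) : im (\sum_j f j) = \sum_j im (f j).
Proof. by apply: (big_morph (@im R ComplexField)); [exact: imD|]. Qed.

Lemma coor_mulmx A v s : coor (A *m v) s = \sum_t rmx A s t * coor v t.
Proof.
rewrite -(pair_bigA _ (fun i b => rmx A s (i, b) * coor v (i, b)))/=.
rewrite /coor mxE; case: s => i [] /=.
  rewrite im_sum; apply: eq_bigr => j _; rewrite big_bool /rmx /= imM; ring.
by rewrite re_sum; apply: eq_bigr => j _; rewrite big_bool /rmx /= reM; ring.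
Qed.

Lemma rmxM A B s t : rmx (A *m B) s t = \sum_r rmx A s r * rmx B r t.
Proof.
rewrite -(pair_bigA _ (fun i b => rmx A s (i, b) * rmx B (i, b) t))/=.
rewrite /rmx mxE; case: s => i []; case: t => j [] /=; rewrite ?re_sum ?im_sum -?sumrN;
  apply: eq_bigr => l _; rewrite big_bool /rmx /= ?reM ?imM; ring.
Qed.

Lemma rmxD A B s t : rmx (A + B) s t = rmx A s t + rmx B s t.
Proof. by rewrite /rmx mxE reD imD; do 2?case: ifP => _; rewrite // opprD. Qed.

Lemma rmxN A s t : rmx (- A) s t = - rmx A s t.
Proof. by rewrite /rmx mxE reN imN; do 2?case: ifP => _. Qed.

Lemma rmx_continuous (A : R -> 'M[C]_m) s t : cCmx A -> continuous (fun x => rmx (A x) s t).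
Proof.
move=> cA; have [rA iA] := cA s.1 t.1; rewrite /rmx; case: (s.2 == t.2) => //.
case: s.2 => // x; apply: cvgN; exact: iA.
Qed.

Lemma rmx_scalar_le (l : C) s t : `|rmx l%:M s t| <= `|re l| + `|im l|.
Proof.
rewrite /rmx mxE; case: (s.1 == t.1); rewrite ?mulr1n ?mulr0n; last first.
  by do 2?case: ifP => _; rewrite /= ?oppr0 normr0 addr_ge0.
by do 2?case: ifP => _; rewrite ?normrN ?lerDl ?lerDr.
Qed.

End complex_matrices.

Section complexification.
Context {R : realType} {F : field_kind} {m : nat}.
Local Notation tc := (@to_complex R F).
Implicit Types (a b : scal R F).

Lemma re_tc a : re (tc a) = re a. Proof. by []. Qed.
Lemma im_tc a : im (tc a) = im a. Proof. by []. Qed.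

Lemma tcD a b : tc (a + b) = tc a + tc b.
Proof. by apply: C_eq; rewrite ?(reD, imD) !(re_tc, im_tc) ?reD ?imD. Qed.

Lemma tcM a b : tc (a * b) = tc a * tc b.
Proof. by apply: C_eq; rewrite ?[RHS](reM, imM) !(re_tc, im_tc) ?reM ?imM. Qed.

Lemma tc0 : tc 0 = 0.
Proof. by apply: (addrI (tc 0)); rewrite -tcD !addr0. Qed.

Lemma tc1 : tc 1 = 1.
Proof. by case: F. Qed.

Lemma map_tcM (A B : 'M[scal R F]_m) : map_mx tc (A *m B) = map_mx tc A *m map_mx tc B.
Proof.
apply/matrixP => i j; rewrite !mxE (big_morph _ tcD tc0).
by apply: eq_bigr => l _; rewrite !mxE tcM.
Qed.

Lemma map_tc_unit (A : 'M[scal R F]_m) : A \in unitmx -> map_mx tc A \in unitmx.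
Proof.
move=> uA; suff /mulmx1_unit[] : map_mx tc A *m map_mx tc (invmx A) = 1%:M by [].
rewrite -map_tcM mulmxV//; apply/matrixP => i j; rewrite !mxE.
by case: (i == j); rewrite ?mulr1n ?mulr0n ?tc1 ?tc0.
Qed.

Lemma map_tc_continuous (A : R -> 'M[scal R F]_m) : continuous A ->
  cCmx (fun x => map_mx tc (A x)).
Proof.
move=> cA i j.
have cc x : (fun y => A y i j) @ x --> A x i j.
  exact: (continuous_comp (cA x) (@coord_continuous _ _ _ i j (A x))).
split; under eq_fun do rewrite mxE ?re_tc ?im_tc; move=> x.
  by apply: (cvg_comp _ _ (cc x)); exact: re_continuous.
by apply: (cvg_comp _ _ (cc x)); exact: im_continuous.
Qed.

End complexification.

(** * Sobolev functions *)

Section square_integrals.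
Context {R : realType} {F : field_kind} {m : nat}.
Local Notation mu := (@lebesgue_measure R).
Local Notation I := ('I_m * bool)%type.
Implicit Types (u w : R -> 'cV[scal R F]_m) (s : I) (D : set R) (a b x : R).

(** The squared norm, for which additivity and monotone convergence can be used directly. *)
Definition n2 D u : \bar R := (\int[mu]_(x in D) (sqnorm (u x))%:E)%E.

Lemma L2normE D u : L2norm D u = sqrte (n2 D u).
Proof. by []. Qed.

Lemma sqnorm_ge0 (v : 'cV[scal R F]_m) : 0 <= sqnorm v.
Proof. by apply: sumr_ge0 => i _; rewrite addr_ge0// sqr_ge0. Qed.

Lemma n2_ge0 D u : (0 <= n2 D u)%E.
Proof. by apply: integral_ge0 => x _; rewrite lee_fin sqnorm_ge0. Qed.

Lemma sqrte_lty (x : \bar R) : (0 <= x)%E -> (sqrte x < +oo)%E = (x < +oo)%E.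
Proof.
move=> x0; have := sqrte_fin_num x0; rewrite !fin_numElt.
by rewrite (lt_le_trans _ x0) ?ltNy0// (lt_le_trans _ (sqrte_ge0 x)) ?ltNy0.
Qed.

Lemma L2norm_lty D u : (L2norm D u < +oo)%E = (n2 D u < +oo)%E.
Proof. by rewrite L2normE sqrte_lty// n2_ge0. Qed.

Lemma vmeasurable_comp u : vmeasurable u <-> forall s, measurable_fun setT (comp u s).
Proof.
split=> [mu' [i b]|mu' i]; first by have [h1 h2] := mu' i; rewrite /comp /coor /=; case: b.
by split; [have := mu' (i, false)|have := mu' (i, true)].
Qed.

Lemma vlocint_comp u : vlocally_integrable u <-> forall s, locint (comp u s).
Proof.
split=> [li [i b]|li i].
  by have [h1 h2] := li i; apply/locintP; rewrite /comp /coor /=; case: b.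
by split; apply/locintP; [have := li (i, false)|have := li (i, true)].
Qed.

Lemma is_wder_comp j u w : is_wder j u w <->
  [/\ forall s, locint (comp u s), forall s, locint (comp w s) &
      forall s, wd j (comp u s) (comp w s)].
Proof.
split=> [[/vlocint_comp h1 /vlocint_comp h2 H]|[h1 h2 H]]; split=> //; try exact/vlocint_comp.
  move=> [i b] psi tp; have [r1 r2] := H psi tp i.
  by rewrite /comp /coor /=; case: b.
by move=> psi tp i; split; [exact: (H (i, false) psi tp)|exact: (H (i, true) psi tp)].
Qed.

Lemma measurable_sqnorm u : vmeasurable u -> measurable_fun setT (fun x => sqnorm (u x)).
Proof.
move=> /vmeasurable_comp mu'.
have -> : (fun x => sqnorm (u x)) = sqI (comp u) by apply/funext => x; rewrite sqnorm_comp.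
apply: measurable_sum => s; exact: measurable_funX.
Qed.

Lemma measurable_sqnormE D u : measurable D -> vmeasurable u ->
  measurable_fun D (fun x => (sqnorm (u x))%:E).
Proof.
move=> mD mu'; apply/measurable_EFinP; apply: measurable_funTS.
exact: measurable_sqnorm.
Qed.

Lemma sq_loc_vmeasurable u : sq_loc (comp u) -> vmeasurable u.
Proof. by move=> us; apply/vmeasurable_comp => s; case: (us s). Qed.

Lemma n2_itv u a b : sq_loc (comp u) -> n2 `[a, b] u = (iint (sqI (comp u)) a b)%:E.
Proof.
move=> us; have [_ ui] := sqI_locint us.
rewrite /n2 /iint /Rintegral fineK; last exact: integrable_fin_num.
by apply: eq_integral => x _; rewrite sqnorm_comp.
Qed.

Lemma n2_oitv u a b : sq_loc (comp u) -> n2 `]a, b[ u = (iint (sqI (comp u)) a b)%:E.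
Proof.
move=> us; rewrite -n2_itv//; have mu' := sq_loc_vmeasurable us.
rewrite /n2 integral_itv_bndo_bndc; last exact: measurable_sqnormE.
by rewrite integral_itv_obnd_cbnd//; exact: measurable_sqnormE.
Qed.

Lemma L2loc_sq_loc u : L2loc u <-> sq_loc (comp u).
Proof.
split=> [[mu' fu] s|us].
  have ms : measurable_fun setT (comp u s) by have /vmeasurable_comp := mu'.
  split=> //; split=> [|a b]; first exact: measurable_funX.
  apply/integrableP; split.
    by apply/measurable_EFinP; apply: measurable_funTS; exact: measurable_funX.
  have := fu a b; rewrite L2norm_lty; apply: le_lt_trans.
  apply: ge0_le_integral => //.
  - apply: measurableT_comp => //; apply/measurable_EFinP; apply: measurable_funTS.
    exact: measurable_funX.
  - exact: measurable_sqnormE.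
  move=> x _; rewrite /= lee_fin ger0_norm ?sqr_ge0// sqnorm_comp /sqI (bigD1 s)//= lerDl.
  by apply: sumr_ge0 => t _; exact: sqr_ge0.
split=> [|a b]; first exact: sq_loc_vmeasurable.
by rewrite L2norm_lty n2_itv// ltry.
Qed.

Lemma n2_subset D D' u : measurable D -> measurable D' -> vmeasurable u -> D `<=` D' ->
  (n2 D u <= n2 D' u)%E.
Proof.
move=> mD mD' mu' DD; apply: ge0_subset_integral => //; first exact: measurable_sqnormE.
by move=> x _; rewrite lee_fin sqnorm_ge0.
Qed.

Lemma bigcup_itv : \bigcup_n `](- n%:R), (n%:R : R)[%classic = setT.
Proof.
apply/seteqP; split=> // x _.
exists (Num.truncn `|x|).+1 => //=; rewrite in_itv/= -ltr_norml.
by have /andP[_] := truncn_itv (normr_ge0 x).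
Qed.

Lemma n2_cvg u : vmeasurable u ->
  (n2 `](- n%:R)%R, n%:R[ u @[n --> \oo] --> n2 setT u)%E.
Proof.
move=> mu'; rewrite -bigcup_itv; apply: ge0_nondecreasing_set_cvg_integral.
- move=> i j ij; apply/subsetPset => x /=; rewrite !in_itv/= => /andP[h1 h2].
  have : i%:R <= j%:R :> R by rewrite ler_nat.
  by move=> h; apply/andP; split; lra.
- by move=> i; exact: measurable_itv.
- by move=> i; exact: measurable_sqnormE.
- by move=> i x _; rewrite lee_fin sqnorm_ge0.
Qed.

Lemma n2_setT_le u (H : R) : sq_loc (comp u) -> (forall a b, iint (sqI (comp u)) a b <= H) ->
  (n2 setT u <= H%:E)%E.
Proof.
move=> us uH; have mu' := sq_loc_vmeasurable us.
apply: (cvge_le _ (n2_cvg mu')).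
by apply: nearW => n; rewrite n2_oitv// lee_fin.
Qed.

Lemma iint_le_n2 u (H : R) a b : sq_loc (comp u) -> (n2 setT u <= H%:E)%E ->
  iint (sqI (comp u)) a b <= H.
Proof.
move=> us uH; rewrite -lee_fin -n2_itv//; apply: le_trans uH.
by apply: n2_subset => //; exact: sq_loc_vmeasurable.
Qed.

Lemma L2_L2loc u : L2 u -> L2loc u.
Proof.
move=> [mu' fu]; split=> // a b; apply: le_lt_trans fu; rewrite !L2normE lee_sqrt ?n2_ge0//.
exact: n2_subset.
Qed.

Lemma L2P u : L2 u <-> sq_loc (comp u) /\ exists H, forall a b, iint (sqI (comp u)) a b <= H.
Proof.
split=> [u2|[us [H uH]]].
  have us : sq_loc (comp u) by apply/L2loc_sq_loc; exact: L2_L2loc.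
  split=> //; exists (fine (n2 setT u)) => a b; apply: iint_le_n2 => //.
  case: u2 => _; rewrite L2norm_lty => fu.
  by rewrite fineK// fin_numElt fu (lt_le_trans _ (n2_ge0 setT u))// ltNy0.
split; first exact: sq_loc_vmeasurable.
by rewrite L2norm_lty (le_lt_trans (n2_setT_le us uH))// ltry.
Qed.

Lemma n2_tail u (e : R) : L2 u -> 0 < e -> exists s0 : R, forall r : R, s0 <= r ->
  (n2 (~` `](- r)%R, r[) u <= e%:E)%E.
Proof.
move=> [mu']; rewrite L2norm_lty => fu e0.
have fn : n2 setT u \is a fin_num by rewrite fin_numElt fu (lt_le_trans _ (n2_ge0 setT u))// ltNy0.
have := n2_cvg mu'; rewrite -(fineK fn) => /fine_cvgP[ffin].
move=> /cvgrPdist_lt/(_ _ e0) => near0.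
have [n _ Hn] := @filterI _ _ _ _ _ ffin near0.
have [fin1 lt1] := Hn n (leqnn n).
exists n%:R => r nr.
apply: (@le_trans _ _ (n2 (~` `](- n%:R)%R, n%:R[) u)).
  apply: n2_subset => //; [exact: measurableC|exact: measurableC|].
  apply: subsetC => x /=; rewrite !in_itv/= => /andP[h1 h2]; apply/andP; split; lra.
have U : n2 setT u = (n2 `](- n%:R)%R, n%:R[ u + n2 (~` `](- n%:R)%R, n%:R[) u)%E.
  rewrite /n2 -[in LHS](@setUv _ `](- n%:R)%R, n%:R[%classic) ge0_integral_setU//.
  - exact: measurableC.
  - by rewrite setUv; exact: measurable_sqnormE.
  - by move=> x _; rewrite lee_fin sqnorm_ge0.
  - exact/disj_setPCl.
have fin2 : n2 (~` `](- n%:R)%R, n%:R[) u \is a fin_num.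
  rewrite fin_numElt (lt_le_trans _ (n2_ge0 _ u)) ?ltNy0//= (le_lt_trans _ fu)//.
  by apply: n2_subset => //; exact: measurableC.
move: lt1; rewrite U /= fineD// addrC addKr => /ltW.
by rewrite ger0_norm ?fine_ge0 ?n2_ge0// -lee_fin fineK.
Qed.

Lemma L2norm_le D u w (c : R) : 0 <= c -> (n2 D u <= (c ^+ 2)%:E * n2 D w)%E ->
  (L2norm D u <= c%:E * L2norm D w)%E.
Proof.
move=> c0 uw; have -> : c%:E = sqrte (c ^+ 2)%:E by rewrite /= sqrtr_sqr ger0_norm.
rewrite !L2normE -sqrteM ?lee_fin ?sqr_ge0// lee_sqrt//.
by rewrite mule_ge0 ?n2_ge0// lee_fin sqr_ge0.
Qed.

(** A resolvent bound allows any real constant; taking the maximum with 0 makes squaring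
    monotone. *)
Lemma n2_le D u w (c : R) : (L2norm D u <= c%:E * L2norm D w)%E ->
  (n2 D u <= (Num.max c 0 ^+ 2)%:E * n2 D w)%E.
Proof.
move=> uw; have c0 : 0 <= Num.max c 0 by rewrite le_max lexx orbT.
have {}uw : (L2norm D u <= (Num.max c 0)%:E * L2norm D w)%E.
  apply: (le_trans uw); apply: lee_wpmul2r; first exact: sqrte_ge0.
  by rewrite lee_fin le_max lexx.
have e : (Num.max c 0)%:E = sqrte (Num.max c 0 ^+ 2)%:E by rewrite /= sqrtr_sqr ger0_norm.
move: uw; rewrite e !L2normE -sqrteM ?lee_fin ?sqr_ge0// lee_sqrt//.
by rewrite mule_ge0 ?n2_ge0// lee_fin sqr_ge0.
Qed.

End square_integrals.

(** * Sobolev functions and their absolutely continuous representatives *)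

Section sobolev_ladders.
Context {R : realType}.
Local Notation mu := (@lebesgue_measure R).
Variable rho : R -> R.
Hypothesis rhoP : bump rho.

Section any_field.
Context {F : field_kind} {m : nat}.
Local Notation I := ('I_m * bool)%type.
Implicit Types (u w : R -> 'cV[scal R F]_m).

Lemma is_wder_unique j u w w' : is_wder j u w -> is_wder j u w' ->
  {ae mu, forall x, w x = w' x}.
Proof.
move=> /is_wder_comp[u1 w1 d1] /is_wder_comp[_ w2 d2].
have := ae_forall_fin (fun s : I => wd_unique rhoP (w1 s) (w2 s) (d1 s) (d2 s)).
by apply: ae_imp => x H; apply: coor_inj.
Qed.

Lemma is_wder_wder j u w : is_wder j u w -> is_wder j u (wder j u).
Proof. by move=> H; apply: (@xgetPex _ (cst 0) [set w | is_wder j u w]); exists w. Qed.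

Lemma wder_ae j u w : is_wder j u w -> {ae mu, forall x, wder j u x = w x}.
Proof. by move=> H; exact: is_wder_unique (is_wder_wder H) H. Qed.

Lemma is_wder0 u : vlocally_integrable u -> is_wder 0 u u.
Proof.
move=> /vlocint_comp ui; apply/is_wder_comp; split=> // s psi tp.
by rewrite derive1n0 expr0 mul1r.
Qed.

Lemma Hkloc_ladder k u : Hkloc k u -> exists y : nat -> I -> R -> R,
  [/\ forall a, ladder k (fun j => y j a),
      forall j, (j <= k)%N -> {ae mu, forall x, forall a, comp (wder j u) a x = y j a x},
      {ae mu, forall x, forall a, comp u a x = y 0%N a x} &
      forall j, (j <= k)%N -> sq_loc (y j)].
Proof.
move=> Hu.
have W j : (j <= k)%N -> is_wder j u (wder j u) by move=> /Hu[].
have W' j (jk : (j <= k)%N) := (is_wder_comp j u (wder j u)).1 (W j jk).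
have ex (a : I) : exists y, ladder k y /\ forall j, (j <= k)%N -> {ae mu, forall x, comp (wder j u) a x = y j x}.
  have [|j jk|j jk|y ly yE] := @wd_ladder R rho rhoP k (comp u a) (fun j => comp (wder j u) a).
  - by have [h _ _] := W' 0%N (leq0n _).
  - by have [_ h _] := W' j jk.
  - by have [_ _ h] := W' j jk.
  by exists y.
have [y Hy] := choice ex; exists (fun j a => y a j); split=> [a|j jk||j jk a].
- by case: (Hy a).
- by apply: ae_forall_fin => a; case: (Hy a) => _; apply.
- have ui : vlocally_integrable u by case: (W 0%N (leq0n _)).
  have := wder_ae (is_wder0 ui); apply: ae_imp2.
    2: by apply: ae_forall_fin => a; case: (Hy a) => _ /(_ 0%N (leq0n _)); exact.
  by move=> x H /= e a; rewrite -H /comp e.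
have [ly yE] := Hy a; have ms := (ladder_locint ly jk).1; split=> //.
have [_ /L2loc_sq_loc/(_ a)[mw wi]] := Hu j jk.
apply: ae_locint wi _; first exact: measurable_funX.
by apply: ae_imp (yE j jk) => x ->.
Qed.

Lemma Hk_Hkloc k u : Hk k u -> Hkloc k u.
Proof. by move=> Hu j jk; have [h1 h2] := Hu j jk; split=> //; exact: L2_L2loc. Qed.

End any_field.

Section complex_field.
Context {m : nat}.
Local Notation I := ('I_m * bool)%type.
Local Notation C := (scal R ComplexField).
Implicit Types (u : R -> 'cV[C]_m) (y : nat -> I -> R -> R).

Definition vfun (c : I -> R -> R) x : 'cV[C]_m := vec (c^~ x).

Lemma comp_vfun (c : I -> R -> R) : comp (vfun c) = c.
Proof.
by apply/funext => -[i b]; apply/funext => x; rewrite /comp /coor /vfun mxE; case: b.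
Qed.

Lemma ladder_wder k y j : (forall a, ladder k (fun j => y j a)) -> (j <= k)%N ->
  is_wder j (vfun (y 0%N)) (vfun (y j)).
Proof.
move=> ly jk; apply/is_wder_comp; rewrite !comp_vfun; split=> s.
- exact: (ladder_locint (ly s)).
- exact: (ladder_locint (ly s) jk).
- exact: (ladder_wd (ly s) jk).
Qed.

Lemma ladder_wder_ae k y j : (forall a, ladder k (fun j => y j a)) -> (j <= k)%N ->
  {ae mu, forall x, wder j (vfun (y 0%N)) x = vfun (y j) x}.
Proof. by move=> ly jk; exact: wder_ae (ladder_wder ly jk). Qed.

Lemma ladder_Hkloc k y : (forall a, ladder k (fun j => y j a)) ->
  (forall j, (j <= k)%N -> sq_loc (y j)) -> Hkloc k (vfun (y 0%N)).
Proof.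
move=> ly ys j jk; have W := is_wder_wder (ladder_wder ly jk); split=> //.
apply/L2loc_sq_loc => s; have /is_wder_comp[_ wi _] := W.
have [ms si] := ys j jk s; split; first by case: (wi s).
apply: ae_locint si _; first by apply: measurable_funX; case: (wi s).
by apply: ae_imp (ladder_wder_ae ly jk) => x e; rewrite /comp e -/(comp _ s x) comp_vfun.
Qed.

Lemma ladder_Hk k y (H : R) : (forall a, ladder k (fun j => y j a)) ->
  (forall j, (j <= k)%N -> sq_loc (y j)) ->
  (forall j a b, (j <= k)%N -> iint (sqI (y j)) a b <= H) -> Hk k (vfun (y 0%N)).
Proof.
move=> ly ys yH j jk; have [W /L2loc_sq_loc us] := ladder_Hkloc ly ys jk; split=> //.
apply/L2P; split=> //; exists H => a b; apply: le_trans (yH j a b jk).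
rewrite le_eqVlt; apply/orP; left; apply/eqP; apply: ae_iint.
- by case: (sqI_locint us).
- by case: (sqI_locint (ys j jk)).
apply: ae_imp (ladder_wder_ae ly jk) => x e; apply: eq_bigr => s _.
by rewrite /comp e -/(comp _ s x) comp_vfun.
Qed.

End complex_field.
End sobolev_ladders.

Section ae_integral.
Import HBNNSimple.
Context {R : realType}.
Local Notation mu := (@lebesgue_measure R).

(* No measurability of [f] and [g] is needed: nonnegative integrals are suprema over
   simple functions. *)
Lemma ae_ge0_le_integral (D : set R) (f g : R -> \bar R) :
  (forall x, (0 <= f x)%E) -> (forall x, (0 <= g x)%E) ->
  {ae mu, forall x, (f x <= g x)%E} ->
  (\int[mu]_(x in D) f x <= \int[mu]_(x in D) g x)%E.
Proof.
move=> f0 g0 [A [mA A0 fgA]].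
rewrite !ge0_integralE//; apply: ge_ereal_sup => _ [h hf <-].
have mTA : measurable (setT `\` A) by exact: measurableD.
have -> : sintegral mu h = sintegral mu (proj_nnsfun h mTA).
  have e := integral_nnsfun mu measurableT h; rewrite patch_setT in e.
  rewrite -e (ge0_negligible_integral mA measurableT _ _ A0)//.
  - by have e2 := integral_nnsfun mu mTA h; rewrite mrestrict in e2.
  - by apply/measurable_EFinP.
  - by move=> x _; rewrite lee_fin.
apply: ereal_sup_ubound; exists (proj_nnsfun h mTA) => // x.
rewrite -(mrestrict h mTA).
rewrite patchE; case: ifPn => [|_].
  rewrite inE => -[_ nAx]; apply: (le_trans (hf x)).
  have fgx : (f x <= g x)%E by apply: contrapT => H; apply: nAx; exact: fgA.
  by rewrite !patchE; case: ifP.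
by rewrite patchE; case: ifP.
Qed.

Context {F : field_kind} {m : nat}.
Implicit Types (u w : R -> 'cV[scal R F]_m).

(** Stated for arbitrary functions, so the image of a function under the operator can be replaced by
    a convenient representative before its measurability is known. *)
Lemma ae_n2 D u w : {ae mu, forall x, u x = w x} -> n2 D u = n2 D w.
Proof.
move=> uw; apply/eqP; rewrite eq_le; apply/andP; split; apply: ae_ge0_le_integral;
  try (by move=> x; rewrite lee_fin sqnorm_ge0).
  by apply: ae_imp uw => x ->.
by apply: ae_imp uw => x ->.
Qed.

End ae_integral.

Section bounded_matrix.
Context {R : realType} {I : finType}.
Implicit Types (f : I -> R -> R) (M : I -> I -> R -> R).

Definition mact M f (s : I) x := \sum_t M s t x * f t x.

Lemma mact_sqI M f (K : R) x : (forall s t, `|M s t x| <= K) ->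
  sqI (mact M f) x <= (#|I|%:R * K) ^+ 2 * sqI f x.
Proof. by move=> MK; exact: (sqs_apply (M := fun s t => M s t x) (fun t => f t x) MK). Qed.

Lemma mact_sq_loc M f (K : R) : (forall s t, continuous (M s t)) ->
  (forall s t x, `|M s t x| <= K) -> sq_loc f -> sq_loc (mact M f).
Proof.
move=> cM MK fs s.
have ms : measurable_fun setT (mact M f s).
  apply: measurable_sum => t; apply: measurable_funM; last by case: (fs t).
  exact: continuous_measurable_fun.
split=> //; apply: (locint_le (g := fun x => (#|I|%:R * K) ^+ 2 * sqI f x)).
- exact: measurable_funX.
- move=> x; rewrite ger0_norm ?sqr_ge0//.
  apply: le_trans (mact_sqI f (fun s t => MK s t x)).
  by rewrite /sqI [leRHS](bigD1 s)//= lerDl; apply: sumr_ge0 => t _; exact: sqr_ge0.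
- by apply: locintZ; exact: sqI_locint.
Qed.

End bounded_matrix.

(** * The linearized operator *)

Section linear_operator.
Context {R : realType} {F : field_kind} {m k : nat}.
Local Notation mu := (@lebesgue_measure R).
Local Notation I := ('I_m * bool)%type.
Local Notation C := (scal R ComplexField).
Variables (alpha : nat -> R -> 'M[scal R F]_m) (T : R).
Hypothesis T0 : 0 < T.
Hypothesis alpha_ok : coefficients_ok k.+1 T alpha.
Implicit Types (y : nat -> I -> R -> R) (x : R) (s t : I) (l : C) (Dm : R -> 'M[C]_m).

Definition ca j x : 'M[C]_m := map_mx (@to_complex R F) (alpha j x).
Definition lead_inv x : 'M[C]_m := invmx (ca k.+1 x).

Lemma ca_continuous j : (1 <= j <= k.+1)%N -> cCmx (ca j).
Proof. by move=> jk; apply: map_tc_continuous; case: alpha_ok => /(_ j jk)[]. Qed.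

Lemma lead_unit x : ca k.+1 x \in unitmx.
Proof. by apply: map_tc_unit; case: alpha_ok => _; exact. Qed.

Lemma lead_inv_continuous : cCmx lead_inv.
Proof.
apply: cCmx_invmx; first exact: lead_unit.
by apply: ca_continuous; rewrite leqnn.
Qed.

Lemma ca_periodic j x : (1 <= j <= k.+1)%N -> ca j (x + T) = ca j x.
Proof. by move=> jk; rewrite /ca; case: alpha_ok => /(_ j jk)[_ ->]. Qed.

Lemma lead_inv_periodic x : lead_inv (x + T) = lead_inv x.
Proof. by rewrite /lead_inv ca_periodic// leqnn. Qed.

(** Coefficients after division by the leading one. The potential and the spectral parameter both
    enter in order 0 only. *)
Definition cmx Dm l j x : 'M[C]_m :=
  - (lead_inv x *m (if j is 0%N then Dm x - l%:M else ca j x)).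

Definition coef Dm l j s t x := rmx (cmx Dm l j x) s t.

Lemma coef_continuous Dm l j s t : cCmx Dm -> (j <= k)%N -> continuous (coef Dm l j s t).
Proof.
move=> cD jk; apply: rmx_continuous => a b.
under eq_fun do rewrite mxE; apply: cC_N; apply: cCmx_mul; first exact: lead_inv_continuous.
case: j jk => [_|j jk]; last by apply: ca_continuous; exact: leqW.
move=> a' b'; under eq_fun do rewrite !mxE.
by apply: cC_D; [exact: cD|exact: cC_cst].
Qed.

Lemma operator_identity (Y : nat -> 'cV[C]_m) Dm l x :
  Y k.+1 = \sum_(j < k.+1) cmx Dm l j x *m Y j +
    lead_inv x *m (\sum_(1 <= j < k.+2) ca j x *m Y j + Dm x *m Y 0%N - l *: Y 0%N).
Proof.
have zmod (V : zmodType) (a b c X : V) : X = - (a + b) - c + (c + X + a + b).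
  by rewrite -opprD [c + X + a]addrAC [_ + X + b]addrAC [c + a]addrC [a + c + b]addrAC addKr.
rewrite big_nat_recr//= big_ord_recl /= /cmx.
rewrite big_add1 /= big_mkord !mulmxDr mulKmx ?lead_unit// mulmx_sumr.
have -> : \sum_(i < k) (- (lead_inv x *m ca (fintype.bump 0 i) x)) *m Y (fintype.bump 0 i) =
  - \sum_(i < k) lead_inv x *m (ca i.+1 x *m Y i.+1).
  by rewrite -sumrN; apply: eq_bigr => i _; rewrite mulNmx mulmxA.
have -> : - (lead_inv x *m Dm x + lead_inv x *m - l%:M) *m Y 0%N =
  - (lead_inv x *m (Dm x *m Y 0%N) + lead_inv x *m - (l *: Y 0%N)).
  by rewrite mulNmx mulmxDl -!mulmxA mulNmx mul_scalar_mx.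
exact: zmod.
Qed.

Lemma coef_csum (Y : nat -> 'cV[C]_m) y Dm l x s :
  (forall j t, (j <= k)%N -> coor (Y j) t = y j t x) ->
  coor (\sum_(j < k.+1) cmx Dm l j x *m Y j) s = csum (k := k) (coef Dm l) y s x.
Proof.
move=> Yy; rewrite coor_sum; apply: eq_bigr => j _; rewrite coor_mulmx.
by apply: eq_bigr => t _; rewrite Yy// -ltnS.
Qed.

Variable N : 'cV[scal R F]_m -> R -> 'cV[scal R F]_m.

Definition Lshift (u : R -> 'cV[scal R F]_m) l (phi : R -> 'cV[C]_m) x : 'cV[C]_m :=
  Lapp k.+1 alpha N u phi x - l *: phi x.

(** [u] is determined only up to null sets; [Dm] will be the potential along a continuous
    representative. *)
Definition potential_ae (u : R -> 'cV[scal R F]_m) Dm :=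
  {ae mu, forall x, map_mx (@to_complex R F) (dN N (u x) x) = Dm x}.

Definition linv_act f := mact (fun s t x => rmx (lead_inv x) s t) f.

Lemma linv_actE (h : R -> 'cV[C]_m) s x :
  linv_act (comp h) s x = coor (lead_inv x *m h x) s.
Proof. by rewrite coor_mulmx. Qed.

Variable rho : R -> R.
Hypothesis rhoP : bump rho.

Lemma Lshift_solves u l Dm (phi : R -> 'cV[C]_m) : potential_ae u Dm -> Hkloc k.+1 phi ->
  exists y, [/\ vladder (k := k) y, solves (k := k) (coef Dm l) y (linv_act (comp (Lshift u l phi))),
    forall j, (j <= k.+1)%N -> {ae mu, forall x, forall a, comp (wder j phi) a x = y j a x},
    {ae mu, forall x, forall a, comp phi a x = y 0%N a x} &
    forall j, (j <= k.+1)%N -> sq_loc (y j)].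
Proof.
move=> uD /(Hkloc_ladder rhoP)[y [ly yw y0 ys]]; exists y; split=> // s.
have W : {ae mu, forall x, forall j : 'I_k.+2, forall a, comp (wder j phi) a x = y j a x}.
  by apply: ae_forall_fin => j; apply: yw; rewrite -ltnS.
have P0 : {ae mu, forall x, wder 0 phi x = phi x}.
  apply: ae_imp2 y0 (yw 0%N (leq0n _)) => x e1 e2; apply: coor_inj => a.
  by have := e1 a; have := e2 a; rewrite /comp => -> ->.
apply: ae_imp2 (ae_imp2 _ W P0) uD; last by move=> x w p; exact: (conj w p).
move=> x [w p] ud.
have wj j a : (j <= k.+1)%N -> coor (wder j phi x) a = y j a x.
  by move=> jk; exact: (w (Ordinal (jk : (j < k.+2)%N)) a).
rewrite -wj// (operator_identity (fun j => wder j phi x) Dm l x) coorD; congr (_ + _).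
  apply: (coef_csum (Y := fun j => wder j phi x) (y := y)) => j t jk.
  by apply: wj; exact: leqW.
by rewrite linv_actE p /Lshift /Lapp /Aop ud.
Qed.

(** The converse reduction: multiplication by the invertible leading coefficient recovers the
    operator from the normalised equation. *)
Lemma solves_Lshift u l Dm y (f : R -> 'cV[C]_m) : potential_ae u Dm -> vladder (k := k) y ->
  (forall s x, y k.+1 s x = csum (k := k) (coef Dm l) y s x + linv_act (comp f) s x) ->
  {ae mu, forall x, Lshift u l (vfun (y 0%N)) x = f x}.
Proof.
move=> uD ly yE; set phi := vfun (y 0%N).
have W : {ae mu, forall x, forall j : 'I_k.+2, wder j phi x = vfun (y j) x}.
  by apply: ae_forall_fin => j; apply: (ladder_wder_ae rhoP ly); rewrite -ltnS.
apply: ae_imp2 W uD => x w ud.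
have wj j : (j <= k.+1)%N -> wder j phi x = vfun (y j) x.
  by move=> jk; exact: (w (Ordinal (jk : (j < k.+2)%N))).
have cj j a : coor (vfun (y j) x) a = y j a x by rewrite -/(comp _ a x) comp_vfun.
have := operator_identity (fun j => vfun (y j) x) Dm l x.
have -> : \sum_(1 <= j < k.+2) ca j x *m vfun (y j) x + Dm x *m vfun (y 0%N) x -
    l *: vfun (y 0%N) x = Lshift u l phi x.
  rewrite /Lshift /Lapp /Aop ud; congr (_ + _ - _).
  by apply: eq_big_nat => j /andP[_ jk]; rewrite wj.
move=> E; have {}E : lead_inv x *m Lshift u l phi x = lead_inv x *m f x.
  apply: coor_inj => s; have := congr1 (coor^~ s) E; rewrite coorD cj yE.
  rewrite linv_actE (coef_csum (Y := fun j => vfun (y j) x) (y := y)); last by move=> j t _; exact: cj.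
  by move=> /addrI ->.
by rewrite -[LHS](mulKVmx (lead_unit x)) -/(lead_inv x) E mulKVmx// lead_unit.
Qed.

End linear_operator.

Section periodic_bounds.
Context {R : realType}.

Lemma periodic_bounded (T : R) (f : R -> R) : 0 < T -> continuous f ->
  (forall x, f (x + T) = f x) -> exists M, 0 <= M /\ forall x, `|f x| <= M.
Proof.
move=> T0 cf fT; have [M M0 HM] := continuous_bounded_itv 0 T cf.
exists M; split=> [|x]; first exact: ltW.
have := periodic_int fT (- Num.floor (x / T)) x => <-.
apply: HM; have /andP[h1 h2] := floor_itv (x / T).
move: h1 h2; rewrite ler_pdivlMr// ltr_pdivrMr// intrD mulrDl mul1r => h1 h2.
by rewrite intrN mulNr; apply/andP; split; lra.
Qed.

Lemma periodic_bounded_fin (T : R) (I : finType) (f : I -> R -> R) : 0 < T ->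
  (forall i, continuous (f i)) -> (forall i x, f i (x + T) = f i x) ->
  exists2 M, 0 <= M & forall i x, `|f i x| <= M.
Proof.
move=> T0 cf fT; have [M HM] := choice (fun i => periodic_bounded T0 (cf i) (fT i)).
exists (\sum_i M i) => [|i x]; first by apply: sumr_ge0 => i _; case: (HM i).
have [_ h] := HM i; apply: (le_trans (h x)).
by rewrite (bigD1 i)//= lerDl; apply: sumr_ge0 => j _; case: (HM j).
Qed.

Lemma sqI_sub_le (I : finType) (f g : I -> R -> R) x :
  sqI (fun a x => f a x - g a x) x <= 2 * sqI f x + 2 * sqI g x.
Proof.
rewrite /sqI !mulr_sumr -big_split; apply: ler_sum => a _ /=.
have := sqr_ge0 (f a x + g a x); nra.
Qed.

Lemma iint_support (q : R -> R) (A a b : R) : continuous q -> (forall x, 0 <= q x) ->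
  (forall x, A <= `|x| -> q x = 0) -> iint q a b <= iint q (- A) A.
Proof.
move=> cq q0 qA; have qi := locint_continuous cq.
case: (leP a b) => [ab|ba]; last first.
  rewrite {1}/iint set_itv_ge ?Rintegral_set0; first exact: iint_ge0.
  by rewrite -leNgt.
case: (leP 0 A) => [A0|A0]; last first.
  rewrite (eq_iint (g := cst 0)) ?iint_cst ?mul0r//; first exact: iint_ge0.
  by move=> x _; apply: qA; apply: le_trans (ltW A0) _.
set B := `|a| + `|b| + A.
have a0 : 0 <= `|a| by []; have b0 : 0 <= `|b| by [].
have := ler_norm b; have := ler_norm (- a); rewrite normrN => h1 h2.
apply: (@le_trans _ _ (iint q (- B) B)).
  by apply: iint_subset => //; rewrite /B; lra.
have AB : A <= B by rewrite /B; lra.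
have BA : - B <= - A by lra.
have AA : - A <= A by lra.
have -> := iint_cat qi BA (le_trans AA AB); have -> := iint_cat qi AA AB.
have z c d : c <= d -> (forall x, c <= x <= d -> A <= `|x|) -> iint q c d = 0.
  move=> cd H; rewrite (eq_iint (g := cst 0)) ?iint_cst ?mul0r// => x /H; exact: qA.
have -> : iint q (- B) (- A) = 0.
  apply: z => // x /andP[_ xA]; rewrite -normrN; apply: le_trans (ler_norm _); lra.
have -> : iint q A B = 0.
  by apply: z => // x /andP[Ax _]; apply: le_trans Ax _; exact: ler_norm.
by rewrite add0r addr0.
Qed.

End periodic_bounds.

(** * A priori bounds for the limit operator, uniform on compact sets *)

Section coercivity.
Context {R : realType} {F : field_kind} {m k : nat}.
Local Notation mu := (@lebesgue_measure R).
Local Notation I := ('I_m * bool)%type.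
Local Notation C := (scal R ComplexField).
Local Notation nI := (#|{: I}|%:R : R).
Variables (alpha : nat -> R -> 'M[scal R F]_m) (T : R).
Hypothesis T0 : 0 < T.
Hypothesis alpha_ok : coefficients_ok k.+1 T alpha.
Variable N : 'cV[scal R F]_m -> R -> 'cV[scal R F]_m.
Variable rho : R -> R.
Hypothesis rhoP : bump rho.
Implicit Types (y : nat -> I -> R -> R) (x : R) (s t : I) (l : C) (Dm : R -> 'M[C]_m).

Local Notation coef := (@coef R F m k alpha).
Local Notation coercive := (@coercive R I k).
Local Notation csum := (@csum R I k).

Lemma lead_inv_bounded : exists2 K, 0 <= K &
  forall s t x, `|rmx (lead_inv (k := k) alpha x) s t| <= K.
Proof.
have [||K K0 HK] := @periodic_bounded_fin R T (I * I)%type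
  (fun st x => rmx (lead_inv (k := k) alpha x) st.1 st.2) T0.
- by move=> st; apply: rmx_continuous; exact: lead_inv_continuous alpha_ok.
- by move=> st x; rewrite (lead_inv_periodic alpha_ok).
by exists K => // s t x; exact: (HK (s, t)).
Qed.

Lemma lead_bounded : exists2 K, 0 <= K &
  forall s t x, `|rmx (ca alpha k.+1 x) s t| <= K.
Proof.
have k1 : (1 <= k.+1 <= k.+1)%N by rewrite leqnn.
have [||K K0 HK] := @periodic_bounded_fin R T (I * I)%type
  (fun st x => rmx (ca alpha k.+1 x) st.1 st.2) T0.
- by move=> st; apply: rmx_continuous; exact: (ca_continuous alpha_ok k1).
- by move=> st x; rewrite (ca_periodic alpha_ok _ k1).
by exists K => // s t x; exact: (HK (s, t)).
Qed.

Lemma classical_vladder y : classical (k := k) y -> vladder (k := k) y.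
Proof.
move=> yc a; have cy j : (j <= k.+1)%N -> continuous (y j a).
  by move=> jk; exact: (classical_continuous yc).
split=> [j jk|j jk|]; [|by apply: cy; exact: ltnW|by apply: locint_continuous; exact: cy].
by apply: derive_prim => [|x]; [exact: cy|apply: yc.1; rewrite -ltnS].
Qed.

Lemma classical_sq_loc y j : classical (k := k) y -> (j <= k.+1)%N -> sq_loc (y j).
Proof.
move=> yc jk a; have cy := classical_continuous (a := a) yc jk.
split; first exact: continuous_measurable_fun.
by apply: locint_continuous; under eq_fun do rewrite expr2; exact: continuousMf.
Qed.

(** A classical function of compact support lies in [H^k], so the resolvent bound applies to it. The
    image under the shifted operator is the leading coefficient times the normalised residual [g],
    which explains the factor [(nI * K) ^+ 2]. *)
Lemma resolvent_coercive u l Dm : potential_ae N u Dm -> cCmx Dm ->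
  resolvent_set (Lop k.+1 alpha N u) l -> exists2 M, 0 <= M & coercive (coef Dm l) M.
Proof.
move=> uD cD [_ _ [M0 HM0]]; have [K K0 HK] := lead_bounded.
exists (Num.max M0 0 ^+ 2 * (nI * K) ^+ 2) => [|y A yc yA]; first by rewrite mulr_ge0 ?sqr_ge0.
have ly := classical_vladder yc.
have ys j : (j <= k.+1)%N -> sq_loc (y j) by exact: classical_sq_loc.
have cq j : (j <= k.+1)%N -> continuous (sqI (y j)).
  by move=> jk; apply: sqI_continuous => a; exact: (classical_continuous yc).
have qA j x : (j <= k.+1)%N -> A <= `|x| -> sqI (y j) x = 0.
  by move=> jk xA; rewrite /sqI big1// => a _; rewrite yA// expr0n.
pose g s x := y k.+1 s x - csum (coef Dm l) y s x.
have cg s : continuous (g s).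
  have c1 : continuous (y k.+1 s) by exact: (classical_continuous yc).
  have c2 : continuous (csum (coef Dm l) y s).
    apply: csum_continuous => [j a b jk|j b jk]; first exact: (coef_continuous alpha_ok).
    by apply: (classical_continuous yc); exact: leqW.
  by move=> x; apply: cvgB; [exact: c1|exact: c2].
have gA s x : A <= `|x| -> g s x = 0.
  move=> xA; rewrite /g yA// /csum big1 ?subr0// => j _; apply: big1 => b _.
  by rewrite yA ?mulr0//; exact: ltnW.
pose f x := ca alpha k.+1 x *m vfun g x.
have cf : comp f = mact (fun s t x => rmx (ca alpha k.+1 x) s t) g.
  apply/funext => s; apply/funext => x; rewrite /comp /f coor_mulmx /mact.
  by apply: eq_bigr => t _; rewrite -/(comp (vfun g) t x) comp_vfun.
have gs : sq_loc g.
  move=> s; split; first exact: continuous_measurable_fun.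
  by apply: locint_continuous; under eq_fun do rewrite expr2; exact: continuousMf.
have fs : sq_loc (comp f).
  rewrite cf; apply: mact_sq_loc HK gs => s t; apply: rmx_continuous.
  by apply: (ca_continuous alpha_ok); rewrite leqnn.
have E : {ae mu, forall x, Lshift (k := k) alpha N u l (vfun (y 0%N)) x = f x}.
  apply: (solves_Lshift alpha_ok rhoP uD ly) => s x.
  by rewrite (linv_actE alpha) /f mulKmx ?(lead_unit alpha_ok)// -/(comp (vfun g) s x) comp_vfun addrC subrK.
have HkP : Hk k.+1 (vfun (y 0%N)).
  apply: (ladder_Hk rhoP ly ys (H := \sum_(j < k.+2) iint (sqI (y j)) (- A) A)) => j a b jk.
  apply: (le_trans (iint_support a b (cq j jk) (fun x => sqI_ge0 _ x) (fun x => qA j x jk))).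
  rewrite (bigD1 (Ordinal (jk : (j < k.+2)%N)))//= lerDl.
  by apply: sumr_ge0 => i _; apply: iint_ge0 => x _; exact: sqI_ge0.
have := n2_le (HM0 _ HkP).
have -> : n2 setT (op_shift (Lop k.+1 alpha N u) l (vfun (y 0%N))) = n2 setT f by exact: ae_n2.
have -> : sqI (y 0%N) = sqI (comp (vfun (y 0%N))) by rewrite comp_vfun.
have ps : sq_loc (comp (vfun (y 0%N))) by rewrite comp_vfun; exact: ys.
move=> H; apply: iint_le_n2 => //; apply: (le_trans H).
rewrite -mulrA [leRHS]EFinM; apply: lee_pmul => //; [by rewrite lee_fin sqr_ge0|exact: n2_ge0|].
apply: n2_setT_le => // a b.
have Gi : locint (sqI g) by exact: sqI_locint.
apply: (@le_trans _ _ (iint (fun x => (nI * K) ^+ 2 * sqI g x) a b)).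
  apply: iint_le; [exact: sqI_locint|exact: locintZ|move=> x _].
  by rewrite cf; apply: mact_sqI => s t; exact: HK.
rewrite iintZ//; apply: ler_wpM2l; first exact: sqr_ge0.
apply: iint_support; first exact: sqI_continuous.
  by move=> x; exact: sqI_ge0.
by move=> x xA; rewrite /sqI big1// => s _; rewrite gA// expr0n.
Qed.

Lemma coercive_le cw M M' : M <= M' -> coercive cw M -> coercive cw M'.
Proof.
move=> MM cM y A yc yA; apply: (le_trans (cM y A yc yA)); apply: ler_wpM2r => //.
by apply: iint_ge0 => x _; exact: sqI_ge0.
Qed.

(** Passing from [l] to [l'] changes the residual by a bounded matrix of size [|l - l'|] applied to
    level 0. If this is small compared with [1/M], half of the left-hand side absorbs it. *)
Lemma coercive_perturb Dm : cCmx Dm -> exists2 K, 0 <= K & forall l l' M, 0 <= M ->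
  coercive (coef Dm l) M -> M * (K * (`|re (l - l')| + `|im (l - l')|) ^+ 2) <= 1 ->
  coercive (coef Dm l') (4 * M).
Proof.
move=> cD; have [K K0 HK] := lead_inv_bounded.
have zz (p c c' q q' r w : R) : c = q + w -> c' = q' + w -> q = q' + r -> p - c = p - c' + - r.
  by move=> -> -> ->; ring.
(* With this factor 4 the absorbed term is exactly half of the left-hand side when the smallness
   condition is sharp. *)
exists (4 * (nI * (nI * K)) ^+ 2) => [|l l' M M0 cM Ml y A yc yA]; first by rewrite mulr_ge0// sqr_ge0.
set d := _ + _ in Ml.
have d0 : 0 <= d by rewrite addr_ge0.
pose e s t x := rmx (lead_inv (k := k) alpha x *m (l - l')%:M) s t.
have eb s t x : `|e s t x| <= nI * K * d.
  rewrite /e rmxM; apply: (le_trans (ler_norm_sum _ _ _)).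
  apply: (@le_trans _ _ (\sum_(r : I) K * d)).
    by apply: ler_sum => r _; rewrite normrM ler_pM// rmx_scalar_le.
  by rewrite sumr_const -[_ *+ _]mulr_natl mulrA.
have rE s x : y k.+1 s x - csum (coef Dm l) y s x =
    (y k.+1 s x - csum (coef Dm l') y s x) + - mact e (y 0%N) s x.
  have E1 l0 : csum (coef Dm l0) y s x = \sum_t coef Dm l0 0%N s t x * y 0%N t x +
      \sum_(i < k) \sum_t rmx (- (lead_inv (k := k) alpha x *m ca alpha i.+1 x)) s t * y i.+1 t x.
    by rewrite /csum big_ord_recl.
  suff E2 : \sum_t coef Dm l 0%N s t x * y 0%N t x =
      \sum_t coef Dm l' 0%N s t x * y 0%N t x + mact e (y 0%N) s x; first exact: zz (E1 l) (E1 l') E2.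
  rewrite /mact -big_split; apply: eq_bigr => t _ /=; rewrite -mulrDl; congr (_ * _).
  rewrite /coef /e /cmx -rmxD; congr (rmx _ s t).
  rewrite -!mulmxN -mulmxDr; congr (_ *m _).
  by rewrite !opprB raddfB/= [RHS]addrC addrA subrK.
have cres l0 s : continuous (fun x => y k.+1 s x - csum (coef Dm l0) y s x).
  have c1 : continuous (y k.+1 s) by exact: (classical_continuous yc).
  have c2 : continuous (csum (coef Dm l0) y s).
    apply: csum_continuous => [j a b jk|j b jk]; first exact: (coef_continuous alpha_ok).
    by apply: (classical_continuous yc); exact: leqW.
  by move=> x; apply: cvgB; [exact: c1|exact: c2].
have ri l0 : locint (sqI (fun s x => y k.+1 s x - csum (coef Dm l0) y s x)).
  by apply: locint_continuous; apply: sqI_continuous; exact: cres.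
have y0i : locint (sqI (y 0%N)).
  by apply: locint_continuous; apply: sqI_continuous => a; exact: (classical_continuous yc).
pose res l0 := sqI (fun s x => y k.+1 s x - csum (coef Dm l0) y s x).
pose X := iint (sqI (y 0%N)) (- A) A.
pose Y l0 := iint (res l0) (- A) A.
have XY : X <= M * Y l := cM y A yc yA.
suff : X <= 4 * M * Y l' by [].
have X0 : 0 <= X by apply: iint_ge0 => x _; exact: sqI_ge0.
have Y0 : 0 <= Y l' by apply: iint_ge0 => x _; exact: sqI_ge0.
have YY : Y l <= 2 * Y l' + 2 * ((nI * (nI * K * d)) ^+ 2 * X).
  have li : locint (fun x => (nI * (nI * K * d)) ^+ 2 * sqI (y 0%N) x) by exact: locintZ.
  rewrite /Y /X -(iintZ _ _ _ y0i) -(iintZ _ _ _ li) -(iintZ _ _ _ (ri l')) -iintD; last 2 first.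
  - exact: (locintZ _ (ri l')).
  - exact: locintZ.
  apply: iint_le => [||x _]; first exact: ri.
    by apply: locintD; [exact: (locintZ _ (ri l'))|exact: locintZ].
  apply: (@le_trans _ _ (2 * res l' x + 2 * sqI (mact e (y 0%N)) x)).
    apply: le_trans (sqI_sub_le _ _ _); rewrite le_eqVlt; apply/orP; left; apply/eqP.
    by congr (sqI _ x); apply/funext => s; apply/funext => z; exact: rE.
  by rewrite lerD2l ler_pM2l//; apply: mact_sqI => s t; exact: eb.
have := ler_wpM2l M0 YY; have := ler_wpM2r X0 Ml.
move: XY Y0; move: (Y l) (Y l') X X0 {YY} => y1 y2 x X0 XY Y0.
have -> : M * (2 * y2 + 2 * ((nI * (nI * K * d)) ^+ 2 * x)) =
  2 * (M * y2) + M * (4 * (nI * (nI * K)) ^+ 2 * d ^+ 2) * x / 2 by field.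
rewrite mul1r; lra.
Qed.

(** Finitely many neighbourhoods on which the constant is fixed cover [K]. The same [M] is made to
    bound [l], since the coefficients involve it. *)
Lemma coercive_compact Dm (K : set (R[i] : numFieldType)) : cCmx Dm -> compact K ->
  (forall l, K l -> 0 <= complex.Re l -> exists2 M, 0 <= M & coercive (coef Dm l) M) ->
  exists2 M, 0 <= M & forall l, K l -> 0 <= complex.Re l ->
    coercive (coef Dm l) M /\ `|complex.Re l| + `|complex.Im l| <= M.
Proof.
move=> cD cK HK; have [KP KP0 pert] := coercive_perturb cD.
have := (compact_near_coveringP K).1 cK R (pinfty_nbhs R)
  (fun M l => 0 <= complex.Re l -> coercive (coef Dm l) M /\ `|complex.Re l| + `|complex.Im l| <= M) _.
case=> [l Kl|M [_ HM]]; last first.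
  have h0 : M < `|M| + 1 by have := ler_norm M; lra.
  by exists (`|M| + 1) => [|l Kl]; [rewrite addr_ge0|exact: HM].
have nearl (e : R) : 0 < e -> \forall l' \near l, `|re (l - l' : C)| + `|im (l - l' : C)| < e.
  move=> e0; have e2 : 0 < e / 2 by rewrite divr_gt0.
  have cr := @re_continuous R ComplexField l; have ci := @im_continuous R ComplexField l.
  move/cvgrPdist_lt : cr => /(_ _ e2) cr; move/cvgrPdist_lt : ci => /(_ _ e2) ci.
  apply: filterS2 cr ci => l' h1 h2; rewrite reD imD reN imN; lra.
(* Points of [K] to the left of the imaginary axis have a neighbourhood where the claim is
   vacuous. *)
case: (leP 0 (complex.Re l)) => [l0|l0]; last first.
  have := nearl (- complex.Re l); rewrite oppr_gt0 => /(_ l0) H.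
  exists ([set l' | `|re (l - l' : C)| + `|im (l - l' : C)| < - complex.Re l], setT).
    by split=> //=; exact: filterT.
  move=> [l' M] [/= h _] l'0; exfalso; move: h.
  rewrite reD reN => h; have := ler_norm (- (re (l : C) - re (l' : C))); rewrite normrN.
  have n0 : 0 <= `|im (l - l' : C)| by [].
  have e1 : re (l : C) = complex.Re l by []; have e2 : re (l' : C) = complex.Re l' by [].
  rewrite e1 e2 in h *; lra.
have [M M0 cM] := HK l Kl l0.
(* As [e <= 1], a distance [d < e] has [d ^+ 2 <= e], so that [M * KP * d ^+ 2 <= 1]. *)
pose e := (M * KP + 1)^-1.
have e1 : 0 < M * KP + 1 by rewrite ltr_wpDl// mulr_ge0.
have e0 : 0 < e by rewrite invr_gt0.
have e01 : e <= 1 by rewrite invf_le1// lerDr mulr_ge0.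
exists ([set l' | `|re (l - l' : C)| + `|im (l - l' : C)| < e],
  [set M' | 4 * M + `|complex.Re l| + `|complex.Im l| + 1 < M']).
  by split=> /=; [exact: nearl|exists (4 * M + `|complex.Re l| + `|complex.Im l| + 1); split => //; exact: num_real].
move=> [l' M'] [/= h1 h2] l'0.
have n1 : 0 <= `|complex.Re l| by []; have n2' : 0 <= `|complex.Im l| by [].
split.
  apply: (@coercive_le _ (4 * M)); first by lra.
  apply: (pert l l') => //.
  set d := _ + _ in h1 *; have d0 : 0 <= d by rewrite addr_ge0.
  have d2 : d ^+ 2 <= e.
    apply: (@le_trans _ _ d); last exact: ltW.
    by rewrite expr2 ler_piMl//; apply: le_trans (ltW h1) e01.
  rewrite mulrA; apply: (@le_trans _ _ (M * KP * e)); first by rewrite ler_wpM2l// mulr_ge0.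
  by rewrite /e ler_pdivrMr// mul1r lerDl.
move: h1; rewrite reD imD reN imN => h1.
have aux (a b : R) : `|b| <= `|a - b| + `|a|.
  by have := ler_normB a (a - b); rewrite subKr addrC.
have a1 := aux (complex.Re l) (complex.Re l').
have a2 := aux (complex.Im l) (complex.Im l').
have r1 : re (l : C) = complex.Re l by []; have r2 : re (l' : C) = complex.Re l' by [].
have i1 : im (l : C) = complex.Im l by []; have i2 : im (l' : C) = complex.Im l' by [].
rewrite r1 r2 i1 i2 in h1; lra.
Qed.

End coercivity.

Section windows.
Context {R : realType}.
Variable L : R.
Hypothesis L0 : 0 < L.
Implicit Types (q : R -> R) (a b x : R).

Lemma window_all q (H : R) a b : locint q -> (forall x, 0 <= q x) -> window L q H ->
  iint q a b <= H.
Proof.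
move=> qi q0 wq; case: (leP a b) => [ab|ba]; last first.
  rewrite {1}/iint set_itv_ge ?Rintegral_set0; last by rewrite -leNgt.
  by have := wq 0 0%N; rewrite addr0 iintxx.
set j := Num.floor (a / L); set n := (Num.truncn ((b - j%:~R * L) / L)).+1.
have /andP[h1 h2] := floor_itv (a / L); rewrite -/j in h1 h2.
rewrite ler_pdivlMr// in h1.
have bj : 0 <= (b - j%:~R * L) / L by rewrite divr_ge0 ?(ltW L0)// subr_ge0 (le_trans h1).
have /andP[_ h3] := truncn_itv bj.
rewrite ltr_pdivrMr// in h3.
apply: le_trans (wq j n); apply: iint_subset => //.
by rewrite intrD mulrDl; apply: ltW; rewrite -ltrBlDl.
Qed.

(** The primitive of [q] vanishes identically, hence so does its derivative. *)
Lemma iint_le0_eq0 q x : continuous q -> (forall x, 0 <= q x) ->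
  (forall a b, iint q a b <= 0) -> q x = 0.
Proof.
move=> cq q0 qH; have qi := locint_continuous cq.
have z a b : iint q a b = 0.
  by apply/eqP; rewrite eq_le qH andTb; exact: iint_ge0.
have Jz : J q = cst 0.
  by apply/funext => y; rewrite /J; case: ifP; rewrite z ?oppr0.
have := prim_derive qi (prim_J qi) (cq x); rewrite Jz => h.
by rewrite -(derive_val (is_derive := h)) derive_cst.
Qed.

Lemma window_periodic q : locint q -> (forall x, q (x + L) = q x) -> iint q 0 L <= 0 ->
  (forall x, 0 <= q x) -> window L q 0.
Proof.
move=> qi qL qz q0 j n; rewrite -window_sum//; apply: sumr_le0 => i _.
rewrite [(_ + 1)%:~R]intrD mulrDl mul1r.
by have -> := periodic_iint ((j + i%:Z)%:~R * L) L0 qi qL.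
Qed.

End windows.

Section vladder_difference.
Context {R : realType} {I : finType} {k : nat}.
Implicit Types (y z : nat -> I -> R -> R).

Definition subl y z j (a : I) (x : R) := y j a x - z j a x.

Lemma vladderB y z : vladder (k := k) y -> vladder (k := k) z -> vladder (k := k) (subl y z).
Proof.
move=> ly lz a; have [py cy iy] := ly a; have [pz cz iz] := lz a; split.
- move=> j jk b d bd.
  have e : (fun x => subl y z j.+1 a x) = fun x => y j.+1 a x - z j.+1 a x by [].
  rewrite [subl y z j.+1 a]e iintB.
  + by rewrite -(py j jk)// -(pz j jk)// /subl; lra.
  + exact: (ladder_locint (ly a) jk).
  + exact: (ladder_locint (lz a) jk).
- by move=> j jk x; apply: cvgB; [exact: cy|exact: cz].
- exact: (locintB iy iz).
Qed.

Lemma sq_locB (f g : I -> R -> R) : sq_loc f -> sq_loc g -> sq_loc (fun a x => f a x - g a x).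
Proof.
move=> fs gs a; have [mf f2] := fs a; have [mg g2] := gs a.
have mN : measurable_fun setT (fun x => - g a x) by exact: measurableT_comp.
split; first exact: measurable_funB.
apply: (@locint_sqD R (f a) (fun x => - g a x)) => //.
by under eq_fun do rewrite sqrrN.
Qed.

Lemma csumB c y z a x : csum (k := k) c (subl y z) a x = csum (k := k) c y a x - csum (k := k) c z a x.
Proof.
rewrite /csum -sumrB; apply: eq_bigr => i _; rewrite -sumrB; apply: eq_bigr => b _.
exact: mulrBr.
Qed.

End vladder_difference.

(** * From the absence of Bloch solutions to the resolvent sets *)

Section resolvent.
Context {R : realType} {F : field_kind} {m k : nat}.
Local Notation mu := (@lebesgue_measure R).
Local Notation I := ('I_m * bool)%type.
Local Notation C := (scal R ComplexField).
Local Notation nI := (#|{: I}|%:R : R).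
Variables (alpha : nat -> R -> 'M[scal R F]_m) (T : R).
Hypothesis T0 : 0 < T.
Hypothesis alpha_ok : coefficients_ok k.+1 T alpha.
Variable N : 'cV[scal R F]_m -> R -> 'cV[scal R F]_m.
Variable rho : R -> R.
Hypothesis rhoP : bump rho.
Implicit Types (y : nat -> I -> R -> R) (x : R) (s t : I) (phi psi : R -> 'cV[C]_m).

Variables (u : R -> 'cV[scal R F]_m) (Dm : R -> 'M[C]_m) (l : C) (L : R).
Hypothesis L0 : 0 < L.
Hypothesis uD : potential_ae N u Dm.
Hypothesis cD : cCmx Dm.

Local Notation c := (@coef R F m k alpha Dm l).
Local Notation csum := (@csum R I k c).
Local Notation act := (@linv_act R F m k alpha).
Local Notation shift := (@Lshift R F m k alpha N u l).

Hypothesis cL : forall j s t x, (j <= k)%N -> c j s t (x + L) = c j s t x.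
Hypothesis leadL : forall x, lead_inv (k := k) alpha (x + L) = lead_inv (k := k) alpha x.
Hypothesis NB : no_bloch_ladder (k := k) c L.

Let cc j s t : (j <= k)%N -> continuous (c j s t).
Proof. exact: (coef_continuous alpha_ok). Qed.

Let act_bound : exists2 K, 0 <= K & forall f,
  (sq_loc f -> sq_loc (act f)) /\ forall x, sqI (act f) x <= K * sqI f x.
Proof.
have [K K0 HK] := lead_inv_bounded T0 alpha_ok.
exists ((nI * K) ^+ 2) => [|f]; first exact: sqr_ge0.
split=> [fs|x]; last by apply: mact_sqI => s t; exact: HK.
apply: mact_sq_loc HK fs => s t; apply: rmx_continuous.
exact: lead_inv_continuous alpha_ok.
Qed.

Let act_iint K f a b : (forall x, sqI (act f) x <= K * sqI f x) -> sq_loc f -> sq_loc (act f) ->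
  iint (sqI (act f)) a b <= K * iint (sqI f) a b.
Proof.
move=> aK fs afs; rewrite -iintZ; last exact: sqI_locint.
by apply: iint_le => [||x _]; [exact: sqI_locint|apply: locintZ; exact: sqI_locint|exact: aK].
Qed.

(** The image of [phi] is replaced by [f], the leading coefficient times the exact residual of the
    ladder. Then [f] is measurable and square integrable on bounded intervals, and the equation
    holds at every point. *)
Lemma shift_representation phi : Hkloc k.+1 phi -> exists y f,
  [/\ vladder (k := k) y, forall s x, y k.+1 s x = csum y s x + act (comp f) s x,
    sq_loc (comp f), {ae mu, forall x, shift phi x = f x} &
    [/\ forall j, (j <= k.+1)%N -> {ae mu, forall x, forall a, comp (wder j phi) a x = y j a x},
    {ae mu, forall x, forall a, comp phi a x = y 0%N a x} &
    forall j, (j <= k.+1)%N -> sq_loc (y j)]].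
Proof.
move=> /(Lshift_solves alpha_ok rhoP l uD)[y [ly ys yw y0 ysq]].
pose g s x := y k.+1 s x - csum y s x.
have cs s : continuous (csum y s).
  by apply: csum_continuous => [j a b|j b jk]; [exact: cc|exact: vladder_continuous ly jk].
have gs : sq_loc g.
  apply: sq_locB; first exact: ysq.
  move=> s; split; first exact: continuous_measurable_fun.
  by apply: locint_continuous; under eq_fun do rewrite expr2; exact: continuousMf.
pose f x := ca alpha k.+1 x *m vfun g x.
have actf s x : act (comp f) s x = g s x.
  by rewrite linv_actE /f mulKmx ?(lead_unit alpha_ok)// -/(comp (vfun g) s x) comp_vfun.
have [K K0 HK] := lead_bounded T0 alpha_ok.
exists y, f; split => //.
- by move=> s x; rewrite actf /g addrC subrK.
- have -> : comp f = mact (fun s t x => rmx (ca alpha k.+1 x) s t) g.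
    apply/funext => s; apply/funext => x; rewrite /comp /f coor_mulmx /mact.
    by apply: eq_bigr => t _; rewrite -/(comp (vfun g) t x) comp_vfun.
  apply: mact_sq_loc HK gs => s t; apply: rmx_continuous.
  by apply: (ca_continuous alpha_ok); rewrite leqnn.
apply: ae_imp (ae_forall_fin ys) => x H.
suff e : lead_inv (k := k) alpha x *m shift phi x = vfun g x.
  by rewrite /f -e /lead_inv mulKVmx// (lead_unit alpha_ok).
apply: coor_inj => s; rewrite -/(comp (vfun g) s x) comp_vfun -linv_actE.
by rewrite /g H addrAC subrr add0r.
Qed.

Let total_window phi y : Hk k.+1 phi ->
  (forall j, (j <= k.+1)%N -> {ae mu, forall x, forall a, comp (wder j phi) a x = y j a x}) ->
  (forall j, (j <= k.+1)%N -> sq_loc (y j)) ->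
  exists M, forall a b, iint (total (k := k) y) a b <= M.
Proof.
move=> Hphi yw ys.
have HM (j : 'I_k.+2) : exists M, forall a b, iint (sqI (y j)) a b <= M.
  have jk : (j <= k.+1)%N by rewrite -ltnS.
  have [_ /L2P[ws [M HM]]] := Hphi j jk; exists M => a b; apply: le_trans (HM a b).
  rewrite le_eqVlt; apply/orP; left; apply/eqP; apply: ae_iint.
  - by case: (sqI_locint (ys j jk)).
  - by case: (sqI_locint ws).
  by apply: ae_imp (yw j jk) => x e; apply: eq_bigr => s _; rewrite e.
have [M HM'] := choice HM; exists (\sum_j M j) => a b.
rewrite /total iint_sum; first by apply: ler_sum => j _; exact: HM'.
by move=> j _; apply: sqI_locint; apply: ys; rewrite -ltnS.
Qed.

Let sqI_energy y j x : (j <= k)%N -> sqI (y j) x <= energy (states (k := k) y) x.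
Proof.
move=> jk; rewrite energyE (bigD1 (Ordinal (jk : (j < k.+1)%N)))//= lerDl.
by apply: sumr_ge0 => i _; exact: sqI_ge0.
Qed.

Let energy_continuous y : vladder (k := k) y -> continuous (energy (states (k := k) y)).
Proof.
move=> ly; apply: sqs_continuous => s.
by apply: vladder_continuous ly _; rewrite -ltnS.
Qed.

Let energy_ge0 y x : 0 <= energy (states (k := k) y) x.
Proof. exact: sqs_ge0. Qed.

Let eq_of_energy y1 y2 phi psi : vladder (k := k) (subl y1 y2) ->
  (forall a b, iint (energy (states (k := k) (subl y1 y2))) a b <= 0) ->
  {ae mu, forall x, forall a, comp phi a x = y1 0%N a x} ->
  {ae mu, forall x, forall a, comp psi a x = y2 0%N a x} -> ae_same (m := m) phi psi.
Proof.
move=> ly yz p1 p2; apply: ae_imp2 p1 p2 => x e1 e2; apply: coor_inj => a.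
rewrite -/(comp phi a x) -/(comp psi a x) e1 e2; apply/eqP; rewrite -subr_eq0.
have ez := iint_le0_eq0 x (energy_continuous ly) (energy_ge0 (subl y1 y2)) yz.
have : sqI (subl y1 y2 0%N) x <= 0 by rewrite -ez; exact: sqI_energy.
move=> /sqs_eq0 /(_ a) h; apply/eqP; exact: h.
Qed.

Let diff_solves y1 y2 f1 f2 phi psi :
  (forall s x, y1 k.+1 s x = csum y1 s x + act (comp f1) s x) ->
  (forall s x, y2 k.+1 s x = csum y2 s x + act (comp f2) s x) ->
  {ae mu, forall x, shift phi x = f1 x} -> {ae mu, forall x, shift psi x = f2 x} ->
  ae_same (m := m) (shift phi) (shift psi) ->
  solves (k := k) c (subl y1 y2) (fun _ _ => 0).
Proof.
move=> E1 E2 a1 a2 s12 s; have h := ae_imp2 (fun x (p : shift phi x = f1 x) (q : shift psi x = f2 x) => conj p q) a1 a2.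
apply: ae_imp2 h s12 => x [e1 e2] e; rewrite csumB /subl E1 E2 addr0 !linv_actE.
by rewrite -e1 -e2 e; ring.
Qed.

Let zero_sq_loc : sq_loc (fun (_ : I) (_ : R) => 0 : R).
Proof.
by move=> s; split=> //; under eq_fun do rewrite expr0n; exact: locint0.
Qed.

Let sqI0 x : sqI (fun (_ : I) (_ : R) => 0 : R) x = 0.
Proof. by rewrite /sqI big1// => a _; rewrite expr0n. Qed.

(** Injectivity is the a priori estimate for the difference of two solutions, whose right-hand side
    is 0. Membership in [H^k] supplies the finite window bound that the estimate presupposes. *)
Lemma resolvent_line : resolvent_set (Lop k.+1 alpha N u) l.
Proof.
have [K K0 HK] := act_bound.
have [C1 C10 HC1] := line_solve_ladder L0 cc cL NB.
have [C2 C20 HC2] := line_bound_ladder L0 cc cL NB.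
split.
- move=> phi psi Hphi Hpsi s12.
  have [y1 [f1 [l1 E1 fs1 a1 [w1 z1 q1]]]] := shift_representation (Hk_Hkloc Hphi).
  have [y2 [f2 [l2 E2 fs2 a2 [w2 z2 q2]]]] := shift_representation (Hk_Hkloc Hpsi).
  have ly := vladderB l1 l2.
  have qj j : (j <= k.+1)%N -> sq_loc (subl y1 y2 j).
    by move=> jk; apply: sq_locB; [exact: q1|exact: q2].
  have [M1 HM1] := total_window Hphi w1 q1; have [M2 HM2] := total_window Hpsi w2 q2.
  have ti y : (forall j, (j <= k.+1)%N -> sq_loc (y j)) -> locint (total (k := k) y).
    by move=> yq; apply: locint_sum => j _; apply: sqI_locint; apply: yq; rewrite -ltnS.
  apply: (eq_of_energy ly _ z1 z2) => a b.
  apply: (window_all L0 (H := 0)).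
  + by apply: locint_continuous; exact: energy_continuous.
  + exact: energy_ge0.
  rewrite -[0](mulr0 C2); apply: (HC2 _ _ _ (2 * M1 + 2 * M2) ly (qj _ (leqnn _)) zero_sq_loc
    (diff_solves E1 E2 a1 a2 s12)) => [j n|j n].
    by rewrite (eq_iint (g := cst 0)) => [|x _]; rewrite ?sqI0// iint_cst ?mul0r// ler_pM2r// ler_int lerDl.
  apply: (@le_trans _ _ (iint (fun x => 2 * total (k := k) y1 x + 2 * total (k := k) y2 x)
      (j%:~R * L) ((j + n%:Z)%:~R * L))).
    apply: iint_le => [||x _]; first exact: ti.
      by apply: locintD; apply: locintZ; exact: ti.
    rewrite /total !mulr_sumr -big_split; apply: ler_sum => i _ /=; exact: sqI_sub_le.
  rewrite iintD; [|by apply: locintZ; exact: ti|by apply: locintZ; exact: ti].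
  by rewrite !iintZ; [|exact: ti|exact: ti]; apply: lerD; rewrite ler_pM2l.
- move=> f /L2P[fs [H fH]].
  have [af_sq af_le] := HK (comp f); have afs := af_sq fs.
  have wf : window L (sqI (act (comp f))) (K * H).
    by move=> j n; apply: (le_trans (act_iint _ _ af_le fs afs)); rewrite ler_wpM2l.
  have [y [ly yE yw]] := HC1 _ _ afs wf.
  have sf := solves_Lshift alpha_ok rhoP uD ly yE.
  exists (vfun (y 0%N)); last exact: sf.
  have [Cb Cb0 HCb] : exists2 Cb, 0 <= Cb & forall j s t x, (j <= k)%N -> `|c j s t x| <= Cb.
    have [||Cb Cb0 HCb] := @periodic_bounded_fin R L ('I_k.+1 * (I * I))%type
      (fun i x => c i.1 i.2.1 i.2.2 x) L0.
    + by move=> i; apply: cc; rewrite -ltnS.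
    + by move=> i x; apply: cL; rewrite -ltnS.
    by exists Cb => // j s t x jk; exact: (HCb (Ordinal (jk : (j < k.+1)%N), (s, t))).
  have cs s : continuous (csum y s).
    by apply: csum_continuous => [j a b|j b jk]; [exact: cc|exact: vladder_continuous ly jk].
  have css : sq_loc (csum y).
    move=> s; split; first exact: continuous_measurable_fun.
    by apply: locint_continuous; under eq_fun do rewrite expr2; exact: continuousMf.
  have y1 : sq_loc (y k.+1).
    move=> s; have [mc c2] := css s; have [ma a2] := afs s.
    have -> : y k.+1 s = fun x => csum y s x + act (comp f) s x by apply/funext => x.
    by split; [exact: measurable_funD|exact: locint_sqD].
  have yq j : (j <= k.+1)%N -> sq_loc (y j) by exact: vladder_sq_loc.
  have ei : locint (energy (states (k := k) y)) by apply: locint_continuous; exact: energy_continuous.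
  have eH a b := window_all (H := C1 * (K * H)) L0 a b ei (energy_ge0 y) yw.
  pose Q := Cb ^+ 2 * (nI * #|{: 'I_k.+1 * I}|%:R).
  have Q0 : 0 <= Q by rewrite mulr_ge0 ?sqr_ge0.
  have H0 : 0 <= H by have := fH 0 0; rewrite iintxx.
  apply: (ladder_Hk rhoP ly yq (H := C1 * (K * H) + (2 * (Q * (C1 * (K * H))) + 2 * (K * H)))) => j a b.
  (* The energy covers the levels up to [k]; the highest one is bounded through the equation. *)
  rewrite leq_eqVlt ltnS => /orP[/eqP->|jk]; last first.
    apply: (@le_trans _ _ (C1 * (K * H))).
      apply: le_trans (eH a b); apply: iint_le => [||x _]; [|exact: ei|exact: sqI_energy].
      by apply: sqI_locint; apply: yq; exact: leqW.
    by rewrite lerDl addr_ge0 ?mulr_ge0.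
  apply: (@le_trans _ _ (2 * (Q * (C1 * (K * H))) + 2 * (K * H))); last first.
    by rewrite lerDr ?mulr_ge0.
  apply: (@le_trans _ _ (iint (fun x => 2 * (Q * energy (states (k := k) y) x) + 2 * sqI (act (comp f)) x) a b)).
    apply: iint_le => [||x _]; first by apply: sqI_locint; exact: yq.
      by apply: locintD; apply: locintZ; [exact: locintZ|exact: sqI_locint].
    have -> : sqI (y k.+1) x = sqI (fun s x => csum y s x - (- act (comp f) s x)) x.
      by apply: eq_bigr => s _; rewrite yE opprK.
    apply: (le_trans (sqI_sub_le _ _ _)); apply: lerD; last first.
      by rewrite /sqI; under eq_bigr do rewrite sqrrN.
    rewrite ler_pM2l// energyE; apply: sqI_le_cst => // s.
    by apply: csum_abs => i t ik; exact: HCb.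
  have li1 : locint (fun x => Q * energy (states (k := k) y) x) by exact: locintZ.
  have li2 : locint (sqI (act (comp f))) by exact: sqI_locint.
  rewrite iintD; [|exact: locintZ|exact: locintZ].
  rewrite (iintZ _ _ _ li1) (iintZ _ _ _ ei) (iintZ _ _ _ li2); apply: lerD; rewrite ler_pM2l//.
    by apply: ler_wpM2l => //; exact: eH.
  by apply: (le_trans (act_iint _ _ af_le fs afs)); rewrite ler_wpM2l.
- exists (1 + C2 * K) => phi Hphi.
  have CK : 0 <= C2 * K by rewrite mulr_ge0.
  have [y [f [ly E fs a1 [w1 z1 q1]]]] := shift_representation (Hk_Hkloc Hphi).
  apply: L2norm_le; first by rewrite addr_ge0.
  have -> : n2 setT (op_shift (Lop k.+1 alpha N u) l phi) = n2 setT f by exact: ae_n2.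
  have -> : n2 setT phi = n2 setT (vfun (y 0%N)).
    apply: ae_n2; apply: ae_imp z1 => x e; apply: coor_inj => a.
    by rewrite -/(comp phi a x) e -/(comp (vfun (y 0%N)) a x) comp_vfun.
  have c0 : 0 < (1 + C2 * K) ^+ 2 by rewrite exprn_gt0// ltr_pwDl.
  (* If the right-hand side is infinite, the estimate is trivial because its constant is
     positive. *)
  case: (ltP (n2 setT f) +oo%E) => [ff|]; last first.
    by rewrite leye_eq => /eqP ->; rewrite gt0_muley ?lte_fin// leey.
  have fn : n2 setT f \is a fin_num.
    by rewrite fin_numElt ff (lt_le_trans _ (n2_ge0 setT f))// ltNy0.
  set H := fine (n2 setT f); have fH : n2 setT f = H%:E by rewrite /H fineK.
  have H0 : 0 <= H by rewrite fine_ge0// n2_ge0.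
  have [af_sq af_le] := HK (comp f); have afs := af_sq fs.
  have fHi a b : iint (sqI (comp f)) a b <= H by apply: iint_le_n2 => //; rewrite fH.
  have wf : window L (sqI (act (comp f))) (K * H).
    by move=> j n; apply: (le_trans (act_iint _ _ af_le fs afs)); rewrite ler_wpM2l.
  have [M HM] := total_window Hphi w1 q1.
  have ys : solves (k := k) c y (act (comp f)) by move=> s; apply: ae_all => x; exact: E.
  have we := HC2 _ _ _ M ly (q1 _ (leqnn _)) afs ys wf (fun j n => HM _ _).
  rewrite fH -EFinM.
  apply: n2_setT_le => [|a b]; rewrite comp_vfun; first exact: q1.
  have ei : locint (energy (states (k := k) y)) by apply: locint_continuous; exact: energy_continuous.
  have eH := window_all (H := C2 * (K * H)) L0 a b ei (energy_ge0 y) we.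
  apply: (@le_trans _ _ (C2 * (K * H))).
    apply: le_trans eH; apply: iint_le => [||x _]; [|exact: ei|exact: sqI_energy].
    by apply: sqI_locint; exact: q1.
  rewrite mulrA ler_wpM2r//; nra.
Qed.

(** Periodicity passes to the continuous representative, as two continuous functions equal almost
    everywhere coincide, and then to its derivatives one after the other. *)
Let per_levels phi y : periodic phi L -> vladder (k := k) y ->
  {ae mu, forall x, forall a, comp phi a x = y 0%N a x} ->
  forall j a x, (j <= k)%N -> y j a (x + L) = y j a x.
Proof.
move=> pL ly y0; elim=> [|j IH] a x jk.
  have c0 : continuous (y 0%N a) by exact: vladder_continuous ly _.
  have cs : continuous (fun x => y 0%N a (x + L)).
    move=> z; apply: continuous_comp; last exact: c0.
    by apply: cvgD; [exact: cvg_id|exact: cvg_cst].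
  have e : {ae mu, forall x, y 0%N a (x + L) = y 0%N a x}.
    by apply: ae_imp2 y0 (ae_shift L y0) => z e1 e2; rewrite -e1 -e2 /comp pL.
  by have := ae_eq_continuousT cs c0 e => /(congr1 (@^~ x)).
have d1 := ladder_derive (x + L) (ly a) (jk : (j.+1 < k.+1)%N).
have d2 := ladder_derive x (ly a) (jk : (j.+1 < k.+1)%N).
have := @is_derive_comp_affine R (y j a) 1 L x (y j.+1 a (x + L)).
rewrite !mul1r => /(_ d1).
have -> : (fun z => y j a (1 * z + L)) = y j a.
  by apply/funext => z; rewrite mul1r IH// ltnW.
by move=> d3; rewrite -(derive_val (is_derive := d2)) -(derive_val (is_derive := d3)).
Qed.

(** Periodic solutions exist and are bounded by the data because 1 is not a multiplier; all
    estimates are made over a single period. *)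
Lemma resolvent_per : resolvent_set (Lper k.+1 alpha N L u) l.
Proof.
have [K K0 HK] := act_bound.
have [C2 C20 HC2] := per_bound_ladder L0 cc cL NB.
have ei y (ly : vladder (k := k) y) : locint (energy (states (k := k) y)).
  by apply: locint_continuous; exact: energy_continuous.
split.
- move=> phi psi [pphi Hphi] [ppsi Hpsi] s12.
  have [y1 [f1 [l1 E1 fs1 a1 [w1 z1 q1]]]] := shift_representation Hphi.
  have [y2 [f2 [l2 E2 fs2 a2 [w2 z2 q2]]]] := shift_representation Hpsi.
  have ly := vladderB l1 l2.
  have yL j a x : (j <= k)%N -> subl y1 y2 j a (x + L) = subl y1 y2 j a x.
    by move=> jk; rewrite /subl (per_levels pphi l1 z1)// (per_levels ppsi l2 z2).
  apply: (eq_of_energy ly _ z1 z2) => a b.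
  apply: (window_all L0 (H := 0) _ _ (ei _ ly) (energy_ge0 _)).
  (* A nonnegative periodic energy with zero integral over one period has zero integral over every
     window. *)
  apply: (window_periodic L0 (ei _ ly)) => [x||]; last exact: energy_ge0.
    rewrite !energyE; apply: eq_bigr => j _; apply: eq_bigr => s _.
    by rewrite yL// -ltnS.
  have yL0 j s : (j <= k)%N -> subl y1 y2 j s L = subl y1 y2 j s 0.
    by move=> jk; rewrite -[in LHS](add0r L) yL.
  have := HC2 _ _ ly zero_sq_loc (diff_solves E1 E2 a1 a2 s12) yL0.
  have -> : iint (sqI (fun (_ : I) (_ : R) => 0 : R)) 0 L = 0.
    by rewrite (eq_iint (g := cst 0)) => [|x _]; rewrite ?sqI0// iint_cst ?mul0r// ltW.
  by rewrite mulr0.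
- move=> f [fL /L2loc_sq_loc fs].
  have [af_sq af_le] := HK (comp f); have afs := af_sq fs.
  have aL s x : act (comp f) s (x + L) = act (comp f) s x.
    by rewrite !linv_actE leadL fL.
  have [y [ly yE yL]] := per_solve_ladder L0 cc cL NB afs aL.
  exists (vfun (y 0%N)); last exact: (solves_Lshift alpha_ok rhoP uD ly yE).
  split=> [x|].
    by apply: coor_inj => a; rewrite -/(comp _ a (x + L)) -/(comp _ a x) comp_vfun yL.
  have cs s : continuous (csum y s).
    by apply: csum_continuous => [j a b|j b jk]; [exact: cc|exact: vladder_continuous ly jk].
  have y1 : sq_loc (y k.+1).
    move=> s; have [ma a2] := afs s.
    have -> : y k.+1 s = fun x => csum y s x + act (comp f) s x by apply/funext => x.
    have mc := continuous_measurable_fun (cs s).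
    split; first exact: measurable_funD.
    apply: locint_sqD => //; apply: locint_continuous.
    by under eq_fun do rewrite expr2; exact: continuousMf.
  by apply: (ladder_Hkloc rhoP ly) => j; exact: vladder_sq_loc.
- exists (1 + C2 * K) => phi [pphi Hphi].
  have CK : 0 <= C2 * K by rewrite mulr_ge0.
  have [y [f [ly E fs a1 [w1 z1 q1]]]] := shift_representation Hphi.
  have [af_sq af_le] := HK (comp f); have afs := af_sq fs.
  apply: L2norm_le; first by rewrite addr_ge0.
  have -> : n2 `]0, L[ (op_shift (Lper k.+1 alpha N L u) l phi) = n2 `]0, L[ f by exact: ae_n2.
  have -> : n2 `]0, L[ phi = n2 `]0, L[ (vfun (y 0%N)).
    apply: ae_n2; apply: ae_imp z1 => x e; apply: coor_inj => a.
    by rewrite -/(comp phi a x) e -/(comp (vfun (y 0%N)) a x) comp_vfun.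
  rewrite !n2_oitv ?comp_vfun//; last exact: q1.
  have ys : solves (k := k) c y (act (comp f)) by move=> s; apply: ae_all => x; exact: E.
  rewrite -EFinM lee_fin; apply: (@le_trans _ _ (iint (energy (states (k := k) y)) 0 L)).
    apply: iint_le => [||x _]; [|exact: ei|exact: sqI_energy].
    by apply: sqI_locint; exact: q1.
  have pl j a (jk : (j <= k)%N) : y j a L = y j a 0.
    by rewrite -[in LHS](add0r L) (per_levels pphi ly z1).
  apply: (le_trans (HC2 _ _ ly afs ys pl)).
  apply: (@le_trans _ _ (C2 * (K * iint (sqI (comp f)) 0 L))).
    by apply: ler_wpM2l => //; exact: act_iint.
  rewrite mulrA ler_wpM2r//; first by apply: iint_ge0 => x _; exact: sqI_ge0.
  nra.
Qed.

End resolvent.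

(** * Closeness of the pulses *)

Section compact_boxes.
Context {R : realType} {q : nat}.
Implicit Types (v w : 'rV[R]_q) (x B T : R).
Variable h : 'rV[R]_q * R -> R.
Hypothesis ch : continuous h.

Definition box B T := [set p : 'rV[R]_q * R | (forall i, `|p.1 0 i| <= B) /\ 0 <= p.2 <= T].

Lemma box_compact B T : compact (box B T).
Proof.
have -> : box B T = [set v : 'rV[R]_q | forall i, `[- B, B]%classic (v 0 i)] `*` `[0, T]%classic.
  apply/seteqP; split=> -[v x] /= [h1 h2]; split=> /=.
  - by move=> i; have := h1 i; rewrite in_itv/= -ler_norml.
  - by rewrite in_itv.
  - by move=> i; have := h1 i; rewrite /= in_itv/= -ler_norml.
  - by move: h2; rewrite /= in_itv.
apply: compact_setX; last exact: segment_compact.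
by apply: (@rV_compact _ _ (fun=> `[- B, B]%classic)) => i; exact: segment_compact.
Qed.

Lemma box_bounded B T : exists2 M, 0 <= M & forall v x, (forall i, `|v 0 i| <= B) ->
  0 <= x <= T -> `|h (v, x)| <= M.
Proof.
have cb : compact (h @` box B T) := continuous_compact (continuous_subspaceT ch) (@box_compact B T).
have [M [_ HM]] := compact_bounded cb.
exists (`|M| + 1) => [|v x vB xT]; first by rewrite addr_ge0.
have M1 : M < `|M| + 1 by have := ler_norm M; lra.
by apply: HM M1 _ _; exists (v, x).
Qed.

(** Heine-Cantor in the first variable. Only [v] is confined to the box; [w] is merely required to
    be near it. *)
Lemma box_uniform B T (e : R) : 0 < e -> exists2 d, 0 < d & forall v w x,
  (forall i, `|v 0 i| <= B) -> 0 <= x <= T -> (forall i, `|w 0 i - v 0 i| <= d) ->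
  `|h (w, x) - h (v, x)| <= e.
Proof.
move=> e0.
have cvr : near_covering (box B T) := (compact_near_coveringP _).1 (@box_compact B T).
have := cvr R (at_right (0 : R))
  (fun d p => forall w, (forall i, `|w 0 i - p.1 0 i| <= d) -> `|h (w, p.2) - h p| <= e) _.
case=> [[v x] _|d /= d0 Hd]; last first.
  have d2 : 0 < d / 2 by rewrite divr_gt0.
  exists (d / 2) => // v w x vB xT wv.
  have := Hd (d / 2); rewrite /= sub0r normrN gtr0_norm// => /(_ _ d2 (v, x)); apply => //.
  by lra.
have e2 : 0 < e / 2 by rewrite divr_gt0.
have := @ch (v, x) => /cvgrPdist_lt/(_ _ e2)/nbhs_ballP[r /= r0 Hr].
have r2 : 0 < r / 2 by rewrite divr_gt0.
exists (ball (v, x) (r / 2), [set d | 0 < d < r / 2]).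
  split=> /=; first exact: nbhsx_ballx.
  exists (r / 2) => //= d; rewrite /= sub0r normrN => d1 d0.
  by rewrite d0 /=; apply: le_lt_trans d1; exact: ler_norm.
move=> [p d] [/= [[_ pv] px] /andP[d0 dr]] w wp.
have h1 : `|h (v, x) - h p| < e / 2.
  apply: Hr; case: p pv px {wp} => p1 p2 /= pv px; split=> /=.
    by split=> // i j; apply: (@le_ball _ _ _ (r / 2)); [lra|exact: pv].
  by apply: (@le_ball _ _ _ (r / 2)); [lra|exact: px].
have h2 : `|h (v, x) - h (w, p.2)| < e / 2.
  apply: Hr; split=> /=; last by apply: (@le_ball _ _ _ (r / 2)); [lra|exact: px].
  split=> // i j; rewrite ord1.
  have := pv 0 j; rewrite /ball/= => h3.
  have := wp j; rewrite distrC => h4; have := ler_distD (p.1 0 j) (v 0 j) (w 0 j); lra.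
have := ler_distD (h (v, x)) (h (w, p.2)) (h p); rewrite [`|h (w, _) - h (v, _)|]distrC; lra.
Qed.

End compact_boxes.

(** * The Jacobian along bounded profiles *)

Section jacobian.
Context {R : realType} {F : field_kind} {m : nat}.
Local Notation I := ('I_m * bool)%type.
Local Notation tc := (@to_complex R F).
Implicit Types (a b : 'cV[scal R F]_m) (x : R) (s t : I).
Variables (T : R) (N : 'cV[scal R F]_m -> R -> 'cV[scal R F]_m).
Hypothesis T0 : 0 < T.
Hypothesis N_ok : nonlinearity_ok T N.

Definition jac a x := map_mx tc (dN N a x).

Lemma dN_periodic a x : dN N a (x + T) = dN N a x.
Proof.
have [_ NT] := N_ok; rewrite /dN.
by have -> : N^~ (x + T) = N^~ x by apply/funext => b; exact: NT.
Qed.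

Lemma jac_periodic a (j : int) x : jac a (x + j%:~R * T) = jac a x.
Proof. by rewrite /jac (periodic_int (dN_periodic a)). Qed.

Lemma jac_continuous (w : R -> 'cV[scal R F]_m) : continuous w -> cCmx (fun x => jac (w x) x).
Proof.
move=> cw; apply: map_tc_continuous => x.
have [[_ _ cN _ _] _] := N_ok.
apply: (@continuous_comp _ _ _ (fun x => (w x, x)) (fun p => dN N p.1 p.2)); last exact: cN.
exact: (cvg_pair (cw x) (@cvg_id _ (nbhs x))).
Qed.

Let q := #|{: I}|.
(** Values are parametrised by real row vectors, for which boxes are compact over either field. *)
Let param (v : 'rV[R]_q) : 'cV[scal R F]_m := vec (fun s => v 0 (enum_rank s)).
Let unparam a : 'rV[R]_q := \row_i coor a (enum_val i).

Let param_unparam a : param (unparam a) = a.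
Proof.
rewrite /param -[RHS]vec_coor; congr vec; apply/funext => s.
by rewrite mxE enum_rankK.
Qed.

Let h (s t : I) (p : 'rV[R]_q * R) := rmx (jac (param p.1) p.2) s t.

Let h_continuous s t : continuous (h s t).
Proof.
move=> p; have [[_ _ cN _ _] _] := N_ok.
have c1 : (fun p : 'rV[R]_q * R => param p.1) @ p --> param p.1.
  apply: cvg_vec => r; apply: (@continuous_comp _ _ _ fst (fun v : 'rV[R]_q => v 0 (enum_rank r))).
    exact: cvg_fst.
  exact: coord_continuous.
have cp : (fun p : 'rV[R]_q * R => (param p.1, p.2)) @ p --> (param p.1, p.2).
  exact: (cvg_pair c1 cvg_snd).
have cd : (fun p : 'rV[R]_q * R => dN N (param p.1) p.2) @ p --> dN N (param p.1) p.2.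
  exact: (@continuous_comp _ _ _ (fun p : 'rV[R]_q * R => (param p.1, p.2)) (fun p => dN N p.1 p.2) p cp (cN _)).
have ce i j : (fun p : 'rV[R]_q * R => dN N (param p.1) p.2 i j) @ p --> dN N (param p.1) p.2 i j.
  exact: (@continuous_comp _ _ _ _ (fun M : 'M[scal R F]_m => M i j) p cd (@coord_continuous _ _ _ i j _)).
have cr i j : (fun p : 'rV[R]_q * R => re (dN N (param p.1) p.2 i j)) @ p --> re (dN N (param p.1) p.2 i j).
  exact: (@continuous_comp _ _ _ _ (@re R F) p (ce i j) (@re_continuous R F _)).
have ci i j : (fun p : 'rV[R]_q * R => im (dN N (param p.1) p.2 i j)) @ p --> im (dN N (param p.1) p.2 i j).
  exact: (@continuous_comp _ _ _ _ (@im R F) p (ce i j) (@im_continuous R F _)).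
rewrite /h /jac /rmx.
have r1 (A : 'M[scal R F]_m) i j : re (map_mx tc A i j) = re (A i j) by rewrite mxE.
have i1 (A : 'M[scal R F]_m) i j : im (map_mx tc A i j) = im (A i j) by rewrite mxE.
case: (s.2 == t.2).
  by under eq_fun do rewrite r1; exact: cr.
case: s.2; under eq_fun do rewrite i1; first exact: ci.
by apply: cvgN; exact: ci.
Qed.

Let reduce x : exists2 y, 0 <= y <= T & forall a, jac a x = jac a y.
Proof.
exists (x + (- Num.floor (x / T))%:~R * T); last by move=> a; rewrite jac_periodic.
have /andP[h1 h2] := floor_itv (x / T).
move: h1 h2; rewrite ler_pdivlMr// ltr_pdivrMr// intrD mulrDl mul1r => h1 h2.
by rewrite intrN mulNr; apply/andP; split; lra.
Qed.

Lemma jac_bounded B : exists2 M, 0 <= M & forall a x s t, (forall r, `|coor a r| <= B) ->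
  `|rmx (jac a x) s t| <= M.
Proof.
have H (st : I * I) : exists M, 0 <= M /\ forall a x, (forall r, `|coor a r| <= B) ->
    `|rmx (jac a x) st.1 st.2| <= M.
  have [M M0 HM] := box_bounded (h_continuous (s := st.1) (t := st.2)) B T.
  exists M; split=> // a x aB; have [y yT ->] := reduce x.
  rewrite -[a]param_unparam; apply: (HM (unparam a)) => // i.
  by rewrite mxE; exact: aB.
have [M HM] := choice H; exists (\sum_st M st) => [|a x s t aB].
  by apply: sumr_ge0 => st _; case: (HM st).
have [_ /(_ a x aB) h1] := HM (s, t); apply: (le_trans h1).
by rewrite (bigD1 (s, t))//= lerDl; apply: sumr_ge0 => st _; case: (HM st).
Qed.

Lemma jac_uniform B (e : R) : 0 < e -> exists2 d, 0 < d & forall a b x s t,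
  (forall r, `|coor a r| <= B) -> (forall r, `|coor b r - coor a r| <= d) ->
  `|rmx (jac b x) s t - rmx (jac a x) s t| <= e.
Proof.
move=> e0.
have H (st : I * I) : exists d, 0 < d /\ forall a b x,
    (forall r, `|coor a r| <= B) -> (forall r, `|coor b r - coor a r| <= d) ->
    `|rmx (jac b x) st.1 st.2 - rmx (jac a x) st.1 st.2| <= e.
  have [d d0 Hd] := box_uniform (h_continuous (s := st.1) (t := st.2)) B T e0.
  exists d; split=> // a b x aB ab; have [y yT xy] := reduce x; rewrite !xy.
  rewrite -[a]param_unparam -[b]param_unparam; apply: (Hd (unparam a) (unparam b)) => // i.
    by rewrite mxE; exact: aB.
  by rewrite !mxE; exact: ab.
have [d Hd] := choice H.
(* The least of the finitely many moduli of continuity, with 1 as the value for an empty index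
   set. *)
exists (\big[Num.min/1]_st d st) => [|a b x s t aB ab].
  by elim/big_ind: _ => // [p r p0 r0|st _]; [rewrite lt_min p0|case: (Hd st)].
have [_] := Hd (s, t); apply => // r; apply: (le_trans (ab r)).
by rewrite (bigminD1 (s, t))// ge_min lexx.
Qed.

End jacobian.

(** * Continuous representatives and Sobolev bounds *)

Section continuous_representatives.
Context {R : realType} {F : field_kind} {m k : nat}.
Local Notation mu := (@lebesgue_measure R).
Local Notation I := ('I_m * bool)%type.
Implicit Types (u w : R -> 'cV[scal R F]_m) (c : I -> R -> R) (x : R) (s : I) (D : set R).
Variable rho : R -> R.
Hypothesis rhoP : bump rho.
Variable T : R.
Hypothesis T0 : 0 < T.

Definition crep u c := (forall s, continuous (c s)) /\ {ae mu, forall x, forall s, comp u s x = c s x}.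

Lemma crep_exists u : Hkloc k.+1 u -> exists c, crep u c.
Proof.
move=> /(Hkloc_ladder rhoP)[y [ly _ y0 _]]; exists (y 0%N); split=> // s.
by have [_ cy _] := ly s; exact: cy.
Qed.

Lemma crep_periodic u c (L : R) : crep u c -> periodic u L -> forall s x, c s (x + L) = c s x.
Proof.
move=> [cc uc] uL s x.
have cs : continuous (fun x => c s (x + L)).
  move=> z; apply: continuous_comp; last exact: cc.
  by apply: cvgD; [exact: cvg_id|exact: cvg_cst].
have e : {ae mu, forall x, c s (x + L) = c s x}.
  by apply: ae_imp2 uc (ae_shift L uc) => z e1 e2; rewrite -e1 -e2 /comp uL.
by have := ae_eq_continuousT cs (cc s) e => /(congr1 (@^~ x)).
Qed.

Definition hk2 D u : \bar R := (\sum_(j < k.+2) n2 D (wder j u))%E.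

Lemma hk2_ge0 D u : (0 <= hk2 D u)%E.
Proof. by apply: sume_ge0 => j _; exact: n2_ge0. Qed.

Lemma HknormE D u : Hknorm k.+1 D u = sqrte (hk2 D u).
Proof.
rewrite /Hknorm /hk2; congr sqrte; apply: eq_bigr => j _.
by rewrite L2normE sqr_sqrte// n2_ge0.
Qed.

Lemma Hknorm_le D D' u w (C : R) : 0 < C -> (Hknorm k.+1 D u <= C%:E * Hknorm k.+1 D' w)%E ->
  (hk2 D u <= (C ^+ 2)%:E * hk2 D' w)%E.
Proof.
move=> C0; rewrite !HknormE.
have -> : C%:E = sqrte (C ^+ 2)%:E by rewrite /= sqrtr_sqr gtr0_norm.
rewrite -sqrteM ?lee_fin ?sqr_ge0// lee_sqrt//.
by rewrite mule_ge0 ?hk2_ge0// lee_fin sqr_ge0.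
Qed.

Lemma n2_le_hk2 D u j : (j <= k.+1)%N -> (n2 D (wder j u) <= hk2 D u)%E.
Proof.
move=> jk; rewrite /hk2 (bigD1 (Ordinal (jk : (j < k.+2)%N)))//= leeDl//.
by apply: sume_ge0 => i _; exact: n2_ge0.
Qed.

(** The Sobolev inequality on an interval of the fixed length [T] inside [D], so the constant does
    not depend on [n]. *)
Lemma crep_sup D u c (e a x : R) s : Hkloc k.+1 u -> crep u c -> measurable D ->
  (hk2 D u <= e%:E)%E -> `[a, a + T] `<=` D -> a <= x <= a + T ->
  c s x ^+ 2 <= (2 / T + 2 * T) * (2 * e).
Proof.
move=> Hu [cc uc] mD ue aD ax.
have [y [ly yw y0 ys]] := Hkloc_ladder rhoP Hu.
have cE : c s = y 0%N s.
  apply: ae_eq_continuousT; [exact: cc|by have [_ cy _] := ly s; exact: cy|].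
  by apply: ae_imp2 uc y0 => z e1 e2; rewrite -e1 -e2.
have le j : (j <= k.+1)%N -> iint (fun x => y j s x ^+ 2) a (a + T) <= e.
  move=> jk; have [_ /L2loc_sq_loc ws] := Hu j jk.
  rewrite -lee_fin; apply: le_trans ue; apply: le_trans (n2_le_hk2 D u jk).
  apply: (@le_trans _ _ (n2 `[a, a + T] (wder j u))); last first.
    by apply: n2_subset => //; exact: sq_loc_vmeasurable.
  rewrite n2_itv// lee_fin.
  have -> : iint (sqI (comp (wder j u))) a (a + T) = iint (sqI (y j)) a (a + T).
    apply: ae_iint; [by case: (sqI_locint ws)|by case: (sqI_locint (ys j jk))|].
    by apply: ae_imp (yw j jk) => z e1; apply: eq_bigr => r _; rewrite e1.
  apply: iint_le; [by case: (ys j jk s)|by apply: sqI_locint; exact: ys|move=> z _].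
  by rewrite /sqI (bigD1 s)//= lerDl; apply: sumr_ge0 => r _; exact: sqr_ge0.
have [m1 i1] := ys 1%N isT s; have [py _ _] := ly s.
have aT : a < a + T by rewrite ltrDl.
have := prim_sup_sq m1 i1 (py 0%N isT) aT ax.
have -> : a + T - a = T by rewrite addrC addKr.
rewrite cE => /le_trans; apply.
have t0 : 0 <= 2 / T by rewrite divr_ge0// ltW.
have t1 : 0 <= 2 * T by rewrite mulr_ge0// ltW.
have h0 := ler_wpM2l t0 (le 0%N isT); have h1 := ler_wpM2l t1 (le 1%N isT).
have e0 : 0 <= e.
  by apply: le_trans (le 0%N isT); apply: iint_ge0 => z _; exact: sqr_ge0.
have := mulr_ge0 t0 e0; have := mulr_ge0 t1 e0; rewrite mulrDl; lra.
Qed.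

Lemma hk2_tail u (e : R) : Hk k.+1 u -> 0 < e -> exists r0 : R, forall r : R, r0 <= r ->
  (hk2 (~` `](- r)%R, r[) u <= e%:E)%E.
Proof.
move=> Hu e0; pose d := e / k.+2%:R.
have d0 : 0 < d by rewrite divr_gt0.
have H (j : 'I_k.+2) : exists r0 : R, forall r : R, r0 <= r ->
    (n2 (~` `](- r)%R, r[) (wder j u) <= d%:E)%E.
  by apply: n2_tail d0; case: (Hu j (ltn_ord j)).
have [r0 Hr] := choice H.
exists (\sum_j `|r0 j|) => r rr.
apply: (@le_trans _ _ (\sum_(j < k.+2) d%:E)%E).
  apply: lee_sum => j _; apply: Hr; apply: le_trans rr.
  rewrite (bigD1 j)//=; apply: le_trans (ler_norm _) _.
  by rewrite lerDl; apply: sumr_ge0.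
rewrite sumEFin lee_fin sumr_const card_ord -[_ *+ _]mulr_natr /d.
by rewrite divfK.
Qed.

Lemma hk2_fin u : Hk k.+1 u -> exists2 H : R, 0 <= H & (hk2 setT u <= H%:E)%E.
Proof.
move=> Hu.
have fj (j : 'I_k.+2) : n2 setT (wder j u) \is a fin_num.
  have [_ [_]] := Hu j (ltn_ord j : (j <= k.+1)%N); rewrite L2norm_lty => h.
  by rewrite fin_numElt h (lt_le_trans _ (n2_ge0 _ _))// ltNy0.
exists (\sum_(j < k.+2) fine (n2 setT (wder j u))).
  by apply: sumr_ge0 => j _; rewrite fine_ge0// n2_ge0.
by rewrite -sumEFin /hk2; apply: lee_sum => j _; rewrite fineK.
Qed.

Lemma eq_closure (f g : R -> R) a b x : continuous f -> continuous g -> a < b ->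
  (forall x, a < x < b -> f x = g x) -> a <= x <= b -> f x = g x.
Proof.
move=> cf cg ab fg /andP[ax xb].
pose h y := f y - g y.
have ch : continuous h by move=> y; apply: cvgB; [exact: cf|exact: cg].
suff : h x = 0 by move=> /eqP; rewrite subr_eq0 => /eqP.
apply: contrapT => /eqP hx; have n0 : 0 < `|h x| by rewrite normr_gt0.
have := @ch x => /cvgrPdist_lt/(_ _ n0)/nbhs_ballP[r /= r0 Hr].
have z y : a < y < b -> ~ `|x - y| < r.
  by move=> yab yr; have := Hr y yr; rewrite {2}/h fg// subrr subr0 ltxx.
pose d := Num.min (r / 2) ((b - a) / 2).
have d0 : 0 < d by rewrite lt_min !divr_gt0// subr_gt0.
have dr : d <= r / 2 by rewrite ge_min lexx.
have db : d <= (b - a) / 2 by rewrite ge_min lexx orbT.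
case: (ltP x ((a + b) / 2)) => xm.
  apply: (z (x + d / 2)); first by apply/andP; split; lra.
  by rewrite opprD addNKr normrN gtr0_norm; lra.
apply: (z (x - d / 2)); first by apply/andP; split; lra.
by rewrite subKr gtr0_norm; lra.
Qed.

End continuous_representatives.

(** * Distance between the periodic pulse and the limit profile *)

Section pulse_closeness.
Context {R : realType} {F : field_kind} {m k : nat}.
Local Notation mu := (@lebesgue_measure R).
Local Notation I := ('I_m * bool)%type.
Implicit Types (x : R) (s : I).
Variable rho : R -> R.
Hypothesis rhoP : bump rho.
Variable T : R.
Hypothesis T0 : 0 < T.
Variables (v z : R -> 'cV[scal R F]_m) (wv wz : I -> R -> R).
Hypothesis v_Hkper : Hkper k.+1 T v.
Hypothesis z_Hk : Hk k.+1 z.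
Hypothesis wvP : crep v wv.
Hypothesis wzP : crep z wz.

Let KT := 2 / T + 2 * T.
Let KT0 : 0 < KT.
Proof. by rewrite addr_gt0 ?divr_gt0 ?mulr_gt0. Qed.

Lemma profile_bounded : exists2 B, 0 <= B & forall s x, `|wz s x + wv s x| <= B.
Proof.
have [vB vB0 HvB] := periodic_bounded_fin T0 wvP.1 (crep_periodic wvP v_Hkper.1).
have [H H0 HH] := hk2_fin z_Hk.
exists (KT * (2 * H) + 1 + vB) => [|s x].
  by rewrite addr_ge0// addr_ge0// mulr_ge0 ?mulr_ge0// ltW.
apply: (le_trans (ler_normD _ _)); apply: lerD => //.
have xx : x <= x <= x + T by rewrite lexx lerDl ltW.
have := crep_sup rhoP T0 s (Hk_Hkloc z_Hk) wzP measurableT HH (@subsetT _ _) xx.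
rewrite -/KT -[leLHS]real_normK ?num_real//; have := normr_ge0 (wz s x); nra.
Qed.

(** The interval of length [T] used in the Sobolev inequality is laid from [x] away from the origin,
    so that it stays in the tail. *)
Lemma profile_decay (e : R) : 0 < e -> exists r0 : R, forall r x s, r0 <= r -> 0 <= r ->
  r <= `|x| -> wz s x ^+ 2 <= e.
Proof.
move=> e0; have d0 : 0 < e / (KT * 2) by rewrite divr_gt0// mulr_gt0.
have [r0 Hr] := hk2_tail z_Hk d0; exists r0 => r x s r0r r_ge0 rx.
have {}Hr := Hr r r0r.
have eE : KT * (2 * (e / (KT * 2))) = e by field; rewrite gt_eqF.
rewrite -[leRHS]eE.
have mD : measurable (~` `](- r)%R, r[) by exact: measurableC.
case: (leP 0 x) => x0.
  apply: (crep_sup (a := x) rhoP T0 s (Hk_Hkloc z_Hk) wzP mD Hr); last by rewrite lexx lerDl ltW.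
  move=> y /=; rewrite !in_itv/= => /andP[xy _]; move: rx; rewrite ger0_norm// => rx.
  by apply/negP; rewrite negb_and -!leNgt (le_trans rx xy) orbT.
apply: (crep_sup (a := x - T) rhoP T0 s (Hk_Hkloc z_Hk) wzP mD Hr); last first.
  by rewrite subrK lexx andbT gerBl ltW.
move=> y /=; rewrite subrK !in_itv/= => /andP[_ yx]; move: rx; rewrite ltr0_norm// => rx.
by apply/negP; rewrite negb_and -!leNgt; apply/orP; left; lra.
Qed.

Variables (alpha : nat -> R -> 'M[scal R F]_m) (NL : 'cV[scal R F]_m -> R -> 'cV[scal R F]_m).
Variable C : R.
Hypothesis C0 : 0 < C.

(** On the central period [u - (z + v)] equals [(chi - 1) z + a], where [chi = 1] near 0 and [z] is
    small elsewhere. In the margins the formula is read at the translate by one period. *)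
Lemma pulse_close (d : R) : 0 < d -> exists N1 : nat, forall n chi a u wu,
  (0 < n)%N -> (N1 <= n)%N -> cutoff k.+1 T n chi ->
  pulse_solution k.+1 T alpha NL v z C n chi a u -> crep u wu ->
  forall s x, `|x| <= 5 / 6 * (n%:R * T) -> `|wu s x - (wz s x + wv s x)| <= d.
Proof.
move=> d0; pose d4 := d / 4; have d40 : 0 < d4 by rewrite divr_gt0.
have [r1 Hr1] : exists r1 : R, forall r x s, r1 <= r -> 0 <= r -> r <= `|x| -> `|wz s x| <= d4.
  have [r1 Hr1] := profile_decay (exprn_gt0 2 d40); exists r1 => r x s h1 h2 h3.
  have := Hr1 r x s h1 h2 h3; rewrite -[leLHS]real_normK ?num_real//.
  by rewrite ler_sqr ?nnegrE// ltW.
(* With this tail bound for [z], the estimate of the correction and the Sobolev constant [2 * KT]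
   give [|a| <= d / 4] pointwise. *)
pose e2 := d4 ^+ 2 / (KT * 2) / C ^+ 2.
have e20 : 0 < e2 by rewrite divr_gt0 ?exprn_gt0// divr_gt0 ?exprn_gt0// mulr_gt0.
have [r2 Hr2] := hk2_tail z_Hk e20.
exists (Num.truncn ((`|r1| + `|r2|) * 6 / T)).+1 => n chi a u wu n0 Nn [schi pchi chi01 _ [chi1 _]] [aH aN uE uH _] wuP s x.
set L := n%:R * T.
have L0 : 0 < L by rewrite mulr_gt0// ltr0n.
have L6 : `|r1| + `|r2| <= L / 6.
  have nn : (`|r1| + `|r2|) * 6 / T <= n%:R.
    apply: ltW; have /andP[_ h] := truncn_itv (divr_ge0 (mulr_ge0 (addr_ge0 (normr_ge0 r1) (normr_ge0 r2)) (ler0n R 6)) (ltW T0)).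
    by apply: (lt_le_trans h); rewrite ler_nat.
  by move: nn; rewrite ler_pdivrMr// -/L => nn; lra.
have a1 := ler_norm r1; have a2 := ler_norm r2; have b1 := normr_ge0 r1; have b2 := normr_ge0 r2.
have nL : n%:R / 6 * T = L / 6 by rewrite /L; field.
have nL2 : n%:R / 2 * T = L / 2 by rewrite /L; field.
have L60 : 0 <= L / 6 by lra.
have zs y r : L / 6 <= `|y| -> `|wz r y| <= d4 by apply: Hr1 => //; lra.
have [wa waP] := crep_exists rhoP aH.2.
have ha : (hk2 (k := k) `[0%R, L] a <= (d4 ^+ 2 / (KT * 2))%:E)%E.
  have := Hknorm_le C0 aN; rewrite nL.
  have -> : hk2 (k := k) `]0%R, (n%:R * T)%R[ a = hk2 (k := k) `[0%R, L] a.
    apply: eq_bigr => j _; have /L2loc_sq_loc ws : L2loc (wder j a).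
      by have [_] := aH.2 j (ltn_ord j).
    by rewrite n2_oitv// n2_itv.
  move=> /le_trans; apply.
  have -> : (d4 ^+ 2 / (KT * 2))%:E = ((C ^+ 2)%:E * e2%:E)%E.
    rewrite -EFinM; congr (_%:E); rewrite /e2 [RHS]mulrC divfK//.
    by rewrite sqrf_eq0 gt_eqF.
  apply: lee_pmul => //; [by rewrite lee_fin sqr_ge0|exact: hk2_ge0|by apply: Hr2; lra].
have as' y r : `|wa r y| <= d4.
  have TL : T <= L by rewrite /L ler_peMl ?(ltW T0)// ler1n.
  have := crep_periodic waP aH.1; rewrite -/L => waL.
  have H y0 : 0 <= y0 <= L -> `|wa r y0| <= d4.
    move=> /andP[y00 y0L].
    suff : wa r y0 ^+ 2 <= d4 ^+ 2.
      by rewrite -[leLHS]real_normK ?num_real// ler_sqr ?nnegrE// ltW.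
    have eE : KT * (2 * (d4 ^+ 2 / (KT * 2))) = d4 ^+ 2 by field; rewrite gt_eqF.
    rewrite -[leRHS]eE.
    have mD : measurable (`[0, L]%classic : set R) by [].
    case: (leP (y0 + T) L) => yT.
      apply: (crep_sup (a := y0) rhoP T0 r aH.2 waP mD ha); last by rewrite lexx lerDl ltW.
      by move=> t /=; rewrite !in_itv/= => /andP[t1 t2]; apply/andP; split; lra.
    apply: (crep_sup (a := L - T) rhoP T0 r aH.2 waP mD ha); last by apply/andP; split; lra.
    by move=> t /=; rewrite !in_itv/= => /andP[t1 t2]; apply/andP; split; lra.
  have := periodic_int (waL r) (- Num.floor (y / L)) y => <-.
  apply: H; have /andP[h1 h2] := floor_itv (y / L).
  move: h1 h2; rewrite ler_pdivlMr// ltr_pdivrMr// intrD mulrDl mul1r => h1 h2.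
  by rewrite intrN mulNr; apply/andP; split; lra.
have cchi := smooth_continuous0 schi.
(* The formula for the pulse is given almost everywhere on a half-open period; continuity extends it
   to every point of the closed one. *)
have core y r : `|y| <= L / 2 -> wu r y = chi y * wz r y + wv r y + wa r y.
  rewrite ler_norml => yL.
  apply: (@eq_closure _ _ (fun y => chi y * wz r y + wv r y + wa r y) (- (L / 2)) (L / 2)) => //.
  - exact: wuP.1.
  - apply: continuousDf; last exact: waP.1.
    by apply: continuousDf; [apply: continuousMf => //; exact: wzP.1|exact: wvP.1].
  - lra.
  apply: ae_eq_continuous; first exact: wuP.1.
    apply: continuousDf; last exact: waP.1.
    by apply: continuousDf; [apply: continuousMf => //; exact: wzP.1|exact: wvP.1].
  have P1 := ae_imp2 (fun t p q => conj p q) wuP.2 waP.2.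
  have P2 := ae_imp2 (fun t p q => conj p q) wzP.2 wvP.2.
  have P3 := ae_imp2 (fun t p q => conj p q) P1 P2.
  apply: ae_imp2 P3 uE => t [[e1 e2'] [e3 e4]] e5 tL.
  rewrite -e1 -e2' -e3 -e4 /comp e5; last by rewrite nL2; lra.
  by rewrite !coorD coor_real.
have chib y : `|chi y| <= 1 by have /andP[h1 h2] := chi01 y; rewrite ger0_norm.
have chiz y r : L / 6 <= `|y| -> `|chi y * wz r y| <= d4.
  move=> /zs h; rewrite normrM; apply: le_trans (h r).
  by rewrite ler_piMl.
have wuL r y : wu r (y + L) = wu r y by exact: crep_periodic wuP uH.1 r y.
have wvL r y : wv r (y + L) = wv r y.
  by have := periodic_int (crep_periodic wvP v_Hkper.1 r) n%:Z y; rewrite -pmulrn.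
have three (p q r : R) : `|p| <= d4 -> `|q| <= d4 -> `|r| <= d4 -> `|p + q - r| <= d.
  move=> h1 h2 h3; apply: (le_trans (ler_normB _ _)).
  by have := ler_normD p q; rewrite /d4 in h1 h2 h3; lra.
move=> x56; case: (leP `|x| (L / 2)) => x2.
  rewrite core//; case: (leP `|x| (L / 6)) => x6.
    rewrite chi1 ?nL// mul1r addrC addKr.
    by apply: (le_trans (as' x s)); rewrite /d4; lra.
  have -> : chi x * wz s x + wv s x + wa s x - (wz s x + wv s x) =
    chi x * wz s x + wa s x - wz s x by ring.
  by apply: three; [apply: chiz; exact: ltW|exact: as'|apply: zs; exact: ltW].
have zx : `|wz s x| <= d4 by apply: zs; lra.
(* For [L/2 < |x| <= 5L/6] the translate towards the origin has modulus between [L/6] and [L/2]. *)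
have [x' [x'2 x'6 e1 e2']] : exists x', [/\ `|x'| <= L / 2, L / 6 <= `|x'|,
    wu s x = wu s x' & wv s x = wv s x'].
  case: (leP 0 x) => x0.
    rewrite ger0_norm// in x2 x56.
    exists (x - L); split.
    - by rewrite ler_norml; lra.
    - by rewrite ler0_norm; lra.
    - by have := wuL s (x - L); rewrite subrK.
    - by have := wvL s (x - L); rewrite subrK.
  rewrite ltr0_norm// in x2 x56.
  exists (x + L); split.
  - by rewrite ler_norml; lra.
  - by rewrite ger0_norm; lra.
  - by rewrite wuL.
  - by rewrite wvL.
rewrite e1 e2' core//.
have -> : chi x' * wz s x' + wv s x' + wa s x' - (wz s x + wv s x') =
    chi x' * wz s x' + wa s x' - wz s x by ring.
by apply: three; [exact: chiz|exact: as'|].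
Qed.

End pulse_closeness.

(** * Bounds for the normalised coefficients *)

Section coefficient_bounds.
Context {R : realType} {F : field_kind} {m k : nat}.
Local Notation I := ('I_m * bool)%type.
Local Notation C := (scal R ComplexField).
Local Notation nI := (#|{: I}|%:R : R).
Variables (alpha : nat -> R -> 'M[scal R F]_m) (T : R).
Hypothesis T0 : 0 < T.
Hypothesis alpha_ok : coefficients_ok k.+1 T alpha.
Implicit Types (x : R) (s t : I) (l : C) (Dm : R -> 'M[C]_m).

Local Notation coef := (@coef R F m k alpha).

Lemma coor_vec_le (c : I -> R) s : `|coor (vec (F := F) c) s| <= `|c s|.
Proof.
case: s => i b; rewrite /coor mxE /mk; case: F; case: b => //=.
by rewrite /im normr0.
Qed.

Lemma coor_vec_sub_le (c c' : I -> R) s :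
  `|coor (vec (F := F) c) s - coor (vec (F := F) c') s| <= `|c s - c' s|.
Proof.
case: s => i b; rewrite /coor !mxE /mk; case: F; case: b => //=.
by rewrite /im subrr normr0.
Qed.

Lemma coef_bound : exists2 K, 0 <= K & exists2 K', 0 <= K' & forall Dm l x (MD M : R),
  (forall s t, `|rmx (Dm x) s t| <= MD) -> `|re l| + `|im l| <= M ->
  forall j s t, (j <= k)%N -> `|coef Dm l j s t x| <= K * (MD + M) + K'.
Proof.
have [K K0 HK] := lead_inv_bounded T0 alpha_ok.
have [||K' K'0 HK'] := @periodic_bounded_fin R T ('I_k * (I * I))%type
  (fun i x => rmx (- (lead_inv (k := k) alpha x *m ca alpha i.1.+1 x)) i.2.1 i.2.2) T0.
- move=> i; apply: rmx_continuous => a b; under eq_fun do rewrite mxE.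
  apply: cC_N; apply: cCmx_mul; first exact: lead_inv_continuous alpha_ok.
  by apply: (ca_continuous alpha_ok); rewrite /= ltnS ltnW.
- move=> i x; rewrite (lead_inv_periodic alpha_ok) (ca_periodic alpha_ok)//.
  by rewrite /= ltnS ltnW.
exists (nI * K); first by rewrite mulr_ge0.
exists K' => // Dm l x MD M DM lM [|j] s t jk; last first.
  apply: (le_trans (HK' (Ordinal jk, (s, t)) x)); rewrite lerDr.
  by rewrite !mulr_ge0// addr_ge0// ?(le_trans _ (DM s s))// (le_trans _ lM)// addr_ge0.
apply: (@le_trans _ _ (nI * K * (MD + M))); last by rewrite lerDl.
rewrite /coef /cmx rmxN normrN rmxM; apply: (le_trans (ler_norm_sum _ _ _)).
apply: (@le_trans _ _ (\sum_(r : I) K * (MD + M))).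
  apply: ler_sum => r _; rewrite normrM ler_pM// rmxD rmxN.
  apply: (le_trans (ler_normB _ _)); apply: lerD; first exact: DM.
  exact: le_trans (rmx_scalar_le _ _ _) lM.
by rewrite sumr_const -[_ *+ _]mulr_natl mulrA.
Qed.

Lemma coef_diff : exists2 K, 0 <= K & forall Dm Dm' l x (e : R), 0 <= e ->
  (forall s t, `|rmx (Dm x) s t - rmx (Dm' x) s t| <= e) ->
  forall j s t, `|coef Dm l j s t x - coef Dm' l j s t x| <= K * e.
Proof.
have [K K0 HK] := lead_inv_bounded T0 alpha_ok.
exists (nI * K) => [|Dm Dm' l x e e0 De [|j] s t]; first by rewrite mulr_ge0.
  have -> : coef Dm l 0 s t x - coef Dm' l 0 s t x =
      - \sum_r rmx (lead_inv (k := k) alpha x) s r * (rmx (Dm x) r t - rmx (Dm' x) r t).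
    rewrite /coef /cmx !rmxN !rmxM -opprB opprK -!sumrN -big_split -sumrN; apply: eq_bigr => r _ /=.
    rewrite !rmxD !rmxN; ring.
  rewrite normrN; apply: (le_trans (ler_norm_sum _ _ _)).
  apply: (@le_trans _ _ (\sum_(r : I) K * e)).
    by apply: ler_sum => r _; rewrite normrM ler_pM.
  by rewrite sumr_const -[_ *+ _]mulr_natl mulrA.
by rewrite subrr normr0 !mulr_ge0.
Qed.

Lemma coef_periodic Dm l n j s t x : (forall x, Dm (x + n%:R * T) = Dm x) -> (j <= k)%N ->
  coef Dm l j s t (x + n%:R * T) = coef Dm l j s t x.
Proof.
move=> DL jk; rewrite /coef /cmx.
have -> : lead_inv (k := k) alpha (x + n%:R * T) = lead_inv (k := k) alpha x.
  by have := periodic_int (lead_inv_periodic alpha_ok) n%:Z x; rewrite -pmulrn.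
case: j jk => [_|j jk]; first by rewrite DL.
have aP y : ca alpha j.+1 (y + T) = ca alpha j.+1 y by apply: (ca_periodic alpha_ok); exact: leqW.
by have := periodic_int aP n%:Z x; rewrite -pmulrn => ->.
Qed.

End coefficient_bounds.

Theorem corollary7p1 (R : realType) (F : field_kind) (k m : nat)
  (k_gt0 : (0 < k)%N) (m_gt0 : (0 < m)%N) (T : R) (T_gt0 : 0 < T)
  (alpha : nat -> R -> 'M[scal R F]_m)
  (alpha_ok : coefficients_ok k T alpha)
  (NL : 'cV[scal R F]_m -> R -> 'cV[scal R F]_m)
  (NL_ok : nonlinearity_ok T NL)
  (v z : R -> 'cV[scal R F]_m)
  (v_Hkper : Hkper k T v) (z_Hk : Hk k z)
  (v_sol : solution k alpha NL v)
  (zv_sol : solution k alpha NL (fun x => z x + v x))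
  (zv_nondeg : nondegenerate_state k alpha NL (fun x => z x + v x))
  (* the associated periodic pulse solutions u n, n >= N0 *)
  (C : R) (C_gt0 : 0 < C) (N0 : nat) (N0_gt0 : (0 < N0)%N)
  (chi : nat -> R -> R)
  (chi_cutoff : forall n, (N0 <= n)%N -> cutoff k T n (chi n))
  (a u : nat -> R -> 'cV[scal R F]_m)
  (u_pulse : forall n, (N0 <= n)%N ->
    pulse_solution k T alpha NL v z C n (chi n) (a n) (u n))
  (zv_stable : strongly_spectrally_stable k alpha NL (fun x => z x + v x))
  (Ln : nat -> @unbounded_operator R m)
  (Ln_def : (forall n, Ln n = Lop k alpha NL (u n)) \/
            (forall n, Ln n = Lper k alpha NL (n%:R * T) (u n)))
  (K : set (R[i] : numFieldType)) (K_compact : compact K)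
  (N : nat) (N0_le_N : (N0 <= N)%N)
  (spec_in_K : forall n, (N <= n)%N ->
    spectrum (Ln n) `&` [set l | 0 <= complex.Re l] `<=` K) :
  exists2 N1 : nat, (N <= N1)%N &
    forall n, (N1 <= n)%N ->
      spectrum (Ln n) `<=` [set l | complex.Re l < 0].
Proof.
case: k k_gt0 alpha_ok v_Hkper z_Hk {v_sol zv_sol} zv_nondeg chi_cutoff u_pulse zv_stable Ln_def
  => [//|k] _ alpha_ok v_Hkper z_Hk _ chi_cutoff u_pulse zv_stable Ln_def.
(* The cut-off with index [N0] already provides the bump, its period being positive. *)
have [rho rhoP] : exists rho : R -> R, bump rho.
  apply: (cutoff_bump (n := N0) _ (chi_cutoff N0 (leqnn _))).
  by rewrite mulr_gt0// ltr0n.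
have [wv wvP] := crep_exists rhoP v_Hkper.2.
have [wz wzP] := crep_exists rhoP (Hk_Hkloc z_Hk).
pose D (c : 'I_m * bool -> R -> R) x := jac NL (vec (F := F) (c^~ x)) x.
have D_cont c : (forall s, continuous (c s)) -> cCmx (D c).
  move=> cc; apply: (jac_continuous NL_ok) => x.
  by apply: (cvg_vec (c := c^~ x)) => s; exact: cc.
pose w s x := wz s x + wv s x.
have cw s : continuous (w s) by apply: continuousDf; [exact: wzP.1|exact: wvP.1].
have cDw := D_cont w cw.
have pw : potential_ae NL (fun x => z x + v x) (D w).
  apply: ae_imp2 wzP.2 wvP.2 => x e1 e2; rewrite /D /jac; congr (map_mx _ (dN NL _ x)).
  rewrite -[LHS]vec_coor; congr vec; apply/funext => s.
  by rewrite coorD /w -e1 -e2.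
(* Strong stability puts every [l] with nonnegative real part in the resolvent set of the limit
   operator, so compactness of [K] yields a single constant. *)
have [M M0 HM] : exists2 M : R, 0 <= M & forall l, K l -> 0 <= complex.Re l ->
    coercive (k := k) (coef (k := k) alpha (D w) l) M /\ `|complex.Re l| + `|complex.Im l| <= M.
  apply: (coercive_compact T_gt0 alpha_ok cDw K_compact) => l Kl l0.
  apply: (resolvent_coercive T_gt0 alpha_ok rhoP pw cDw).
  apply: contrapT => nr; have [r r0 Hr] := zv_stable.
  by have := Hr l nr; lra.
have [B B0 HB] := profile_bounded rhoP T_gt0 v_Hkper z_Hk wvP wzP.
have [MD MD0 HMD] := jac_bounded T_gt0 NL_ok (B + 1).
have [K1 K10 [K2 K20 HC]] := coef_bound T_gt0 alpha_ok.
have [K3 K30 HD] := coef_diff T_gt0 alpha_ok.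
pose Cb := K1 * (MD + M) + K2.
have Cb0 : 0 <= Cb by rewrite addr_ge0// mulr_ge0// addr_ge0.
have [e [L1 [e0 HNB]]] := @no_bloch_small R ('I_m * bool)%type k rho Cb M rhoP Cb0 M0.
pose e' := e / (K3 + 1).
have K31 : 0 < K3 + 1 by rewrite ltr_wpDl.
have e'0 : 0 < e' by rewrite divr_gt0.
have K3e : K3 * e' <= e.
  by rewrite /e' mulrCA ler_piMr ?(ltW e0)// ler_pdivrMr// mul1r lerDl.
have [d d0 Hd] := jac_uniform T_gt0 NL_ok B e'0.
(* [d] makes the coefficients close, and 1 keeps the pulses within the bound [B + 1] for which [MD]
   was chosen. *)
have d'0 : 0 < Num.min d 1 by rewrite lt_min d0 ltr01.
have [N1 HN1] := pulse_close rhoP T_gt0 v_Hkper z_Hk wvP wzP alpha NL C_gt0 d'0.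
exists (maxn N (maxn N1 (Num.truncn (`|L1| / T)).+1)); first by rewrite leq_maxl.
move=> n; rewrite !geq_max => /and3P[Nn N1n Ln1] l spec_l.
have N0n : (N0 <= n)%N := leq_trans N0_le_N Nn.
have n0 : (0 < n)%N := leq_trans N0_gt0 N0n.
rewrite /= ltNge; apply/negP => l0.
have Kl : K l by exact: (spec_in_K n Nn l (conj spec_l l0)).
(* A spectral point outside the open left half-plane lies in [K]; it remains to show that it belongs
   to the resolvent set. *)
apply: spec_l.
have [cM lM] := HM l Kl l0.
set L := n%:R * T.
have L0 : 0 < L by rewrite mulr_gt0// ltr0n.
have L1L : L1 <= L.
  apply: (le_trans (ler_norm _)); rewrite -ler_pdivrMr//.
  apply: ltW; have /andP[_ h] := truncn_itv (divr_ge0 (normr_ge0 L1) (ltW T_gt0)).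
  by apply: (lt_le_trans h); rewrite ler_nat.
have pn := u_pulse n N0n.
have uH : Hkper k.+1 L (u n) by case: pn.
have [wu wuP] := crep_exists rhoP uH.2.
have close := HN1 n _ _ _ wu n0 N1n (chi_cutoff n N0n) pn wuP.
have wuL : forall s x, wu s (x + L) = wu s x by exact: crep_periodic wuP uH.1.
have cDu := D_cont wu wuP.1.
have pu : potential_ae NL (u n) (D wu).
  apply: ae_imp wuP.2 => x e1; rewrite /D /jac; congr (map_mx _ (dN NL _ x)).
  by rewrite -[LHS]vec_coor; congr vec; apply/funext => s; rewrite -e1.
have DuL x : D wu (x + L) = D wu x.
  rewrite /D; have -> : wu^~ (x + L) = wu^~ x by apply/funext => s; exact: wuL.
  by have := jac_periodic NL_ok (vec (wu^~ x)) n%:Z x; rewrite -pmulrn.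
(* Closeness to the limit profile bounds the pulse on a central period, reached by subtracting the
   multiple of [L] nearest to [x]; periodicity does the rest. *)
have wuB s x : `|wu s x| <= B + 1.
  pose j := - Num.floor (x / L + 1 / 2).
  have <- := periodic_int (wuL s) j x.
  have /andP[h1 h2] := floor_itv (x / L + 1 / 2).
  have xE : x = x / L * L by rewrite divfK// gt_eqF.
  have x'L : `|x + j%:~R * L| <= L / 2.
    have -> : x + j%:~R * L = (x / L + j%:~R) * L by rewrite mulrDl -xE.
    rewrite normrM [`|L|]gtr0_norm// mulrC ler_pM2l// ler_norml /j intrN.
    by move: h1 h2; rewrite intrD => h1 h2; apply/andP; split; lra.
  have := close s (x + j%:~R * L) _; set y := x + _ in x'L *.
  have yL : `|y| <= 5 / 6 * L by lra.
  move=> /(_ yL); rewrite le_min => /andP[_ h]; have hB := HB s y.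
  have := ler_normD (wu s y - (wz s y + wv s y)) (wz s y + wv s y); rewrite subrK; lra.
have Cu j s t x : (j <= k)%N -> `|coef (k := k) alpha (D wu) l j s t x| <= Cb.
  apply: HC lM _ _ _ => s' t'; apply: HMD => r.
  by apply: (le_trans (coor_vec_le _ _)); exact: wuB.
have Cw j s t x : (j <= k)%N -> `|coef (k := k) alpha (D w) l j s t x| <= Cb.
  apply: HC lM _ _ _ => s' t'; apply: HMD => r.
  by apply: (le_trans (coor_vec_le _ _)); apply: (le_trans (HB r x)); rewrite lerDl.
have cwc j s t : (j <= k)%N -> continuous (coef (k := k) alpha (D w) l j s t).
  exact: (coef_continuous alpha_ok).
have diff j s t x : (j <= k)%N -> `|x| <= 5 / 6 * L ->
    `|coef (k := k) alpha (D wu) l j s t x - coef (k := k) alpha (D w) l j s t x| <= e.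
  move=> _ x56; apply: le_trans K3e; apply: HD; first exact: ltW.
  move=> s' t'; apply: Hd => r; first by apply: (le_trans (coor_vec_le _ _)); exact: HB.
  apply: (le_trans (coor_vec_sub_le _ _ _)); apply: (le_trans (close r x x56)).
  by rewrite ge_min lexx.
(* All thresholds were fixed before [n] and [l], so this applies to every remaining spectral
   parameter at once. *)
have NB := HNB L _ _ L0 L1L cwc Cu Cw diff cM.
have cL j s t x : (j <= k)%N ->
    coef (k := k) alpha (D wu) l j s t (x + L) = coef (k := k) alpha (D wu) l j s t x.
  exact: (coef_periodic alpha_ok).
case: Ln_def => ->; first exact: (resolvent_line T_gt0 alpha_ok rhoP L0 pu cDu cL NB).
apply: (resolvent_per T_gt0 alpha_ok rhoP L0 pu cDu cL _ NB) => x.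
by have := periodic_int (lead_inv_periodic alpha_ok) n%:Z x; rewrite -pmulrn.
Qed.
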